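(* Suppose that $m=\sum_{k\ge 0}kp_k\in(0,1)$, that $\sum_{k=1}^\infty k(\log k)p_k<\infty$, and let $x>0$. (i) For $\rho=0$ and $z\ge0$, $$\lim_{t\to\infty}\sqrt{t}\,e^{\alpha t}\,\mathbb{P}_x\big(\widetilde{M}_t^{-\rho}>\sqrt{t}z\big)=\sqrt{\tfrac{2}{\pi}}\,C_{sub}\,x\,e^{-z^2/2},$$ or equivalently, as $t\to\infty$, $$\mathbb{P}_x\big(\widetilde{M}_t^{-\rho}>\sqrt{t}z\big)\sim C_{sub}\,\mathbb{E}_x\big(\widetilde{Z}_t^{-\rho}((\sqrt{t}z,\infty))\big).$$ (ii) For $\rho<0$ and $z\in\mathbb{R}$, $$\lim_{t\to\infty}e^{\alpha t}\,\mathbb{P}_x\big(\widetilde{M}_t^{-\rho}+\rho t>\sqrt{t}z\big)=\frac{C_{sub}(1-e^{2\rho x})}{\sqrt{2\pi}}\int_z^\infty e^{-\frac{y^2}{2}}\,\mathrm{d}y,$$ or equivalently, as $t\to\infty$, $$\mathbb{P}_x\big(\widetilde{M}_t^{-\rho}+\rho t>\sqrt{t}z\big)\sim C_{sub}\,\mathbb{E}_x\big(\widetilde{Z}_t^{-\rho}((\sqrt{t}z-\rho t,\infty))\big).$$ (iii) For $\rho>0$ and $z\ge0$, $$\lim_{t\to\infty}t^{3/2}e^{(\alpha+\frac{\rho^2}{2})t}\,\mathbb{P}_x\big(\widetilde{M}_t^{-\rho}>z\big)=\sqrt{\tfrac{2}{\pi}}\,C_z(\rho)\,x\,e^{\rho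 x},$$ where the limit $C_z(\rho):=\lim_{N\to\infty}e^{(\alpha+\frac{\rho^2}{2})N}\int_0^\infty ye^{-\rho y}\,\mathbb{P}_y\big(\widetilde{M}_N^{-\rho}>z\big)\,\mathrm{d}y$ exists, belongs to $(0,\infty)$, and is a function of $z$ independent of $x$. Or equivalently, as $t\to\infty$, $$\mathbb{P}_x\big(\widetilde{M}_t^{-\rho}>z\big)\sim\frac{\rho^2C_z(\rho)e^{\rho z}}{\rho z+1}\,\mathbb{E}_x\big(\widetilde{Z}_t^{-\rho}((z,\infty))\big).$$
   Context: Branching Brownian motion with drift $-\rho\in\mathbb{R}$: at time $0$ there is one particle at $x$, which moves as a Brownian motion with drift $-\rho$ (unit variance). After an exponential time of parameter $\beta>0$, independent of the motion, it dies and is replaced at its death position by $k$ offspring with probability $p_k$, $k\ge0$; the offspring evolve independently in the same way. $\mathbb{P}_x,\mathbb{E}_x$ denote the law and expectation. $N_t^{-\rho}$ is the set of particles alive at time $t$; for $u\in N_t^{-\rho}$ and $s\le t$, $X_u(s)$ is the position at time $s$ of $u$ or of its ancestor alive at time $s$. $\zeta:=\inf\{t>0: N_t^{-\rho}=\emptyset\}$ is the extinction time (its law depends neither on $\rho$ nor on $x$). $m:=\sum_{k\ge0}kp_k$ is the mean offspring number, assumed to satisfy $m\in(0,1)$ (subcritical case), and $\alpha:=\beta(1-m)\in(0,\infty)$. Under $\sum_{k\ge1}k(\log k)p_k<\infty$ it is known that the limit $C_{sub}:=\lim_{t\to\infty}e^{\alpha t}\mathbb{P}_0(\zeta>t)$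 exists and lies in $(0,\infty)$. The branching killed Brownian motion with drift $-\rho$ (particles are killed, along with their descendants, upon hitting the origin) is $\widetilde{Z}_t^{-\rho}:=\sum_{u\in N_t^{-\rho}}1_{\{\min_{s\le t}X_u(s)>0\}}\delta_{X_u(t)}$, and its maximal position at time $t$ is $\widetilde{M}_t^{-\rho}:=\max\{X_u(t):u\in N_t^{-\rho},\ \min_{s\le t}X_u(s)>0\}$, with $\max\emptyset=-\infty$. The notation $f(t)\sim g(t)$ as $t\to\infty$ means $\lim_{t\to\infty}f(t)/g(t)=1$. *)

(* Defs.v *)
From HB Require Import structures.
From mathcomp Require Import all_boot all_order all_algebra.
From mathcomp Require Import finmap.
From mathcomp Require Import all_classical all_reals all_analysis.
Set Implicit Arguments.
Unset Strict Implicit.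
Unset Printing Implicit Defensive.
Import Order.TTheory GRing.Theory Num.Theory.
Import numFieldNormedType.Exports.
Local Open Scope classical_set_scope.
Local Open Scope ring_scope.

Definition asymp_equiv (R : realType) (f g : R -> R) : Prop :=
  f t / g t @[t --> +oo] --> (1 : R).

Section Independence.
Context d (T : measurableType d) (R : realType) (P : probability T R).

Definition mutually_independent (I : choiceType) (F : I -> set (set T)) : Prop :=
  forall (J : {fset I}) (A : I -> set T),
    (forall i, i \in J -> F i (A i)) ->
    P (\bigcap_(i in [set` J]) A i) = (\prod_(i <- J) P (A i))%E.

Definition sigma_rv d' (T' : measurableType d') (X : T -> T') : set (set T) :=
  preimage_set_system setT X measurable.

Definition sigma_process (D : set R) (X : R -> T -> R) : set (set T) :=
  <<s \bigcup_(s in D) sigma_rv (X s) >>.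

(* Standard Brownian motion on [0, +oo[, started at 0; the values at negative
   times are irrelevant.  Every path is continuous (not just almost every one),
   since P need not be complete. *)
Record brownian_motion (B : R -> {RV P >-> R}) : Prop := BrownianMotion {
  bm_start : forall w, B 0 w = 0 ;
  bm_continuous : forall w, {within `[0, +oo[, continuous (fun s : R => B s w)} ;
  bm_gaussian : forall (s t : R) (A : set R), 0 <= s -> s < t -> measurable A ->
    P [set w | A (B t w - B s w)] = normal_prob 0 (Num.sqrt (t - s)) A ;
  bm_increments : forall (s t : R) (E : set T) (A : set R), 0 <= s -> s < t ->
    sigma_process `[0, s] B E -> measurable A ->
    P (E `&` [set w | A (B t w - B s w)]) =
    (P E * P [set w | A (B t w - B s w)%R])%E }.

End Independence.

Section Offspring.
Context (R : realType).
Implicit Types (p : nat -> R) (beta : R).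

Definition offspring_law p : Prop :=
  (forall k, 0 <= p k) /\ (\sum_(0 <= k <oo) (p k)%:E)%E = 1%E.

Definition mean_offspring p : \bar R := (\sum_(0 <= k <oo) (k%:R * p k)%:E)%E.

Definition klogk_moment p : \bar R :=
  (\sum_(1 <= k <oo) (k%:R * ln k%:R * p k)%:E)%E.

Definition alpha beta p : R := beta * (1 - fine (mean_offspring p)).

End Offspring.

(* Potential particles carry Ulam-Harris labels, written from the particle up to
   the root: [::] is the initial particle and i :: u is the i-th child of u
   (counting from 0). *)
Definition label := seq nat.

(* The randomness of a branching Brownian motion: each label u has a Brownian
   motion (its displacement since birth), a lifetime and a number of offspring,
   all mutually independent.  The initial position and the drift are added
   afterwards, so the law P_x is that of the process started from x under P.
   Lifetimes are positive for every sample point, so that the events below are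
   measurable. *)
Record branching_data d (T : measurableType d) (R : realType)
    (P : probability T R) (beta : R) (p : nat -> R) := BranchingData {
  motion : label -> R -> {RV P >-> R} ;
  lifetime : label -> {RV P >-> R} ;
  litter : label -> {RV P >-> nat} ;
  motion_brownian : forall u, brownian_motion (motion u) ;
  lifetime_gt0 : forall u w, 0 < lifetime u w ;
  lifetime_law : forall u (A : set R), measurable A ->
    distribution P (lifetime u) A = exponential_prob beta A ;
  litter_law : forall u k, P (litter u @^-1` [set k]) = (p k)%:E ;
  data_independent : mutually_independent P
    (fun i : label + label + label =>
       match i with
       | inl (inl u) => sigma_process `[0, +oo[ (motion u)
       | inl (inr u) => sigma_rv (lifetime u)
       | inr u => sigma_rv (litter u)
       end) }.

Section BranchingBrownianMotion.
Context d (T : measurableType d) (R : realType) (P : probability T R).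
Context (beta : R) (p : nat -> R) (W : branching_data P beta p).
Implicit Types (u : label) (x rho s t z : R) (w : T).

Fixpoint birth u w : R :=
  if u is _ :: v then birth v w + lifetime W v w else 0.

Definition death u w : R := birth u w + lifetime W u w.

Fixpoint in_tree u w : Prop :=
  if u is i :: v then in_tree v w /\ (i < litter W v w)%N else True.

(* N_t *)
Definition alive t w : set label :=
  [set u | in_tree u w /\ birth u w <= t < death u w].

(* X_u(s) for the process started at x with drift -rho; before the birth of u,
   this is the position of the ancestor of u alive at time s *)
Fixpoint position x rho u s w : R :=
  match u with
  | [::] => x + motion W [::] s w - rho * s
  | _ :: v =>
      if s < birth u w then position x rho v s w
      else position x rho v (birth u w) w
           + motion W u (s - birth u w) w - rho * (s - birth u w)
  end.

Definition extinction_time w : \bar R :=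
  ereal_inf [set t%:E | t in [set t | 0 < t /\ alive t w = set0]].

Definition C_sub : R :=
  lim (expR (alpha beta p * t) * fine (P [set w | (t%:E < extinction_time w)%E])
       @[t --> +oo]).

(* Paths are continuous, so this infimum is a minimum. *)
Definition path_min x rho u t w : R :=
  inf [set position x rho u s w | s in `[0, t]].

Definition killed_alive x rho t w : set label :=
  [set u | alive t w u /\ 0 < path_min x rho u t w].

Definition killed_measure x rho t w (A : set R) : \bar R :=
  \esum_(u in killed_alive x rho t w) \d_(position x rho u t w) A.

(* Almost surely only finitely many particles are alive, so this supremum is a
   maximum (-oo when there is no particle). *)
Definition killed_max x rho t w : \bar R :=
  ereal_sup [set (position x rho u t w)%:E | u in killed_alive x rho t w].

Definition expected_killed x rho t (A : set R) : R :=
  fine (\int[P]_w killed_measure x rho t w A)%E.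

Definition Cz_approx rho z (N : R) : \bar R :=
  ((expR ((alpha beta p + rho ^+ 2 / 2) * N))%:E *
   \int[lebesgue_measure]_(y in `]0%R, +oo[)
     ((y * expR (- rho * y))%:E *
      P [set w | z%:E < killed_max y rho N w]))%E.

Definition Cz rho z : \bar R := lim (Cz_approx rho z N @[N --> +oo]).

End BranchingBrownianMotion.

(* Main.v *)
(** Conditioning on the first branching event shows that u(t, x), the probability
    that some unkilled particle lies beyond a given level at time t, solves a renewal
    equation driven by the killed Brownian semigroup K and by the convex generating
    function of p. Since 1 - f(1 - v) <= m v, and since (1 - f(1 - v)) / v is
    nonincreasing in v, comparing solutions of such equations gives, with
    q(t) = P(zeta > t),

      q(t+N) / q(N) * K_t u(N, .) <= u(t+N, .) <= exp(- alpha t) * K_t u(N, .).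

    The same equation for q, with the k log k moment, gives
    exp(alpha t) q(t) --> C_sub > 0, so both bounds agree up to a factor that tends to
    1 as N grows. It remains to let t tend to infinity in K_t, whose kernel is explicit
    by reflection. For rho <= 0 the upper bound is closed by
    u(N, y) <= q(N) 1{y > a - k} + (Gaussian tail at k). For rho > 0 the kernel of K_t is
    asymptotic to a multiple of t^(-3/2) exp(- rho^2 t / 2) x exp(rho x) y exp(- rho y),
    and the two bounds make the approximations of C_z(rho) converge to a positive
    limit. *)

Require Import Defs.
From HB Require Import structures.
From mathcomp Require Import all_boot all_order all_algebra.
From mathcomp Require Import finmap.
From mathcomp Require Import all_classical all_reals all_analysis.
From mathcomp Require Import measurable_realfun ring lra.
Set Implicit Arguments.
Unset Strict Implicit.
Unset Printing Implicit Defensive.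
Import Order.TTheory GRing.Theory Num.Theory.
Import numFieldNormedType.Exports.
Local Open Scope classical_set_scope.
Local Open Scope ring_scope.

(** * Independence of blocks of data *)

(** The comparison concerns one quantity [reach], with a boolean that switches the killing on and a
    target set: the tail of the killed maximum and q are two instances of it, so that q obeys the
    same renewal equation and serves as a gauge for u. Subsolutions and supersolutions can be
    compared because m < 1 makes the renewal operator a contraction. The lower bound rests on K_t
    u(N, .) <= q(N), which turns K_t u(N, .) / q(N) into a number of [0, 1] to which concavity
    applies. Two obstacles shape the rest. Killing is a condition on a continuum of times; the
    reflection identity is obtained by stopping at the first nonpositive grid time, where the Markov
    property at deterministic times is enough, and by refining the mesh. The branching recursion
    puts a random residual time and a random death position inside events of the subtrees; these
    events are therefore made measurable jointly in time, start and sample, for the sigma-algebra of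
    the subtree alone, and independence is used by freezing one block of data at a time. *)

Section independent_blocks.
Context d (T : measurableType d) (R : realType) (P : probability T R).

(** For fixed [E], restricting [P] to [E] and multiplying [P] by P(E) give two finite measures that
    agree on the pi-system [G]; [G setT] supplies the exhausting sequence for uniqueness. *)
Lemma g_sigma_algebra_indep (E : set T) (G : set (set T)) :
    measurable E -> G `<=` measurable -> setI_closed G -> G setT ->
    (forall A, G A -> P (E `&` A) = (P E * P A)%E) ->
  forall A, <<s G >> A -> P (E `&` A) = (P E * P A)%E.
Proof.
move=> mE mG GI GT EG A sA.
have PE0 : 0 <= fine (P E) by rewrite fine_ge0.
have PEfin : (P E \is a fin_num)%E by rewrite fin_num_measure.
have := @g_sigma_algebra_measure_unique _ R _ G mG (fun=> setT) (fun=> GT) _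
  (mrestr P mE) (mscale (NngNum PE0) P) GI _ _ A sA.
have mrE B : mrestr P mE B = P (E `&` B) by rewrite setIC.
have msE B : mscale (NngNum PE0) P B = (P E * P B)%E.
  by rewrite -[in RHS](fineK PEfin).
rewrite -mrE -msE; apply=> //.
- by rewrite bigcup_const//; exists 0%N.
- by move=> B GB; rewrite -[LHS]/(mrestr P mE B) mrE EG// -msE.
- by move=> _; rewrite -[ltLHS]/(mrestr P mE setT) mrE setIT ltey_eq PEfin.
Qed.

Lemma g_sigma_algebra_indep2 (G H : set (set T)) :
    G `<=` measurable -> setI_closed G -> G setT ->
    H `<=` measurable -> setI_closed H -> H setT ->
    (forall A B, G A -> H B -> P (A `&` B) = (P A * P B)%E) ->
  forall A B, <<s G >> A -> <<s H >> B -> P (A `&` B) = (P A * P B)%E.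
Proof.
move=> mG GI GT mH HI HT GH A B sA sB.
have mA : measurable A.
  by move: A sA; apply: smallest_sub => //; exact: sigma_algebra_measurable.
apply: (g_sigma_algebra_indep mA mH HI HT _ sB) => C HC.
rewrite setIC muleC; apply: (g_sigma_algebra_indep _ mG GI GT _ sA).
  exact: mH.
by move=> D GD; rewrite setIC muleC; exact: GH.
Qed.

Variables (I : choiceType) (F : I -> set (set T)).
Hypotheses (FI : forall i, setI_closed (F i)) (mF : forall i, F i `<=` measurable).

(** The pi-system behind a block of indices: mutual independence speaks about exactly these finite
    intersections. *)
Definition cylinders (D : set I) : set (set T) :=
  [set A | exists (J : {fset I}) (B : I -> set T),
    (forall i, i \in J -> D i /\ F i (B i)) /\ A = \bigcap_(i in [set` J]) B i].

Lemma cylinders_setI D : setI_closed (cylinders D).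
Proof.
move=> _ _ [J [A [JA ->]]] [K [B [KB ->]]].
(* An index outside one of the two sets gets the factor [setT], so that both intersections run over
   the union. *)
exists (J `|` K)%fset, (fun i => (if i \in J then A i else setT) `&`
                                 (if i \in K then B i else setT)); split.
  move=> i; rewrite in_fsetU.
  case: ifPn => iJ; case: ifPn => iK //= _; rewrite ?setIT ?setTI;
    have := JA i; have := KB i; rewrite ?iJ ?iK; try by move=> + /(_ isT).
  + by move=> /(_ isT)[Di FB] /(_ isT)[_ FA]; split=> //; exact: FI.
  + by move=> /(_ isT).
apply/seteqP; split=> w.
  move=> [wA wB] i /= _; split; case: ifPn => //.
  + by move=> ?; exact: wA.
  + by move=> ?; exact: wB.
move=> wAB; split=> i /= iJ; have /= := wAB i;
  rewrite in_fsetU iJ ?orbT => /(_ isT)[].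
+ by [].
+ by [].
Qed.

Lemma cylinders_setT D : cylinders D setT.
Proof. by exists fset0, (fun=> setT); split=> //; rewrite set_fset0 bigcap_set0. Qed.

Lemma cylinders_measurable D : cylinders D `<=` measurable.
Proof.
move=> _ [J [A [JA ->]]]; apply: fin_bigcap_measurable; first exact: finite_fset.
by move=> i /= iJ; apply: (mF (i := i)); have [] := JA i iJ.
Qed.

Lemma sub_cylinders D : \bigcup_(i in D) F i `<=` cylinders D.
Proof.
move=> A [i Di FA]; exists [fset i]%fset, (fun=> A); split.
  by move=> j; rewrite inE => /eqP ->.
by rewrite set_fset1 bigcap_set1.
Qed.

(** Two cylinders over disjoint blocks form one cylinder over the union, to which mutual
    independence applies; the pi-system argument does the rest. *)
Lemma independent_blocks (D1 D2 : set I) : mutually_independent P F ->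
    D1 `&` D2 = set0 ->
  forall A B, <<s \bigcup_(i in D1) F i >> A -> <<s \bigcup_(i in D2) F i >> B ->
  P (A `&` B) = (P A * P B)%E.
Proof.
move=> PF D12 A B sA sB.
apply: (g_sigma_algebra_indep2 (G := cylinders D1) (H := cylinders D2)).
- exact: cylinders_measurable.
- exact: cylinders_setI.
- exact: cylinders_setT.
- exact: cylinders_measurable.
- exact: cylinders_setI.
- exact: cylinders_setT.
- move=> _ _ [J [A1 [JA ->]]] [K [B1 [KB ->]]].
  have JK i : i \in J -> i \in K -> False.
    move=> /JA[D1i _] /KB[D2i _].
    by have : (D1 `&` D2) i by []; rewrite D12.
  have kK i : i \in K -> (i \in J) = false.
    by move=> iK; apply/negP => iJ; exact: (JK i).
  pose C i := if i \in J then A1 i else B1 i.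
  have -> : \bigcap_(i in [set` J]) A1 i = \bigcap_(i in [set` J]) C i.
    by apply: eq_bigcapr => i /= iJ; rewrite /C iJ.
  have -> : \bigcap_(i in [set` K]) B1 i = \bigcap_(i in [set` K]) C i.
    by apply: eq_bigcapr => i /= iK; rewrite /C kK.
  have JC i : i \in J -> F i (C i).
    by move=> iJ; rewrite /C iJ; have [] := JA i iJ.
  have KC i : i \in K -> F i (C i).
    by move=> iK; rewrite /C kK//; have [] := KB i iK.
  rewrite (PF J)// (PF K)// -bigcap_setU.
  have -> : [set` J] `|` [set` K] = [set` (J `|` K)%fset].
    by rewrite set_fsetU.
  rewrite PF; last by move=> i; rewrite in_fsetU => /orP[/JC|/KC].
  rewrite -big_cat/=; apply: perm_big; apply: uniq_perm.
  + exact: fset_uniq.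
  + rewrite cat_uniq !fset_uniq/= andbT; apply/hasPn => i /= iK.
    by rewrite kK.
  + by move=> i; rewrite mem_cat in_fsetU.
- exact: (sub_sigma_algebra2 (@sub_cylinders D1)) sA.
- exact: (sub_sigma_algebra2 (@sub_cylinders D2)) sB.
Qed.

End independent_blocks.

Section freezing.
Context d d1 d2 (T : measurableType d) (S1 : measurableType d1)
  (S2 : measurableType d2) (R : realType) (P : probability T R).

(** Independence says that the law of the pair is the product of the laws, and Tonelli concludes.
    This plays the part of conditional expectation: [X] is frozen while a second copy of the sample
    point averages [Y]. *)
Lemma integral_independent (X : T -> S1) (Y : T -> S2) (f : (S1 * S2)%type -> \bar R) :
    measurable_fun setT X -> measurable_fun setT Y ->
    (forall A B, measurable A -> measurable B ->
      P (X @^-1` A `&` Y @^-1` B) = (P (X @^-1` A) * P (Y @^-1` B))%E) ->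
    measurable_fun setT f -> (forall z, 0 <= f z)%E ->
  (\int[P]_w f (X w, Y w) = \int[P]_w \int[P]_v f (X w, Y v))%E.
Proof.
move=> mX mY XY mf f0.
pose X' : {mfun T >-> S1} := mfun_Sub (mem_set mX).
pose Y' : {mfun T >-> S2} := mfun_Sub (mem_set mY).
have mXY : measurable_fun setT (fun w => (X w, Y w)) by exact: measurable_fun_pair.
pose Z' : {mfun T >-> (S1 * S2)%type} := mfun_Sub (mem_set mXY).
have -> : (\int[P]_w f (X w, Y w) = \int[distribution P Z']_z f z)%E.
  by rewrite ge0_integral_distribution.
have -> : (\int[distribution P Z']_z f z =
    \int[distribution P X' \x distribution P Y']_z f z)%E.
  apply: eq_measure_integral => A mA _.
  by apply/esym; apply: (product_measure_unique (m1 := distribution P X')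
    (m2 := distribution P Y') (m' := distribution P Z')) => // B C; exact: XY.
rewrite fubini_tonelli1// /fubini_F ge0_integral_distribution//; last 2 first.
- exact: measurable_fun_fubini_tonelli_F.
- by move=> y; exact: integral_ge0.
apply: eq_integral => w _ /=; rewrite ge0_integral_distribution//.
by apply: measurableT_comp => //; exact: measurable_pair1.
Qed.

End freezing.

Lemma measurable_integral_param d1 d2 (Z : measurableType d1) (T : measurableType d2)
    (R : realType) (m : {sigma_finite_measure set T -> \bar R}) (f : Z -> T -> \bar R) :
    measurable_fun setT (fun z : Z * T => f z.1 z.2) -> (forall z w, 0 <= f z w)%E ->
  measurable_fun setT (fun z => \int[m]_w f z w)%E.
Proof.
move=> mf f0.
exact: (@measurable_fun_fubini_tonelli_F _ _ _ _ _ m (fun z : Z * T => f z.1 z.2)).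
Qed.

(** * Joint measurability of continuous processes *)

Section grid.
Context (R : realType).
Implicit Types r s : R.

Definition grid_floor (n : nat) r : R :=
  (Num.trunc (r * n.+1%:R))%:R / n.+1%:R.

Lemma grid_floor_ge0 n r : 0 <= grid_floor n r.
Proof. by rewrite divr_ge0. Qed.

Lemma grid_floor_le n r : 0 <= r -> grid_floor n r <= r.
Proof.
by move=> r0; rewrite ler_pdivrMr ?ltr0n// truncn_le mulr_ge0.
Qed.

Lemma lt_grid_floor n r : r - n.+1%:R^-1 < grid_floor n r.
Proof.
have n0 : 0 < n.+1%:R :> R by rewrite ltr0n.
rewrite ltrBlDr -(ltr_pM2r n0) mulrDl mulVf ?gt_eqF// divfK ?gt_eqF//.
by rewrite natr1 -truncn_le_nat.
Qed.

Lemma cvg_grid_floor r : 0 <= r -> grid_floor n r @[n --> \oo] --> r.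
Proof.
move=> r0; apply: (@squeeze_cvgr _ _ _ _ (fun n => r - harmonic n) (fun=> r)).
- near=> n; rewrite grid_floor_le// andbT ltW//; exact: lt_grid_floor.
- by rewrite -[X in _ --> X]subr0; apply: cvgB; [exact: cvg_cst|exact: cvg_harmonic].
- exact: cvg_cst.
Unshelve. all: by end_near. Qed.

(** Grid points stay nonnegative, hence continuity relative to the half-line is enough. *)
Lemma cvg_within_nonneg_grid (f : R -> R) s r :
    {within `[0, +oo[, continuous f} -> 0 <= s -> 0 <= r ->
  f (s * grid_floor n r) @[n --> \oo] --> f (s * r).
Proof.
move=> /subspace_continuousP cf s0 r0.
have srge : `[0, +oo[%classic (s * r) by rewrite /= in_itv/= andbT mulr_ge0.
apply: (cvg_comp _ _ _ (cf _ srge)) => A /= [e e0 eA].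
have [N _ HN] : \forall n \near \oo, ball (s * r) e (s * grid_floor n r).
  have /cvgrPdist_lt/(_ e e0) : s * grid_floor n r @[n --> \oo] --> s * r.
    by apply: cvgMr; exact: cvg_grid_floor.
  by apply.
exists N => // n /HN/eA; apply.
by rewrite /= in_itv/= andbT mulr_ge0// grid_floor_ge0.
Qed.

End grid.

Section joint_measurability.
Context d' (T' : measurableType d') (R : realType) (X : R -> T' -> R).
Hypothesis mX : forall s : R, 0 <= s -> measurable_fun setT (X s).
Hypothesis cX : forall w, {within `[0, +oo[, continuous (X^~ w)}.

(** A random time is approached from below by times with countably many values, and continuity of
    paths identifies the limit. [T'] is left abstract because it will be the sample space with a
    smaller sigma-algebra. *)
Lemma measurable_evaluation dZ (Z : measurableType dZ) (tau : Z -> R) (g : Z -> T') :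
    measurable_fun setT tau -> measurable_fun setT g -> (forall z, 0 <= tau z) ->
  measurable_fun setT (fun z => X (tau z) (g z)).
Proof.
move=> mtau mg tau0.
apply: (@measurable_fun_cvg _ _ _ _ (fun n z => X (grid_floor n (tau z)) (g z))).
  move=> n _ A mA; rewrite setTI.
  rewrite (_ : _ @^-1` A = \bigcup_k ([set z | Num.trunc (tau z * n.+1%:R) = k] `&`
      g @^-1` (X (k%:R / n.+1%:R) @^-1` A))); last first.
    apply/seteqP; split=> z /=; first by move=> Az; exists (Num.trunc (tau z * n.+1%:R)).
    by move=> [k _ /= [<-]].
  apply: bigcupT_measurable => k; apply: measurableI.
    rewrite (_ : [set z | _] = (fun z => tau z * n.+1%:R) @^-1` `[k%:R, k.+1%:R[); last first.
      apply/seteqP; split=> z /=; rewrite in_itv/=.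
        by move=> <-; apply: truncn_itv; rewrite mulr_ge0.
      by move=> kz; apply: truncn_def.
    rewrite -[X in measurable X]setTI; apply: measurable_funM => //.
  have mk := mX (s := k%:R / n.+1%:R) _.
  rewrite -[X in measurable X]setTI; apply: mg => //.
  by rewrite -[X in measurable X]setTI; apply: mk => //; rewrite divr_ge0.
move=> z _; have := @cvg_within_nonneg_grid _ (X^~ (g z)) 1 (tau z) (@cX _) ler01 (tau0 z).
by rewrite mul1r; under eq_fun do rewrite mul1r.
Qed.

(** Makes survival over an interval a countable condition: a positive continuous function has a
    positive minimum, and conversely a uniform lower bound at the rational multiples of [s] passes
    to every point by continuity. *)
Lemma pos_on_itvP (f : R -> R) (s : R) : {within `[0, +oo[, continuous f} -> 0 <= s ->
  (forall r : R, 0 <= r <= s -> 0 < f r) <->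
  exists n : nat, forall j m : nat, (j <= m.+1)%N ->
    n.+1%:R^-1 <= f (s * (j%:R / m.+1%:R)).
Proof.
move=> cf s0; split=> [f0|[n fn] r /andP[r0 rs]].
  have [|c] := @EVT_min _ f 0 s s0.
    by apply: continuous_subspaceW cf => r /=; rewrite !in_itv/= => /andP[->].
  rewrite in_itv/= => cs fc.
  have [N fN] : exists N : nat, N.+1%:R^-1 < f c.
    have /cvgrPdist_lt/(_ _ (f0 c cs)) := @cvg_harmonic R.
    move=> [N _ /(_ N (leqnn N))]; rewrite sub0r normrN /harmonic/= ger0_norm//.
    by exists N.
  exists N => j m jm; apply: le_trans (ltW fN) (fc _ _).
  rewrite in_itv/= mulr_ge0//= ler_piMr// ler_pdivrMr ?ltr0n// mul1r ler_nat//.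
have [s_eq0|s_neq0] := eqVneq s 0.
  have -> : r = 0 by apply/eqP; rewrite eq_le r0 andbT -s_eq0.
  by have := fn 0%N 0%N isT; rewrite mul0r mulr0; apply: lt_le_trans; rewrite invr_gt0.
have s_gt0 : 0 < s by rewrite lt_neqAle eq_sym s_neq0.
have rs0 : 0 <= r / s by rewrite divr_ge0.
have := cvg_within_nonneg_grid cf s0 rs0.
rewrite (_ : s * (r / s) = r) => [fr|]; last by rewrite mulrC divfK.
apply: (@lt_le_trans _ _ n.+1%:R^-1); first by rewrite invr_gt0.
apply: (cvgr_to_ge fr); near=> k; apply: fn.
rewrite -(ler_nat R) (@le_trans _ _ (r / s * k.+1%:R))// ?truncn_le ?mulr_ge0// ?invr_ge0//.
by rewrite ler_piMl// ler_pdivrMr// mul1r.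
Unshelve. all: by end_near. Qed.

Lemma within_continuous_drift (a rho : R) w :
  {within `[0, +oo[, continuous (fun r => a + X r w - rho * r)}.
Proof.
apply/subspace_continuousP => r r0; apply: cvgB.
  by apply: cvgD; [exact: cvg_cst|exact: (subspace_continuousP _ _).1 (@cX w) r r0].
by apply: cvg_within_filter; exact: mulrl_continuous.
Qed.

Lemma measurable_pos_on_itv dZ (Z : measurableType dZ) (xi tau : Z -> R)
    (g : Z -> T') (rho : R) :
    measurable_fun setT xi -> measurable_fun setT tau -> measurable_fun setT g ->
    (forall z, 0 <= tau z) ->
  measurable [set z | forall r : R, 0 <= r <= tau z -> 0 < xi z + X r (g z) - rho * r].
Proof.
move=> mxi mtau mg tau0.
rewrite (_ : [set z | _] = \bigcup_n \bigcap_j \bigcap_m [set z | (j <= m.+1)%N ->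
    n.+1%:R^-1 <= xi z + X (tau z * (j%:R / m.+1%:R)) (g z)
                  - rho * (tau z * (j%:R / m.+1%:R))]); last first.
  apply/seteqP; split=> z /=.
    move=> /pos_on_itvP[| |n Hn] //; last by exists n => // j _ m _ /=; exact: Hn.
    exact: within_continuous_drift.
  move=> [n _ Hn]; apply/pos_on_itvP => //; last by exists n => j m; exact: Hn.
  exact: within_continuous_drift.
apply: bigcupT_measurable => n; apply: bigcapT_measurable => j.
apply: bigcapT_measurable => m.
have [jm|jm] := boolP (j <= m.+1)%N; last first.
  by rewrite (_ : [set z | _] = setT)//; apply/seteqP; split.
rewrite (_ : [set z | _] = (fun z => xi z + X (tau z * (j%:R / m.+1%:R)) (g z)
                  - rho * (tau z * (j%:R / m.+1%:R))) @^-1` `[n.+1%:R^-1, +oo[); last first.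
  by apply/seteqP; split=> z /=; rewrite in_itv/= andbT => // ->.
rewrite -[X in measurable X]setTI.
apply: measurable_funB => //; last first.
  by apply: measurable_funM => //; exact: measurable_funM.
apply: measurable_funD => //; apply: measurable_evaluation => //.
  exact: measurable_funM.
by move=> z; rewrite mulr_ge0// divr_ge0.
Qed.

End joint_measurability.

(** * Gaussian transition kernel *)

Section density.
Context d (T : measurableType d) (R : realType).
Variables (nu mu : {measure set T -> \bar R}) (g : T -> R).
Hypotheses (mg : measurable_fun setT g) (g0 : forall x, 0 <= g x).
Hypothesis nuE : forall A, measurable A -> nu A = (\int[mu]_(x in A) (g x)%:E)%E.

Import HBNNSimple.
Local Open Scope ereal_scope.

(** The hypothesis is the case of indicators; linearity gives simple functions and monotone
    convergence the rest. *)
Lemma ge0_integral_density (f : T -> \bar R) :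
    measurable_fun setT f -> (forall x, 0 <= f x) ->
  \int[nu]_x f x = \int[mu]_x (f x * (g x)%:E).
Proof.
move=> mf f0.
pose h := nnsfun_approx measurableT mf.
have hf x : (EFin \o h n) x @[n --> \oo] --> f x by exact: cvg_nnsfun_approx.
have hmono x a b : (a <= b)%N -> (h a x <= h b x)%R.
  by move=> ab; exact/lefP/nd_nnsfun_approx.
have mh n : measurable_fun setT (EFin \o h n) by exact/measurable_EFinP.
have mgE : measurable_fun setT (EFin \o g) by exact/measurable_EFinP.
have -> : \int[nu]_x f x = limn (fun n => \int[nu]_x (EFin \o h n) x).
  rewrite -monotone_convergence//.
  - by apply: eq_integral => x _; apply/esym/cvg_lim.
  - by move=> n x _; rewrite lee_fin.
  - by move=> x _ a b ab; rewrite lee_fin hmono.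
have -> : \int[mu]_x (f x * (g x)%:E) =
    limn (fun n => \int[mu]_x ((EFin \o h n) x * (g x)%:E)).
  rewrite -monotone_convergence//.
  - by apply: eq_integral => x _; apply/esym/cvg_lim => //; exact: cvgeZr.
  - by move=> n; exact: emeasurable_funM.
  - by move=> n x _; rewrite mule_ge0// lee_fin.
  - by move=> x _ a b ab; rewrite lee_wpmul2r ?lee_fin ?hmono.
congr (limn _); apply/funext => n.
transitivity (\int[nu]_x (\sum_(y \in range (h n)) (y * \1_(h n @^-1` [set y]) x)%:E)).
  by apply: eq_integral => t _; rewrite /= fimfunE -fsumEFin.
have indich r : measurable_fun setT (fun x => (r * \1_(h n @^-1` [set r]) x)%:E).
  by apply/measurable_EFinP; exact: measurable_funM.
rewrite ge0_integral_fsum//; last by move=> m y _; exact: nnfun_muleindic_ge0.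
transitivity (\int[mu]_x (\sum_(y \in range (h n))
   (y * \1_(h n @^-1` [set y]) x)%:E * (g x)%:E)); last first.
  apply: eq_integral => t _; rewrite -ge0_mule_fsuml => [|y].
    by rewrite /= fimfunE -fsumEFin.
  exact: nnfun_muleindic_ge0.
rewrite ge0_integral_fsum//; last 2 first.
- by move=> y; exact: emeasurable_funM.
- by move=> y x _; rewrite mule_ge0 ?lee_fin//; exact: nnfun_muleindic_ge0.
apply: eq_fsbigr => r rh.
have r0 : (0 <= r)%R by move: rh; rewrite inE => -[x _ <-].
under eq_integral do rewrite EFinM.
rewrite ge0_integralZl//; last exact/measurable_EFinP.
under [RHS]eq_integral do rewrite EFinM -muleA.
rewrite [RHS]ge0_integralZl//; last 2 first.
- by apply: emeasurable_funM => //; exact/measurable_EFinP.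
- by move=> x _; rewrite mule_ge0// lee_fin.
congr *%E.
rewrite integral_indic// setIT nuE// integral_mkcond.
by apply: eq_integral => x _; rewrite epatch_indic muleC.
Qed.

End density.

Section lebesgue_change.
Context (R : realType).
Notation mu := (@lebesgue_measure R).

Lemma ge0_integral_shift (a : R) (f : R -> \bar R) :
    measurable_fun setT f -> (forall x, 0 <= f x)%E ->
  (\int[mu]_x f (x + a)%R = \int[mu]_x f x)%E.
Proof.
move=> mf f0.
have ma : measurable_fun setT ((fun x => x + a) : measurableTypeR R -> measurableTypeR R).
  exact: measurable_funD.
pose phi := @mfun_Sub _ _ (measurableTypeR R) (measurableTypeR R) _ (mem_set ma).
have shift A : measurable A -> mu A = pushforward mu phi A.
  move=> mA; apply: lebesgue_measure_unique => //= _ [[b c]] _ <-.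
  rewrite /pushforward (_ : _ @^-1` _ = `]b - a, c - a]%classic); last first.
    by apply/seteqP; split=> x /=; rewrite !in_itv/= ltrBlDr lerBrDr.
  rewrite !lebesgue_measure_itv/= !lte_fin ltrD2r; case: ifPn => // _.
  by rewrite -!EFinB; congr EFin; ring.
have := @ge0_integral_pushforward _ _ _ _ R _ ma mu setT f measurableT mf.
rewrite preimage_setT => /= <-//.
apply: eq_measure_integral => A mA _; exact/esym/shift.
Qed.

Lemma ge0_integral_oppr (f : R -> \bar R) :
    measurable_fun setT f -> (forall x, 0 <= f x)%E ->
  (\int[mu]_x f (- x)%R = \int[mu]_x f x)%E.
Proof.
move=> mf f0.
have ma : measurable_fun setT (-%R : measurableTypeR R -> measurableTypeR R).
  exact: measurable_funN.
have := @ge0_integral_pushforward _ _ _ _ R _ ma mu setT f measurableT mf.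
rewrite preimage_setT => /= <-//.
by apply: eq_measure_integral => A mA _; exact: lebesgue_measureN.
Qed.

Definition heat (s y : R) : R :=
  (Num.sqrt (2 * pi * s))^-1 * expR (- y ^+ 2 / (2 * s)).

Lemma heat_normal_pdf (s : R) : 0 < s -> normal_pdf 0 (Num.sqrt s) = heat s.
Proof.
move=> s0; rewrite normal_pdfE; last by rewrite gt_eqF// sqrtr_gt0.
apply/funext => y; rewrite /normal_peak /normal_fun /heat sqr_sqrtr ?ltW// subr0.
congr (_^-1 * expR (_ / _)); last by rewrite mulr_natl.
by congr Num.sqrt; rewrite -mulr_natl; ring.
Qed.

Lemma heat_ge0 (s y : R) : 0 <= heat s y.
Proof. by rewrite mulr_ge0 ?expR_ge0// invr_ge0. Qed.

Lemma measurable_heat (s : R) : measurable_fun setT (heat s).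
Proof.
apply: measurable_funM => //; apply: measurableT_comp => //=.
by apply: measurable_funM => //; apply: measurableT_comp.
Qed.

(** The point 2 rho s - y is the image of y in the change of variables behind
    [free_mean_reflection]; the weight compensates exactly what this substitution does to the
    Gaussian exponent. *)
Lemma heat_tilt (s rho y : R) : 0 < s ->
  expR (2 * rho * (rho * s - y)) * heat s (2 * rho * s - y) = heat s y.
Proof.
move=> s0; rewrite /heat mulrCA -expRD; congr (_ * expR _); field.
by rewrite gt_eqF.
Qed.

End lebesgue_change.

Section brownian.
Context d (T : measurableType d) (R : realType) (P : probability T R).
Context (B : R -> {RV P >-> R}) (bmB : brownian_motion B) (rho : R).
Notation mu := (@lebesgue_measure R).
Implicit Types (s t x y : R) (f : R -> \bar R).

Lemma ge0_integral_increment s t f : 0 <= s -> s < t ->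
    measurable_fun setT f -> (forall y, 0 <= f y)%E ->
  (\int[P]_w f (B t w - B s w)%R = \int[mu]_y (f y * (heat (t - s) y)%:E))%E.
Proof.
move=> s0 st mf f0.
have mBB : measurable_fun setT (fun w => B t w - B s w) by exact: measurable_funB.
pose D := @mfun_Sub _ _ T (measurableTypeR R) _ (mem_set mBB).
rewrite -(@ge0_integral_density _ (measurableTypeR R) R (distribution P D) mu)//.
- by rewrite ge0_integral_distribution.
- exact: measurable_heat.
- exact: heat_ge0.
- move=> A mA; have := bm_gaussian bmB s0 st mA.
  by rewrite /normal_prob heat_normal_pdf ?subr_gt0.
Qed.

Definition free_mean s f x : \bar R := (\int[P]_w f (x + B s w - rho * s)%R)%E.

Lemma free_mean0 f x : free_mean 0 f x = f x.
Proof.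
rewrite /free_mean; under eq_integral do rewrite (bm_start bmB) mulr0 subr0 addr0.
rewrite integral_cst//; transitivity (f x * 1)%E; last by rewrite mule1.
by congr (_ * _)%E; exact: probability_setT.
Qed.

Lemma free_meanE s f x : 0 < s -> measurable_fun setT f -> (forall y, 0 <= f y)%E ->
  free_mean s f x = (\int[mu]_y (f (x + y - rho * s)%R * (heat s y)%:E))%E.
Proof.
move=> s0 mf f0; rewrite /free_mean -[in RHS](subr0 s).
rewrite -(@ge0_integral_increment 0 s (fun y => f (x + y - rho * (s - 0))))//.
  by apply: eq_integral => w _; rewrite (bm_start bmB) !subr0.
by apply: measurableT_comp => //; apply: measurable_funB => //; exact: measurable_funD.
Qed.

Lemma free_mean_ge0 s f x : (forall y, 0 <= f y)%E -> (0 <= free_mean s f x)%E.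
Proof. by move=> f0; exact: integral_ge0. Qed.

Lemma measurable_free_mean s f : measurable_fun setT f -> (forall y, 0 <= f y)%E ->
  measurable_fun setT (free_mean s f).
Proof.
move=> mf f0.
apply: measurable_integral_param => //.
apply: measurableT_comp => //; apply: measurable_funB => //.
by apply: measurable_funD => //; exact: measurableT_comp.
Qed.

(** The past up to [s] and the increment after it are independent, so the past can be frozen. Every
    later use of the Markov property of the motion, including the one at grid exits, goes back to
    this deterministic time. *)
Lemma markov_free_mean (E : set T) s t f x : 0 <= s -> s <= t ->
    sigma_process `[0, s] B E -> measurable_fun setT f -> (forall y, 0 <= f y)%E ->
  (\int[P]_(w in E) f (x + B t w - rho * t)%R =
   \int[P]_(w in E) free_mean (t - s) f (x + B s w - rho * s)%R)%E.
Proof.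
move=> s0; rewrite le_eqVlt => /predU1P[->|st] sE mf f0.
  by apply: eq_integral => w _; rewrite subrr free_mean0.
pose G : set (set T) := \bigcup_(u in `[0, s]) sigma_rv (B u).
have sG : forall A : set T, <<s G >> A -> measurable A.
  apply: smallest_sub; first exact: sigma_algebra_measurable.
  by move=> A [u _ [C mC <-]]; exact: (@measurable_funP _ _ _ _ _ (B u)) => //; exact: mC.
(* The identity into [T] with the sigma-algebra of the past is the random variable that carries the
   entire past; the indicator of [E] and [B s] are functions of it. *)
have mid : measurable_fun setT (id : T -> g_sigma_algebraType G).
  by move=> _ A mA; rewrite setTI; exact: sG.
have mBs : measurable_fun setT (B s : g_sigma_algebraType G -> R).
  move=> _ A mA; rewrite setTI; apply: sub_sigma_algebra.
  by exists s; [rewrite /= in_itv/= s0 lexx|exists A => //; rewrite setTI].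
have mE1 : measurable_fun setT (\1_E : g_sigma_algebraType G -> R).
  exact: measurable_indic.
have mBB : measurable_fun setT (fun w => B t w - B s w) by exact: measurable_funB.
pose F (z : g_sigma_algebraType G * R) :=
  ((\1_E z.1)%:E * f (x + B s z.1 + z.2 - rho * t)%R)%E.
have mF : measurable_fun setT F.
  apply: emeasurable_funM.
    by apply/measurable_EFinP; apply: measurableT_comp.
  apply: measurableT_comp => //; apply: measurable_funB => //.
  apply: measurable_funD => //; apply: measurable_funD => //.
  exact: measurableT_comp.
have F0 z : (0 <= F z)%E by rewrite mule_ge0// lee_fin.
transitivity (\int[P]_w F (w, (B t w - B s w)%R))%E.
  rewrite integral_mkcond; apply: eq_integral => w _ /=.
  rewrite epatch_indic muleC /F /=; congr (_ * f _)%E; ring.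
rewrite (integral_independent mid mBB _ mF F0); last first.
  move=> A C mA mC; exact: (bm_increments bmB s0 st mA mC).
rewrite [RHS]integral_mkcond; apply: eq_integral => w _.
rewrite epatch_indic muleC /F /=.
rewrite ge0_integralZl//; last first.
  by apply: measurableT_comp => //; apply: measurable_funB => //; exact: measurable_funD.
congr (_ * _)%E.
rewrite (@ge0_integral_increment s t (fun y => f (x + B s w + y - rho * t)))//; last first.
  by apply: measurableT_comp => //; apply: measurable_funB => //; exact: measurable_funD.
rewrite free_meanE ?subr_gt0//; apply: eq_integral => y _.
by congr (f _ * _)%E; ring.
Qed.

Lemma free_mean_semigroup s t f x : 0 <= s -> 0 <= t ->
    measurable_fun setT f -> (forall y, 0 <= f y)%E ->
  free_mean s (free_mean t f) x = free_mean (s + t) f x.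
Proof.
move=> s0 t0 mf f0.
have sst : s <= s + t by rewrite lerDl.
have sT : sigma_process `[0, s] B [set: T].
  exact: (@measurableT _ (g_sigma_algebraType _)).
have := markov_free_mean x s0 sst sT mf f0.
by rewrite -/(free_mean _ _ _) => ->; rewrite addrAC subrr add0r.
Qed.

(* Method of images: this commutes with the drifted heat semigroup, and
   free_mean s f - reflection (free_mean s f) vanishes at 0. *)
Definition reflection f y : \bar R := ((expR (2 * rho * y))%:E * f (- y)%R)%E.

Lemma free_mean_reflection s f x : 0 <= s ->
    measurable_fun setT f -> (forall y, 0 <= f y)%E ->
  free_mean s (reflection f) x = reflection (free_mean s f) x.
Proof.
rewrite le_eqVlt => /predU1P[<-|s0] mf f0.
  by rewrite /reflection !free_mean0.
have mr : measurable_fun setT (reflection f).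
  apply: emeasurable_funM; last by apply: measurableT_comp.
  by apply/measurable_EFinP; apply: measurableT_comp => //; exact: measurable_funM.
rewrite free_meanE//; last by move=> y; rewrite mule_ge0// lee_fin expR_ge0.
rewrite [RHS]/reflection free_meanE//.
rewrite -ge0_integralZl//; last 2 first.
- apply: emeasurable_funM; last by apply/measurable_EFinP; exact: measurable_heat.
  by apply: measurableT_comp => //; apply: measurable_funB => //; exact: measurable_funD.
- by move=> y _; rewrite mule_ge0// lee_fin heat_ge0.
pose g y := ((expR (2 * rho * (x + y - rho * s)))%:E *
   f (- (x + y - rho * s))%R * (heat s y)%:E)%E.
have mg : measurable_fun setT g.
  apply: emeasurable_funM; last by apply/measurable_EFinP; exact: measurable_heat.
  apply: (measurableT_comp (f := reflection f)) => //.
  by apply: measurable_funB => //; exact: measurable_funD.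
have g0 y : (0 <= g y)%E by rewrite !mule_ge0// lee_fin ?heat_ge0 ?expR_ge0.
(* The shift followed by the sign change is the substitution y |-> 2 rho s - y, under which
   [heat_tilt] exchanges the weights. *)
rewrite -[LHS](ge0_integral_shift (2 * rho * s) mg)// -ge0_integral_oppr//; last first.
  by apply: measurableT_comp => //; exact: measurable_funD.
apply: eq_integral => y _; rewrite /g.
rewrite (_ : - (x + (- y + 2 * rho * s) - rho * s) = - x + y - rho * s); last by ring.
rewrite (_ : x + (- y + 2 * rho * s) - rho * s = x + (rho * s - y)); last by ring.
rewrite (addrC (- y)) -[in RHS](heat_tilt rho y s0) mulrDr expRD.
move: (heat _ _) (expR _) (expR _) (f _) => h a c e.
by rewrite muleAC -EFinM [RHS]muleCA -EFinM muleC; congr (_ * _%:E)%E; ring.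
Qed.

End brownian.

(** Uniform continuity on [0, t] at the mesh of the grid, by compactness. Only [r] is confined to
    [0, t], so [r'] may lie slightly beyond. *)
Lemma uniform_modulus (R : realType) (f : R -> R) (t e : R) :
    {within `[0, +oo[, continuous f} -> 0 < e ->
  \forall n \near \oo, forall r r' : R, 0 <= r <= t -> 0 <= r' ->
    `|r - r'| <= t / n.+1%:R -> `|f r - f r'| < e.
Proof.
move=> /subspace_continuousP cf e0.
have /compact_near_coveringP/(_ nat \oo
    (fun n r => forall r', 0 <= r -> 0 <= r' -> `|r - r'| <= t / n.+1%:R ->
      `|f r - f r'| < e)) := @segment_compact R 0 t.
move=> /(_ _) H.
have {H} : \forall n \near \oo, `[0, t]%classic `<=` (fun r => forall r' : R, 0 <= r ->
    0 <= r' -> `|r - r'| <= t / n.+1%:R -> `|f r - f r'| < e).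
  apply: H => x /=; rewrite in_itv/= => /andP[x0 xt].
  have e20 : 0 < e / 2 by rewrite divr_gt0.
  have x0' : `[0, +oo[%classic x by rewrite /= in_itv/= x0.
  have /cvgrPdist_lt/(_ _ e20)[/= dl dl0 Hdl] := cf _ x0'.
  have dl20 : 0 < dl / 2 by rewrite divr_gt0.
  near=> r n => /= r' r0 r'0 rr'.
  have rx : `|x - r| < dl / 2 by near: r; apply: nbhsx_ballx.
  have tn : t / n.+1%:R < dl / 2.
    near: n.
    have : t * harmonic n @[n --> \oo] --> t * 0 by apply: cvgMr; exact: cvg_harmonic.
    rewrite mulr0 => /cvgrPdist_lt/(_ _ dl20); apply: filterS => n.
    by rewrite sub0r normrN; exact/le_lt_trans/ler_norm.
  have Hd u : 0 <= u -> `|x - u| < dl -> `|f x - f u| < e / 2.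
    by move=> u0 xu; apply: (Hdl u xu); rewrite /= in_itv/= u0.
  have H1 : `|f x - f r| < e / 2.
    by apply: Hd => //; apply: (lt_le_trans rx).
  have H2 : `|f x - f r'| < e / 2.
    apply: Hd => //; rewrite -(subrKA r) (le_lt_trans (ler_normD _ _))//.
    by rewrite [ltRHS]splitr ltrD// (le_lt_trans rr').
  rewrite -(subrKA (f x)) (le_lt_trans (ler_normD _ _))// distrC.
  by rewrite [ltRHS]splitr ltrD.
apply: filterS => n H r r' /andP[r0 rt] r'0 rr'; apply: H => //=.
by rewrite in_itv/= r0.
Unshelve. all: by end_near. Qed.

(** * Killed Brownian motion *)

Section grid_stopping.
Context d (T : measurableType d) (R : realType) (P : probability T R).
Context (B : R -> {RV P >-> R}) (bmB : brownian_motion B) (rho x t : R).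
Hypotheses (x_gt0 : 0 < x) (t_gt0 : 0 < t).
Variable n : nat.
Implicit Types (f : R -> \bar R) (j k : nat).

Definition drifted (y s : R) (w : T) : R := y + B s w - rho * s.

Definition grid_time j : R := t * (j%:R / n.+1%:R).

Definition grid_pos j : set T :=
  [set w | forall i, (i <= j)%N -> 0 < drifted x (grid_time i) w].

(** [j] is the index of the first grid time at which the path is nonpositive. This discrete time
    replaces the hitting time of 0, and each of its values is deterministic. *)
Definition grid_exit j : set T :=
  [set w | (forall i, (i < j)%N -> 0 < drifted x (grid_time i) w) /\
           drifted x (grid_time j) w <= 0].

Lemma grid_time_ge0 j : 0 <= grid_time j.
Proof. by rewrite mulr_ge0 ?divr_ge0// ltW. Qed.

Lemma grid_time_le j k : (j <= k)%N -> grid_time j <= grid_time k.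
Proof. by move=> jk; rewrite ler_pM2l// ler_pM2r ?invr_gt0// ler_nat. Qed.

Lemma grid_time_max : grid_time n.+1 = t.
Proof. by rewrite /grid_time divff ?mulr1// pnatr_eq0. Qed.

Lemma sigma_process_drifted (s u y : R) (A : set R) : 0 <= u -> u <= s ->
  measurable A -> sigma_process `[0, s] B (drifted y u @^-1` A).
Proof.
move=> u0 us mA; apply: sub_sigma_algebra; exists u; first by rewrite /= in_itv/= u0.
exists ((fun z => y + z - rho * u) @^-1` A); last by rewrite setTI.
rewrite -[X in measurable X]setTI; apply: measurable_funB => //.
by apply: measurable_funD.
Qed.

Lemma sigma_process_grid_exit j : sigma_process `[0, grid_time j] B (grid_exit j).
Proof.
rewrite (_ : grid_exit j = \bigcap_(i < j) (drifted x (grid_time i) @^-1` `]0, +oo[)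
    `&` drifted x (grid_time j) @^-1` `]-oo, 0]); last first.
  by apply/seteqP; split=> w /= [H1]; rewrite ?in_itv/= => H2; split=> // i ij;
    have := H1 i ij; rewrite /= ?in_itv/= ?andbT.
apply: (@measurableI _ (g_sigma_algebraType _)).
  apply: (@bigcap_measurableType _ (g_sigma_algebraType _)) => i ij.
  apply: sigma_process_drifted => //; first exact: grid_time_ge0.
  by apply: grid_time_le; exact: ltnW.
by apply: sigma_process_drifted => //; exact: grid_time_ge0.
Qed.

Lemma sub_sigma_process (D : set R) (A : set T) : sigma_process D B A -> measurable A.
Proof.
move: A; apply: smallest_sub; first exact: sigma_algebra_measurable.
by move=> A [u _ [C mC <-]]; exact: (@measurable_funP _ _ _ _ _ (B u)).
Qed.

Lemma measurable_grid_exit j : measurable (grid_exit j).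
Proof. exact: (sub_sigma_process (@sigma_process_grid_exit j)). Qed.

Lemma measurable_drifted y s : measurable_fun setT (drifted y s).
Proof. by apply: measurable_funB => //; exact: measurable_funD. Qed.

Lemma measurable_grid_pos j : measurable (grid_pos j).
Proof.
rewrite (_ : grid_pos j = \bigcap_(i in [set i | (i <= j)%N])
    (drifted x (grid_time i) @^-1` `]0, +oo[)); last first.
  by apply/seteqP; split=> w H1 i ij; have := H1 i ij; rewrite /= in_itv/= andbT.
apply: bigcap_measurableType => i _; rewrite -[X in measurable X]setTI.
by apply: measurable_drifted.
Qed.

Lemma grid_exit0 : grid_exit 0 = set0.
Proof.
apply/seteqP; split=> // w [_].
by rewrite /drifted /grid_time !mul0r !mulr0 (bm_start bmB) addr0 subr0 leNgt x_gt0.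
Qed.

Lemma grid_pos0 : grid_pos 0 = setT.
Proof.
apply/seteqP; split=> // w _ i; rewrite leqn0 => /eqP->.
by rewrite /drifted /grid_time !mul0r !mulr0 (bm_start bmB) addr0 subr0.
Qed.

Lemma grid_posS j : grid_pos j = grid_pos j.+1 `|` grid_exit j.+1.
Proof.
apply/seteqP; split=> w.
  move=> wj; have [H|H] := ltP 0 (drifted x (grid_time j.+1) w); last by right.
  by left=> i; rewrite leq_eqVlt => /predU1P[->//|]; exact: wj.
by case=> [H i ij|[H _] i ij]; apply: H => //; exact: leqW.
Qed.

Lemma grid_pos_exit_disjoint j : [disjoint grid_pos j.+1 & grid_exit j.+1].
Proof.
apply/disj_setPS => w [/(_ j.+1 (leqnn _))].
by rewrite ltNge => /negP Hp [_ He]; exact: Hp.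
Qed.

Local Open Scope ereal_scope.

(** Splits according to the first grid exit. The exit of index 0 is empty because the start is
    positive; keeping it makes the induction uniform. *)
Lemma ge0_integral_grid (g : T -> \bar R) j : measurable_fun setT g ->
    (forall w, 0 <= g w) ->
  \int[P]_w g w = \int[P]_(w in grid_pos j) g w +
    \sum_(i < j.+1) \int[P]_(w in grid_exit i) g w.
Proof.
move=> mg g0; elim: j => [|j ->].
  by rewrite big_ord1/= grid_pos0 grid_exit0 integral_set0 adde0.
rewrite grid_posS ge0_integral_setU//.
- rewrite [in RHS]big_ord_recr/= [RHS]addeA [LHS]addeAC.
  by [].
- exact: measurable_grid_pos.
- exact: measurable_grid_exit.
- exact: measurable_funTS.
- exact: grid_pos_exit_disjoint.
Qed.

Lemma markov_grid_exit f j : (j <= n.+1)%N -> measurable_fun setT f ->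
    (forall y, 0 <= f y) ->
  \int[P]_(w in grid_exit j) f (drifted x t w) =
  \int[P]_(w in grid_exit j)
    free_mean B rho (t - grid_time j) f (drifted x (grid_time j) w).
Proof.
move=> jn mf f0; apply: markov_free_mean => //.
- exact: grid_time_ge0.
- by rewrite -[leRHS]grid_time_max; exact: grid_time_le.
- exact: sigma_process_grid_exit.
Qed.

(** The exit events are disjoint, so at most one summand is nonzero. *)
Lemma sum_grid_exit_le (e : R -> R) (c : R) j w : (0 <= c)%R ->
    (forall i, (i <= j)%N -> grid_exit i w -> (e (drifted x (grid_time i) w) <= c)%R) ->
  (\sum_(i < j.+1) \1_(grid_exit i) w * e (drifted x (grid_time i) w) <= c)%R.
Proof.
move=> c0; elim: j => [|j IH] H.
  rewrite big_ord1 indicE; case: (boolP (_ \in _)) => [/set_mem He|]/=.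
    by rewrite mul1r; exact: H.
  by rewrite mul0r.
rewrite big_ord_recr/= indicE; case: (boolP (_ \in _)) => [/set_mem He|_].
  rewrite mul1r big1 ?add0r ?H// => i _.
  rewrite indicE memNset ?mul0r// => -[_]; apply/negP; rewrite -ltNge.
  by have [Hi _] := He; apply: Hi.
by rewrite mul0r addr0 IH// => i ij; apply: H; exact: leqW.
Qed.

End grid_stopping.

Lemma bounded_cvg_integral0 d (T : measurableType d) (R : realType)
    (P : probability T R) (g : nat -> T -> R) (M : R) :
    (forall n, measurable_fun setT (g n)) -> (forall n w, 0 <= g n w <= M) ->
    (forall w, g n w @[n --> \oo] --> 0) ->
  (\int[P]_w (g n w)%:E)%E @[n --> \oo] --> 0%E.
Proof.
move=> mg gM gc.
have := @dominated_cvg _ T R P setT measurableT (fun n w => (g n w)%:E)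
  (cst 0%E) (cst M%:E).
rewrite integral0; apply=> //.
- by move=> n; apply/measurable_EFinP.
- by move=> w _; apply: cvg_EFin; [exact: nearW|exact: gc].
- exact: finite_measure_integrable_cst.
- move=> n w _; have /andP[g0 gM'] := gM n w.
  by rewrite abse_EFin lee_fin ger0_norm.
Qed.

Section free_mean_bounds.
Context d (T : measurableType d) (R : realType) (P : probability T R).
Context (B : R -> {RV P >-> R}) (rho : R).
Implicit Types (s x y z : R) (f : R -> \bar R).

Lemma measurable_comp_drifted f s x : measurable_fun setT f ->
  measurable_fun setT (fun w => f (drifted B rho x s w)).
Proof. by move=> mf; apply: measurableT_comp => //; exact: measurable_drifted. Qed.

Lemma le_free_mean f g s x : measurable_fun setT f -> measurable_fun setT g ->
    (forall y, 0 <= f y)%E -> (forall y, f y <= g y)%E ->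
  (free_mean B rho s f x <= free_mean B rho s g x)%E.
Proof.
move=> mf mg f0 fg; apply: ge0_le_integral => //.
- exact: measurable_comp_drifted.
- exact: measurable_comp_drifted.
Qed.

Lemma free_mean_cst (c : \bar R) s x : free_mean B rho s (fun=> c) x = c.
Proof.
rewrite /free_mean integral_cst//; transitivity (c * 1)%E; last by rewrite mule1.
by congr (_ * _)%E; exact: probability_setT.
Qed.

Lemma free_mean_le_cst f (c : R) s x : measurable_fun setT f ->
    (forall y, 0 <= f y)%E -> (forall y, f y <= c%:E)%E ->
  (free_mean B rho s f x <= c%:E)%E.
Proof.
move=> mf f0 fc; rewrite -[leRHS](free_mean_cst _ s x).
exact: le_free_mean.
Qed.

Section lipschitz.
Variables (h : R -> R) (L b : R).
Hypotheses (h01 : forall y, 0 <= h y <= 1) (hL : forall y z, h y <= h z + L * `|y - z|).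
Hypotheses (L0 : 0 <= L) (b0 : 0 <= b).
Hypotheses (mh : measurable_fun setT h).
Hypotheses (h_neg : forall y, y <= 0 -> h y = 0) (h_far : forall y, b <= y -> h y = 0).

Let f1 y : \bar R := (h y)%:E.
Let f2 := reflection rho f1.
Let M := expR (2 * `|rho| * b).

Let mf1 : measurable_fun setT f1. Proof. exact/measurable_EFinP. Qed.

Let f10 y : (0 <= f1 y)%E.
Proof. by rewrite lee_fin; have /andP[] := h01 y. Qed.

Lemma measurable_reflection f : measurable_fun setT f -> measurable_fun setT (reflection rho f).
Proof.
move=> mf; apply: emeasurable_funM; last by apply: measurableT_comp.
by apply/measurable_EFinP; apply: measurableT_comp => //; exact: measurable_funM.
Qed.

Lemma reflection_ge0 f y : (forall y, 0 <= f y)%E -> (0 <= reflection rho f y)%E.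
Proof. by move=> f0; rewrite mule_ge0// lee_fin expR_ge0. Qed.

Let f2M y : (f2 y <= M%:E)%E.
Proof.
rewrite /f2 /reflection -EFinM lee_fin.
have /andP[hy0 hy1] := h01 (- y).
have [y0|y0] := leP 0 y; first by rewrite h_neg ?oppr_le0// mulr0 expR_ge0.
have [yb|yb] := leP b (- y); first by rewrite h_far// mulr0 expR_ge0.
rewrite (@le_trans _ _ (expR (2 * rho * y)))// ?ler_piMr ?expR_ge0// ler_expR.
rewrite -!mulrA ler_pM2l// (le_trans (ler_norm _))// normrM ler_wpM2l//.
by rewrite ltr0_norm// ltW.
Qed.

(** Both starting points follow the same Brownian path, hence keep their distance. *)
Lemma free_mean_lipschitz s y z :
  (free_mean B rho s f1 y <= free_mean B rho s f1 z + (L * `|y - z|)%:E)%E.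
Proof.
rewrite -(free_mean_cst (L * `|y - z|)%:E s z) -ge0_integralD//; last 2 first.
- exact: measurable_comp_drifted.
- by move=> w _; rewrite lee_fin mulr_ge0.
apply: ge0_le_integral => //.
- exact: measurable_comp_drifted.
- by apply: emeasurable_funD => //; exact: measurable_comp_drifted.
- move=> w _; rewrite -EFinD lee_fin (le_trans (hL _ (z + B s w - rho * s)))//.
  by rewrite lerD2l ler_wpM2l// opprB addrA subrK opprD addrACA subrr addr0.
Qed.

(** Price of stopping at an overshoot [y] instead of at 0, where a function and its reflection have
    equal means. The second bound compares the starts [y] and [- y] and the weight exp(2 rho y) with
    1. The first bounds both means globally, because [h] vanishes outside [0, b], and provides
    domination. *)
Definition exit_error y : R := Num.min M (2 * L * `|y| + `|1 - expR (2 * rho * y)|).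

Lemma exit_error_ge0 y : 0 <= exit_error y.
Proof. by rewrite le_min expR_ge0/= addr_ge0// mulr_ge0// mulr_ge0. Qed.

Lemma measurable_exit_error : measurable_fun setT exit_error.
Proof.
apply: measurable_minr => //; apply: measurable_funD.
  by apply: measurable_funM => //; exact: measurableT_comp.
apply: measurableT_comp => //; apply: measurable_funB => //.
by apply: measurableT_comp => //; exact: measurable_funM.
Qed.

Lemma cvg_exit_error : exit_error y @[y --> 0] --> 0.
Proof.
apply: (@squeeze_cvgr _ _ _ _ (fun=> 0) (fun y => 2 * L * `|y| + `|1 - expR (2 * rho * y)|)).
- by near=> y; rewrite exit_error_ge0/= ge_min lexx orbT.
- exact: cvg_cst.
- have c1 : (2 * L * `|y|) @[y --> (0 : R)] --> 2 * L * `|0 : R|.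
    by apply: cvgMr; exact: norm_continuous.
  have c2 : `|1 - expR (2 * rho * y)| @[y --> (0 : R)] --> `|1 - expR (2 * rho * 0)|.
    apply: cvg_norm; apply: cvgB; first exact: cvg_cst.
    apply: continuous_comp; first exact: mulrl_continuous.
    exact: continuous_expR.
  rewrite [X in _ --> X](_ : 0 = 2 * L * `|0 : R| + `|1 - expR (2 * rho * 0)|).
    exact: cvgD.
  by rewrite normr0 !mulr0 expR0 subrr normr0 addr0.
Unshelve. all: by end_near. Qed.

Let fin_f1 s y : free_mean B rho s f1 y = (fine (free_mean B rho s f1 y))%:E.
Proof.
rewrite fineK// ge0_fin_numE ?free_mean_ge0//.
apply: (@le_lt_trans _ _ 1%:E); last exact: ltry.
by apply: free_mean_le_cst => // z; rewrite lee_fin; have /andP[] := h01 z.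
Qed.

Lemma free_mean_reflection_near (bmB : brownian_motion B) s y : 0 <= s ->
  (free_mean B rho s f1 y <= free_mean B rho s f2 y + (exit_error y)%:E)%E /\
  (free_mean B rho s f2 y <= free_mean B rho s f1 y + (exit_error y)%:E)%E.
Proof.
move=> s0.
have M1 : 1 <= M by rewrite -expR0 ler_expR !mulr_ge0.
have a1 z : fine (free_mean B rho s f1 z) <= 1.
  rewrite -lee_fin -fin_f1; apply: free_mean_le_cst => // u.
  by rewrite lee_fin; have /andP[] := h01 u.
have a0 z : 0 <= fine (free_mean B rho s f1 z) by rewrite -lee_fin -fin_f1 free_mean_ge0.
have f2E : free_mean B rho s f2 y =
    (expR (2 * rho * y) * fine (free_mean B rho s f1 (- y)))%:E.
  by rewrite free_mean_reflection// /reflection fin_f1.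
have f2le : expR (2 * rho * y) * fine (free_mean B rho s f1 (- y)) <= M.
  rewrite -lee_fin -f2E; apply: free_mean_le_cst => //.
    exact: measurable_reflection.
  by move=> z; exact: reflection_ge0.
have aL u v : fine (free_mean B rho s f1 u) <= fine (free_mean B rho s f1 v) + L * `|u - v|.
  by rewrite -lee_fin EFinD -2!fin_f1; exact: free_mean_lipschitz.
rewrite f2E (fin_f1 s y) -!EFinD !lee_fin.
move: (aL y (- y)) (aL (- y) y); rewrite opprK -opprD normrN.
have -> : `|y + y| = 2 * `|y| by rewrite -mulr2n normrMn mulr_natl.
move: (a1 y) (a0 y) (a1 (- y)) (a0 (- y)) f2le.
move: (fine _) (fine _) => v u u1 u0 v1 v0 ev H1 H2.
rewrite /exit_error; set E := expR (2 * rho * y) in ev *.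
have E0 : 0 <= E by exact: expR_ge0.
have Ev : `|v - E * v| <= `|1 - E|.
  by rewrite -{1}[v]mul1r -mulrBl normrM (ger0_norm v0) ler_piMr.
have := Ev; rewrite ler_norml => /andP[Ev1 Ev2].
have EE : 0 <= E * v by rewrite mulr_ge0.
case: (leP M (2 * L * `|y| + `|1 - E|)) => _; split; lra.
Qed.

End lipschitz.
End free_mean_bounds.

Lemma lee_cvg_add0 (R : realType) (a b : \bar R) (e : nat -> \bar R) :
  e n @[n --> \oo] --> 0%E -> (forall n, a <= b + e n)%E -> (a <= b)%E.
Proof.
move=> e0 abe; rewrite -[leRHS]adde0.
have be : (b + e n)%E @[n --> \oo] --> (b + 0)%E.
  by apply: cvgeD => //; [rewrite fin_num_adde_defl|exact: cvg_cst].
by apply: (cvge_to_ge be); exact: nearW.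
Qed.

(** * Reflection principle for the killed motion *)

Section reflection_principle.
Context d (T : measurableType d) (R : realType) (P : probability T R).
Context (B : R -> {RV P >-> R}) (bmB : brownian_motion B) (rho : R).
Implicit Types (s t x y z : R) (f : R -> \bar R).

Definition survival x s : set T :=
  [set w | forall r : R, 0 <= r <= s -> 0 < drifted B rho x r w].

Definition killed_mean s f x : \bar R :=
  (\int[P]_(w in survival x s) f (drifted B rho x s w))%E.

Lemma measurable_survival x s : measurable (survival x s).
Proof.
have [s0|s0] := ltP s 0.
  rewrite (_ : survival x s = setT); first exact: measurableT.
  apply/seteqP; split=> // w _ r /andP[r0 rs].
  by have := le_lt_trans (le_trans r0 rs) s0; rewrite ltxx.
apply: (@measurable_pos_on_itv _ T R (fun s w => B s w) _ _ _ T (fun=> x) (fun=> s) id rho) => //.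
exact: (bm_continuous bmB).
Qed.

Lemma survival_gt0 x s w : 0 <= s -> survival x s w -> 0 < x.
Proof.
move=> s0 /(_ 0); rewrite lexx s0 => /(_ isT).
by rewrite /drifted (bm_start bmB) mulr0 subr0 addr0.
Qed.

Lemma survival_grid x t n : 0 < t -> survival x t `<=` grid_pos B rho x t n n.+1.
Proof.
move=> t0 w H i ij; apply: H; rewrite grid_time_ge0//=.
by rewrite -[leRHS](grid_time_max t n) grid_time_le.
Qed.

Lemma killed_mean_le0 s f x : 0 <= s -> x <= 0 -> killed_mean s f x = 0%E.
Proof.
move=> s0 x0; rewrite /killed_mean (_ : survival x s = set0) ?integral_set0//.
by apply/seteqP; split=> // w /(survival_gt0 s0); rewrite ltNge x0.
Qed.

Section lipschitz.
Variables (h : R -> R) (L b : R).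
Hypotheses (h01 : forall y, 0 <= h y <= 1) (hL : forall y z, h y <= h z + L * `|y - z|).
Hypotheses (L0 : 0 <= L) (b0 : 0 <= b).
Hypotheses (mh : measurable_fun setT h).
Hypotheses (h_neg : forall y, y <= 0 -> h y = 0) (h_far : forall y, b <= y -> h y = 0).

Let f1 y : \bar R := (h y)%:E.
Let f2 := reflection rho f1.

Let mf1 : measurable_fun setT f1. Proof. exact/measurable_EFinP. Qed.

Let f10 y : (0 <= f1 y)%E.
Proof. by rewrite lee_fin; have /andP[] := h01 y. Qed.

Let mf2 : measurable_fun setT f2. Proof. exact: measurable_reflection. Qed.

Let f20 y : (0 <= f2 y)%E. Proof. exact: reflection_ge0. Qed.

Let err n x t w : R := \sum_(i < n.+2) \1_(grid_exit B rho x t n i) w *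
  exit_error rho L b (drifted B rho x (grid_time t n i) w).

Let err_ge0 n x t w : 0 <= err n x t w.
Proof. by apply: sumr_ge0 => i _; rewrite mulr_ge0// exit_error_ge0. Qed.

Let merr_term n x t i : 0 < t -> measurable_fun setT (fun w =>
  \1_(grid_exit B rho x t n i) w *
  exit_error rho L b (drifted B rho x (grid_time t n i) w)).
Proof.
move=> t0; apply: measurable_funM.
  by apply: measurable_indic; exact: measurable_grid_exit.
apply: measurableT_comp; first exact: measurable_exit_error.
exact: measurable_drifted.
Qed.

Let merr n x t : 0 < t -> measurable_fun setT (err n x t).
Proof. by move=> t0; apply: measurable_sum => i; exact: merr_term. Qed.

Let cvg_err x t : 0 < x -> 0 < t ->
  (\int[P]_w (err n x t w)%:E)%E @[n --> \oo] --> 0%E.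
Proof.
move=> x0 t0.
apply: (@bounded_cvg_integral0 _ _ _ _ _ (expR (2 * `|rho| * b))).
- by move=> n; exact: merr.
- move=> n w; rewrite err_ge0/=; apply: sum_grid_exit_le; first exact: expR_ge0.
  by move=> i _ _; rewrite ge_min lexx.
move=> w; apply/cvgrPdist_le => e e0.
have /cvgrPdist_lt/(_ _ e0)[/= dl dl0 Hdl] := cvg_exit_error rho b L0.
have cX : {within `[0, +oo[, continuous (fun s => drifted B rho x s w)}.
  exact: (@within_continuous_drift _ _ _ (fun s w => B s w) (bm_continuous bmB)).
have := uniform_modulus t cX dl0; apply: filterS => n Hn.
rewrite sub0r normrN ger0_norm ?err_ge0//.
apply: sum_grid_exit_le; first exact: ltW.
move=> [|i] ij; first by rewrite grid_exit0.
move=> [Hi Hneg].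
set u := drifted _ _ _ _ _ in Hneg *.
have gti : grid_time t n i.+1 <= t.
  by rewrite -[leRHS](grid_time_max t n) grid_time_le.
have := Hn (grid_time t n i.+1) (grid_time t n i).
rewrite grid_time_ge0// gti grid_time_ge0// => /(_ isT isT).
have -> : `|grid_time t n i.+1 - grid_time t n i| = t / n.+1%:R.
  rewrite /grid_time -mulrBr -mulrBl -natrB// subSnn mul1r ger0_norm//.
  by rewrite divr_ge0// ltW.
rewrite lexx => /(_ isT) Hu.
(* One mesh earlier the path was positive, so the overshoot below 0 is at most the oscillation over
   one mesh. *)
have := Hi i (leqnn _); rewrite -/u in Hu; move: Hu.
set v := drifted _ _ _ _ _ => Hu v0.
apply: le_trans (_ : `|0 - exit_error rho L b u| <= e); last apply: ltW.
  by rewrite sub0r normrN ler_norm.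
apply: Hdl; rewrite /= sub0r normrN ler0_norm//.
apply: le_lt_trans Hu; rewrite distrC (le_trans _ (ler_norm _))// lerDr ltW//.
Qed.

Let exit_compare f g x t (n : nat) : 0 < x -> 0 < t ->
    measurable_fun setT f -> measurable_fun setT g ->
    (forall y, 0 <= f y)%E -> (forall y, 0 <= g y)%E ->
    (forall s y, (0 <= s)%R -> free_mean B rho s f y <=
       free_mean B rho s g y + (exit_error rho L b y)%:E)%E ->
  (\sum_(i < n.+2) \int[P]_(w in grid_exit B rho x t n i) f (drifted B rho x t w) <=
   \sum_(i < n.+2) \int[P]_(w in grid_exit B rho x t n i) g (drifted B rho x t w) +
   \int[P]_w (err n x t w)%:E)%E.
Proof.
move=> x0 t0 mf mg f0 g0 fg.
have mE := measurable_grid_exit B rho x t0 n.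
have mee : measurable_fun setT (exit_error rho L b) by exact: measurable_exit_error.
have -> : (\int[P]_w (err n x t w)%:E = \sum_(i < n.+2)
    \int[P]_(w in grid_exit B rho x t n i)
      (exit_error rho L b (drifted B rho x (grid_time t n i) w))%:E)%E.
  under eq_integral do rewrite /err -sumEFin.
  rewrite ge0_integral_sum//; last 2 first.
  - by move=> i; apply/measurable_EFinP; exact: merr_term.
  - by move=> i w _; rewrite lee_fin mulr_ge0// exit_error_ge0.
  apply: eq_bigr => i _; rewrite [RHS]integral_mkcond; apply: eq_integral => w _.
  by rewrite epatch_indic muleC EFinM.
rewrite -big_split/=; apply: lee_sum => i _.
have iN : (i <= n.+1)%N by rewrite -ltnS.
have t_i : 0 <= t - grid_time t n i.
  by rewrite subr_ge0 -[leRHS](grid_time_max t n) grid_time_le.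
rewrite !(markov_grid_exit bmB)// -ge0_integralD//; last 4 first.
- by move=> w _; exact: free_mean_ge0.
- by apply: measurable_funTS; apply: measurable_comp_drifted; exact: measurable_free_mean.
- by move=> w _; rewrite lee_fin exit_error_ge0.
- apply: measurable_funTS; apply: (@measurable_comp_drifted _ _ _ _ B rho (EFin \o exit_error rho L b)).
  exact/measurable_EFinP.
apply: ge0_le_integral => //.
- by move=> w _; exact: free_mean_ge0.
- by apply: measurable_funTS; apply: measurable_comp_drifted; exact: measurable_free_mean.
- apply: measurable_funTS; apply: emeasurable_funD.
    by apply: measurable_comp_drifted; exact: measurable_free_mean.
  apply: (@measurable_comp_drifted _ _ _ _ B rho (EFin \o exit_error rho L b)).
  exact/measurable_EFinP.
- by move=> w _; exact: fg.
Qed.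

Let near1 s y : 0 <= s ->
  (free_mean B rho s f1 y <= free_mean B rho s f2 y + (exit_error rho L b y)%:E)%E.
Proof.
by move=> s0; have [] := @free_mean_reflection_near _ _ _ _ B rho h L b h01 hL L0 b0 mh h_neg h_far bmB s y s0.
Qed.

Let near2 s y : 0 <= s ->
  (free_mean B rho s f2 y <= free_mean B rho s f1 y + (exit_error rho L b y)%:E)%E.
Proof.
by move=> s0; have [] := @free_mean_reflection_near _ _ _ _ B rho h L b h01 hL L0 b0 mh h_neg h_far bmB s y s0.
Qed.

Let grid_pos_f2 x t n : 0 < t ->
  (\int[P]_(w in grid_pos B rho x t n n.+1) f2 (drifted B rho x t w) = 0)%E.
Proof.
move=> t0; apply: integral0_eq => w /(_ n.+1 (leqnn _)); rewrite grid_time_max => X0.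
by rewrite /f2 /reflection /f1 h_neg ?mule0// oppr_le0 ltW.
Qed.

Let mXt f x t : measurable_fun setT f -> measurable_fun setT (fun w => f (drifted B rho x t w)).
Proof. exact: measurable_comp_drifted. Qed.

Let split_grid f x t n : 0 < x -> 0 < t -> measurable_fun setT f -> (forall y, 0 <= f y)%E ->
  (free_mean B rho t f x = \int[P]_(w in grid_pos B rho x t n n.+1) f (drifted B rho x t w)
   + \sum_(i < n.+2) \int[P]_(w in grid_exit B rho x t n i) f (drifted B rho x t w))%E.
Proof. by move=> x0 t0 mf f0; rewrite -(ge0_integral_grid bmB)//; exact: mXt. Qed.

(** Survivors are grid survivors, which bounds [killed_mean] by the surviving part of the grid
    splitting. The reflected function vanishes on grid survivors, and on the exits both functions
    have the same mean up to an error that tends to 0. *)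
Lemma killed_mean_reflection_le x t : 0 < x -> 0 < t ->
  (killed_mean t f1 x + free_mean B rho t f2 x <= free_mean B rho t f1 x)%E.
Proof.
move=> x0 t0.
apply: (lee_cvg_add0 (cvg_err x0 t0)) => n.
rewrite (split_grid n x0 t0 mf1 f10) (split_grid n x0 t0 mf2 f20) grid_pos_f2// add0e.
have K : (killed_mean t f1 x <=
    \int[P]_(w in grid_pos B rho x t n n.+1) f1 (drifted B rho x t w))%E.
  apply: ge0_subset_integral => //.
  - exact: measurable_survival.
  - exact: measurable_grid_pos.
  - by apply: measurable_funTS; exact: mXt.
  - exact: survival_grid.
rewrite -[leRHS]addeA; apply: leeD K _.
by apply: exit_compare => // s y s0; exact: near2.
Qed.

(** A grid survivor from [x] may dip below 0 between grid times, but by less than [e] once the mesh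
    is fine; outside an event of vanishing probability it therefore survives when started at x +
    e. *)
Lemma survival_shift_ge x t e : 0 < x -> 0 < t -> 0 < e ->
  (free_mean B rho t f1 x <=
   \int[P]_(w in survival (x + e) t) f1 (drifted B rho x t w) + free_mean B rho t f2 x)%E.
Proof.
move=> x0 t0 e0.
pose bad n := grid_pos B rho x t n n.+1 `\` survival (x + e) t.
have mbad n : measurable (bad n).
  by apply: measurableD; [exact: measurable_grid_pos|exact: measurable_survival].
have badP : (\int[P]_w (\1_(bad n) w : R)%:E)%E @[n --> \oo] --> 0%E.
  apply: (@bounded_cvg_integral0 _ _ _ _ _ 1) => [n|n w|w].
  - exact: measurable_indic.
  - by rewrite indicE; case: (_ \in _); rewrite lexx ler01.
  apply/cvgrPdist_lt => u u0.
  have cX : {within `[0, +oo[, continuous (fun s => drifted B rho x s w)}.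
    exact: (@within_continuous_drift _ _ _ (fun s w => B s w) (bm_continuous bmB)).
  have := uniform_modulus t cX e0; apply: filterS => n Hn.
  rewrite indicE memNset ?subrr ?normr0// => -[Hpos]; apply=> r /andP[r0 rt].
  pose q := grid_floor n (r / t).
  have rt0 : 0 <= r / t by rewrite divr_ge0// ltW.
  have qr : t * q <= r.
    rewrite -[leRHS](divfK (lt0r_neq0 t0)) mulrC ler_pM2r//; exact: grid_floor_le.
  have rq : r - t * q <= t / n.+1%:R.
    rewrite -[X in X - _](divfK (lt0r_neq0 t0)) [_ * t]mulrC -mulrBr ler_pM2l//.
    by rewrite lerBlDr -lerBlDl ltW// lt_grid_floor.
  have tq0 : 0 <= t * q by rewrite mulr_ge0 ?grid_floor_ge0// ltW.
  have := Hn r (t * q); rewrite r0 rt => /(_ isT tq0).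
  rewrite ger0_norm ?subr_ge0// => /(_ rq).
  have : 0 < drifted B rho x (t * q) w.
    apply: (Hpos (Num.trunc (r / t * n.+1%:R))).
    rewrite -(ler_nat R) (@le_trans _ _ (r / t * n.+1%:R))//.
      by rewrite truncn_le mulr_ge0.
    by rewrite ler_piMl// ler_pdivrMr// mul1r.
  by rewrite ltr_norml => H /andP[H1 _]; move: H H1; rewrite /drifted; lra.
have bc : (\int[P]_w (\1_(bad n) w : R)%:E + \int[P]_w (err n x t w)%:E)%E
    @[n --> \oo] --> 0%E.
  by rewrite -[X in _ --> X]adde0; apply: cvgeD => //; exact: cvg_err.
apply: (lee_cvg_add0 bc) => n.
rewrite (split_grid n x0 t0 mf1 f10) (split_grid n x0 t0 mf2 f20) grid_pos_f2// add0e.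
rewrite [leRHS]addeACA; apply: leeD; last first.
  by apply: exit_compare => // s y s0; exact: near1.
rewrite [leLHS]integral_mkcond [X in (_ <= X + _)%E]integral_mkcond.
rewrite -ge0_integralD//; last 3 first.
- by move=> w _; exact: erestrict_ge0.
- by apply/(measurable_restrictT _ (measurable_survival _ _)); exact/measurable_funTS/mXt.
- by apply/measurable_EFinP; exact: measurable_indic.
apply: ge0_le_integral => //.
- by move=> w _; exact: erestrict_ge0.
- apply/(measurable_restrictT _ (measurable_grid_pos _ _ _ _ _ _)).
  exact/measurable_funTS/mXt.
- apply: emeasurable_funD.
    by apply/(measurable_restrictT _ (measurable_survival _ _)); exact/measurable_funTS/mXt.
  by apply/measurable_EFinP; exact: measurable_indic.
move=> w _; rewrite !epatch_indic /= !indicE /bad /f1 -!EFinM -EFinD lee_fin.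
have h0 : 0 <= h (drifted B rho x t w) by have /andP[] := h01 (drifted B rho x t w).
have h1 : h (drifted B rho x t w) <= 1 by have /andP[] := h01 (drifted B rho x t w).
rewrite in_setD; case: (w \in survival _ _); case: (w \in grid_pos _ _ _ _ _ _) => /=;
  rewrite ?mulr1 ?mulr0 ?addr0 ?add0r//.
Qed.

(** The missing inequality comes from [survival_shift_ge] started at x - e; the Lipschitz bound
    absorbs the displacement as e decreases to 0. *)
Lemma killed_mean_reflection_lip x t : 0 < x -> 0 < t ->
  (killed_mean t f1 x + free_mean B rho t f2 x = free_mean B rho t f1 x)%E.
Proof.
move=> x0 t0; apply/eqP; rewrite eq_le killed_mean_reflection_le//=.
have h1 z : h z <= 1 by have /andP[] := h01 z.
have f1le z : (f1 z <= 1%:E)%E by rewrite lee_fin.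
pose a z := fine (free_mean B rho t f1 z).
have aE z : free_mean B rho t f1 z = (a z)%:E.
  rewrite fineK// ge0_fin_numE ?free_mean_ge0//.
  by apply: (@le_lt_trans _ _ 1%:E); [exact: free_mean_le_cst|exact: ltry].
have f2E z : free_mean B rho t f2 z = (expR (2 * rho * z) * a (- z))%:E.
  by rewrite free_mean_reflection ?ltW// /reflection aE EFinM.
have aL u v : a u <= a v + L * `|u - v|.
  by rewrite -lee_fin EFinD -!aE; exact: free_mean_lipschitz.
have killed_le : (killed_mean t f1 x <= free_mean B rho t f1 x)%E.
  apply: ge0_subset_integral => //; first exact: measurable_survival.
  exact: mXt.
pose k := fine (killed_mean t f1 x).
have kE : killed_mean t f1 x = k%:E.
  rewrite fineK// ge0_fin_numE ?integral_ge0//.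
  by rewrite (le_lt_trans killed_le)// aE ltry.
rewrite aE kE f2E -EFinD lee_fin.
(* One L e comes from the killed integral, one from the free mean at x, and the third from the
   reflected start - x. *)
pose r e := k + 2 * L * e + expR (2 * rho * (x - e)) * (a (- x) + L * e).
have rc : r e @[e --> 0^'+] --> k + expR (2 * rho * x) * a (- x).
  have -> : k + expR (2 * rho * x) * a (- x) = r 0.
    by rewrite /r !mulr0 subr0 !addr0.
  apply: cvg_at_right_filter; apply: cvgD.
    by apply: cvgD; [exact: cvg_cst|apply: cvgMr].
  apply: cvgM; last by apply: cvgD; [exact: cvg_cst|exact: cvgMr].
  apply: continuous_cvg; first exact: continuous_expR.
  by apply: cvgMr; apply: cvgB; first exact: cvg_cst.
apply: (cvgr_to_ge rc); near=> e.
have e0 : 0 < e by [].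
have ex : 0 < x - e by rewrite subr_gt0; near: e; exact: nbhs_right_lt.
have := survival_shift_ge ex t0 e0; rewrite subrK aE f2E.
have S1 : (\int[P]_(w in survival x t) f1 (drifted B rho (x - e) t w) <=
    k%:E + (L * e)%:E)%E.
  rewrite -kE; apply: (@le_trans _ _ (\int[P]_(w in survival x t)
      (f1 (drifted B rho x t w) + (L * e)%:E)))%E.
    apply: ge0_le_integral => //.
    - exact: measurable_survival.
    - by apply: measurable_funTS; exact: mXt.
    - by apply: measurable_funTS; apply: emeasurable_funD => //; exact: mXt.
    - move=> w _; rewrite -EFinD lee_fin (le_trans (hL _ (drifted B rho x t w)))//.
      rewrite lerD2l ler_wpM2l// /drifted.
      rewrite (_ : _ - _ = - e); last by ring.
      by rewrite normrN ger0_norm// ltW.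
  rewrite ge0_integralD//; last 3 first.
  - exact: measurable_survival.
  - by apply: measurable_funTS; exact: mXt.
  - by move=> w _; rewrite lee_fin mulr_ge0// ltW.
  rewrite leeD2l// (@integral_cst _ _ _ P _ (measurable_survival x t) (L * e)%:E).
  rewrite -[leRHS]mule1 lee_wpmul2l ?lee_fin ?(mulr_ge0 L0 (ltW e0))//.
  by apply: probability_le1; exact: measurable_survival.
move=> S2; have := le_trans S2 (leeD S1 (lexx _)).
rewrite -!EFinD lee_fin => S3.
have := aL x (x - e); rewrite subKr ger0_norm ?(ltW e0)// => S4.
have := aL (- (x - e)) (- x); rewrite opprK opprB subrK ger0_norm ?(ltW e0)// => S5.
have S6 : expR (2 * rho * (x - e)) * a (- (x - e)) <=
    expR (2 * rho * (x - e)) * (a (- x) + L * e).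
  by rewrite ler_pM2l ?expR_gt0// opprB.
rewrite /r; move: (expR _ * _) (expR _ * _) S6 S3 S4 => u v; lra.
Unshelve. all: by end_near. Qed.

End lipschitz.

End reflection_principle.

Lemma cvg_integral_nd d (T : measurableType d) (R : realType)
    (mu : {measure set T -> \bar R}) (D : set T) (g_ : nat -> T -> \bar R) (g : T -> \bar R) :
    measurable D -> (forall n, measurable_fun D (g_ n)) ->
    (forall n w, D w -> 0 <= g_ n w)%E ->
    (forall w, D w -> {homo g_^~ w : n m / (n <= m)%N >-> (n <= m)%E}) ->
    (forall w, D w -> g_ n w @[n --> \oo] --> g w) ->
  (\int[mu]_(w in D) g_ n w)%E @[n --> \oo] --> (\int[mu]_(w in D) g w)%E.
Proof.
move=> mD mg g0 nd gc; have := cvg_monotone_convergence mD mg g0 nd (mu := mu).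
rewrite (eq_integral g)// => w /set_mem Dw; apply/cvg_lim => //; exact: gc.
Qed.

Lemma ge0_integral_mrestr d (T : measurableType d) (R : realType)
    (mu : {measure set T -> \bar R}) (E : set T) (mE : measurable E) (f : T -> \bar R) :
    measurable_fun setT f -> (forall w, 0 <= f w)%E ->
  (\int[mrestr mu mE]_w f w = \int[mu]_(w in E) f w)%E.
Proof.
move=> mf f0; rewrite (@ge0_integral_density _ _ _ (mrestr mu mE) mu \1_E)//.
- by rewrite [RHS]integral_mkcond epatch_indic.
- by move=> A mA; rewrite integral_indic// setIC.
Qed.

Section ramp.
Variable R : realType.
Implicit Types (a y z : R) (n : nat).

(** Lipschitz functions that increase to the indicator of the ray beyond [a], cut off at [n] because
    the reflected weight has to stay bounded. *)
Definition ramp a n y : R :=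
  Num.min 1 (n.+1%:R * Num.max 0 (Num.min (y - a) (n%:R - y))).

Lemma ramp01 a n y : 0 <= ramp a n y <= 1.
Proof.
rewrite /ramp le_min ler01 ge_min lexx/= andbT mulr_ge0// le_max lexx//.
Qed.

Lemma ramp_lipschitz a n y z : ramp a n y <= ramp a n z + n.+1%:R * `|y - z|.
Proof.
have n0 : 0 < n.+1%:R :> R by rewrite ltr0n.
have H : Num.max 0 (Num.min (y - a) (n%:R - y)) <=
    Num.max 0 (Num.min (z - a) (n%:R - z)) + `|y - z|.
  have yz := ler_norm (y - z); have zy := ler_norm (z - y); rewrite distrC in zy.
  rewrite ge_max addr_ge0 ?le_max ?lexx//=.
  apply: (@le_trans _ _ (Num.min (z - a) (n%:R - z) + `|y - z|)).
    rewrite -lerBlDr le_min !lerBlDr.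
    by rewrite !ge_min; apply/andP; split; apply/orP; [left|right]; lra.
  by rewrite lerD2r le_max lexx orbT.
rewrite /ramp; set u := Num.max _ _ in H *; set v := Num.max _ _ in H *.
have H2 : n.+1%:R * u <= n.+1%:R * v + n.+1%:R * `|y - z|.
  by rewrite -mulrDr ler_pM2l.
have H3 : 0 <= n.+1%:R * `|y - z| by rewrite mulr_ge0.
by case: (leP 1 (n.+1%:R * u)) => ?; case: (leP 1 (n.+1%:R * v)) => ?; lra.
Qed.

Lemma ramp_le0 a n y : y <= a -> ramp a n y = 0.
Proof.
move=> ya; rewrite /ramp; have -> : Num.max 0 (Num.min (y - a) (n%:R - y)) = 0.
  by apply/max_idPl; rewrite ge_min subr_le0 ya.
by rewrite mulr0; apply/min_idPr.
Qed.

Lemma ramp_far a n y : n%:R <= y -> ramp a n y = 0.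
Proof.
move=> ya; rewrite /ramp; have -> : Num.max 0 (Num.min (y - a) (n%:R - y)) = 0.
  by apply/max_idPl; rewrite ge_min [_ - y <= 0]subr_le0 ya orbT.
by rewrite mulr0; apply/min_idPr.
Qed.

Lemma measurable_ramp a n : measurable_fun setT (ramp a n).
Proof.
apply: measurable_minr => //; apply: measurable_funM => //.
apply: measurable_maxr => //; apply: measurable_minr; exact: measurable_funB.
Qed.

Lemma ramp_nd a y n m : (n <= m)%N -> ramp a n y <= ramp a m y.
Proof.
move=> nm; rewrite /ramp le_min ge_min lexx/= ge_min; apply/orP; right.
apply: ler_pM => //; [by rewrite le_max lexx|by rewrite ler_nat|].
rewrite ge_max [X in X && _]le_max lexx/= le_max; apply/orP; right.
by rewrite le_min !ge_min lexx lerD2r ler_nat nm !orbT.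
Qed.

Lemma cvg_ramp a y : ramp a n y @[n --> \oo] --> (\1_`]a, +oo[ y : R).
Proof.
rewrite indicE mem_setE in_itv/= andbT; have [ay|ya] := ltP a y; last first.
  by apply: cvg_near_cst; apply: nearW => n; rewrite ramp_le0.
apply: cvg_near_cst; near=> n.
apply/min_idPl; rewrite -[leLHS](mulfV (lt0r_neq0 (_ : 0 < y - a))); last by rewrite subr_gt0.
rewrite mulrC; apply: ler_pM; rewrite ?invr_ge0 ?subr_ge0 ?(ltW ay)//.
  rewrite ltW// (lt_le_trans (_ : _ < n%:R))// ?ler_nat//.
  by near: n; exact: nbhs_infty_gtr.
rewrite le_max le_min lexx/= lerBrDr; apply/orP; right.
by near: n; exact: nbhs_infty_ger.
Unshelve. all: by end_near. Qed.

End ramp.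

Section killed_mean_kernel.
Context d (T : measurableType d) (R : realType) (P : probability T R).
Context (B : R -> {RV P >-> R}) (bmB : brownian_motion B) (rho : R).
Variables (t x : R).
Hypotheses (t0 : 0 < t) (x0 : 0 < x).
Implicit Types (f : R -> \bar R) (a y : R).

Let pos f := f \_ (`]0, +oo[ : set R).

Let mpos f : measurable_fun setT f -> measurable_fun setT (pos f).
Proof. move=> mf; apply/(measurable_restrictT _ (measurable_itv _)).
exact: measurable_funTS. Qed.

Let pos_ge0 f y : (forall y, 0 <= f y)%E -> (0 <= pos f y)%E.
Proof. by move=> f0; exact: erestrict_ge0. Qed.

Let killed_mean_ray a : 0 <= a ->
  let f y : \bar R := (\1_(`]a, +oo[ : set R) y)%:E in
  (killed_mean B rho t f x + free_mean B rho t (reflection rho f) x = free_mean B rho t f x)%E.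
Proof.
move=> a0 f.
pose g n y : \bar R := (ramp a n y)%:E.
have mg n : measurable_fun setT (g n) by apply/measurable_EFinP; exact: measurable_ramp.
have g0 n y : (0 <= g n y)%E by rewrite lee_fin; have /andP[] := ramp01 a n y.
have gnd y : {homo g^~ y : n m / (n <= m)%N >-> (n <= m)%E}.
  by move=> n m nm; rewrite lee_fin ramp_nd.
have gc y : g n y @[n --> \oo] --> f y.
  by apply: cvg_EFin; [exact: nearW|exact: cvg_ramp].
have c1 : killed_mean B rho t (g n) x @[n --> \oo] --> killed_mean B rho t f x.
  apply: cvg_integral_nd => //; first exact: measurable_survival.
  by move=> n; apply: measurable_funTS; exact: measurable_comp_drifted.
have c2 : free_mean B rho t (g n) x @[n --> \oo] --> free_mean B rho t f x.
  by apply: cvg_integral_nd => // n; exact: measurable_comp_drifted.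
have c3 : free_mean B rho t (reflection rho (g n)) x @[n --> \oo] -->
    free_mean B rho t (reflection rho f) x.
  apply: cvg_integral_nd => //.
  - by move=> n; apply: measurable_comp_drifted; exact: measurable_reflection.
  - by move=> n w _; exact: reflection_ge0.
  - by move=> w _ n m nm; rewrite lee_wpmul2l ?lee_fin ?expR_ge0//; exact: gnd.
  - by move=> w _; apply: cvgeZl => //; exact: gc.
have E n : (killed_mean B rho t (g n) x + free_mean B rho t (reflection rho (g n)) x =
    free_mean B rho t (g n) x)%E.
  apply: (@killed_mean_reflection_lip _ _ _ _ _ bmB rho (ramp a n) n.+1%:R n%:R) => //.
  - by move=> y; exact: ramp01.
  - by move=> y z; exact: ramp_lipschitz.
  - exact: measurable_ramp.
  - by move=> y y0; rewrite ramp_le0// (le_trans y0).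
  - by move=> y ny; rewrite ramp_far.
apply: (cvg_unique _ _ c2) => //.
have -> : (fun n => free_mean B rho t (g n) x) = (fun n => killed_mean B rho t (g n) x +
    free_mean B rho t (reflection rho (g n)) x)%E by apply/funext => n; rewrite E.
rewrite /=; apply: cvgeD => //; apply: ge0_adde_def; rewrite inE.
- by apply: integral_ge0 => w _; rewrite lee_fin.
- by apply: free_mean_ge0 => y; apply: reflection_ge0 => z; rewrite lee_fin.
Qed.

Let X := @mfun_Sub _ _ T (measurableTypeR R) _
  (mem_set (measurable_drifted B rho x t)).
Let Y := @mfun_Sub _ _ T (measurableTypeR R) _
  (mem_set (measurable_drifted B rho (- x) t)).
Let mpos0 : measurable (`]0, +oo[ : set (measurableTypeR R)).
Proof. exact: measurable_itv. Qed.

(** The three terms of the reflection identity as measures in the test function; [m2] uses the path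
    started at - x, since reflection commutes with the free mean. *)
Let m1 := pushforward (mrestr P (measurable_survival bmB rho x t)) X.
Let m2 := mscale (NngNum (expR_ge0 (2 * rho * x))) (mrestr (distribution P Y) mpos0).
Let m3 := mrestr (distribution P X) mpos0.

Let int1 f : measurable_fun setT f -> (forall y, 0 <= f y)%E ->
  (\int[m1]_y f y = killed_mean B rho t f x)%E.
Proof.
move=> mf f0; rewrite ge0_integral_pushforward// preimage_setT.
rewrite ge0_integral_mrestr//; first exact: (@measurable_comp_drifted _ _ _ _ B rho f t x mf).
by move=> w; exact: f0.
Qed.

Let int3 f : measurable_fun setT f -> (forall y, 0 <= f y)%E ->
  (\int[m3]_y f y = free_mean B rho t (pos f) x)%E.
Proof.
move=> mf f0; rewrite ge0_integral_mrestr// integral_mkcond.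
rewrite ge0_integral_distribution//; first exact: mpos.
by move=> y; exact: pos_ge0.
Qed.

Let int2 f : measurable_fun setT f -> (forall y, 0 <= f y)%E ->
  (\int[m2]_y f y = free_mean B rho t (reflection rho (pos f)) x)%E.
Proof.
move=> mf f0; rewrite ge0_integral_mscale// ge0_integral_mrestr// integral_mkcond.
rewrite ge0_integral_distribution//; last 2 first.
- exact: mpos.
- by move=> y; exact: pos_ge0.
rewrite (free_mean_reflection bmB) ?ltW//.
- exact: mpos.
- by move=> y; exact: pos_ge0.
Qed.

(** Both sides are measures in [f] that agree on rays, a pi-system; a ray beyond a negative level is
    first cut to the positive half-line. The additive form avoids differences of extended reals. *)
Lemma killed_mean_reflection f : measurable_fun setT f -> (forall y, 0 <= f y)%E ->
  (killed_mean B rho t f x + free_mean B rho t (reflection rho (f \_ `]0%R, +oo[)) x =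
   free_mean B rho t (f \_ `]0%R, +oo[) x)%E.
Proof.
move=> mf f0; rewrite -int1// -int2// -int3// -ge0_integral_measure_add//.
apply: eq_measure_integral => A mA _.
apply: (@measure_unique _ R (measurableTypeR R) (@RGenOInfty.G R)
  (fun n => `]- (n%:R : R), +oo[%classic) _ _ _ _ (measure_add m1 m2) m3 _ _ A mA) => //.
- exact: RGenOInfty.measurableE.
- move=> _ _ [a ->] [b ->]; exists (Num.max a b).
  by apply/seteqP; split=> y /=; rewrite !in_itv/= !andbT gt_max; [move=> [-> ->]|move=> /andP].
- by move=> n; exists (- n%:R).
- apply/seteqP; split=> // y _; exists (Num.trunc `|y|).+1 => //=.
  rewrite in_itv/= andbT ltrNl (le_lt_trans (ler_norm _))// normrN.
  by have /andP[] := truncn_itv (normr_ge0 y).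
- move=> _ [a ->].
  have mI : measurable_fun setT (fun y => (\1_(`]a, +oo[ : set R) y)%:E : \bar R).
    by apply/measurable_EFinP; exact: measurable_indic.
  have I0 y : (0 <= (\1_(`]a, +oo[ : set R) y)%:E :> \bar R)%E by rewrite lee_fin.
  pose f1 y : \bar R := (\1_(`]Num.max 0 a, +oo[ : set R) y)%:E.
  have posE : pos (fun y => (\1_(`]a, +oo[ : set R) y)%:E) = f1.
    apply/funext => y; rewrite /pos patchE /f1 !indicE !mem_setE !in_itv/= !andbT gt_max.
    by case: (0 < y) => /=.
  transitivity (\int[m1]_y (\1_(`]a, +oo[ : set R) y)%:E +
                \int[m2]_y (\1_(`]a, +oo[ : set R) y)%:E)%E.
    by rewrite [LHS]measure_addE !integral_indic// !setIT.
  transitivity (\int[m3]_y (\1_(`]a, +oo[ : set R) y)%:E)%E; last first.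
    by rewrite integral_indic// setIT.
  rewrite int1// int2// int3// posE -killed_mean_ray ?le_max ?lexx//.
  congr (_ + _)%E; apply: eq_integral => w /set_mem ws.
  have := ws t; rewrite lexx ltW// => /(_ isT) Xt.
  by rewrite -/(f1 _) -posE /pos patchE mem_set// /= in_itv/= Xt.
- move=> n; rewrite [ltLHS]measure_addE lte_add_pinfty//.
    apply: (@le_lt_trans _ _ (P (survival B rho x t))); last first.
      by rewrite -ge0_fin_numE// fin_num_measure//; exact: measurable_survival.
    rewrite /m1 /pushforward /mrestr; apply: (le_measure P); rewrite ?inE.
    + apply: measurableI; last exact: measurable_survival.
      by rewrite -[X in measurable X]setTI; apply: (measurable_drifted B rho x t).
    + exact: measurable_survival.
    + exact: subIsetr.
  rewrite /m2 /mscale/= /mrestr lte_mul_pinfty ?lee_fin ?expR_ge0//.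
  by rewrite -ge0_fin_numE// fin_num_measure//; apply: measurableI => //; exact: measurable_itv.
Qed.

End killed_mean_kernel.

Section killed_semigroup.
Context d (T : measurableType d) (R : realType) (P : probability T R).
Context (B : R -> {RV P >-> R}) (bmB : brownian_motion B) (rho : R).
Implicit Types (f : R -> \bar R) (s r t x y : R).

Lemma killed_mean_ge0 s f x : (forall y, 0 <= f y)%E -> (0 <= killed_mean B rho s f x)%E.
Proof. by move=> f0; exact: integral_ge0. Qed.

Lemma le_killed_mean s f g x : measurable_fun setT f -> measurable_fun setT g ->
    (forall y, 0 <= f y)%E -> (forall y, f y <= g y)%E ->
  (killed_mean B rho s f x <= killed_mean B rho s g x)%E.
Proof.
move=> mf mg f0 fg; apply: ge0_le_integral => //.
- exact: measurable_survival.
- by apply: measurable_funTS; exact: measurable_comp_drifted.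
- by apply: measurable_funTS; exact: measurable_comp_drifted.
Qed.

Lemma killed_mean_le_cst s f (c : R) x : measurable_fun setT f -> 0 <= c ->
    (forall y, 0 <= f y)%E -> (forall y, f y <= c%:E)%E ->
  (killed_mean B rho s f x <= c%:E)%E.
Proof.
move=> mf c0 f0 fc.
apply: le_trans (free_mean_le_cst B rho s x mf f0 fc).
by apply: ge0_subset_integral => //; [exact: measurable_survival|exact: measurable_comp_drifted].
Qed.

Lemma killed_mean_fin s f (c : R) x : measurable_fun setT f ->
    (forall y, 0 <= f y)%E -> (forall y, f y <= c%:E)%E ->
  (killed_mean B rho s f x \is a fin_num)%E.
Proof.
move=> mf f0 fc; rewrite ge0_fin_numE ?killed_mean_ge0//.
apply: le_lt_trans (ltry c); apply: killed_mean_le_cst => //.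
by rewrite -lee_fin (le_trans (f0 0)).
Qed.

(** Time, start and test function may all depend on the parameter, as they do in the renewal
    integrand. *)
Lemma measurable_killed_mean dZ (Z : measurableType dZ) (tau xi : Z -> R) (h : Z -> R -> \bar R) :
    measurable_fun setT tau -> (forall z, 0 <= tau z) -> measurable_fun setT xi ->
    measurable_fun setT (fun z : Z * R => h z.1 z.2) -> (forall z y, 0 <= h z y)%E ->
  measurable_fun setT (fun z => killed_mean B rho (tau z) (h z) (xi z)).
Proof.
move=> mtau tau0 mxi mh h0.
pose S : set (Z * T) := [set z | survival B rho (xi z.1) (tau z.1) z.2].
have mtau1 : measurable_fun setT (fun z : Z * T => tau z.1).
  by apply: measurableT_comp.
have mxi1 : measurable_fun setT (fun z : Z * T => xi z.1).
  by apply: measurableT_comp.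
have mS : measurable S.
  apply: (@measurable_pos_on_itv _ T R (fun s w => B s w) _ _ _ (Z * T)%type
    (fun z => xi z.1) (fun z => tau z.1) snd rho) => //.
  exact: (bm_continuous bmB).
have mX : measurable_fun setT (fun z : Z * T => drifted B rho (xi z.1) (tau z.1) z.2).
  apply: measurable_funB; last by apply: measurable_funM.
  apply: measurable_funD => //.
  apply: (@measurable_evaluation _ T R (fun s w => B s w)) => //.
  exact: (bm_continuous bmB).
have -> : (fun z => killed_mean B rho (tau z) (h z) (xi z)) = (fun z =>
    \int[P]_w (((\1_S (z, w) : R)%:E) * h z (drifted B rho (xi z) (tau z) w)))%E.
  apply/funext => z; rewrite /killed_mean integral_mkcond; apply: eq_integral => w _.
  rewrite epatch_indic muleC !indicE.
  have -> // : ((z, w) \in S) = (w \in survival B rho (xi z) (tau z)).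
  by apply/idP/idP => /set_mem H; exact/mem_set.
apply: measurable_integral_param.
  apply: emeasurable_funM; first by apply/measurable_EFinP; exact: measurable_indic.
  exact: (measurableT_comp mh (measurable_fun_pair (@measurable_fst _ _ Z T) mX)).
by move=> z w; rewrite mule_ge0// lee_fin.
Qed.

Lemma measurable_killed_mean_pos s f : 0 <= s -> measurable_fun setT f ->
    (forall y, 0 <= f y)%E -> measurable_fun setT (killed_mean B rho s f).
Proof.
move=> s0 mf f0; apply: (measurable_killed_mean (tau := fun=> s) (h := fun=> f)) => //.
exact: measurableT_comp.
Qed.

Lemma killed_mean0 f x : killed_mean B rho 0 f x = if 0 < x then f x else 0%E.
Proof.
have [x0|x0] := ltP 0 x; last by rewrite killed_mean_le0.
rewrite /killed_mean (_ : survival B rho x 0 = setT).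
  under eq_integral do rewrite /drifted (bm_start bmB) mulr0 subr0 addr0.
  rewrite integral_cst//; transitivity (f x * 1)%E; last by rewrite mule1.
  by congr (_ * _)%E; exact: probability_setT.
apply/seteqP; split=> // w _ r r0.
have -> : r = 0 by apply/eqP; rewrite eq_le andbC.
by rewrite /drifted (bm_start bmB) mulr0 subr0 addr0.
Qed.

Lemma eq_killed_mean s f g x : 0 <= s -> (forall y, 0 < y -> f y = g y) ->
  killed_mean B rho s f x = killed_mean B rho s g x.
Proof.
move=> s0 fg; apply: eq_integral => w /set_mem ws; apply: fg.
by apply: ws; rewrite s0 lexx.
Qed.

(** The reflection identity at times s, r and s + r reduces the claim to the free semigroup. The
    bound [c] keeps all terms finite, so that they can be cancelled. *)
Lemma killed_mean_semigroup s r f (c : R) x : 0 <= s -> 0 <= r ->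
    measurable_fun setT f -> (forall y, 0 <= f y)%E -> (forall y, f y <= c%:E)%E ->
  killed_mean B rho s (killed_mean B rho r f) x = killed_mean B rho (s + r) f x.
Proof.
move=> s0 r0 mf f0 fc.
have [x_le0|x0] := leP x 0; first by rewrite !killed_mean_le0// addr_ge0.
have [->|s_neq0] := eqVneq s 0; first by rewrite killed_mean0 x0 add0r.
have [->|r_neq0] := eqVneq r 0.
  rewrite addr0; apply: eq_killed_mean => // y y0.
  by rewrite killed_mean0 y0.
have {s_neq0}s_gt0 : 0 < s by rewrite lt_neqAle eq_sym s_neq0.
have {r_neq0}r_gt0 : 0 < r by rewrite lt_neqAle eq_sym r_neq0.
pose g := killed_mean B rho r f.
pose fp := f \_ (`]0, +oo[ : set R).
have mfp : measurable_fun setT fp.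
  by apply/(measurable_restrictT _ (measurable_itv _)); exact: measurable_funTS.
have fp0 y : (0 <= fp y)%E by exact: erestrict_ge0.
have c0 : 0 <= c by rewrite -lee_fin (le_trans (f0 0)).
have fpc y : (fp y <= c%:E)%E by rewrite /fp patchE; case: ifP.
pose a := free_mean B rho r fp.
have mg : measurable_fun setT g by exact: measurable_killed_mean_pos.
have g0 y : (0 <= g y)%E by exact: killed_mean_ge0.
have gc y : (g y <= c%:E)%E by exact: killed_mean_le_cst.
have ma : measurable_fun setT a by exact: measurable_free_mean.
have a0 y : (0 <= a y)%E by exact: free_mean_ge0.
have ac y : (a y <= c%:E)%E by exact: free_mean_le_cst.
have gneg y : y <= 0 -> g y = 0%E by move=> y0; rewrite /g killed_mean_le0.
have gpE : g \_ (`]0, +oo[ : set R) = g.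
  apply/funext => y; rewrite patchE mem_setE in_itv/= andbT.
  by have [//|/gneg ->] := ltP 0 y.
have Kpos y : 0 < y -> (g y + reflection rho a y = a y)%E.
  move=> y0; rewrite /a -(free_mean_reflection bmB)//.
  exact: killed_mean_reflection.
(* Adding the reflection of [g] on the right extends the identity to negative [y] by symmetry, so
   that the free mean over time s can be applied to it. *)
have Kall y : (g y + reflection rho a y = a y + reflection rho g y)%E.
  have [y0|y0|y0] := ltgtP y 0; last 1 first.
  - by rewrite y0 gneg// /reflection mulr0 expR0 !mul1e oppr0 gneg// adde0 add0e.
  - rewrite (gneg y (ltW y0)) add0e.
    rewrite /reflection -[in LHS](Kpos (- y)) ?oppr_gt0//.
    rewrite ge0_muleDr ?reflection_ge0//.
    rewrite addeC; congr (_ + _)%E.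
    rewrite /reflection opprK muleA -EFinM -expRD mulrN subrr expR0 mul1e//.
  - by rewrite Kpos// /reflection (gneg (- y)) ?oppr_le0 ?ltW// mule0 adde0.
have Grefl h : measurable_fun setT h -> (forall y, 0 <= h y)%E ->
    free_mean B rho s (reflection rho h) x = reflection rho (free_mean B rho s h) x.
  by move=> mh h0; exact: free_mean_reflection.
have GD h k : measurable_fun setT h -> measurable_fun setT k ->
    (forall y, 0 <= h y)%E -> (forall y, 0 <= k y)%E ->
    free_mean B rho s (fun y => h y + k y)%E x =
    (free_mean B rho s h x + free_mean B rho s k x)%E.
  by move=> mh mk h0 k0; rewrite /free_mean ge0_integralD//;
    [exact: (measurable_comp_drifted B rho s x mh)|exact: (measurable_comp_drifted B rho s x mk)].
have E1 : (free_mean B rho s g x + reflection rho (free_mean B rho s a) x =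
    free_mean B rho s a x + reflection rho (free_mean B rho s g) x)%E.
  have mra : measurable_fun setT (reflection rho a) by exact: measurable_reflection.
  have mrg : measurable_fun setT (reflection rho g) by exact: measurable_reflection.
  have ra0 y : (0 <= reflection rho a y)%E by exact: reflection_ge0.
  have rg0 y : (0 <= reflection rho g y)%E by exact: reflection_ge0.
  rewrite -(Grefl a ma a0) -(Grefl g mg g0) -(GD g _ mg mra g0 ra0) -(GD a _ ma mrg a0 rg0).
  by congr (free_mean B rho s _ x); exact/funext.
have E2 := killed_mean_reflection bmB rho s_gt0 x0 mg g0.
rewrite gpE Grefl// in E2.
have E3 := killed_mean_reflection bmB rho (addr_gt0 s_gt0 r_gt0) x0 mf f0.
rewrite -/fp (free_mean_reflection bmB) ?addr_ge0// in E3.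
have aE y : free_mean B rho (s + r) fp y = free_mean B rho s a y.
  by rewrite -(free_mean_semigroup bmB).
rewrite /reflection !aE in E3; rewrite /reflection in E1 E2.
have finG h y : measurable_fun setT h -> (forall z, 0 <= h z)%E -> (forall z, h z <= c%:E)%E ->
    (free_mean B rho s h y \is a fin_num)%E.
  move=> mh h0 hc; rewrite ge0_fin_numE ?free_mean_ge0//.
  by apply: le_lt_trans (ltry c); exact: free_mean_le_cst.
have fK := killed_mean_fin s x mg g0 gc.
have fK2 := killed_mean_fin (s + r) x mf f0 fc.
move: E1 E2 E3 fK fK2 (finG g x mg g0 gc) (finG g (- x) mg g0 gc) (finG a x ma a0 ac)
  (finG a (- x) ma a0 ac); rewrite -/g.
move: (killed_mean _ _ _ _ _) (killed_mean _ _ _ _ _) (free_mean _ _ _ _ _)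
  (free_mean _ _ _ _ _) (free_mean _ _ _ _ _) (free_mean _ _ _ _ _).
move=> [k1||] [k2||] [u1||] [u2||] [u3||] [u4||] //= + + + _ _ _ _ _ _.
rewrite -!EFinM -!EFinD => -[H1] [H2] [H3]; congr (_%:E); lra.
Qed.

End killed_semigroup.

(** By reflection the killed mean is determined by free means, whose density is explicit and the
    same for every Brownian motion. *)
Lemma killed_mean_law d (T : measurableType d) (R : realType) (P : probability T R)
    (B B' : R -> {RV P >-> R}) (rho s c x : R) (f : R -> \bar R) :
    brownian_motion B -> brownian_motion B' ->
    0 <= s -> measurable_fun setT f -> (forall y, 0 <= f y)%E -> (forall y, f y <= c%:E)%E ->
  killed_mean B' rho s f x = killed_mean B rho s f x.
Proof.
move=> bmB bmB' s0 mf f0 fc.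
have [x_le0|x0] := leP x 0; first by rewrite !killed_mean_le0.
have [->|s_neq0] := eqVneq s 0; first by rewrite !killed_mean0.
have {s_neq0 s0} s0 : 0 < s by rewrite lt_neqAle eq_sym s_neq0.
have := killed_mean_reflection bmB' rho s0 x0 mf f0.
have := killed_mean_reflection bmB rho s0 x0 mf f0.
set fp := f \_ _.
have mfp : measurable_fun setT fp.
  by apply/(measurable_restrictT _ (measurable_itv _)); exact: measurable_funTS.
have fp0 y : (0 <= fp y)%E by exact: erestrict_ge0.
have c0 : 0 <= c by rewrite -lee_fin (le_trans (f0 0)).
have fpc y : (fp y <= c%:E)%E by rewrite /fp patchE; case: ifP.
rewrite !free_mean_reflection ?ltW// /reflection.
have GG y : free_mean B' rho s fp y = free_mean B rho s fp y.
  by rewrite (free_meanE bmB')// (free_meanE bmB).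
have finG y : (free_mean B rho s fp y \is a fin_num)%E.
  rewrite ge0_fin_numE ?free_mean_ge0//.
  by apply: le_lt_trans (ltry c); exact: free_mean_le_cst.
rewrite !GG => <-; move: (finG (- x)) (killed_mean_fin bmB rho s x mf f0 fc)
  (killed_mean_fin bmB' rho s x mf f0 fc).
move: (killed_mean _ _ _ _ _) (killed_mean _ _ _ _ _) (free_mean _ _ _ _ _).
by move=> [k1||] [k2||] [u1||]//= _ _ _; rewrite -!EFinM -!EFinD => -[/addIr ->].
Qed.

Lemma mutually_independent_inj d (T : measurableType d) (R : realType) (P : probability T R)
    (I I' : choiceType) (F : I -> set (set T)) (g : I' -> I) :
  injective g -> mutually_independent P F -> mutually_independent P (F \o g).
Proof.
move=> ig PF J A JA.
(* Transports the events along [g], with [setT] off the image; injectivity makes the chosen preimage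
   the right one. *)
pose A' i : set T := if pselect (exists2 j, j \in J & g j = i) is left e
  then A (s2val (cid2 e)) else setT.
have A'E j : j \in J -> A' (g j) = A j.
  rewrite /A' => jJ; case: pselect => [e|]; last by case; exists j.
  by case: cid2 => k /= kJ /ig ->.
have -> : \bigcap_(j in [set` J]) A j = \bigcap_(i in [set` [fset g j | j in J]%fset]) A' i.
  apply/seteqP; split=> w.
    move=> wA i /= /imfsetP[j /= jJ ->]; rewrite A'E//; exact: wA.
  by move=> wA j jJ; rewrite -A'E//; apply: wA; apply/imfsetP; exists j.
rewrite PF; last by move=> i /imfsetP[j /= jJ ->]; rewrite A'E//; exact: JA.
rewrite big_imfset/=; last by move=> i j _ _ /ig.
by apply: eq_big_seq => j jJ; rewrite A'E.
Qed.

Notation data_index := (label + label + label)%type.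

(** * Decomposition at the first branching time *)

Section shifted_data.
Context d (T : measurableType d) (R : realType) (P : probability T R).
Context (beta : R) (p : nat -> R).
Implicit Types (W : branching_data P beta p) (u : label).

Definition data_family W (j : data_index) : set (set T) :=
  match j with
  | inl (inl u) => sigma_process `[0, +oo[ (motion W u)
  | inl (inr u) => sigma_rv (lifetime W u)
  | inr u => sigma_rv (litter W u)
  end.

Definition index_label (j : data_index) : label :=
  match j with inl (inl u) => u | inl (inr u) => u | inr u => u end.

Definition shift_index (i : nat) (j : data_index) : data_index :=
  match j with
  | inl (inl u) => inl (inl (rcons u i))
  | inl (inr u) => inl (inr (rcons u i))
  | inr u => inr (rcons u i)
  end.

Lemma shift_index_inj i : injective (shift_index i).
Proof.
by move=> [[u|u]|u] [[v|v]|v] //= [] /rcons_inj[->].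
Qed.

Lemma data_family_independent W : mutually_independent P (data_family W).
Proof.
move=> J A JA; apply: (@data_independent _ _ _ _ _ _ W) => j jJ; have := JA j jJ.
by case: j {jJ} => [[]|].
Qed.

Lemma child_independent W i :
  mutually_independent P (data_family W \o shift_index i).
Proof.
exact: (mutually_independent_inj (@shift_index_inj i) (@data_family_independent W)).
Qed.

Lemma child_independent_match W i : mutually_independent P
  (fun j : label + label + label => match j with
   | inl (inl u) => sigma_process `[0, +oo[ (motion W (rcons u i))
   | inl (inr u) => sigma_rv (lifetime W (rcons u i))
   | inr u => sigma_rv (litter W (rcons u i))
   end).
Proof.
move=> J A JA; apply: (@child_independent W i) => j jJ; have := JA j jJ.
by case: j {jJ} => [[]|].
Qed.

(** The subtree is again branching data, on the same sample space; self-similarity of the process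
    becomes plain recursion over labels. *)
Definition child W i : branching_data P beta p :=
  @BranchingData _ _ _ P beta p (fun u => motion W (rcons u i))
    (fun u => lifetime W (rcons u i)) (fun u => litter W (rcons u i))
    (fun u => motion_brownian W (rcons u i))
    (fun u => lifetime_gt0 W (rcons u i))
    (fun u => @lifetime_law _ _ _ _ _ _ W (rcons u i))
    (fun u => litter_law W (rcons u i)) (@child_independent_match W i).

Lemma birth_child W i u w :
  birth W (rcons u i) w = lifetime W [::] w + birth (child W i) u w.
Proof. by elim: u => [|j u IH] /=; [rewrite add0r addr0|rewrite IH addrA]. Qed.

Lemma birth_ge0 W u w : 0 <= birth W u w.
Proof. by elim: u => [|j u IH]//=; rewrite addr_ge0// ltW// lifetime_gt0. Qed.

Lemma in_tree_child W i u w :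
  in_tree W (rcons u i) w <-> (i < litter W [::] w)%N /\ in_tree (child W i) u w.
Proof.
elim: u => [|j u IH] /=; first by split=> [[_ ->]|[->]].
by split=> [[/IH[-> +] ->]|[ilt [uin ->]]] //; split=> //; apply/IH.
Qed.

Lemma alive_child W i u t w : alive W t w (rcons u i) <->
  [/\ lifetime W [::] w <= t, (i < litter W [::] w)%N &
      alive (child W i) (t - lifetime W [::] w) w u].
Proof.
rewrite /alive/= /death in_tree_child birth_child.
rewrite lerBrDl ltrBlDl addrA; split=> [[[iK itu] /andP[bt td]]|[Lt iK [itu]]]//.
split=> //; last by split=> //; rewrite bt.
by apply: le_trans bt; rewrite lerDl birth_ge0.
Qed.

Lemma position0 W (x rho : R) u w : position W x rho u 0 w = x.
Proof.
elim: u => [|j u IH] /=.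
  by rewrite (bm_start (motion_brownian W [::])) mulr0 subr0 addr0.
by rewrite ltr_wpDl// ?birth_ge0// lifetime_gt0.
Qed.

Lemma position_child W (x rho : R) i u s w : position W x rho (rcons u i) s w =
  if s < lifetime W [::] w then drifted (motion W [::]) rho x s w
  else position (child W i) (drifted (motion W [::]) rho x (lifetime W [::] w) w) rho u
         (s - lifetime W [::] w) w.
Proof.
have L0 := lifetime_gt0 W [::] w.
elim: u s => [|j u IH] s /=.
  rewrite add0r /drifted; case: ifPn => // _; ring.
rewrite birth_child -addrA !IH ltrBlDl.
have b0 := birth_ge0 (child W i) u w; have l0 := lifetime_gt0 (child W i) u w.
set b := birth (child W i) u w in b0 *.
have -> : lifetime W [::] w + (b + lifetime W (rcons u i) w) < lifetime W [::] w = false.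
  by apply/negbTE; rewrite -leNgt lerDl addr_ge0// ltW// (lifetime_gt0 W).
have [sL|Ls] := ltP s (lifetime W [::] w).
  rewrite ifT//; apply: (lt_le_trans sL).
  by rewrite lerDl addr_ge0// ltW// (lifetime_gt0 W).
case: ifPn => // _; set c := b + _.
rewrite (_ : lifetime W [::] w + c - lifetime W [::] w = c); last by ring.
by rewrite (_ : s - (lifetime W [::] w + c) = s - lifetime W [::] w - c); last by ring.
Qed.

End shifted_data.

Section particle_events.
Context d (T : measurableType d) (R : realType) (P : probability T R).
Context (beta : R) (p : nat -> R) (rho : R).
Implicit Types (W : branching_data P beta p) (u : label) (x t s : R).

Lemma drifted_lower_bound W x t w : 0 <= t ->
    (forall s, 0 <= s <= t -> 0 < drifted (motion W [::]) rho x s w) ->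
  exists2 e, 0 < e & forall s, 0 <= s <= t -> e <= drifted (motion W [::]) rho x s w.
Proof.
move=> t0 H.
have cX : {within `[0, +oo[, continuous (fun s => drifted (motion W [::]) rho x s w)}.
  exact: (@within_continuous_drift _ _ _ (fun s w => motion W [::] s w)
    (bm_continuous (motion_brownian W [::]))).
have [|c] := @EVT_min _ (fun s => drifted (motion W [::]) rho x s w) 0 t t0.
  by apply: continuous_subspaceW cX => r /=; rewrite !in_itv/= => /andP[->].
rewrite in_itv/= => ct Hc; exists (drifted (motion W [::]) rho x c w); first exact: H.
by move=> s st; apply: Hc; rewrite in_itv.
Qed.

(** [path_min] is an infimum, so pointwise positivity has to be made uniform. The ancestral path is
    a concatenation of continuous pieces, each with a positive minimum; the induction glues the root
    piece to the path inside the subtree. *)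
Lemma position_lower_bound W x u t w : 0 <= t ->
    (forall s, 0 <= s <= t -> 0 < position W x rho u s w) ->
  exists2 e, 0 < e & forall s, 0 <= s <= t -> e <= position W x rho u s w.
Proof.
elim/last_ind: u W x t => [|u i IH] W x t t0 H; first exact: drifted_lower_bound.
pose L := lifetime W [::] w; have L0 : 0 < L by exact: lifetime_gt0.
have [tL|Lt] := ltP t L.
  have E s : 0 <= s <= t -> position W x rho (rcons u i) s w =
      drifted (motion W [::]) rho x s w.
    by move=> /andP[_ st]; rewrite position_child (le_lt_trans st).
  have [|e e0 He] := @drifted_lower_bound W x t w t0.
    by move=> s st; rewrite -E//; exact: H.
  by exists e => // s st; rewrite E//; exact: He.
have tL0 : 0 <= t - L by rewrite subr_ge0.
have [|e e0 He] := IH (child W i) (drifted (motion W [::]) rho x L w) (t - L) tL0.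
  move=> s /andP[s0 st]; have := H (s + L); rewrite position_child.
  rewrite [_ + _ < _]ltNge lerDr s0/= addrK; apply.
  by rewrite addr_ge0 ?(ltW L0)//= -lerBrDr.
have [|e' e'0 He'] := @drifted_lower_bound W x L w (ltW L0).
  move=> s /andP[s0]; rewrite le_eqVlt => /predU1P[->|sL].
    have := H L; rewrite (ltW L0) Lt => /(_ isT).
    by rewrite position_child ltxx subrr position0.
  have := H s; rewrite s0 (le_trans (ltW sL))// => /(_ isT).
  by rewrite position_child sL.
exists (Num.min e e'); first by rewrite lt_min e0.
move=> s /andP[s0 st]; rewrite position_child ge_min; case: ifPn => [sL|].
  by rewrite He' ?orbT// s0 ltW.
by rewrite -leNgt => Ls; rewrite He// subr_ge0 Ls/= lerD2r.
Qed.

Lemma path_min_gt0P W x u t w : 0 <= t -> (0 < path_min W x rho u t w) <->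
  (forall s, 0 <= s <= t -> 0 < position W x rho u s w).
Proof.
move=> t0; rewrite /path_min; split=> [H s st|/(position_lower_bound t0)[e e0 He]].
  apply: (lt_le_trans H); apply: ge_inf; last by exists s => //=; rewrite in_itv.
  (* A set without lower bound has [inf] equal to 0 by convention, which contradicts the assumed
     positivity. *)
  apply: contrapT => nl; move: H; rewrite inf_out ?ltxx// => -[_].
  exact: nl.
apply: (lt_le_trans e0); apply: lb_le_inf.
  by exists (position W x rho u 0 w); exists 0 => //=; rewrite in_itv/= lexx.
by move=> _ [s /= + <-]; rewrite in_itv/= => st; exact: He.
Qed.

Variables (b : bool) (A : set R).
Hypothesis mA : measurable A.

(** [b] switches the killing on. With [b] false and [A] the whole line the event says that [u] is
    alive, so survival of the tree is covered by the same proofs. *)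
Definition particle_event W u t x : set T :=
  [set w | [/\ alive W t w u, b -> 0 < path_min W x rho u t w &
               A (position W x rho u t w)]].

Definition root_survival W x s : set T :=
  [set w | b -> survival (motion W [::]) rho x s w].

Lemma particle_event_nil W t x : 0 <= t -> particle_event W [::] t x =
  [set w | [/\ t < lifetime W [::] w, root_survival W x t w &
               A (drifted (motion W [::]) rho x t w)]].
Proof.
move=> t0; apply/seteqP; split=> w [].
  move=> [_ /andP[_]]; rewrite /death add0r => tL H At; split=> //.
  by move=> /H /path_min_gt0P; apply.
move=> tL H At; split=> //; first by split=> //; rewrite /death/= t0 add0r.
by move=> /H Hb; apply/path_min_gt0P.
Qed.

Lemma particle_event_rcons W u i t x : 0 <= t -> particle_event W (rcons u i) t x =
  [set w | [/\ lifetime W [::] w <= t, root_survival W x (lifetime W [::] w) w,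
     (i < litter W [::] w)%N & particle_event (child W i) u (t - lifetime W [::] w)
       (drifted (motion W [::]) rho x (lifetime W [::] w) w) w]].
Proof.
move=> t0; apply/seteqP; split=> w.
  move=> [/alive_child[Lt iK al] H At].
  have L0 := lifetime_gt0 W [::] w.
  have tL : 0 <= t - lifetime W [::] w by rewrite subr_ge0.
  rewrite position_child ltNge Lt/= in At.
  split=> //.
    move=> /H /path_min_gt0P -/(_ t0) Hs s /andP[s0].
    rewrite le_eqVlt => /predU1P[->|sL].
      have := Hs (lifetime W [::] w); rewrite (ltW L0) Lt => /(_ isT).
      by rewrite position_child ltxx subrr position0.
    have := Hs s; rewrite s0 (le_trans (ltW sL))// => /(_ isT).
    by rewrite position_child sL.
  split=> // /H /path_min_gt0P -/(_ t0) Hs; apply/path_min_gt0P => // s /andP[s0 st].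
  have := Hs (s + lifetime W [::] w); rewrite position_child.
  rewrite [_ + _ < _]ltNge lerDr s0/= addrK; apply.
  by rewrite addr_ge0 ?(ltW L0)//= -lerBrDr.
move=> [Lt surv iK [al H At]].
have tL : 0 <= t - lifetime W [::] w by rewrite subr_ge0.
split; [exact/alive_child| |by rewrite position_child ltNge Lt].
move=> bt; apply/path_min_gt0P => // s /andP[s0 st]; rewrite position_child.
case: ifPn => [sL|]; first by apply: surv => //; rewrite s0 ltW.
rewrite -leNgt => Ls; have /path_min_gt0P := H bt; apply => //.
by rewrite subr_ge0 Ls/= lerD2r.
Qed.

End particle_events.

Lemma measurable_set_le d (Z : measurableType d) (R : realType) (f g : Z -> R) :
  measurable_fun setT f -> measurable_fun setT g -> measurable [set z | f z <= g z].
Proof. by move=> mf mg; rewrite -[X in measurable X]setTI; exact: measurable_fun_le. Qed.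

Lemma measurable_set_lt d (Z : measurableType d) (R : realType) (f g : Z -> R) :
  measurable_fun setT f -> measurable_fun setT g -> measurable [set z | f z < g z].
Proof.
move=> mf mg; rewrite (_ : [set z | _] = ~` [set z | g z <= f z]).
  by apply: measurableC; exact: measurable_set_le.
by apply/seteqP; split=> z /=; rewrite leNgt; [move=> ->|move/negP; rewrite negbK].
Qed.

(** * Measurability of particle events in time, position and data *)

Section data_measurability.
Context d (T : measurableType d) (R : realType) (P : probability T R).
Context (beta : R) (p : nat -> R) (rho : R).
Implicit Types (W : branching_data P beta p) (u : label) (x t s : R).

(** Only a generator: the sigma-algebra it generates is the information carried by the block [D]. *)
Definition sigma_data W (D : set data_index) : set (set T) :=
  \bigcup_(j in D) data_family W j.

Local Notation sigmaT W D := (g_sigma_algebraType (sigma_data W D)).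

Lemma data_family_measurable W j : data_family W j `<=` measurable.
Proof.
case: j => [[u|u]|u] A /=.
- exact: sub_sigma_process.
- by move=> [C mC <-]; exact: (@measurable_funP _ _ _ _ _ (lifetime W u)).
- by move=> [C mC <-]; exact: (@measurable_funP _ _ _ _ _ (litter W u)).
Qed.

Lemma data_family_setI W j : setI_closed (data_family W j).
Proof.
case: j => [[u|u]|u] A A' /=.
- exact: (@measurableI _ (g_sigma_algebraType _)).
- move=> [C mC <-] [C' mC' <-]; exists (C `&` C'); first exact: measurableI.
  by rewrite !setTI.
- move=> [C mC <-] [C' mC' <-]; exists (C `&` C'); first exact: measurableI.
  by rewrite !setTI.
Qed.

Lemma sigma_data_measurable W D A : <<s sigma_data W D >> A -> measurable A.
Proof.
move: A; apply: smallest_sub; first exact: sigma_algebra_measurable.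
by move=> A [j _]; exact: data_family_measurable.
Qed.

(** The identity into a coarser sigma-algebra serves as the random variable that carries a block of
    data. *)
Lemma measurable_id_sigma W D : measurable_fun setT (id : T -> sigmaT W D).
Proof. by move=> _ A mA; rewrite setTI; exact: (@sigma_data_measurable W D). Qed.

Lemma measurable_id_sub W W' D D' :
    sigma_data W D `<=` sigma_data W' D' ->
  measurable_fun setT (id : sigmaT W' D' -> sigmaT W D).
Proof.
by move=> DD _ A mA; rewrite setTI; exact: (sub_sigma_algebra2 DD).
Qed.

Lemma sigma_data_le W D D' : D `<=` D' -> sigma_data W D `<=` sigma_data W D'.
Proof. by move=> DD A [j Dj Aj]; exists j => //; exact: DD. Qed.

Definition descendant_index : set data_index := [set j | index_label j != [::]].

Definition child_index i : set data_index := range (shift_index i).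

Lemma sigma_data_child W i : sigma_data (child W i) setT = sigma_data W (child_index i).
Proof.
apply/seteqP; split=> A.
  by move=> [j _ Aj]; exists (shift_index i j); [exists j|case: j Aj => [[]|]].
by move=> [_ [j _ <-] Aj]; exists j => //; case: j Aj => [[]|].
Qed.

Lemma child_index_descendant i : child_index i `<=` descendant_index.
Proof.
by move=> _ [j _ <-]; rewrite /descendant_index/=; case: j => [[]|] u /=;
  rewrite -size_eq0 size_rcons.
Qed.

Section measurable_data.
Variables (W : branching_data P beta p) (D : set data_index).

Lemma measurable_motion_sigma u s : D (inl (inl u)) -> 0 <= s ->
  measurable_fun setT (motion W u s : sigmaT W D -> R).
Proof.
move=> Du s0 _ A mA; apply: sub_sigma_algebra; exists (inl (inl u)) => //=.
apply: sub_sigma_algebra; exists s; first by rewrite /= in_itv/= s0.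
by exists A.
Qed.

Lemma measurable_lifetime_sigma u : D (inl (inr u)) ->
  measurable_fun setT (lifetime W u : sigmaT W D -> R).
Proof.
by move=> Du _ A mA; apply: sub_sigma_algebra; exists (inl (inr u)) => //=; exists A.
Qed.

Lemma measurable_litter_sigma u : D (inr u) ->
  measurable_fun setT (litter W u : sigmaT W D -> nat).
Proof.
by move=> Du _ A mA; apply: sub_sigma_algebra; exists (inr u) => //=; exists A.
Qed.

Variables (dZ : measure_display) (Z : measurableType dZ) (tau xi : Z -> R)
  (g : Z -> sigmaT W D).
Hypotheses (D0 : D (inl (inl [::]))) (mtau : measurable_fun setT tau)
  (tau0 : forall z, 0 <= tau z) (mxi : measurable_fun setT xi) (mg : measurable_fun setT g).

Lemma measurable_drifted_sigma :
  measurable_fun setT (fun z => drifted (motion W [::]) rho (xi z) (tau z) (g z)).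
Proof.
apply: measurable_funB; last exact: measurable_funM.
apply: measurable_funD => //.
apply: (@measurable_evaluation _ (sigmaT W D) R (fun s w => motion W [::] s w)) => //.
  by move=> s s0; exact: measurable_motion_sigma.
exact: (bm_continuous (motion_brownian W [::])).
Qed.

Lemma measurable_root_survival b :
  measurable [set z | root_survival rho b W (xi z) (tau z) (g z)].
Proof.
case: b; last first.
  by rewrite (_ : [set z | _] = setT)//; apply/seteqP; split.
rewrite (_ : [set z | _] = [set z | survival (motion W [::]) rho (xi z) (tau z) (g z)]); last first.
  by apply/seteqP; split=> z; [apply|move=> + _].
apply: (@measurable_pos_on_itv _ (sigmaT W D) R (fun s w => motion W [::] s w) _ _ _ Z) => //.
  by move=> s s0; exact: measurable_motion_sigma.
exact: (bm_continuous (motion_brownian W [::])).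
Qed.

End measurable_data.

Variables (b : bool) (A : set R).
Hypothesis mA : measurable A.

(** Time and position are variables because they will be the residual time and the death position of
    the root. Negative times are excluded here once and for all. *)
Definition joint_event W u : set ((R * R) * T) :=
  [set z | 0 <= z.1.1 /\ particle_event rho b A W u z.1.1 z.1.2 z.2].

Lemma measurable_joint_event W u :
  measurable (joint_event W u : set ((R * R) * sigmaT W setT)).
Proof.
(* Path evaluation is measurable at nonnegative times only; the clamp is invisible under 0 <= t. *)
pose pos0 t : R := Num.max 0 t.
have mT : measurable_fun setT (fun z : (R * R) * sigmaT W setT => z.1.1).
  exact: measurableT_comp.
have mx : measurable_fun setT (fun z : (R * R) * sigmaT W setT => z.1.2).
  exact: measurableT_comp.
have mge0 : measurable [set z : (R * R) * sigmaT W setT | 0 <= z.1.1].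
  exact: measurable_set_le.
elim/last_ind: u W mT mx mge0 => [|u i IH] W mT mx mge0.
  rewrite (_ : joint_event W [::] = [set z | 0 <= z.1.1] `&`
    ([set z | z.1.1 < lifetime W [::] z.2] `&`
    ([set z | root_survival rho b W z.1.2 (pos0 z.1.1) z.2] `&`
     (fun z => drifted (motion W [::]) rho z.1.2 (pos0 z.1.1) z.2) @^-1` A))); last first.
    apply/seteqP; split=> -[[t x] w] /=.
      move=> [t0]; rewrite particle_event_nil// => -[tL surv At].
      by rewrite /pos0 max_r.
    move=> [t0 [tL [+ +]]]; rewrite /pos0 max_r// => surv At.
    by split=> //; rewrite particle_event_nil.
  have mpos : measurable_fun setT (fun z : (R * R) * sigmaT W setT => pos0 z.1.1).
    by apply: measurable_maxr.
  have pos0_ge0 (z : (R * R) * sigmaT W setT) : 0 <= pos0 z.1.1 by rewrite le_max lexx.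
  apply: measurableI => //; apply: measurableI; last apply: measurableI.
  - apply: measurable_set_lt => //.
    exact: (measurableT_comp (@measurable_lifetime_sigma W setT [::] I) measurable_snd).
  - exact: (measurable_root_survival (W := W) (D := setT) (g := snd)).
  - rewrite -[X in measurable X]setTI.
    by apply: (measurable_drifted_sigma (W := W) (D := setT) (g := snd)).
pose L (z : (R * R) * sigmaT W setT) := lifetime W [::] z.2.
have mL : measurable_fun setT L.
  exact: (measurableT_comp (@measurable_lifetime_sigma W setT [::] I) measurable_snd).
have L0 z : 0 <= L z by rewrite ltW// lifetime_gt0.
(* Residual time, death position of the root, and the same sample point read through the data of the
   child. *)
pose psi (z : (R * R) * sigmaT W setT) : (R * R) * sigmaT (child W i) setT :=
  ((z.1.1 - L z, drifted (motion W [::]) rho z.1.2 (L z) z.2), z.2).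
have mpsi : measurable_fun setT psi.
  apply: measurable_fun_pair.
    apply: measurable_fun_pair; first exact: measurable_funB.
    exact: (measurable_drifted_sigma (W := W) (D := setT) (g := snd)).
  have mid : measurable_fun setT (id : sigmaT W setT -> sigmaT (child W i) setT).
    by apply: measurable_id_sub; rewrite sigma_data_child; exact: sigma_data_le.
  exact: (measurableT_comp mid measurable_snd).
rewrite (_ : joint_event W (rcons u i) = [set z | L z <= z.1.1] `&`
    ([set z | root_survival rho b W z.1.2 (L z) z.2] `&`
    ([set z | (i < litter W [::] z.2)%N] `&` psi @^-1` joint_event (child W i) u))); last first.
  apply/seteqP; split=> -[[t x] w] /=.
    move=> [t0]; rewrite particle_event_rcons// => -[Lt surv iK ev].
    by rewrite /joint_event/= subr_ge0.
  move=> [Lt [surv [iK [tL ev]]]].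
  have t0 : 0 <= t by apply: le_trans Lt; rewrite ltW// lifetime_gt0.
  by split=> //; rewrite particle_event_rcons.
apply: measurableI; last apply: measurableI; last apply: measurableI.
- exact: measurable_set_le.
- exact: (measurable_root_survival (W := W) (D := setT) (g := snd)).
- rewrite (_ : [set z | _] = (fun z : (R * R) * sigmaT W setT => litter W [::] z.2) @^-1`
    [set k | (i < k)%N])//.
  rewrite -[X in measurable X]setTI.
  by apply: (measurableT_comp (@measurable_litter_sigma W setT [::] I) measurable_snd).
- rewrite -[X in measurable X]setTI; apply: mpsi => //; apply: IH.
  + exact: measurableT_comp.
  + exact: measurableT_comp.
  + by apply: measurable_set_le => //; exact: measurableT_comp.
Qed.

End data_measurability.

Lemma eq_indic (S S' : Type) (R : realType) (A : set S) (A' : set S') a a' :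
  (A a <-> A' a') -> \1_A a = \1_A' a' :> R.
Proof.
move=> AA; rewrite !indicE; congr (_%:R : R); congr nat_of_bool.
by apply/idP/idP => /set_mem ?; apply/mem_set; apply/AA.
Qed.

Lemma measurable_fun_nat_pair d (Z : measurableType d) (R : realType) (f : Z * nat -> \bar R) :
  (forall k, measurable_fun setT (fun z => f (z, k))) -> measurable_fun setT f.
Proof.
move=> mf _ A mA; rewrite setTI.
rewrite (_ : f @^-1` A = \bigcup_k (((fun z => f (z, k)) @^-1` A) `*` [set k])).
  apply: bigcupT_measurable => k; apply: measurableX => //.
  by rewrite -[X in measurable X]setTI; apply: mf.
apply/seteqP; split=> [[z k] /= Az|[z k] [j _ [/= Az ->]]]//.
by exists k.
Qed.

Section one_step.
Context d (T : measurableType d) (R : realType) (P : probability T R).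
Context (beta : R) (p : nat -> R) (rho : R) (b : bool).
Hypotheses (beta_gt0 : 0 < beta) (p_ge0 : forall k, 0 <= p k).
Variable (W : branching_data P beta p).
Local Notation sigmaT D := (g_sigma_algebraType (sigma_data W D)).
Local Notation B := (motion W [::]).
Local Notation L := (lifetime W [::]).
Local Notation K := (litter W [::]).
Notation mu := (@lebesgue_measure R).

Definition root_mean s (f : R -> \bar R) x : \bar R :=
  (\int[P]_(w in root_survival rho b W x s) f (drifted B rho x s w))%E.

Lemma data_independence (D1 D2 : set data_index) E1 E2 : D1 `&` D2 = set0 ->
  <<s sigma_data W D1 >> E1 -> <<s sigma_data W D2 >> E2 ->
  P (E1 `&` E2) = (P E1 * P E2)%E.
Proof.
move=> D12; apply: (independent_blocks _ _ (@data_family_independent _ _ _ _ _ _ W) D12).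
- exact: data_family_setI.
- exact: data_family_measurable.
Qed.

Lemma ge0_integral_lifetime (g : R -> \bar R) : measurable_fun setT g ->
    (forall y, 0 <= g y)%E ->
  (\int[P]_w g (L w) = \int[mu]_(s in `[0%R, +oo[) ((beta * expR (- beta * s))%:E * g s))%E.
Proof.
move=> mg g0.
pose L' := @mfun_Sub _ _ T (measurableTypeR R) _ (mem_set (@measurable_funPT _ _ _ _ L)).
have -> : (\int[P]_w g (L w) = \int[distribution P L']_s g s)%E.
  by rewrite ge0_integral_distribution.
rewrite (@ge0_integral_density _ (measurableTypeR R) R (distribution P L') mu
  (exponential_pdf beta))//.
- rewrite [RHS]integral_mkcond; apply: eq_integral => s _.
  rewrite patchE /exponential_pdf patchE muleC; case: ifPn => //.
  by rewrite mul0e.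
- exact: measurable_exponential_pdf.
- by move=> s; exact/exponential_pdf_ge0/ltW.
- by move=> A mA; exact: lifetime_law.
Qed.

Lemma ge0_integral_litter (h : nat -> \bar R) : (forall k, 0 <= h k)%E ->
  (\int[P]_w h (K w) = \sum_(0 <= k <oo) (p k)%:E * h k)%E.
Proof.
move=> h0.
have -> : setT = \bigcup_k (K @^-1` [set k]).
  by apply/seteqP; split=> // w _; exists (K w).
have mK k : measurable (K @^-1` [set k]).
  by rewrite -[X in measurable X]setTI; exact: (@measurable_funP _ _ _ _ _ K).
rewrite ge0_integral_bigcup//=.
- apply: eq_eseriesr => k _.
  rewrite (eq_integral (fun=> h k)); last by move=> w /set_mem /= ->.
  by rewrite integral_cst// muleC; congr (_ * _)%E; exact: litter_law.
- apply: measurable_funTS; apply: measurableT_comp => //.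
- by apply/trivIsetP => i j _ _ ij; apply/seteqP; split=> // w [/= -> /eqP]; rewrite (negbTE ij).
Qed.

(** [D k] is what the descendants must do when the root leaves [k] children. It stays abstract to
    serve both the event that some child succeeds and the event that a given line of descent
    does. *)
Variable (D : nat -> set ((R * R) * T)).
Hypothesis mD : forall k, measurable (D k : set ((R * R) * sigmaT descendant_index)).
Variables (t x : R).
Hypothesis t0 : 0 <= t.

Definition section_probability k t' y : \bar R := P [set w | D k ((t', y), w)].

Let H := section_probability.

Let idC : {mfun T >-> sigmaT descendant_index} :=
  mfun_Sub (mem_set (@measurable_id_sigma _ _ _ _ _ _ W descendant_index)).

Let mH k : measurable_fun setT (fun z : R * R => H k z.1 z.2).
Proof.
have := measurable_fun_xsection (distribution P idC) (mD k).
congr (measurable_fun _ _); apply/funext => -[t' y] /=.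
rewrite /distribution /pushforward /H /section_probability; congr (P _).
by apply/seteqP; split=> w /=; rewrite /xsection/= inE.
Qed.

Definition average_section t' y : \bar R :=
  (\sum_(0 <= k <oo) (p k)%:E * H k t' y)%E.

Let G := average_section.

Lemma measurable_average_section : measurable_fun setT (fun z : R * R => G z.1 z.2).
Proof.
apply: ge0_emeasurable_sum => [k z _ _|k _]; first by rewrite mule_ge0// lee_fin.
exact: emeasurable_funM.
Qed.

Let G0 t' y : (0 <= G t' y)%E.
Proof. by apply: nneseries_ge0 => k _ _; rewrite mule_ge0// lee_fin. Qed.

Let root_index : set data_index := [set j | index_label j = [::]].

Let before : set T := [set w | L w <= t /\ root_survival rho b W x (L w) w].

Let mbefore D' : D' (inl (inl [::])) -> D' (inl (inr [::])) ->
  measurable (before : set (sigmaT D')).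
Proof.
move=> DB DL; apply: measurableI.
  by apply: measurable_set_le => //; exact: measurable_lifetime_sigma.
apply: (@measurable_root_survival _ T R P beta p rho W D' _ (sigmaT D') L (fun=> x) id) => //.
- exact: measurable_lifetime_sigma.
- by move=> w; rewrite ltW// lifetime_gt0.
Qed.

Let at_death (w : T) : R * R := (t - L w, drifted B rho x (L w) w).

Let mat_death D' : D' (inl (inl [::])) -> D' (inl (inr [::])) ->
  measurable_fun setT (at_death : sigmaT D' -> R * R).
Proof.
move=> DB DL; apply: measurable_fun_pair.
  by apply: measurable_funB => //; exact: measurable_lifetime_sigma.
apply: (@measurable_drifted_sigma _ T R P beta p rho W D' _ (sigmaT D') L (fun=> x) id) => //.
- exact: measurable_lifetime_sigma.
- by move=> w; rewrite ltW// lifetime_gt0.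
Qed.

(** The data of the root and those of its descendants are disjoint blocks, so the descendants are
    averaged with the root frozen. *)
Let freeze_descendants :
  (P [set w | before w /\ D (K w) (at_death w, w)] =
   \int[P]_w ((\1_before w)%:E * H (K w) (at_death w).1 (at_death w).2))%E.
Proof.
have DB : root_index (inl (inl [::])) by [].
have DL : root_index (inl (inr [::])) by [].
have DK : root_index (inr [::]) by [].
(* [S] reads root data and descendant data from separate sample points; the event of interest is its
   diagonal. *)
pose S : set (sigmaT root_index * sigmaT descendant_index) :=
  [set z | before z.1 /\ D (K z.1) (at_death z.1, z.2)].
pose phi (z : sigmaT root_index * sigmaT descendant_index) : (R * R) * sigmaT descendant_index :=
  (at_death z.1, z.2).
have mphi : measurable_fun setT phi.
  apply: measurable_fun_pair; last exact: measurable_snd.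
  exact: (measurableT_comp (mat_death DB DL) measurable_fst).
have mS : measurable S.
  rewrite (_ : S = (fst @^-1` (before : set (sigmaT root_index))) `&`
      \bigcup_k ((fun z => K z.1) @^-1` [set k] `&` phi @^-1` (D k))); last first.
    apply/seteqP; split=> z /=; first by move=> [Bz Dz]; split=> //; exists (K z.1).
    by move=> [Bz [k _ [/= <- Dz]]].
  apply: measurableI.
    by rewrite -[X in measurable X]setTI; apply: measurable_fst => //; exact: mbefore.
  apply: bigcupT_measurable => k; apply: measurableI.
    rewrite -[X in measurable X]setTI.
    by apply: (measurableT_comp (@measurable_litter_sigma _ _ _ _ _ _ W root_index [::] DK)
      measurable_fst).
  by rewrite -[X in measurable X]setTI; apply: mphi.
have mdiag : measurable ([set w : T | S (w, w)] : set T).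
  have mid : measurable_fun setT (fun w : T => (w, w) : sigmaT root_index * sigmaT descendant_index).
    by apply: measurable_fun_pair; exact: measurable_id_sigma.
  by rewrite -[X in measurable X]setTI; apply: mid.
transitivity (\int[P]_w (\1_S (w, w))%:E)%E.
  transitivity (\int[P]_w (\1_([set w : T | S (w, w)] : set T) w)%:E)%E.
    by rewrite integral_indic// setIT.
  by apply: eq_integral => w _; congr EFin; exact: eq_indic.
have mS1 : measurable_fun setT (fun z : sigmaT root_index * sigmaT descendant_index =>
    (\1_S z : R)%:E).
  by apply/measurable_EFinP; exact: measurable_indic.
rewrite (@integral_independent _ _ _ T (sigmaT root_index) (sigmaT descendant_index) R P
  id id (fun z => (\1_S z : R)%:E))//.
- apply: eq_integral => w _ /=.
  rewrite indicE; case: (boolP (w \in before)) => [/set_mem wb|wb].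
    rewrite mul1e /H /section_probability.
    transitivity (\int[P]_v (\1_([set v | D (K w) (at_death w, v)] : set T) v)%:E)%E.
      by apply: eq_integral => v _; congr EFin; apply: eq_indic; split=> [[]|].
    rewrite integral_indic ?setIT//.
    apply: (@sigma_data_measurable _ _ _ _ _ _ W descendant_index).
    have mpair : measurable_fun setT (fun v : sigmaT descendant_index => (at_death w, v)).
      by apply: measurable_fun_pair.
    by have := mpair measurableT _ (mD (K w)); rewrite setTI.
  rewrite mul0e; apply: integral0_eq => v _; rewrite indicE memNset//.
  by case=> /mem_set; rewrite (negbTE wb).
- exact: measurable_id_sigma.
- exact: measurable_id_sigma.
- move=> E1 E2 mE1 mE2; apply: (@data_independence root_index descendant_index) => //.
  by apply/seteqP; split=> // j [/= jr]; rewrite /descendant_index/= jr.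
Qed.

Let two_index : set data_index := [set inl (inl [::]); inl (inr [::])].

Let two_motion : two_index (inl (inl [::])). Proof. by left. Qed.

Let two_lifetime : two_index (inl (inr [::])). Proof. by right. Qed.

Let freeze_litter :
  (\int[P]_w ((\1_before w)%:E * H (K w) (at_death w).1 (at_death w).2) =
   \int[P]_w ((\1_before w)%:E * G (at_death w).1 (at_death w).2))%E.
Proof.
pose f (z : sigmaT two_index * nat) : \bar R :=
  ((\1_before z.1)%:E * H z.2 (at_death z.1).1 (at_death z.1).2)%E.
have mf : measurable_fun setT f.
  apply: measurable_fun_nat_pair => k; apply: emeasurable_funM.
    by apply/measurable_EFinP; apply: measurable_indic; exact: mbefore.
  exact: (measurableT_comp (mH k) (mat_death two_motion two_lifetime)).
have f0 z : (0 <= f z)%E by rewrite mule_ge0// lee_fin.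
rewrite (@integral_independent _ _ _ T (sigmaT two_index) nat R P id K f)//.
- apply: eq_integral => w _; rewrite /f /=.
  rewrite (ge0_integral_litter (h := fun k => ((\1_before w)%:E * H k (at_death w).1 (at_death w).2)%E)).
    rewrite /G /average_section -nneseriesZl//; last first.
      by move=> k _; rewrite mule_ge0// lee_fin.
    by apply: eq_eseriesr => k _; rewrite muleCA.
  by move=> k; rewrite mule_ge0// lee_fin.
- exact: measurable_id_sigma.
- move=> E1 E2 mE1 mE2; apply: (@data_independence two_index [set inr [::]]) => //.
    by apply/seteqP; split=> // j [[-> //|->]].
  apply: sub_sigma_algebra; exists (inr [::]) => //=; exists E2 => //.
  by rewrite setTI.
Qed.

Let pos0 (l : R) : R := Num.max 0 l.

(** The lifetime becomes a variable of its own, detached from the motion; [pos0] keeps path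
    evaluation within nonnegative times. *)
Let f3 (z : R * T) : \bar R := ((\1_(`]-oo, t]%classic : set R) z.1)%:E *
  ((\1_(root_survival rho b W x (pos0 z.1)) z.2)%:E *
   G (t - z.1)%R (drifted B rho x (pos0 z.1) z.2)))%E.

Let mot_index : set data_index := [set inl (inl [::])].

Let mf3 : measurable_fun setT (f3 : R * sigmaT mot_index -> \bar R).
Proof.
have m0 : measurable_fun setT (fun z : R * sigmaT mot_index => pos0 z.1).
  by apply: measurable_maxr.
have max0 (z : R * sigmaT mot_index) : 0 <= pos0 z.1 by rewrite le_max lexx.
apply: emeasurable_funM.
  apply/measurable_EFinP.
  have m1 : measurable_fun setT (\1_(`]-oo, t]%classic : set R) : R -> R).
    exact: measurable_indic.
  exact: (measurableT_comp m1 measurable_fst).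
apply: emeasurable_funM.
  apply/measurable_EFinP.
  pose S := [set z : R * sigmaT mot_index | root_survival rho b W x (pos0 z.1) z.2].
  have mS : measurable S.
    exact: (@measurable_root_survival _ T R P beta p rho W mot_index _ (R * sigmaT mot_index)%type
      (fun z => pos0 z.1) (fun=> x) snd).
  have := @measurable_indic _ _ R setT S mS.
  congr (measurable_fun _ _); apply/funext => z; exact: eq_indic.
have mpair : measurable_fun setT (fun z : R * sigmaT mot_index =>
    (t - z.1, drifted B rho x (pos0 z.1) z.2)); last first.
  exact: (measurableT_comp measurable_average_section mpair).
apply: measurable_fun_pair; first exact: measurable_funB.
exact: (@measurable_drifted_sigma _ T R P beta p rho W mot_index _ (R * sigmaT mot_index)%type
  (fun z => pos0 z.1) (fun=> x) snd).
Qed.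

Let f30 z : (0 <= f3 z)%E. Proof. by rewrite !mule_ge0// lee_fin. Qed.

(** Descendants, litter and lifetime are frozen in turn. What remains is the root motion up to the
    integration variable [s], weighted by the exponential density. *)
Lemma one_step :
  (P [set w | [/\ (L w <= t)%R, root_survival rho b W x (L w) w &
       D (K w) ((t - L w, drifted B rho x (L w) w)%R, w)]] =
   \int[mu]_(s in `[0%R, t]) ((beta * expR (- beta * s))%:E *
     root_mean s (average_section (t - s)%R) x))%E.
Proof.
transitivity (P [set w | before w /\ D (K w) (at_death w, w)]).
  by congr (P _); apply/seteqP; split=> w; [move=> []|move=> [[]]].
rewrite freeze_descendants freeze_litter.
transitivity (\int[P]_w f3 (L w, w))%E.
  apply: eq_integral => w _; rewrite /f3/= /pos0 (max_r (ltW (lifetime_gt0 W _ w))).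
  rewrite muleA -EFinM; congr (_%:E * _)%E.
  rewrite !indicE -natrM mulnb; congr ((nat_of_bool _)%:R).
  apply/idP/andP => [/set_mem[Lt surv]|[/set_mem/= + /set_mem surv]].
    by split; apply/mem_set => //=; rewrite in_itv.
  by rewrite in_itv/= => Lt; apply/mem_set.
rewrite (@integral_independent _ _ _ T R (sigmaT mot_index) R P L id f3)//; last 2 first.
- exact: measurable_id_sigma.
- move=> E1 E2 mE1 mE2; apply: (@data_independence [set inl (inr [::])] mot_index) => //.
    by apply/seteqP; split=> // j [-> ].
  apply: sub_sigma_algebra; exists (inl (inr [::])) => //=; exists E1 => //.
  by rewrite setTI.
rewrite (ge0_integral_lifetime (g := fun l => \int[P]_v f3 (l, v))%E); last 2 first.
- apply: (@measurable_integral_param _ _ R T R P (fun l v => f3 (l, v))) => //.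
  have mid2 : measurable_fun setT (fun z : R * T => (z.1, z.2) : R * sigmaT mot_index).
    apply: measurable_fun_pair; first exact: measurable_fst.
    exact: (measurableT_comp (@measurable_id_sigma _ _ _ _ _ _ W mot_index) measurable_snd).
  exact: (measurableT_comp mf3 mid2).
- by move=> l; exact: integral_ge0.
rewrite [LHS]integral_mkcond [RHS]integral_mkcond; apply: eq_integral => s _.
rewrite !patchE !mem_setE !in_itv/= andbT.
have [s0|s0] := leP 0 s => //=.
rewrite /f3/= /pos0 max_r// indicE mem_setE in_itv/=.
case: ifPn => st; last first.
  by rewrite (_ : (\int[P]_v _)%E = 0%E) ?mule0//; apply: integral0_eq => v _; rewrite mul0e.
congr (_ * _)%E; rewrite [RHS]integral_mkcond; apply: eq_integral => v _.
by rewrite mul1e epatch_indic muleC.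
Qed.

End one_step.

Section root_mean_theory.
Context d (T : measurableType d) (R : realType) (P : probability T R).
Context (beta : R) (p : nat -> R) (rho : R) (b : bool).
Implicit Types (W : branching_data P beta p) (s r t x c : R) (f g : R -> \bar R).

Lemma root_meanE W s f x : root_mean rho b W s f x =
  if b then killed_mean (motion W [::]) rho s f x else free_mean (motion W [::]) rho s f x.
Proof.
rewrite /root_mean; case: b.
  rewrite (_ : root_survival rho true W x s = survival (motion W [::]) rho x s)//.
  by apply/seteqP; split=> z; [apply|move=> + _].
by rewrite (_ : root_survival rho false W x s = setT)//; apply/seteqP; split.
Qed.

Lemma root_mean_ge0 W s f x : (forall y, 0 <= f y)%E -> (0 <= root_mean rho b W s f x)%E.
Proof. by move=> f0; exact: integral_ge0. Qed.

Lemma le_root_mean W s f g x : measurable_fun setT f -> measurable_fun setT g ->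
    (forall y, 0 <= f y)%E -> (forall y, f y <= g y)%E ->
  (root_mean rho b W s f x <= root_mean rho b W s g x)%E.
Proof.
move=> mf mg f0 fg; rewrite !root_meanE; case: b; last exact: le_free_mean.
by apply: le_killed_mean => //; exact: motion_brownian.
Qed.

Lemma measurable_root_survival_set W x s : measurable (root_survival rho b W x s).
Proof.
case: b; last by rewrite (_ : root_survival _ _ _ _ _ = setT)//; apply/seteqP; split.
rewrite (_ : root_survival rho true W x s = survival (motion W [::]) rho x s).
  by apply: measurable_survival; exact: motion_brownian.
by apply/seteqP; split=> z; [apply|move=> + _].
Qed.

Lemma root_meanD W s f g x : measurable_fun setT f -> measurable_fun setT g ->
    (forall y, 0 <= f y)%E -> (forall y, 0 <= g y)%E ->
  root_mean rho b W s (fun y => f y + g y)%E x =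
  (root_mean rho b W s f x + root_mean rho b W s g x)%E.
Proof.
move=> mf mg f0 g0; rewrite /root_mean ge0_integralD//.
- exact: measurable_root_survival_set.
- by apply: measurable_funTS; exact: measurable_comp_drifted.
- by apply: measurable_funTS; exact: measurable_comp_drifted.
Qed.

Lemma root_meanZ W s c f x : 0 <= c -> measurable_fun setT f -> (forall y, 0 <= f y)%E ->
  root_mean rho b W s (fun y => c%:E * f y)%E x = (c%:E * root_mean rho b W s f x)%E.
Proof.
move=> c0 mf f0; rewrite /root_mean ge0_integralZl//.
- exact: measurable_root_survival_set.
- by apply: measurable_funTS; exact: measurable_comp_drifted.
Qed.

Lemma root_mean_le_cst W s f c x : measurable_fun setT f -> (forall y, 0 <= f y)%E ->
    (forall y, f y <= c%:E)%E ->
  (root_mean rho b W s f x <= c%:E)%E.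
Proof.
move=> mf f0 fc; rewrite root_meanE; case: b; last exact: free_mean_le_cst.
apply: killed_mean_le_cst => //; first exact: motion_brownian.
by rewrite -lee_fin (le_trans (f0 0)).
Qed.

(** Children carry other Brownian motions than the root; this expresses their means through a single
    [W]. *)
Lemma root_mean_law W W' s f c x : 0 <= s -> measurable_fun setT f ->
    (forall y, 0 <= f y)%E -> (forall y, f y <= c%:E)%E ->
  root_mean rho b W' s f x = root_mean rho b W s f x.
Proof.
move=> s0 mf f0 fc; rewrite !root_meanE; case: b.
  by apply: (killed_mean_law rho x _ _ s0 mf f0 fc); exact: motion_brownian.
move: s0; rewrite le_eqVlt => /predU1P[<-|s0].
  by rewrite !free_mean0//; exact: motion_brownian.
by rewrite !free_meanE//; exact: motion_brownian.
Qed.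

Lemma root_mean_semigroup W s r f c x : 0 <= s -> 0 <= r -> measurable_fun setT f ->
    (forall y, 0 <= f y)%E -> (forall y, f y <= c%:E)%E ->
  root_mean rho b W s (root_mean rho b W r f) x = root_mean rho b W (s + r) f x.
Proof.
move=> s0 r0 mf f0 fc.
have -> : root_mean rho b W r f = if b then killed_mean (motion W [::]) rho r f
    else free_mean (motion W [::]) rho r f.
  by apply/funext => y; rewrite root_meanE; case: b.
rewrite !root_meanE; case: b.
  by apply: (killed_mean_semigroup _ rho x s0 r0 mf f0 fc); exact: motion_brownian.
by apply: free_mean_semigroup => //; exact: motion_brownian.
Qed.

Lemma measurable_root_mean W dZ (Z : measurableType dZ) (tau xi : Z -> R)
    (h : Z -> R -> \bar R) :
    measurable_fun setT tau -> (forall z, 0 <= tau z) -> measurable_fun setT xi ->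
    measurable_fun setT (fun z : Z * R => h z.1 z.2) -> (forall z y, 0 <= h z y)%E ->
  measurable_fun setT (fun z => root_mean rho b W (tau z) (h z) (xi z)).
Proof.
move=> mtau tau0 mxi mh h0.
rewrite (_ : (fun z => _) = fun z => if b then
    killed_mean (motion W [::]) rho (tau z) (h z) (xi z)
    else free_mean (motion W [::]) rho (tau z) (h z) (xi z)); last first.
  by apply/funext => z; rewrite root_meanE; case: b.
case: b; first by apply: measurable_killed_mean => //; exact: motion_brownian.
have mX : measurable_fun setT
    (fun z : Z * T => drifted (motion W [::]) rho (xi z.1) (tau z.1) z.2).
  have mtau1 : measurable_fun setT (fun z : Z * T => tau z.1) by exact: measurableT_comp.
  apply: measurable_funB; last by apply: measurable_funM.
  apply: measurable_funD; first exact: measurableT_comp.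
  apply: (@measurable_evaluation _ T R (fun s w => motion W [::] s w)) => //.
  exact: (bm_continuous (motion_brownian W [::])).
apply: (@measurable_integral_param _ _ Z T R P
  (fun z w => h z (drifted (motion W [::]) rho (xi z) (tau z) w))) => //.
exact: (measurableT_comp mh (measurable_fun_pair (@measurable_fst _ _ Z T) mX)).
Qed.

Lemma measurable_root_mean_pos W s f : 0 <= s -> measurable_fun setT f ->
    (forall y, 0 <= f y)%E -> measurable_fun setT (root_mean rho b W s f).
Proof.
move=> s0 mf f0.
apply: (@measurable_root_mean W _ R (fun=> s) id (fun=> f)) => //.
exact: measurableT_comp.
Qed.

Hypothesis beta_gt0 : 0 < beta.
Variables (A : set R) (mA : measurable A).

Lemma lifetime_tail W t : 0 <= t ->
  P [set w | t < lifetime W [::] w] = (expR (- beta * t))%:E.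
Proof.
rewrite le_eqVlt => /predU1P[<-|t0].
  rewrite mulr0 expR0 (_ : [set w | _] = setT) ?probability_setT//.
  by apply/seteqP; split=> // w _ /=; exact: lifetime_gt0.
have -> : [set w | t < lifetime W [::] w] = ~` (lifetime W [::] @^-1` `[0, t]).
  apply/seteqP; split=> w /=; rewrite in_itv/= (ltW (lifetime_gt0 W [::] w))/= ltNge.
    by move/negP.
  by move/negP.
rewrite probability_setC; last first.
  by rewrite -[X in measurable X]setTI; apply: (@measurable_funP _ _ _ _ _ (lifetime W [::])).
have -> : P (lifetime W [::] @^-1` `[0, t]) = exponential_prob beta `[0, t].
  by rewrite -(@lifetime_law _ _ _ _ _ _ W [::]).
rewrite exponential_prob_itv0c//.
by rewrite -[1%E]/(1%:E) -!EFinB; congr (_%:E); ring.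
Qed.

Lemma prob_particle_nil W t x : 0 <= t ->
  P (particle_event rho b A W [::] t x) =
  ((expR (- beta * t))%:E * root_mean rho b W t (fun y => (\1_A y)%:E) x)%E.
Proof.
move=> t0; rewrite particle_event_nil//.
pose E2 := root_survival rho b W x t `&` drifted (motion W [::]) rho x t @^-1` A.
have -> : [set w | [/\ t < lifetime W [::] w, root_survival rho b W x t w
    & A (drifted (motion W [::]) rho x t w)]] = [set w | t < lifetime W [::] w] `&` E2.
  by apply/seteqP; split=> w; [move=> []|move=> [? []]].
have mD : @measurable _ (g_sigma_algebraType (sigma_data W [set inl (inl [::])])) E2.
  apply: measurableI.
    exact: (@measurable_root_survival _ T R P beta p rho W _ _
      (g_sigma_algebraType (sigma_data W [set inl (inl [::])])) (fun=> t) (fun=> x) id).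
  rewrite -[X in measurable X]setTI.
  by apply: (@measurable_drifted_sigma _ T R P beta p rho W _ _
      (g_sigma_algebraType (sigma_data W [set inl (inl [::])])) (fun=> t) (fun=> x) id).
have mL : @measurable _ (g_sigma_algebraType (sigma_data W [set inl (inr [::])]))
    [set w | t < lifetime W [::] w].
  by apply: measurable_set_lt => //; exact: measurable_lifetime_sigma.
rewrite (@data_independence _ _ _ _ _ _ W [set inl (inr [::])] [set inl (inl [::])])//; last first.
  by apply/seteqP; split=> // j [-> ].
rewrite lifetime_tail//; congr (_ * _)%E.
have mE2 : measurable E2 by exact: (@sigma_data_measurable _ _ _ _ _ _ W [set inl (inl [::])]).
rewrite -[E2]setIT -integral_indic// /root_mean [RHS]integral_mkcond.
apply: eq_integral => w _; rewrite epatch_indic -EFinM.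
congr EFin; rewrite !indicE -natrM mulnC mulnb; congr ((nat_of_bool _)%:R).
apply/idP/andP => [/set_mem[? ?]|[/set_mem ? /set_mem ?]]; last exact/mem_set.
by split; exact/mem_set.
Qed.

End root_mean_theory.

(** * Generating function and renewal equation *)

Section offspring_generating.
Context (R : realType).
Implicit Types (p : nat -> R) (u v c : R) (k : nat).

(** Makes the generating function total: the renewal comparison feeds it values such as U + c, which
    may exceed 1. *)
Definition clip v : R := Num.max 0 (Num.min 1 v).

(* 1 - f(1 - v), where f is the generating function of p *)
Definition branch p v : R :=
  fine (\sum_(0 <= k <oo) (p k * (1 - (1 - clip v) ^+ k))%:E)%E.

Lemma clip_ge0 v : 0 <= clip v. Proof. by rewrite le_max lexx. Qed.

Lemma clip_le1 v : clip v <= 1. Proof. by rewrite ge_max ler01 ge_min lexx. Qed.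

Lemma clip_id v : 0 <= v <= 1 -> clip v = v.
Proof. by move=> /andP[v0 v1]; rewrite /clip min_r// max_r. Qed.

Lemma le_clip u v : u <= v -> clip u <= clip v.
Proof. by move=> uv; rewrite /clip ge_max !le_max lexx/=; apply/orP; right; rewrite le_min !ge_min lexx uv orbT. Qed.

Lemma clipD u c : 0 <= c -> clip (u + c) <= clip u + c.
Proof. move=> c0; rewrite {1}/clip ge_max addr_ge0 ?clip_ge0//= ge_min.
have c1 : 1 <= clip u -> 1 <= clip u + c by lra.
have cu : u <= clip u -> u + c <= clip u + c by lra.
apply/orP; case: (leP 1 u) => u1; [left; apply: c1|right; apply: cu].
  by rewrite le_max le_min lexx u1 orbT.
by rewrite le_max le_min lexx (ltW u1) orbT.
Qed.

Lemma measurable_clip : measurable_fun setT clip.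
Proof. by apply: measurable_maxr => //; apply: measurable_minr. Qed.

Context (p : nat -> R) (p_law : offspring_law p).

Let p0 k : 0 <= p k. Proof. by case: p_law. Qed.

Let power_le1 v k : (1 - clip v) ^+ k <= 1.
Proof. by rewrite exprn_ile1// ?subr_ge0 ?clip_le1// gerBl clip_ge0. Qed.

Let term_ge0 v k : 0 <= p k * (1 - (1 - clip v) ^+ k).
Proof. by rewrite mulr_ge0// subr_ge0. Qed.

Lemma branchE v : (branch p v)%:E = (\sum_(0 <= k <oo) (p k * (1 - (1 - clip v) ^+ k))%:E)%E.
Proof.
rewrite fineK// ge0_fin_numE; last by apply: nneseries_ge0 => k _ _; rewrite lee_fin.
apply: (@le_lt_trans _ _ 1%E); last exact: ltry.
case: p_law => _ <-; apply: lee_nneseries => k _; first by rewrite lee_fin.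
by rewrite lee_fin ler_piMr// gerBl exprn_ge0// subr_ge0 clip_le1.
Qed.

Lemma branch_ge0 v : 0 <= branch p v.
Proof. by rewrite -lee_fin branchE; apply: nneseries_ge0 => k _ _; rewrite lee_fin. Qed.

Lemma branch_le1 v : branch p v <= 1.
Proof.
rewrite -lee_fin branchE; case: p_law => _ <-.
apply: lee_nneseries => k _; first by rewrite lee_fin.
by rewrite lee_fin ler_piMr// gerBl exprn_ge0// subr_ge0 clip_le1.
Qed.

Lemma le_branch u v : u <= v -> branch p u <= branch p v.
Proof.
move=> uv; rewrite -lee_fin !branchE; apply: lee_nneseries => k _; first by rewrite lee_fin.
rewrite lee_fin ler_wpM2l// lerB// lerXn2r// ?nnegrE ?subr_ge0 ?clip_le1// lerB//.
exact: le_clip.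
Qed.

Lemma measurable_branch : measurable_fun setT (branch p).
Proof.
apply: (@measurableT_comp _ _ _ _ _ _ _ _ (fun v => \sum_(0 <= k <oo) (p k * (1 - (1 - clip v) ^+ k))%:E)%E) => //.
apply: ge0_emeasurable_sum => [k v _ _|k _]; first by rewrite lee_fin.
apply/measurable_EFinP; apply: measurable_funM => //; apply: measurable_funB => //.
by apply: measurable_funX; apply: measurable_funB => //; exact: measurable_clip.
Qed.

(** Convexity of the power along the segment from 1 to 1 - v, by induction on [k]. *)
Let power_convex a v k : 0 <= a <= 1 -> 0 <= v <= 1 ->
  (1 - a * v) ^+ k <= 1 - a + a * (1 - v) ^+ k.
Proof.
move=> /andP[a0 a1] /andP[v0 v1].
have q1 j : (1 - v) ^+ j <= 1 by rewrite exprn_ile1//; lra.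
have av : a * v <= 1 by rewrite mulr_ile1.
elim: k => [|k IH]; first by rewrite !expr0; lra.
rewrite !exprS (le_trans (ler_wpM2l _ IH)) ?subr_ge0//.
rewrite -subr_ge0; set y := (1 - v) ^+ k.
rewrite (_ : _ - _ = a * (1 - a) * v * (1 - y)); last by ring.
by rewrite mulr_ge0 ?mulr_ge0// subr_ge0//; exact: q1.
Qed.

(** Concavity combined with the value 0 at 0: the monotonicity of [branch p v / v], in a form
    without division. *)
Lemma branch_concave a v : 0 <= a <= 1 -> 0 <= v <= 1 ->
  a * branch p v <= branch p (a * v).
Proof.
move=> a01 v01; have /andP[a0 a1] := a01; have /andP[v0 v1] := v01.
rewrite -lee_fin EFinM !branchE -nneseriesZl; last by move=> k _; rewrite lee_fin.
apply: lee_nneseries => k _; first by rewrite -EFinM lee_fin mulr_ge0.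
rewrite -EFinM lee_fin mulrCA ler_wpM2l// !clip_id//; last by rewrite mulr_ge0//= mulr_ile1.
by have := power_convex k a01 v01; lra.
Qed.

Let power_lipschitz (x y : R) k : 0 <= x -> x <= y -> y <= 1 ->
  y ^+ k - x ^+ k <= k%:R * (y - x).
Proof.
move=> x0 xy y1; elim: k => [|k IH]; first by rewrite !expr0; lra.
rewrite !exprS (_ : _ - _ = y * (y ^+ k - x ^+ k) + (y - x) * x ^+ k); last by ring.
rewrite (_ : k.+1%:R * _ = k%:R * (y - x) + (y - x)) ?lerD//; last 2 first.
  by rewrite ler_piMr ?subr_ge0// exprn_ile1//; lra.
  by rewrite -natr1; ring.
apply: le_trans IH; rewrite ler_piMl// subr_ge0 lerXn2r// nnegrE//.
exact: le_trans xy.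
Qed.

Hypothesis m_fin : mean_offspring p \is a fin_num.
Let m := fine (mean_offspring p).

Let mE : (\sum_(0 <= k <oo) (k%:R * p k)%:E)%E = m%:E. Proof. by rewrite fineK. Qed.

(** The k-th power has slope at most k on [0, 1], and these slopes average to the mean. *)
Lemma branchD u c : 0 <= c -> branch p (u + c) <= branch p u + m * c.
Proof.
move=> c0; rewrite -lee_fin EFinD EFinM !branchE -mE.
rewrite [X in (_ <= _ + X)%E]muleC -nneseriesZl; last by move=> k _; rewrite lee_fin mulr_ge0.
rewrite -nneseriesD; try (by move=> k _ _; rewrite -?EFinM lee_fin ?mulr_ge0 // subr_ge0).
apply: lee_nneseries => k _; first by rewrite lee_fin.
rewrite -EFinM -EFinD lee_fin (_ : c * _ = p k * (k%:R * c)); last by ring.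
rewrite -mulrDr ler_wpM2l//.
have uc : clip u <= clip (u + c) by apply: le_clip; rewrite lerDl.
have := @power_lipschitz (1 - clip (u + c)) (1 - clip u) k.
rewrite subr_ge0 clip_le1 gerBl clip_ge0 lerB// => /(_ erefl erefl erefl) H.
have : k%:R * (1 - clip u - (1 - clip (u + c))) <= k%:R * c.
  by rewrite ler_wpM2l//; have := clipD u c0; lra.
lra.
Qed.

Lemma branch0 : branch p 0 = 0.
Proof.
apply/EFin_inj; rewrite branchE eseries0// => k _ _.
by rewrite clip_id ?lexx ?ler01// subr0 expr1n subrr mulr0.
Qed.

Lemma branch_le_mean v : 0 <= v -> branch p v <= m * v.
Proof. by move=> v0; have := branchD 0 v0; rewrite branch0 !add0r. Qed.

End offspring_generating.

(** * Reaching probabilities and their recursion *)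

Section reach_probability.
Context d (T : measurableType d) (R : realType) (P : probability T R).
Context (beta : R) (p : nat -> R) (rho : R) (b : bool).
Implicit Types (W : branching_data P beta p) (t x y s : R) (S : set label).
Variables (A : set R) (mA : measurable A).

Local Notation sigmaT W D := (g_sigma_algebraType (sigma_data W D)).

(** The label set [S] allows truncation at a number of generations, on which the law of [reach] is
    studied by induction. *)
Definition some_particle S W : set ((R * R) * T) :=
  \bigcup_(u in S) joint_event rho b A W u.

Lemma measurable_some_particle S W :
  measurable (some_particle S W : set ((R * R) * sigmaT W setT)).
Proof.
rewrite /some_particle bigcup_mkcond; apply: countable_bigcupT_measurable => [|u]; first exact: (@countableP (seq nat)).
by case: ifP => // _; exact: measurable_joint_event.
Qed.

Lemma measurable_some_particle_sigma S W W' (D : set data_index) :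
    sigma_data W setT `<=` sigma_data W' D ->
  measurable (some_particle S W : set ((R * R) * sigmaT W' D)).
Proof.
move=> WW'; have := @measurable_some_particle S W.
have mf : measurable_fun setT (fun z : (R * R) * sigmaT W' D => (z.1, (z.2 : sigmaT W setT))).
  apply: measurable_fun_pair => //.
  exact: (measurableT_comp (@measurable_id_sub _ _ _ _ _ _ _ _ _ _ WW')
    (@measurable_snd _ _ (R * R)%type (sigmaT W' D))).
by move=> /(mf measurableT _); rewrite setTI; congr (measurable _).
Qed.

Lemma measurable_some_particle_section S W t x :
  <<s sigma_data W setT >> [set w | some_particle S W ((t, x), w)].
Proof.
have := measurable_xsection (t, x) (@measurable_some_particle S W).
by congr (measurable _); apply/seteqP; split=> w; rewrite /xsection/= inE.
Qed.

(* probability that some particle with label in S is in A at time t; junk value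
   0 at negative times *)
Definition reach S W t x : R := fine (P [set w | some_particle S W ((t, x), w)]).

Lemma reachE S W t x : (reach S W t x)%:E = P [set w | some_particle S W ((t, x), w)].
Proof.
rewrite fineK// fin_num_measure//; apply: sigma_data_measurable.
exact: (@measurable_some_particle_section S W t x).
Qed.

Lemma reach_ge0 S W t x : 0 <= reach S W t x. Proof. exact: fine_ge0. Qed.

Lemma reach_le1 S W t x : reach S W t x <= 1.
Proof.
rewrite -lee_fin reachE probability_le1//; apply: sigma_data_measurable.
exact: (@measurable_some_particle_section S W t x).
Qed.

Lemma measurable_reach S W : measurable_fun setT (fun z : R * R => reach S W z.1 z.2).
Proof.
apply/measurable_EFinP.
pose idT : {mfun T >-> sigmaT W setT} :=
  mfun_Sub (mem_set (@measurable_id_sigma _ _ _ _ _ _ W setT)).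
have := measurable_fun_xsection (distribution P idT) (@measurable_some_particle S W).
congr (measurable_fun _ _); apply/funext => -[t x] /=.
rewrite reachE /distribution /pushforward; congr (P _).
by apply/seteqP; split=> w /=; rewrite /xsection/= inE.
Qed.

Lemma measurable_reachr S W t : measurable_fun setT (reach S W t).
Proof. exact: (measurableT_comp (@measurable_reach S W) (measurable_pair1 t)). Qed.

(** Independence of the subtrees, one child at a time. The second conjunct, measurability for the
    data of the first [k] children, is what makes the next independence step possible. *)
Lemma prob_no_particle S W t x k :
  P [set w | forall i, (i < k)%N -> ~ some_particle S (child W i) ((t, x), w)] =
  (\prod_(i < k) (1 - reach S (child W i) t x))%:E /\
  <<s sigma_data W (\bigcup_(i in `I_k) child_index i) >>
    [set w | forall i, (i < k)%N -> ~ some_particle S (child W i) ((t, x), w)].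
Proof.
elim: k => [|k [IHP IHm]].
  rewrite big_ord0 (_ : [set w | _] = setT); last by apply/seteqP; split.
  by rewrite probability_setT; split=> //; exact: (@measurableT _ (g_sigma_algebraType _)).
pose E2 := ~` [set w | some_particle S (child W k) ((t, x), w)].
have mE2 : <<s sigma_data W (child_index k) >> E2.
  rewrite -sigma_data_child; apply: (@measurableC _ (g_sigma_algebraType _)).
  exact: measurable_some_particle_section.
rewrite (_ : [set w | _] =
  [set w | forall i, (i < k)%N -> ~ some_particle S (child W i) ((t, x), w)] `&` E2); last first.
  apply/seteqP; split=> w.
    by move=> H; split; [move=> i ik; apply: H; exact: leqW|exact: H].
  by move=> [H Hk] i; rewrite ltnS leq_eqVlt => /predU1P[->|/H].
split; last first.
  apply: (@measurableI _ (g_sigma_algebraType _)).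
    apply: (sub_sigma_algebra2 _ IHm); apply: sigma_data_le => j [i ik ij].
    by exists i => //=; apply: leqW.
  apply: (sub_sigma_algebra2 _ mE2); apply: sigma_data_le => j ij.
  by exists k => //=.
rewrite (@data_independence _ _ _ _ _ _ W (\bigcup_(i in `I_k) child_index i) (child_index k))//.
  rewrite IHP big_ord_recr/= EFinM; congr (_ * _)%E.
  rewrite probability_setC; first by rewrite -reachE.
  apply: sigma_data_measurable; exact: (@measurable_some_particle_section S (child W k) t x).
apply/seteqP; split=> // j [[i /= ik [j1 _ <-]] [j2 _]].
case: j1 j2 => [[u|u]|u] [[v|v]|v] //= [] /rcons_inj[_ ki]; by rewrite ki ltnn in ik.
Qed.

Definition children_event S W k : set ((R * R) * T) :=
  \bigcup_(i in `I_k) some_particle S (child W i).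

Lemma measurable_children_event S W k :
  measurable (children_event S W k : set ((R * R) * sigmaT W descendant_index)).
Proof.
apply: bigcup_measurable => i _; apply: measurable_some_particle_sigma.
by rewrite sigma_data_child; apply: sigma_data_le; exact: child_index_descendant.
Qed.

Lemma prob_children_event S W t x k :
  P [set w | children_event S W k ((t, x), w)] =
  (1 - \prod_(i < k) (1 - reach S (child W i) t x))%:E.
Proof.
have [H mH] := prob_no_particle S W t x k.
rewrite (_ : [set w | _] =
  ~` [set w | forall i, (i < k)%N -> ~ some_particle S (child W i) ((t, x), w)]); last first.
  apply/seteqP; split=> w; first by move=> [i ik +] /(_ i ik).
  by move=> /existsNP[i /not_implyP[ik /contrapT]]; exists i.
by rewrite probability_setC ?H//; exact: sigma_data_measurable mH.
Qed.

Hypotheses (beta_gt0 : 0 < beta) (p_law : offspring_law p).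

(** The root outlives [t], or leaves k independent subtrees that all fail with probability (1 -
    r)^k; averaging over k gives [branch]. The label sets cover truncated trees and the full tree
    alike, and the common value [r] of the children is assumed because equality in law is itself
    derived from this recursion. *)
Lemma reach_recursion S S' W (r : R -> R -> R) t x : 0 <= t ->
    S [::] -> (forall u i, S (rcons u i) <-> S' u) ->
    (forall i t' y, reach S' (child W i) t' y = r t' y) ->
  (reach S W t x)%:E =
  ((expR (- beta * t))%:E * root_mean rho b W t (fun y => (\1_A y)%:E) x +
   \int[lebesgue_measure]_(s in `[0%R, t]) ((beta * expR (- beta * s))%:E *
     root_mean rho b W s (fun y => (branch p (r (t - s)%R y))%:E) x))%E.
Proof.
move=> t0 S0 SS' rE.
rewrite reachE.
pose E1 := particle_event rho b A W [::] t x.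
pose E2 := [set w | [/\ lifetime W [::] w <= t,
               root_survival rho b W x (lifetime W [::] w) w
             & children_event S' W (litter W [::] w)
                 (t - lifetime W [::] w,
                  drifted (motion W [::]) rho x (lifetime W [::] w) w, w)]].
have SE : [set w | some_particle S W ((t, x), w)] = E1 `|` E2.
  apply/seteqP; split=> w.
    move=> [u]; elim/last_ind: u => [|u i _] Su [/= _]; first by left.
    rewrite particle_event_rcons// => -[Lt sv iK pe]; right; split=> //.
    by exists i => //; exists u; [exact: (proj1 (SS' u i) Su)|split=> //=; rewrite subr_ge0].
  move=> [pe|[Lt sv [i /= iK [u S'u [_ /= pe]]]]]; first by exists [::].
  by exists (rcons u i); [exact: (proj2 (SS' u i) S'u)|split=> //=; rewrite particle_event_rcons].
have mE1 : measurable E1.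
  apply: (@sigma_data_measurable _ _ _ _ _ _ W setT).
  have := @measurable_some_particle_section [set [::]] W t x.
  congr (<<s _ >> _); apply/seteqP; split=> w; first by move=> [u -> []].
  by move=> pe; exists [::] => //; split.
have mSW : measurable [set w | some_particle S W ((t, x), w)].
  exact: (sigma_data_measurable (@measurable_some_particle_section S W t x)).
have E12 : E1 `&` E2 = set0.
  apply/seteqP; split=> // w []; rewrite /E1 particle_event_nil// => -[tL _ _] [Lt _ _].
  by move: (lt_le_trans tL Lt); rewrite ltxx.
have mE2 : measurable E2.
  rewrite (_ : E2 = [set w | some_particle S W ((t, x), w)] `\` E1); first exact: measurableD.
  rewrite SE; apply/seteqP; split=> w; last by move=> [[]].
  by move=> w2; split; [right|move=> w1; have : (E1 `&` E2) w by []; rewrite E12].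
rewrite SE measureU//; congr (_ + _)%E; first exact: prob_particle_nil.
apply: (etrans (one_step rho b beta_gt0 (proj1 p_law) (@measurable_children_event S' W) t x)).
apply: eq_integral => s _; congr (_ * _)%E; congr (root_mean _ _ _ _ _ _).
apply/funext => y; rewrite /average_section branchE//.
apply: eq_eseriesr => k _; rewrite EFinM; congr (_ * _)%E.
rewrite /section_probability prob_children_event; congr (1 - _)%:E.
under eq_bigr do rewrite rE.
by rewrite prodr_const card_ord clip_id// -(rE 0) reach_ge0 reach_le1.
Qed.

(** Induction on the depth: the recursion determines n + 1 generations from n, through means that
    are the same for all branching data. *)
Lemma reach_size_law n W W' t x :
  reach [set u | (size u < n)%N] W t x = reach [set u | (size u < n)%N] W' t x.
Proof.
(* At negative times both sides are 0, by the convention in [joint_event]. *)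
have [t0|t_lt0] := leP 0 t; last first.
  have E V : reach [set u | (size u < n)%N] V t x = 0.
    rewrite /reach (_ : [set w | _] = set0) ?measure0//.
    by apply/seteqP; split=> // w [u _ [/=]]; rewrite leNgt t_lt0.
  by rewrite !E.
elim: n W W' t t0 x => [|n IH] W W' t t0 x.
  have -> : [set u : label | (size u < 0)%N] = set0 by apply/seteqP; split.
  by rewrite /reach /some_particle !bigcup_set0.
have IH' V i t' y : reach [set u | (size u < n)%N] (child V i) t' y =
    reach [set u | (size u < n)%N] W t' y.
  have [t'0|t'0] := leP 0 t'; first exact: IH.
  have E U : reach [set u | (size u < n)%N] U t' y = 0.
    rewrite /reach (_ : [set w | _] = set0) ?measure0//.
    by apply/seteqP; split=> // w [u _ [/=]]; rewrite leNgt t'0.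
  by rewrite !E.
apply: EFin_inj.
pose Sn := [set u : label | (size u < n)%N].
have SS (u : label) i : [set u : label | (size u < n.+1)%N] (rcons u i) <-> Sn u.
  by rewrite /Sn/= size_rcons.
pose J (V : branching_data P beta p) := root_mean rho b V t (fun y => (\1_A y)%:E) x.
pose I (V : branching_data P beta p) := (\int[lebesgue_measure]_(s in `[0%R, t])
  ((beta * expR (- beta * s))%:E *
   root_mean rho b V s (fun y => (branch p (reach Sn W (t - s) y))%:E) x))%E.
have rec V : (reach [set u : label | (size u < n.+1)%N] V t x)%:E =
    ((expR (- beta * t))%:E * J V + I V)%E.
  exact: (@reach_recursion [set u : label | (size u < n.+1)%N] Sn V
    (reach Sn W) t x t0 (ltn0Sn n) SS (IH' V)).
have EJ : J W = J W'.
  apply: (@root_mean_law _ _ _ _ _ _ _ _ _ _ _ _ 1) => //.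
  - by apply/measurable_EFinP; exact: measurable_indic.
  - by move=> y; rewrite lee_fin indicE; case: (_ \in _).
have E s : 0 <= s ->
    root_mean rho b W s (fun y => (branch p (reach Sn W (t - s) y))%:E) x =
    root_mean rho b W' s (fun y => (branch p (reach Sn W (t - s) y))%:E) x.
  move=> s0; apply: (@root_mean_law _ _ _ _ _ _ _ _ _ _ _ _ 1) => //.
  - apply/measurable_EFinP; apply: measurableT_comp; first exact: measurable_branch.
    exact: measurable_reachr.
  - by move=> y; rewrite lee_fin branch_ge0.
  - by move=> y; rewrite lee_fin branch_le1.
have EI : I W = I W'.
  by apply: eq_integral => s; rewrite inE/= in_itv/= => /andP[s0 _]; rewrite E.
by rewrite (rec W) (rec W') EJ EI.
Qed.

(** The truncated events increase to the event for the full tree. *)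
Lemma reach_law W W' t x : reach setT W t x = reach setT W' t x.
Proof.
apply: EFin_inj; rewrite !reachE.
have cvgV V : P [set w | some_particle [set u | (size u < n)%N] V ((t, x), w)] @[n --> \oo] -->
    P [set w | some_particle setT V ((t, x), w)].
  rewrite (_ : [set w | some_particle setT V _] =
    \bigcup_n [set w | some_particle [set u | (size u < n)%N] V ((t, x), w)]).
    apply: nondecreasing_cvg_mu.
    - move=> n; exact: (sigma_data_measurable (@measurable_some_particle_section _ V t x)).
    - apply: bigcupT_measurable => n.
      exact: (sigma_data_measurable (@measurable_some_particle_section _ V t x)).
    - move=> n n' nn'; apply/subsetPset => w [u /= un uw]; exists u => //=.
      exact: leq_trans nn'.
  apply/seteqP; split=> w; first by move=> [u _ uw]; exists (size u).+1 => //; exists u => /=.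
  by move=> [n _ [u _ uw]]; exists u.
apply: (cvg_unique _ (cvgV W)) => //.
rewrite /= (_ : (fun n : nat => _) = fun n =>
    P [set w | some_particle [set u | (size u < n)%N] W' ((t, x), w)]); first exact: cvgV.
by apply/funext => n; rewrite -!reachE (reach_size_law _ W W').
Qed.

Lemma reach_equation W t x : 0 <= t -> (reach setT W t x)%:E =
  ((expR (- beta * t))%:E * root_mean rho b W t (fun y => (\1_A y)%:E) x +
   \int[lebesgue_measure]_(s in `[0%R, t]) ((beta * expR (- beta * s))%:E *
     root_mean rho b W s (fun y => (branch p (reach setT W (t - s)%R y))%:E) x))%E.
Proof.
move=> t0; apply: (@reach_recursion _ setT) => // i t' y; exact: reach_law.
Qed.

End reach_probability.

Lemma root_mean_fin_num d (T : measurableType d) (R : realType) (P : probability T R)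
    (beta : R) (p : nat -> R) (rho : R) (b : bool) (W : branching_data P beta p)
    (s : R) (f : R -> \bar R) (c x : R) : measurable_fun setT f ->
    (forall y, 0 <= f y)%E -> (forall y, f y <= c%:E)%E ->
  root_mean rho b W s f x \is a fin_num.
Proof.
move=> mf f0 fc; rewrite ge0_fin_numE; last exact: root_mean_ge0.
by apply: (@le_lt_trans _ _ c%:E); [exact: root_mean_le_cst|exact: ltry].
Qed.

Section esum_countable.
Context (R : realType) (I : countType).
Implicit Types (a : I -> \bar R) (A : set I).

Lemma esum_pickle a : (forall i, 0 <= a i)%E ->
  (\esum_(i in [set: I]) a i = \sum_(0 <= n <oo) oapp a 0 (choice.pickle_inv n))%E.
Proof.
move=> a0.
rewrite (_ : [set: I] = \bigcup_n [set i : I | choice.pickle i = n]); last first.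
  by apply/seteqP; split=> // i _; exists (choice.pickle i).
rewrite nneseries_sum_bigcup//; last by apply/trivIsetP => m n _ _ mn; apply/seteqP;
  split=> // i [/= -> /eqP]; rewrite (negbTE mn).
apply: eq_eseriesr => n _; case E : (choice.pickle_inv n) => [i|] /=.
  rewrite (_ : [set _ | _] = [set i]) ?esum_set1//.
  have := @choice.pickle_invK I n; rewrite E /= => pn.
  apply/seteqP; split=> [j /= jn|j /= -> //]; apply: (pcan_inj (@choice.pickleK I)).
  by rewrite jn pn.
rewrite (_ : [set _ | _] = set0) ?esum_set0//.
by apply/seteqP; split=> // j /= jn; have := @choice.pickleK_inv I j; rewrite jn E.
Qed.

Lemma ge0_esumZl A (c : R) a : 0 <= c -> (forall i, 0 <= a i)%E ->
  (\esum_(i in A) (c%:E * a i) = c%:E * \esum_(i in A) a i)%E.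
Proof.
move=> c0 a0; rewrite esum_mkcond [X in (_ = _ * X)%E]esum_mkcond.
rewrite !esum_pickle; try by move=> i; case: ifP => // _; rewrite ?mule_ge0.
rewrite -nneseriesZl; last first.
  by move=> n _; case: (choice.pickle_inv n) => //= i; case: ifP.
apply: eq_eseriesr => n _; case: (choice.pickle_inv n) => [i|] /=; last by rewrite mule0.
by case: ifP; rewrite ?mule0.
Qed.

Lemma ge0_integral_esum d (T : measurableType d) (mu : measure T R) (f : I -> T -> \bar R) :
    (forall i, measurable_fun setT (f i)) -> (forall i w, (0 <= f i w)%E) ->
  (\int[mu]_w (\esum_(i in [set: I]) f i w) = \esum_(i in [set: I]) \int[mu]_w f i w)%E.
Proof.
move=> mf f0; under eq_integral do rewrite esum_pickle//.
rewrite esum_pickle; last by move=> i; exact: integral_ge0.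
rewrite integral_nneseries//.
- apply: eq_eseriesr => n _; case: (choice.pickle_inv n) => //=.
  by rewrite integral0.
- by move=> n; case: (choice.pickle_inv n) => [i|] //=; exact: measurable_cst.
- by move=> n w _; case: (choice.pickle_inv n) => /=.
Qed.

End esum_countable.

Section events.
Context d (T : measurableType d) (R : realType) (P : probability T R).
Context (beta : R) (p : nat -> R) (W : branching_data P beta p) (rho : R).
Implicit Types (a t x y s : R) (w : T).

Lemma killed_max_gtP a t x w : 0 <= t -> (a%:E < killed_max W x rho t w)%E <->
  some_particle rho true `]a, +oo[%classic setT W ((t, x), w).
Proof.
move=> t0; split.
  move=> /ereal_sup_gt[_ [u [al pm] <-]]; rewrite lte_fin => au.
  exists u => //; split=> //; split=> //.
  by rewrite /= in_itv/= au.
move=> [u _ [_ [al /(_ erefl) pm]]]; rewrite /= in_itv/= andbT => au.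
apply: (@lt_le_trans _ _ (position W x rho u t w)%:E); first by rewrite lte_fin.
by apply: ereal_sup_ubound; exists u.
Qed.

Lemma alive_ancestor u w s t : 0 <= s -> s <= t -> alive W t w u -> alive W s w !=set0.
Proof.
move=> s0 st [uin /andP[_ td]]; have := le_lt_trans st td => {st td}.
elim: u uin => [_|i u IH [uin iK]] sd; first by exists [::]; split=> //; rewrite s0.
have [bs|sb] := leP (birth W (i :: u) w) s; first by exists (i :: u); split=> //; rewrite bs.
exact: IH.
Qed.

Lemma extinction_gtP t x w : 0 <= t -> (t%:E < extinction_time W w)%E <->
  some_particle rho false setT setT W ((t, x), w).
Proof.
move=> t0; split.
  move=> te; suff [u ut] : alive W t w !=set0 by exists u.
  (* Time 0 is apart: extinction is an infimum over positive times, and at 0 the root is alive since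
     its lifetime is positive. *)
  move: t0; rewrite le_eqVlt => /predU1P[<-|t0].
    by exists [::]; split=> //; rewrite lexx /death/= add0r lifetime_gt0.
  apply/set0P/eqP => a0; move: te; apply/negP; rewrite -leNgt.
  by apply: ereal_inf_lbound; exists t.
move=> [u _ [_ [[uin /andP[bt td]] _ _]]].
(* [u] lives strictly beyond [t], and at any time before its death [u] or one of its ancestors is
   alive, so extinction cannot come before [death W u w]. *)
apply: (@lt_le_trans _ _ (death W u w)%:E); first by rewrite lte_fin.
apply: le_ereal_inf_tmp => _ [s [s0 as0] <-]; rewrite lee_fin leNgt.
apply/negP => sd; have : alive W s w !=set0; last by move=> /set0P; rewrite as0 eqxx.
have [sb|bs] := leP (birth W u w) s; first by exists u; split=> //; rewrite sb.
apply: (@alive_ancestor u _ _ (birth W u w)) (ltW s0) (ltW bs) _.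
by split=> //; rewrite lexx (le_lt_trans bt td).
Qed.

End events.

(** * Many-to-one formula *)

Section many_to_one.
Context d (T : measurableType d) (R : realType) (P : probability T R).
Context (beta : R) (p : nat -> R) (rho : R) (b : bool).
Implicit Types (W : branching_data P beta p) (t x y s : R) (u : label).
Variables (A : set R) (mA : measurable A).
Hypotheses (beta_gt0 : 0 < beta) (p_law : offspring_law p).

Let p0 k : 0 <= p k. Proof. by case: p_law. Qed.

Definition litter_tail i : R := fine (\sum_(0 <= k <oo) (p k * (i < k)%N%:R)%:E)%E.

Lemma litter_tailE i : (litter_tail i)%:E = (\sum_(0 <= k <oo) (p k * (i < k)%N%:R)%:E)%E.
Proof.
rewrite fineK// ge0_fin_numE; last by apply: nneseries_ge0 => k _ _; rewrite lee_fin mulr_ge0.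
apply: (@le_lt_trans _ _ 1%E); last exact: ltry.
case: p_law => _ <-; apply: lee_nneseries => k _; first by rewrite lee_fin mulr_ge0.
by rewrite lee_fin ler_piMr//; case: ltnP.
Qed.

Lemma litter_tail_ge0 i : 0 <= litter_tail i.
Proof. by apply: fine_ge0; apply: nneseries_ge0 => k _ _; rewrite lee_fin mulr_ge0. Qed.

(** Poisson probability of n branchings before time t along a line of descent. *)
Definition generation_rate t (n : nat) : R := expR (- beta * t) * exp_coeff (beta * t) n.

(** The Poisson recursion given by the first branching time; once the exponentials are merged the
    integrand is a multiple of (t - s)^n. *)
Lemma integral_generation_rate t n : 0 <= t ->
  (\int[lebesgue_measure]_(s in `[0%R, t])
     (beta * expR (- beta * s) * generation_rate (t - s) n)%:E =
   (generation_rate t n.+1)%:E)%E.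
Proof.
rewrite le_eqVlt => /predU1P[<-|t0].
  rewrite set_itv1 integral_set1 /generation_rate /exp_coeff/=.
  by rewrite !mulr0 expr0n/= mul0r mulr0.
pose c : R := expR (- beta * t) * beta ^+ n.+1 / n`!%:R.
pose F s : R := - (c / n.+1%:R) * (t - s) ^+ n.+1.
pose f s : R := c * (t - s) ^+ n.
have nf0 : n`!%:R != 0 :> R by rewrite pnatr_eq0 -lt0n fact_gt0.
have -> : (fun s => (beta * expR (- beta * s) * generation_rate (t - s) n)%:E) = EFin \o f.
  apply/funext => s /=; congr EFin; rewrite /generation_rate /f /c /exp_coeff/=.
  rewrite (_ : expR (- beta * t) = expR (- beta * s) * expR (- beta * (t - s))).
    by rewrite exprMn exprS; field.
  by rewrite -expRD; congr expR; ring.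
have dF s : is_derive s 1 F (f s).
  have dg : is_derive s 1 (cst t - id : R -> R) (-1).
    by apply: (is_derive_eq (is_deriveB _ _)); rewrite sub0r.
  have := is_deriveZ (- (c / n.+1%:R)) (is_deriveX n.+1 dg).
  rewrite (_ : _ \*: _ = F); last first.
    by apply/funext => r; rewrite /F exprfctE.
  move=> dF; apply: (is_derive_eq dF); rewrite /f /GRing.scale/= fctE/=.
  change (- (c / n.+1%:R) * (n.+1%:R * (t - s) ^+ n * -1) = c * (t - s) ^+ n).
  have : n.+1%:R != 0 :> R by rewrite pnatr_eq0.
  by move: (n.+1%:R) => N N0; field.
have cF s : {for s, continuous F}.
  by apply: differentiable_continuous; apply/derivable1_diffP; case: (dF s).
have cf : continuous f.
  move=> s; apply: (@continuousM _ _ (cst c) (fun s => (t - s) ^+ n)); first exact: cvg_cst.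
  apply: (@continuous_comp _ _ _ (fun s => t - s) (fun s => s ^+ n)); last exact: exprn_continuous.
  by apply: (@continuousB _ _ _ (cst t) id) => //; exact: cvg_cst.
rewrite (@continuous_FTC2 _ f F)//.
- rewrite -EFinB /F subrr subr0 expr0n/= mulr0 sub0r; congr EFin.
  rewrite /generation_rate /exp_coeff/= /c factS natrM exprMn.
  by field; rewrite nf0 addrC natr1 pnatr_eq0.
- exact: continuous_subspaceT.
- split=> [s _||]; first by case: (dF s).
  + by apply: cvg_at_right_filter; exact: cF.
  + by apply: cvg_at_left_filter; exact: cF.
- by move=> s _; rewrite derive1E; apply: derive_val.
Qed.

Lemma generation_rate_ge0 t n : 0 <= t -> 0 <= generation_rate t n.
Proof. by move=> t0; rewrite mulr_ge0 ?expR_ge0// exp_coeff_ge0// mulr_ge0// ltW. Qed.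

(** Probability that every ancestor of [u] has enough children for [u] to exist. *)
Fixpoint label_weight u : R := if u is i :: v then litter_tail i * label_weight v else 1.

Lemma label_weight_rcons u i : label_weight (rcons u i) = litter_tail i * label_weight u.
Proof. by elim: u => //= j u ->; rewrite mulrCA. Qed.

Lemma label_weight_ge0 u : 0 <= label_weight u.
Proof. by elim: u => //= i u IH; rewrite mulr_ge0 ?litter_tail_ge0. Qed.

Let one_A y : \bar R := (\1_A y)%:E.
Let m1 : measurable_fun setT one_A.
Proof. by apply/measurable_EFinP; exact: measurable_indic. Qed.

Let one_A0 y : (0 <= one_A y)%E. Proof. by rewrite lee_fin. Qed.

Let one_A1 y : (one_A y <= 1%:E)%E.
Proof. by rewrite lee_fin indicE; case: (_ \in _). Qed.

(** Existence of the label, number of branchings and motion decouple. The induction peels off the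
    root, and the semigroup property glues the motions before and after its death. *)
Lemma prob_particle_event W u t x : 0 <= t ->
  P (particle_event rho b A W u t x) =
  ((label_weight u * generation_rate t (size u))%:E * root_mean rho b W t one_A x)%E.
Proof.
elim/last_ind: u W t x => [|u i IH] W t x t0.
  rewrite prob_particle_nil//; congr (_%:E * _)%E.
  by rewrite /generation_rate /exp_coeff/= expr0 fact0 divr1 mulr1 mul1r.
rewrite particle_event_rcons//.
(* Only the i-th subtree matters, and it exists exactly when the root has more than [i] children. *)
pose D k : set ((R * R) * T) := if (i < k)%N then joint_event rho b A (child W i) u else set0.
have mD k : measurable (D k : set ((R * R) * g_sigma_algebraType (sigma_data W descendant_index))).
  rewrite /D; case: ifP => // _.
  have := @measurable_some_particle_sigma _ _ _ _ _ p rho b A mA [set u] (child W i) W descendant_index.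
  rewrite /some_particle bigcup_set1; apply.
  by rewrite sigma_data_child; apply: sigma_data_le; exact: child_index_descendant.
transitivity (P [set w | [/\ lifetime W [::] w <= t,
               root_survival rho b W x (lifetime W [::] w) w
             & D (litter W [::] w)
                 (t - lifetime W [::] w,
                  drifted (motion W [::]) rho x (lifetime W [::] w) w, w)]]).
  congr (P _); apply/seteqP; split=> w; rewrite /D.
    by move=> [Lt sv iK pe]; split=> //; rewrite iK; split=> //=; rewrite subr_ge0.
  by move=> [Lt sv]; case: ifP => // iK [_ pe]; split.
apply: (etrans (one_step rho b beta_gt0 (proj1 p_law) mD t x)).
pose M := root_mean rho b W t one_A x.
transitivity (\int[lebesgue_measure]_(s in `[0%R, t])
  ((label_weight (rcons u i))%:E *
   ((beta * expR (- beta * s) * generation_rate (t - s) (size u))%:E * M)))%E.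
  apply: eq_integral => s; rewrite inE/= in_itv/= => /andP[s0 st].
  have ts0 : 0 <= t - s by rewrite subr_ge0.
  have G0 : 0 <= generation_rate (t - s) (size u) by exact: generation_rate_ge0.
  rewrite (_ : average_section P p D (t - s) = fun y =>
     ((label_weight (rcons u i) * generation_rate (t - s) (size u))%:E *
      root_mean rho b W (t - s) one_A y)%E); last first.
    apply/funext => y; rewrite /average_section label_weight_rcons -mulrA EFinM -muleA.
    rewrite litter_tailE.
    have [v v0 vE] : exists2 v, 0 <= v & root_mean rho b W (t - s) one_A y = v%:E.
      have r0 : (0 <= root_mean rho b W (t - s) one_A y)%E by exact: root_mean_ge0.
      exists (fine (root_mean rho b W (t - s) one_A y)); first exact: fine_ge0.
      rewrite fineK// ge0_fin_numE//; apply: (@le_lt_trans _ _ 1%:E); last exact: ltry.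
      exact: root_mean_le_cst.
    rewrite vE -EFinM.
    transitivity (\sum_(0 <= k <oo) ((label_weight u * generation_rate (t - s) (size u) * v)%:E *
        (p k * (i < k)%N%:R)%:E))%E.
      apply: eq_eseriesr => k _; rewrite /section_probability /D.
      case: ifP => ik; last by rewrite mulr0 mule0 (_ : [set w | _] = set0) ?measure0 ?mule0.
      rewrite mulr1 muleC; congr (_ * _)%E.
      rewrite (_ : [set w | _] = particle_event rho b A (child W i) u (t - s) y).
        rewrite IH// (@root_mean_law _ _ _ _ _ _ rho b W (child W i) _ one_A 1 y ts0)//.
        by rewrite vE -EFinM.
      by apply/seteqP; split=> w; [move=> []|move=> ?; split].
    rewrite nneseriesZl; last by move=> k _; rewrite lee_fin mulr_ge0.
    by rewrite muleC.
  have c0 : 0 <= label_weight (rcons u i) * generation_rate (t - s) (size u).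
    by rewrite mulr_ge0 ?label_weight_ge0.
  rewrite root_meanZ//; last first.
  - by move=> y; exact: root_mean_ge0.
  - exact: measurable_root_mean_pos.
  rewrite (@root_mean_semigroup _ _ _ _ _ _ _ _ _ _ _ _ 1)// [(s + _)%R]addrC subrK -/M.
  rewrite !muleA -!EFinM; congr (_%:E * _)%E; ring.
have M0 : (0 <= M)%E by exact: root_mean_ge0.
have mg : measurable_fun `[0, t] (fun s => (beta * expR (- beta * s) *
    generation_rate (t - s) (size u))%:E).
  apply/measurable_EFinP; apply: measurable_funTS; apply: measurable_funM.
    by apply: measurable_funM => //; apply: measurableT_comp => //; exact: measurable_funM.
  apply: measurable_funM.
    apply: measurableT_comp => //; apply: measurable_funM => //.
    exact: measurable_funB.
  apply: measurable_funM => //; apply: measurable_funX; apply: measurable_funM => //.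
  exact: measurable_funB.
have g0 s : `[0, t]%classic s -> (0 <= (beta * expR (- beta * s) *
    generation_rate (t - s) (size u))%:E)%E.
  rewrite /= in_itv/= => /andP[s0 st].
  by rewrite lee_fin mulr_ge0 ?generation_rate_ge0 ?subr_ge0// mulr_ge0 ?expR_ge0// ltW.
rewrite ge0_integralZl_EFin ?label_weight_ge0//; last 2 first.
- by move=> s /g0 ?; rewrite mule_ge0.
- by apply: emeasurable_funM => //; exact: measurable_cst.
rewrite ge0_integralZr// integral_generation_rate//.
by rewrite muleA -EFinM size_rcons.
Qed.

Hypothesis m_fin : mean_offspring p \is a fin_num.
Let m := fine (mean_offspring p).

(** The tail formula for an expectation. *)
Lemma sum_litter_tail : (\sum_(0 <= i <oo) (litter_tail i)%:E)%E = m%:E.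
Proof.
under eq_eseriesr do rewrite litter_tailE.
rewrite nneseries_interchange; last by move=> i j; rewrite lee_fin mulr_ge0.
rewrite /m fineK//; apply: eq_eseriesr => k _.
rewrite (nneseries_split _ k)/= ?add0n; last by move=> i _; rewrite lee_fin mulr_ge0.
rewrite eseries0 ?adde0; last by move=> i ki _; rewrite ltnNge ki mulr0.
rewrite (eq_big_nat _ _ (F2 := fun=> (p k)%:E)); last by move=> i /andP[_ ik]; rewrite ik mulr1.
by rewrite sumEFin big_const_nat subn0 iter_addr addr0 -[RHS]/((k%:R * p k)%:E) mulr_natl.
Qed.

(** Choosing the last letter multiplies the total by the sum of the litter tails, which is the
    mean. *)
Lemma sum_label_weight n :
  (\esum_(u in [set u : label | size u = n]) (label_weight u)%:E)%E = (m ^+ n)%:E.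
Proof.
elim: n => [|n IH].
  rewrite (_ : [set u : label | _] = [set [::]]) ?esum_set1 ?expr0//.
  by apply/seteqP; split=> [[|i u]|u ->].
rewrite (@reindex_esum _ _ _ ([set u : label | size u = n] `*` setT) _ (fun z => z.2 :: z.1)).
  rewrite -[X in \esum_(i in X) _]/(_ `*`` (fun=> setT)).
  rewrite -(esum_esum (a := fun u i => (litter_tail i * label_weight u)%:E)); last first.
    by move=> u i _ _; rewrite lee_fin mulr_ge0 ?litter_tail_ge0 ?label_weight_ge0.
  transitivity (\esum_(u in [set u : label | size u = n]) (m%:E * (label_weight u)%:E)%E).
    apply: eq_esum => u _; rewrite -nneseries_esumT; last first.
      by move=> i; rewrite lee_fin mulr_ge0 ?litter_tail_ge0 ?label_weight_ge0.
    rewrite -sum_litter_tail muleC -nneseriesZl; last by move=> i _; rewrite lee_fin litter_tail_ge0.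
    by apply: eq_eseriesr => i _; rewrite -EFinM mulrC.
  rewrite (@ge0_esumZl _ (seq nat)) ?IH ?exprS//.
    by rewrite fine_ge0//; apply: nneseries_ge0 => k _ _; rewrite lee_fin mulr_ge0.
  by move=> u; rewrite lee_fin label_weight_ge0.
split=> [[u i] [/= <- _]//|[u i] [v j] _ _ /= [-> ->]//|[|i u] //= [un]].
by exists (u, i).
Qed.

Lemma sum_generation_rate t : 0 <= t ->
  (\sum_(0 <= n <oo) (generation_rate t n * m ^+ n)%:E)%E = (expR (- alpha beta p * t))%:E.
Proof.
move=> t0; have -> : expR (- alpha beta p * t) = expR (- beta * t) * expR (m * (beta * t)).
  by rewrite -expRD; congr expR; rewrite /alpha -/m; ring.
have E k : generation_rate t k * m ^+ k = expR (- beta * t) * exp_coeff (m * (beta * t)) k.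
  by rewrite /generation_rate /exp_coeff/= [in RHS]exprMn; ring.
transitivity (\sum_(0 <= k <oo) ((expR (- beta * t))%:E * (exp_coeff (m * (beta * t)) k)%:E))%E.
  by apply: eq_eseriesr => k _; rewrite E EFinM.
have x0 : 0 <= m * (beta * t).
  rewrite mulr_ge0 ?mulr_ge0 ?(ltW beta_gt0)// fine_ge0//.
  by apply: nneseries_ge0 => k _ _; rewrite lee_fin mulr_ge0.
rewrite nneseriesZl; last by move=> k _; rewrite lee_fin exp_coeff_ge0.
rewrite EFinM; congr (_ * _)%E; apply/cvg_lim => //.
rewrite (_ : (fun n => _) = EFin \o series (exp_coeff (m * (beta * t)))).
  by apply: cvg_EFin; [exact: nearW|exact: is_cvg_series_exp_coeff].
by apply/funext => n /=; rewrite sumEFin.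
Qed.

(** The labels are grouped by generation: their weights sum to m^n, and the Poisson probabilities
    then sum to exp(- alpha t). *)
Lemma integral_killed_particles W t x : 0 <= t ->
  (\int[P]_w (\esum_(u in [set: label]) (\1_(particle_event rho b A W u t x) w)%:E) =
   (expR (- alpha beta p * t))%:E * root_mean rho b W t one_A x)%E.
Proof.
move=> t0.
have mE u : measurable (particle_event rho b A W u t x).
  apply: (@sigma_data_measurable _ _ _ _ _ _ W setT).
  have := @measurable_some_particle_section _ _ _ _ _ p rho b A mA [set u] W t x.
  congr (<<s _ >> _); apply/seteqP; split=> w; first by move=> [_ -> []].
  by move=> pe; exists u => //; split.
rewrite (@ge0_integral_esum _ (seq nat)); last 2 first.
- by move=> u; apply/measurable_EFinP; exact: measurable_indic.
- by move=> u w; rewrite lee_fin.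
have [v v0 vE] : exists2 v, 0 <= v & root_mean rho b W t one_A x = v%:E.
  have r0 : (0 <= root_mean rho b W t one_A x)%E by exact: root_mean_ge0.
  exists (fine (root_mean rho b W t one_A x)); first exact: fine_ge0.
  rewrite fineK// ge0_fin_numE//; apply: (@le_lt_trans _ _ 1%:E); last exact: ltry.
  exact: root_mean_le_cst.
transitivity (\esum_(u in [set: label]) (v%:E * (label_weight u * generation_rate t (size u))%:E)%E).
  apply: eq_esum => u _; have -> : (\int[P]_w (\1_(particle_event rho b A W u t x) w)%:E)%E =
      P (particle_event rho b A W u t x) by rewrite integral_indic// setIT.
  by rewrite prob_particle_event// vE muleC.
have w0 u : 0 <= label_weight u * generation_rate t (size u).
  by rewrite mulr_ge0 ?label_weight_ge0 ?generation_rate_ge0.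
rewrite (@ge0_esumZl _ (seq nat))// vE muleC; congr (_ * _)%E.
rewrite -sum_generation_rate// (_ : [set: label] = \bigcup_n [set u : label | size u = n]); last first.
  by apply/seteqP; split=> // u _; exists (size u).
rewrite nneseries_sum_bigcup//; last by apply/trivIsetP => i j _ _ ij; apply/seteqP;
  split=> // u [/= -> /eqP]; rewrite (negbTE ij).
apply: eq_eseriesr => n _; rewrite EFinM -sum_label_weight -(@ge0_esumZl _ (seq nat)); last 2 first.
- exact: generation_rate_ge0.
- by move=> u; rewrite lee_fin label_weight_ge0.
by apply: eq_esum => u /= ->; rewrite mulrC EFinM.
Qed.

End many_to_one.

Lemma expected_killedE d (T : measurableType d) (R : realType) (P : probability T R)
    (beta : R) (p : nat -> R) (W : branching_data P beta p) (rho t x : R) (A : set R) :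
    0 < beta -> offspring_law p -> mean_offspring p \is a fin_num -> 0 <= t -> measurable A ->
  expected_killed W x rho t A = expR (- alpha beta p * t) *
    fine (killed_mean (motion W [::]) rho t (fun y => (\1_A y)%:E) x).
Proof.
move=> b0 pl mf t0 mA; rewrite /expected_killed.
have := integral_killed_particles rho true mA b0 pl mf W x t0.
rewrite root_meanE => E.
transitivity (fine ((expR (- alpha beta p * t))%:E *
    killed_mean (motion W [::]) rho t (fun y => (\1_A y)%:E) x)%E).
  rewrite -E; congr fine; apply: eq_integral => w _.
  rewrite /killed_measure esum_mkcond; apply: eq_esum => u _.
  rewrite indicE diracE; case: ifPn => [/set_mem[al pm]|].
    by congr (_%:E); congr (_%:R); congr nat_of_bool; apply/idP/idP => /set_mem H; apply/mem_set;
      [split|case: H].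
  by move=> nk; rewrite memNset// => -[al /(_ erefl) pm _]; move/negP: nk; apply; apply/mem_set.
have := @root_mean_fin_num _ _ _ P _ _ rho true W t (fun y => (\1_A y)%:E) 1 x.
rewrite root_meanE => fK; rewrite fineM// fK//.
- by apply/measurable_EFinP; exact: measurable_indic.
- by move=> y; rewrite lee_fin indicE; case: (_ \in _).
Qed.

Lemma ge0_integral_itv_split (R : realType) (h : R -> \bar R) (r s t : R) : r <= s -> s <= t ->
    measurable_fun `[r, t] h -> (forall y, (0 <= h y)%E) ->
  (\int[@lebesgue_measure R]_(y in `[r, t]) h y =
   \int[@lebesgue_measure R]_(y in `]s, t]) h y + \int[@lebesgue_measure R]_(y in `[r, s]) h y)%E.
Proof.
move=> rs st mh h0.
have E : `[r, t]%classic = `]s, t] `|` `[r, s] by rewrite setUC -itv_bndbnd_setU ?bnd_simp.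
have mh' : measurable_fun (`]s, t] `|` `[r, s]) h by rewrite -E.
have D : [disjoint `]s, t]%classic & `[r, s]%classic].
  apply/disj_setPS => y []; rewrite /= !in_itv/= => /andP[sy _] /andP[_ ys].
  by move: (lt_le_trans sy ys); rewrite ltxx.
rewrite E; apply: ge0_integral_setU => // y _; exact: h0.
Qed.

(** * Renewal equation and comparison principle *)

Section renewal_equation.
Context d (T : measurableType d) (R : realType) (P : probability T R).
Context (beta : R) (p : nat -> R) (W : branching_data P beta p) (rho : R) (b : bool).
Implicit Types (s t x y c : R) (f : R -> \bar R) (U V : R -> R -> R).
Hypotheses (beta_gt0 : 0 < beta) (p_law : offspring_law p).
Hypotheses (m_gt0 : (0 < mean_offspring p)%E) (m_lt1 : (mean_offspring p < 1)%E).

Local Notation mu := (@lebesgue_measure R).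
Local Notation K := (root_mean rho b W).
Local Notation jmeas U := (measurable_fun setT (fun z : R * R => U z.1 z.2)).
Let m := fine (mean_offspring p).

Lemma mean_fin_num : mean_offspring p \is a fin_num.
Proof. by rewrite ge0_fin_numE ?ltW// (lt_trans m_lt1)// ltry. Qed.

Lemma mean_gt0 : 0 < m.
Proof. by rewrite -lte_fin /m fineK ?mean_fin_num. Qed.

Lemma mean_lt1 : m < 1.
Proof. by rewrite -lte_fin /m fineK ?mean_fin_num. Qed.

Lemma alpha_gt0 : 0 < alpha beta p.
Proof. by rewrite mulr_gt0// subr_gt0 mean_lt1. Qed.

Lemma root_mean_integral t x (phi : R -> R -> \bar R) : jmeas phi ->
    (forall r y, 0 <= phi r y)%E ->
  (K t (fun y => \int[mu]_r phi r y) x = \int[mu]_r K t (phi r) x)%E.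
Proof.
move=> mphi phi0; pose S := root_survival rho b W x t.
have mS : measurable S by exact: measurable_root_survival_set.
pose X w := drifted (motion W [::]) rho x t w.
have mX : measurable_fun setT X by apply: measurable_funB => //; exact: measurable_funD.
have E f : K t f x = (\int[P]_w (f (X w) * (\1_S w)%:E))%E.
  by rewrite /root_mean integral_mkcond; apply: eq_integral => w _; rewrite epatch_indic.
have mphi1 y : measurable_fun setT (phi ^~ y) by exact: (measurableT_comp mphi (measurable_pair2 y)).
rewrite E; transitivity (\int[P]_w \int[mu]_r (phi r (X w) * (\1_S w)%:E))%E.
  by apply: eq_integral => w _; rewrite ge0_integralZr ?lee_fin//; exact: (mphi1 (X w)).
rewrite (@fubini_tonelli _ _ T (measurableTypeR R) R P mu
  (fun z => phi z.2 (X z.1) * (\1_S z.1)%:E)%E)/=; last 2 first.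
- apply: emeasurable_funM.
    have mg : measurable_fun setT (fun z : T * measurableTypeR R => (z.2 : R, X z.1)).
      apply: measurable_fun_pair; first exact: measurable_snd.
      exact: (measurableT_comp mX measurable_fst).
    exact: (measurableT_comp mphi mg).
  have m1S : measurable_fun setT (\1_S : T -> R) by exact: measurable_indic.
  by apply/measurable_EFinP; exact: (measurableT_comp m1S measurable_fst).
- by move=> z; rewrite mule_ge0// lee_fin.
by apply: eq_integral => r _; rewrite E.
Qed.

Lemma measurable_integral_lebesgue (g : R -> R -> \bar R) : jmeas g ->
  (forall s y, 0 <= g s y)%E -> measurable_fun setT (fun y => \int[mu]_s g s y)%E.
Proof.
move=> mg g0.
have msw : measurable_fun setT (fun z : R * measurableTypeR R => (z.2 : R, z.1)).
  by apply: measurable_fun_pair; [exact: measurable_snd|exact: measurable_fst].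
exact: (@measurable_integral_param _ _ R (measurableTypeR R) R mu (fun y s => g s y)
  (measurableT_comp mg msw) (fun y s => g0 s y)).
Qed.

Definition renewal V t x : \bar R :=
  (\int[mu]_(s in `[0%R, t]) ((beta * expR (- beta * s))%:E *
    K s (fun y => (branch p (V (t - s)%R y))%:E) x))%E.

Let mF V : jmeas V -> forall t, measurable_fun setT (fun y => (branch p (V t y))%:E).
Proof.
move=> mV t; apply/measurable_EFinP; apply: measurableT_comp; first exact: measurable_branch.
exact: (measurableT_comp mV (measurable_pair1 t)).
Qed.

Let F0 v : (0 <= (branch p v)%:E)%E. Proof. by rewrite lee_fin branch_ge0. Qed.

Let F1 v : ((branch p v)%:E <= 1%:E)%E. Proof. by rewrite lee_fin branch_le1. Qed.

Let density_ge0 s : (0 <= (beta * expR (- beta * s))%:E)%E.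
Proof. by rewrite lee_fin mulr_ge0 ?expR_ge0// ltW. Qed.

Let mdensity : measurable_fun setT (fun s => (beta * expR (- beta * s))%:E).
Proof.
by apply/measurable_EFinP; apply: measurable_funM => //; apply: measurableT_comp.
Qed.

Let mmax0 dZ (Z : measurableType dZ) (g : Z -> R) : measurable_fun setT g ->
  measurable_fun setT (fun z => Num.max 0 (g z)).
Proof. by move=> mg; exact: measurable_maxr. Qed.

Lemma measurable_renewal_integrand V t x : jmeas V -> measurable_fun `[0, t] (fun s =>
  (beta * expR (- beta * s))%:E * K s (fun y => (branch p (V (t - s)%R y))%:E) x)%E.
Proof.
move=> mV; apply: emeasurable_funM; first exact: measurable_funTS.
have mK : measurable_fun setT
    (fun s => K (Num.max 0 s) (fun y => (branch p (V (t - s) y))%:E) x).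
  apply: (@measurable_root_mean _ _ _ _ _ _ rho b W _ R (fun s => Num.max 0 s) (fun=> x)
    (fun s y => (branch p (V (t - s) y))%:E)) => //.
  - exact: mmax0.
  - by move=> s; rewrite le_max lexx.
  apply/measurable_EFinP; apply: measurableT_comp; first exact: measurable_branch.
  apply: (measurableT_comp (f := fun z : R * R => V z.1 z.2)
    (g := fun z : R * R => (t - z.1, z.2))) => //.
  apply: measurable_fun_pair => //; apply: measurable_funB => //.
apply: (eq_measurable_fun _ _ (measurable_funTS mK)) => s.
by rewrite inE/= in_itv/= => /andP[s0 _]; rewrite max_r.
Qed.

Let renewal_term_ge0 V t x s : (0 <= (beta * expR (- beta * s))%:E *
  K s (fun y => (branch p (V (t - s)%R y))%:E) x)%E.
Proof. by rewrite mule_ge0//; exact: root_mean_ge0. Qed.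

Lemma renewal_ge0 V t x : (0 <= renewal V t x)%E.
Proof. by apply: integral_ge0 => s _. Qed.

Lemma integral_exponential_rate c t : 0 <= c -> 0 <= t ->
  (\int[mu]_(s in `[0%R, t]) (c * expR (- c * s))%:E = (1 - expR (- c * t))%:E)%E.
Proof.
move=> c0; rewrite le_eqVlt => /predU1P[<-|t0].
  by rewrite set_itv1 integral_set1 mulr0 expR0 subrr.
pose f s := c * expR (- c * s); pose H s := - expR (- c * s).
have dH s : is_derive s 1 H (f s).
  have dg : is_derive s 1 (fun s => - c * s) (- c).
    by apply: (is_derive_eq (is_deriveZ (- c) (is_derive_id s 1))); rewrite /GRing.scale/= mulr1.
  have := @is_derive1_comp _ expR _ s _ _ (is_derive_expR (- c * s)) dg.
  move=> /is_deriveN; rewrite (_ : - (expR \o _) = H)//.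
  by move=> dH; apply: (is_derive_eq dH); rewrite /f; ring.
have cH s : {for s, continuous H}.
  by apply: differentiable_continuous; apply/derivable1_diffP; case: (dH s).
have cf : continuous f.
  move=> s; apply: (@continuousM _ _ (cst c) (fun s => expR (- c * s))); first exact: cvg_cst.
  apply: (@continuous_comp _ _ _ (fun s => - c * s) expR); last exact: continuous_expR.
  by apply: (@continuousM _ _ (cst (- c)) id) => //; exact: cvg_cst.
rewrite (@continuous_FTC2 _ f H)//.
- by rewrite -EFinB /H mulr0 expR0 opprK addrC.
- exact: continuous_subspaceT.
- split=> [s _||]; first by case: (dH s).
  + by apply: cvg_at_right_filter; exact: cH.
  + by apply: cvg_at_left_filter; exact: cH.
- by move=> s _; rewrite derive1E; apply: derive_val.
Qed.

(** The source of the contraction: [branch] has slope at most m, and the exponential density has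
    mass at most 1 on [0, t]. *)
Lemma renewalD V U c t x : 0 <= t -> 0 <= c -> jmeas V -> jmeas U ->
    (forall s y, 0 <= s -> V s y <= U s y + c) ->
  (renewal V t x <= renewal U t x + (m * c)%:E)%E.
Proof.
move=> t0 c0 mV mU VU.
have mc0 : 0 <= m * c by rewrite mulr_ge0// ltW// mean_gt0.
apply: (@le_trans _ _ (\int[mu]_(s in `[0%R, t]) ((beta * expR (- beta * s))%:E *
    K s (fun y => (branch p (U (t - s)%R y))%:E) x +
    (m * c)%:E * (beta * expR (- beta * s))%:E))%E).
  apply: ge0_le_integral => //; first exact: measurable_renewal_integrand.
    by apply: emeasurable_funD; [exact: measurable_renewal_integrand|apply: emeasurable_funM => //; exact: measurable_funTS].
  move=> s; rewrite /= in_itv/= => /andP[s0 st].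
  rewrite [X in (_ + X)%E]muleC -muleDr//; last first.
    by rewrite ge0_adde_def// inE ?lee_fin//; exact: root_mean_ge0.
  rewrite lee_wpmul2l//.
  apply: (@le_trans _ _ (K s (fun y => (branch p (U (t - s)%R y))%:E + (m * c)%:E)%E x)).
    apply: le_root_mean => //; [exact: mF|by apply: emeasurable_funD => //; exact: mF|].
    move=> y; rewrite -EFinD lee_fin (le_trans (le_branch p_law (VU _ _ _)))//.
      by rewrite subr_ge0.
    by rewrite branchD// mean_fin_num.
  rewrite root_meanD//; last exact: mF.
  by rewrite leeD2l//; exact: root_mean_le_cst.
have B0 s : `[0, t]%classic s -> (0 <= (m * c)%:E * (beta * expR (- beta * s))%:E)%E.
  by move=> _; rewrite mule_ge0.
have mB : measurable_fun `[0, t] (fun s => (m * c)%:E * (beta * expR (- beta * s))%:E)%E.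
  by apply: emeasurable_funM => //; exact: measurable_funTS.
have mA := @measurable_renewal_integrand U t x mU.
rewrite ge0_integralD//.
rewrite leeD2l// ge0_integralZl//; last exact: measurable_funTS.
rewrite integral_exponential_rate ?(ltW beta_gt0)// -EFinM lee_fin ler_piMr// gerBl expR_ge0.
Qed.

(* V - U <= 1, and feeding V - U <= c into the renewal inequalities improves it to
   V - U <= m c. *)
Lemma renewal_comparison V U (h : R -> R -> \bar R) : jmeas V -> jmeas U ->
    (forall t x, 0 <= t -> V t x <= 1) -> (forall t x, 0 <= t -> 0 <= U t x) ->
    (forall t x, 0 <= t -> ((V t x)%:E <= h t x + renewal V t x)%E) ->
    (forall t x, 0 <= t -> (h t x + renewal U t x <= (U t x)%:E)%E) ->
  forall t x, 0 <= t -> V t x <= U t x.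
Proof.
move=> mV mU V1 U0 Vh hU.
have H n : forall t x, 0 <= t -> V t x <= U t x + m ^+ n.
  elim: n => [|n IH] t x t0.
    by rewrite expr0 (le_trans (V1 _ _ t0))// lerDr U0.
  rewrite -lee_fin EFinD (le_trans (Vh _ _ t0))//.
  rewrite (@le_trans _ _ (h t x + (renewal U t x + (m * m ^+ n)%:E))%E)//.
    by rewrite leeD2l// renewalD// exprn_ge0// ltW// mean_gt0.
  by rewrite addeA exprS leeD2r// hU.
move=> t x t0.
have m1 : `|m| < 1 by rewrite gtr0_norm ?mean_gt0 ?mean_lt1.
have cv : U t x + m ^+ n @[n --> \oo] --> U t x + 0.
  by apply: cvgD; [exact: cvg_cst|exact: cvg_expr].
rewrite -[leRHS]addr0; apply: (cvgr_to_ge cv); apply: nearW => n; exact: H.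
Qed.

Variables (f : R -> \bar R) (U : R -> R -> R).
Hypotheses (mf : measurable_fun setT f) (f0 : forall y, (0 <= f y)%E) (f1 : forall y, (f y <= 1%:E)%E).
Hypotheses (mU : jmeas U) (U01 : forall t y, 0 <= U t y <= 1).
Hypothesis eqU : forall t x, 0 <= t ->
  (U t x)%:E = ((expR (- beta * t))%:E * K t f x + renewal U t x)%E.

(** In the equation at time t + N, first branchings before t give the restarted integral. Those in
    ]t, t + N], together with the absence of any branching, are exp(- beta t) K_t applied to the
    equation at time N. *)
Lemma renewal_restart N t x : 0 <= N -> 0 <= t ->
  (U (t + N) x)%:E = ((expR (- beta * t))%:E * K t (fun y => (U N y)%:E) x +
    renewal (fun s y => U (s + N) y) t x)%E.
Proof.
move=> N0 t0.
(* The integrand of the renewal term at time N, extended by 0 outside ]0, N] and with a clamped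
   time, so that Tonelli applies over the whole line. *)
pose g (s y : R) := ((beta * expR (- beta * s) * \1_`]0%R, N]%classic s)%:E *
  K (Num.max 0 s)%R (fun v => (branch p (U (N - s)%R v))%:E) y)%E.
have c0 s : 0 <= beta * expR (- beta * s) * \1_`]0%R, N]%classic s.
  by rewrite mulr_ge0// -lee_fin density_ge0.
have g0 s y : (0 <= g s y)%E.
  by rewrite !mule_ge0 ?lee_fin//; exact: root_mean_ge0.
have mKF : measurable_fun setT (fun z : R * R =>
    K (Num.max 0 z.1) (fun v => (branch p (U (N - z.1)%R v))%:E) z.2).
  apply: (@measurable_root_mean _ _ _ _ _ _ rho b W _ (R * R)%type (fun z => Num.max 0 z.1) snd
    (fun z y => (branch p (U (N - z.1) y))%:E)) => //.
  - exact: mmax0.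
  - by move=> s; rewrite le_max lexx.
  apply/measurable_EFinP; apply: measurableT_comp; first exact: measurable_branch.
  apply: (measurableT_comp (f := fun z : R * R => U z.1 z.2)
    (g := fun z : (R * R) * R => (N - z.1.1, z.2))) => //.
  apply: measurable_fun_pair => //; apply: measurable_funB => //.
  exact: (measurableT_comp measurable_fst measurable_fst).
have mg : jmeas g.
  apply: emeasurable_funM => //.
  apply: (measurableT_comp (f := fun s => (beta * expR (- beta * s) * \1_`]0%R, N]%classic s)%:E)) => //.
  apply/measurable_EFinP; apply: measurable_funM; last exact: measurable_indic.
  exact/measurable_EFinP.
have renewalE y : renewal U N y = (\int[mu]_s g s y)%E.
  rewrite /renewal -integral_itv_obnd_cbnd; last first.
    apply: (@measurable_funS _ _ _ _ (`[0%R, N]%classic)) => //; last exact: measurable_renewal_integrand.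
    by apply: subset_itvr; rewrite bnd_simp.
  rewrite integral_mkcond; apply: eq_integral => s _.
  rewrite epatch_indic /g; case: (boolP (s \in `]0, N]%classic)) => sN.
    rewrite /= !indicE sN mulr1 mule1.
    by move: (sN); rewrite inE/= in_itv/= => /andP[s0 _]; rewrite max_r// ltW.
  by rewrite /= !indicE (negbTE sN) mulr0 mule0 mul0e.
have renewal_g : renewal U N = fun y => (\int[mu]_s g s y)%E by apply/funext.
have mR : measurable_fun setT (renewal U N).
  by rewrite renewal_g; exact: (@measurable_integral_lebesgue g mg g0).
have KR : K t (renewal U N) x = (\int[mu]_s K t (g s) x)%E.
  by rewrite renewal_g; exact: root_mean_integral.
have KN0 y : (0 <= K N f y)%E by exact: root_mean_ge0.
have mKN : measurable_fun setT (K N f) by exact: measurable_root_mean_pos.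
have eN0 : 0 <= expR (- beta * N) by exact: expR_ge0.
have et0 : (0 <= (expR (- beta * t))%:E)%E by rewrite lee_fin expR_ge0.
have A0 y : (0 <= (expR (- beta * N))%:E * K N f y)%E by exact: mule_ge0.
have mA : measurable_fun setT (fun y => (expR (- beta * N))%:E * K N f y)%E.
  by apply: emeasurable_funM => //; exact: measurable_cst.
have SG : K t (K N f) x = K (t + N) f x.
  exact: (@root_mean_semigroup _ _ _ _ _ _ rho b W t N f 1 x t0 N0 mf f0 f1).
have KU : K t (fun y => (U N y)%:E) x =
    ((expR (- beta * N))%:E * K (t + N) f x + \int[mu]_s K t (g s) x)%E.
  have -> : (fun y => (U N y)%:E) = fun y => ((expR (- beta * N))%:E * K N f y + renewal U N y)%E.
    by apply/funext => y; rewrite -eqU.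
  rewrite (@root_meanD _ _ _ _ _ _ rho b W t _ _ x mA mR A0 (renewal_ge0 U N)).
  by rewrite (@root_meanZ _ _ _ _ _ _ rho b W t _ _ x eN0 mKN KN0) SG KR.
have Kg0 s : (0 <= K t (g s) x)%E by exact: root_mean_ge0.
have mKg : measurable_fun setT (fun s => K t (g s) x).
  exact: (@measurable_root_mean _ _ _ _ _ _ rho b W _ R (fun=> t) (fun=> x) g).
rewrite eqU; last exact: addr_ge0.
have a0 : (0 <= (expR (- beta * N))%:E * K (t + N) f x)%E.
  by apply: mule_ge0; [rewrite lee_fin|exact: root_mean_ge0].
have b0 : (0 <= \int[mu]_s K t (g s) x)%E by apply: integral_ge0 => s _; exact: Kg0.
rewrite KU (ge0_muleDr _ a0 b0).
rewrite muleA -EFinM -expRD -mulrDr -addeA; congr (_ + _)%E.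
pose h s := ((beta * expR (- beta * s))%:E *
    K s (fun y => (branch p (U (t + N - s)%R y))%:E) x)%E.
have R1 : renewal U (t + N) x = (\int[mu]_(s in `]t, (t + N)%R]) h s + \int[mu]_(s in `[0%R, t]) h s)%E.
  apply: (@ge0_integral_itv_split R h 0 t (t + N) t0 _ (@measurable_renewal_integrand U (t + N) x mU)).
    by rewrite lerDl.
  by move=> s; exact: renewal_term_ge0.
have R2 : (\int[mu]_(s in `[0%R, t]) h s)%E = renewal (fun s y => U (s + N) y) t x.
  apply: eq_integral => s _; rewrite /h.
  have -> // : (fun y => (branch p (U (t + N - s) y))%:E) = fun y => (branch p (U (t - s + N) y))%:E.
  by apply/funext => y; congr (branch p (U _ y))%:E; ring.
suff R3 : (\int[mu]_(s in `]t, (t + N)%R]) h s = (expR (- beta * t))%:E * \int[mu]_s K t (g s) x)%E.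
  rewrite R1 R2.
  exact: (congr1 (fun z => z + renewal (fun s y => U (s + N) y) t x)%E R3).
rewrite -ge0_integralZl; last 4 first.
- by [].
- exact: mKg.
- by move=> s _; exact: Kg0.
- exact: et0.
(* The translation matches a branching at s in ]t, t + N] with one at s - t in ]0, N]. *)
rewrite -[RHS](@ge0_integral_shift _ (- t)); last 2 first.
- by apply: emeasurable_funM; [exact: measurable_cst|exact: mKg].
- by move=> s; apply: mule_ge0; [exact: et0|exact: Kg0].
rewrite integral_mkcond; apply: eq_integral => s _; rewrite epatch_indic /g /h.
have KFm : measurable_fun setT (K (Num.max 0 (s - t)) (fun v => (branch p (U (N - (s - t)) v))%:E)).
  have m00 : 0 <= Num.max 0 (s - t) by rewrite le_max lexx.
  exact: (@measurable_root_mean_pos _ _ _ _ _ _ rho b W _ _ m00 (@mF U mU (N - (s - t))) (fun y => F0 _)).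
rewrite (@root_meanZ _ _ _ _ _ _ rho b W t _ _ x (c0 (s - t)) KFm); last first.
  by move=> y; exact: root_mean_ge0.
rewrite /= indicE (_ : (s \in _) = (s - t \in `]0, N]%classic)); last first.
  by apply/idP/idP; rewrite !inE/= !in_itv/= subr_gt0 lerBlDr [N + t]addrC.
rewrite indicE; case: (boolP (s - t \in `]0, N]%classic)) => sN; last by rewrite mulr0 mul0e !mule0.
move: sN; rewrite inE/= in_itv/= => /andP[st _].
have st0 : 0 <= s - t by exact: ltW.
rewrite mule1 mulr1 max_r; last exact: st0.
rewrite (@root_mean_semigroup _ _ _ _ _ _ rho b W t (s - t) _ 1 x t0 st0 (mF mU _)); last 2 first.
- by move=> y; exact: F0.
- by move=> y; exact: F1.
rewrite [(t + (s - t))%R]addrC subrK muleA -EFinM.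
have -> : beta * expR (- beta * s) = expR (- beta * t) * (beta * expR (- beta * (s - t))).
  by rewrite mulrCA -expRD; congr (_ * expR _); ring.
have -> : (fun y => (branch p (U (t + N - s) y))%:E) =
    fun y => (branch p (U (N - (s - t)) y))%:E.
  by apply/funext => y; congr (branch p (U _ y))%:E; ring.
by [].
Qed.
Transparent root_mean.

End renewal_equation.

(** * Comparison of reaching probabilities with means *)

Section mean_bounds.
Context d (T : measurableType d) (R : realType) (P : probability T R).
Context (beta : R) (p : nat -> R) (W : branching_data P beta p).
Implicit Types (s t x y c N : R).
Hypotheses (beta_gt0 : 0 < beta) (p_law : offspring_law p).
Hypotheses (m_gt0 : (0 < mean_offspring p)%E) (m_lt1 : (mean_offspring p < 1)%E).

Local Notation mu := (@lebesgue_measure R).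
Let m := fine (mean_offspring p).
Let m0 : 0 < m := mean_gt0 m_gt0 m_lt1.
Let m1 : m < 1 := mean_lt1 m_gt0 m_lt1.

Let rate_ge0 s : (0 <= (beta * expR (- beta * s))%:E)%E.
Proof. by rewrite lee_fin mulr_ge0 ?expR_ge0// ltW. Qed.

(** Says that a exp(- beta (1 - c) t) solves the renewal equation with the linear branching v |-> c
    v. The slope c is m in the upper bound and a frozen value of [branch p v / v] in the lower bound
    for q. *)
Lemma integral_rate_convolution c a t : 0 <= c -> 0 <= a -> 0 <= t ->
  (\int[mu]_(s in `[0%R, t])
     (beta * expR (- beta * s) * (c * (a * expR (- (beta * (1 - c)) * (t - s)))))%:E =
   (a * (expR (- (beta * (1 - c)) * t) - expR (- beta * t)))%:E)%E.
Proof.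
move=> c0 a0 t0.
pose k := a * expR (- (beta * (1 - c)) * t).
transitivity (\int[mu]_(s in `[0%R, t]) (k%:E * (beta * c * expR (- (beta * c) * s))%:E))%E.
  apply: eq_integral => s _; rewrite -EFinM /k; congr EFin.
  have -> : expR (- (beta * (1 - c)) * (t - s)) = expR (- (beta * (1 - c)) * t) * expR (- (beta * c) * s) * expR (beta * s).
    by rewrite -!expRD; congr expR; ring.
  have E1 : expR (- beta * s) * expR (beta * s) = 1 by rewrite -expRD mulNr addNr expR0.
  transitivity (expR (- beta * s) * expR (beta * s) * (a * expR (- (beta * (1 - c)) * t) *
    (beta * c * expR (- (beta * c) * s)))); first by ring.
  by rewrite E1 mul1r.
have bc0 : 0 <= beta * c by rewrite mulr_ge0// ltW.
rewrite ge0_integralZl_EFin//; last 3 first.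
- by move=> s _; rewrite lee_fin mulr_ge0// expR_ge0.
- apply/measurable_EFinP; apply: measurable_funTS; apply: measurable_funM => //.
  by apply: measurableT_comp => //; exact: measurable_funM.
- by rewrite mulr_ge0// expR_ge0.
rewrite integral_exponential_rate// -EFinM /k; congr EFin.
rewrite -mulrA; congr (a * _); rewrite mulrBr mulr1 -expRD; congr (_ - expR _); ring.
Qed.

Section renewal_bounds.
Variables (rho : R) (b : bool) (V : R -> R -> R) (g : R -> R) (t x : R).
Hypotheses (mV : measurable_fun setT (fun z : R * R => V z.1 z.2)).
Hypotheses (mg : measurable_fun setT g) (g0 : forall s, 0 <= s <= t -> 0 <= g s).

Let mrhs : measurable_fun `[0, t] (fun s => (beta * expR (- beta * s) * g s)%:E).
Proof.
apply/measurable_EFinP; apply: measurable_funTS; apply: measurable_funM => //.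
by apply: measurable_funM => //; apply: measurableT_comp => //; exact: measurable_funM.
Qed.

Lemma renewal_le_integral : (forall s, 0 <= s <= t ->
    (root_mean rho b W s (fun y => (branch p (V (t - s) y))%:E) x <= (g s)%:E)%E) ->
  (renewal W rho b V t x <=
   \int[mu]_(s in `[0%R, t]) (beta * expR (- beta * s) * g s)%:E)%E.
Proof.
move=> H; apply: ge0_le_integral => //.
- by move=> s _; apply: mule_ge0 => //; apply: root_mean_ge0 => y; rewrite lee_fin branch_ge0.
- exact: measurable_renewal_integrand.
- move=> s; rewrite /= in_itv/= => st; rewrite [X in (_ <= X)%E]EFinM.
  by apply: lee_wpmul2l; [exact: rate_ge0|exact: H].
Qed.

Lemma renewal_ge_integral : (forall s, 0 <= s <= t ->
    ((g s)%:E <= root_mean rho b W s (fun y => (branch p (V (t - s) y))%:E) x)%E) ->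
  (\int[mu]_(s in `[0%R, t]) (beta * expR (- beta * s) * g s)%:E <=
   renewal W rho b V t x)%E.
Proof.
move=> H; apply: ge0_le_integral => //.
- by move=> s; rewrite /= in_itv/= => st; rewrite EFinM mule_ge0// lee_fin; exact: g0.
- exact: measurable_renewal_integrand.
- move=> s; rewrite /= in_itv/= => st; rewrite [X in (X <= _)%E]EFinM.
  by apply: lee_wpmul2l; [exact: rate_ge0|exact: H].
Qed.

End renewal_bounds.

Section restart_bounds.
Variables (rho : R) (b : bool) (A : set R).
Hypothesis mA : measurable A.

Local Notation K := (root_mean rho b W).
Let u := reach rho b A setT W.

Let mu_ : measurable_fun setT (fun z : R * R => u z.1 z.2) := @measurable_reach _ _ _ _ _ p rho b A mA setT W.
Lemma measurable_reach_shift N : measurable_fun setT (fun z : R * R => u (z.1 + N) z.2).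
Proof.
apply: (measurableT_comp (f := fun z : R * R => u z.1 z.2) (g := fun z : R * R => (z.1 + N, z.2))) => //.
by apply: measurable_fun_pair => //; exact: measurable_funD.
Qed.

Let muN N : measurable_fun setT (fun y => (u N y)%:E).
Proof. by apply/measurable_EFinP; exact: measurable_reachr. Qed.

Let uN0 N y : (0 <= (u N y)%:E)%E. Proof. by rewrite lee_fin reach_ge0. Qed.

Let uN1 N y : ((u N y)%:E <= 1%:E)%E. Proof. by rewrite lee_fin reach_le1. Qed.

Definition mean_reach N t x : R := fine (root_mean rho b W t (fun y => (reach rho b A setT W N y)%:E) x).

Let v := mean_reach.

Lemma mean_reachE N t x : (mean_reach N t x)%:E = K t (fun y => (u N y)%:E) x.
Proof. by rewrite fineK//; exact: (@root_mean_fin_num _ _ _ P _ _ rho b W t _ 1 x (muN N) (uN0 N) (uN1 N)). Qed.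

Lemma mean_reach_ge0 N t x : 0 <= mean_reach N t x.
Proof. by rewrite -lee_fin mean_reachE; exact: root_mean_ge0. Qed.

Lemma mean_reach_le c N t x : (forall y, u N y <= c) -> mean_reach N t x <= c.
Proof.
move=> uc; rewrite -lee_fin mean_reachE; apply: root_mean_le_cst => //.
Qed.

Lemma measurable_mean_reach N : measurable_fun setT (fun z : R * R => v N (Num.max 0 z.1) z.2).
Proof.
apply: measurableT_comp => //.
apply: (@measurable_root_mean _ _ _ _ _ _ rho b W _ (R * R)%type (fun z => Num.max 0 z.1) snd
    (fun z y => (u N y)%:E)) => //.
- exact: measurable_maxr.
- by move=> z; rewrite le_max lexx.
- exact: (measurableT_comp (muN N)).
Qed.

Lemma mean_reach_semigroup N s t x : 0 <= s <= t ->
  K s (fun y => (mean_reach N (t - s) y)%:E) x = (mean_reach N t x)%:E.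
Proof.
move=> /andP[s0 st]; have ts0 : 0 <= t - s by rewrite subr_ge0.
rewrite mean_reachE (_ : (fun y => _) = K (t - s) (fun y => (u N y)%:E)); last first.
  by apply/funext => y; rewrite mean_reachE.
rewrite (@root_mean_semigroup _ _ _ _ _ _ rho b W s (t - s) _ 1 x s0 ts0 (muN N) (uN0 N) (uN1 N)).
by rewrite addrC subrK.
Qed.

Lemma measurable_mean_reachr N t : 0 <= t -> measurable_fun setT (fun y => (v N t y)%:E).
Proof.
move=> t0; rewrite (_ : (fun y => _) = K t (fun y => (u N y)%:E)).
  exact: (@measurable_root_mean_pos _ _ _ _ _ _ rho b W _ _ t0 (muN N) (uN0 N)).
by apply/funext => y; rewrite mean_reachE.
Qed.

Lemma reach_equation_K t x : 0 <= t -> (u t x)%:E =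
  ((expR (- beta * t))%:E * K t (fun y => (\1_A y)%:E) x + renewal W rho b u t x)%E.
Proof. by move=> t0; exact: reach_equation. Qed.

Lemma reach_restart N t x : 0 <= N -> 0 <= t -> (u (t + N) x)%:E =
  ((expR (- beta * t) * mean_reach N t x)%:E + renewal W rho b (fun s y => u (s + N) y) t x)%E.
Proof.
move=> N0 t0; rewrite EFinM mean_reachE.
apply: (@renewal_restart _ _ _ P _ _ W rho b beta_gt0 p_law (fun y => (\1_A y)%:E) u) => //.
- by apply/measurable_EFinP; exact: measurable_indic.
- by move=> y; rewrite lee_fin indicE; case: (_ \in _).
- exact: reach_equation_K.
Qed.

(** The right-hand side solves the restarted equation with [branch] replaced by its linear majorant
    v |-> m v, hence is a supersolution. *)
Lemma reach_le_mean N t x : 0 <= N -> 0 <= t ->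
  u (t + N) x <= expR (- alpha beta p * t) * mean_reach N t x.
Proof.
move=> N0 t0.
pose V t x := expR (- alpha beta p * t) * v N (Num.max 0 t) x.
have mV : measurable_fun setT (fun z : R * R => V z.1 z.2).
  apply: measurable_funM; last exact: measurable_mean_reach.
  by apply: measurableT_comp => //; exact: measurable_funM.
have VE s y : 0 <= s -> V s y = expR (- alpha beta p * s) * v N s y.
  by move=> s0; rewrite /V max_r.
rewrite -[leRHS]VE//.
apply: (@renewal_comparison _ _ _ P _ _ W rho b beta_gt0 p_law m_gt0 m_lt1
  (fun s y => u (s + N) y) V (fun t x => (expR (- beta * t) * v N t x)%:E)) => //.
- exact: measurable_reach_shift.
- by move=> s y _; rewrite reach_le1.
- by move=> s y s0; rewrite VE// mulr_ge0 ?expR_ge0// mean_reach_ge0.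
- by move=> s y s0; rewrite reach_restart.
move=> {t x t0} t x t0.
have W0 := mean_reach_ge0 N t x.
apply: (@le_trans _ _ ((expR (- beta * t) * v N t x)%:E + (v N t x *
    (expR (- (beta * (1 - m)) * t) - expR (- beta * t)))%:E)%E); last first.
  by rewrite -EFinD lee_fin VE// /alpha -/m le_eqVlt; apply/orP; left; apply/eqP; ring.
rewrite leeD2l// -integral_rate_convolution//; last exact: ltW.
apply: renewal_le_integral => //.
  apply: measurable_funM => //; apply: measurable_funM => //; apply: measurableT_comp => //.
  by apply: measurable_funM => //; exact: measurable_funB.
move=> s st; have /andP[s0 st'] := st; have ts0 : 0 <= t - s by rewrite subr_ge0.
have k0 : 0 <= m * expR (- (beta * (1 - m)) * (t - s)) by rewrite mulr_ge0 ?expR_ge0// ltW.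
apply: (@le_trans _ _ (K s (fun y => (m * expR (- (beta * (1 - m)) * (t - s)))%:E * (v N (t - s) y)%:E)%E x)).
  apply: le_root_mean.
  - by apply/measurable_EFinP; apply: measurableT_comp; [exact: measurable_branch|exact: (measurableT_comp mV (measurable_pair1 (t - s)))].
  - by apply: emeasurable_funM; [exact: measurable_cst|exact: measurable_mean_reachr].
  - by move=> y; rewrite lee_fin branch_ge0.
  move=> y; rewrite -EFinM lee_fin.
  rewrite (le_trans (branch_le_mean p_law (mean_fin_num m_gt0 m_lt1) _))//.
    by rewrite VE// mulr_ge0 ?expR_ge0// mean_reach_ge0.
  by rewrite VE// -/m mulrA.
rewrite root_meanZ//; [|exact: measurable_mean_reachr|by move=> y; rewrite lee_fin mean_reach_ge0].
rewrite mean_reach_semigroup// -EFinM lee_fin le_eqVlt; apply/orP; left; apply/eqP; rewrite -/v; ring.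
Qed.

End restart_bounds.

(** Drift and start are set to 0 by convention; [reach_false] shows that the value is the same for
    all others. *)
Definition survival_prob t : R := reach 0 false setT setT W t 0.

Let q := survival_prob.

Lemma reach_false rho t x : reach rho false setT setT W t x = q t.
Proof.
congr (fine (P _)); apply/seteqP; split=> w [u _ [t0 [al _ _]]]; exists u => //; split=> //; split=> //.
Qed.

Lemma extinction_survival t : 0 <= t ->
  fine (P [set w | (t%:E < extinction_time W w)%E]) = q t.
Proof.
by move=> t0; congr (fine (P _)); apply/seteqP; split=> w /(extinction_gtP _ 0 0 _ t0).
Qed.

Lemma survival_ge0 t : 0 <= q t. Proof. exact: reach_ge0. Qed.

Lemma survival_le1 t : q t <= 1. Proof. exact: reach_le1. Qed.

Lemma reach_le_survival rho b A t x : measurable A -> reach rho b A setT W t x <= q t.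
Proof.
move=> mA; rewrite -lee_fin -(reach_false rho t x) !reachE//.
apply: le_measure.
- rewrite inE; exact: (sigma_data_measurable (@measurable_some_particle_section _ _ _ _ _ p rho b A mA setT W t x)).
- rewrite inE; exact: (sigma_data_measurable (@measurable_some_particle_section _ _ _ _ _ p rho false setT measurableT setT W t x)).
by move=> w [u _ [/= t0 [al _ _]]]; exists u => //; split.
Qed.

Let root_mean_const s c x : 0 <= c -> root_mean 0 false W s (fun=> c%:E) x = c%:E.
Proof. by move=> c0; rewrite root_meanE free_mean_cst. Qed.

Lemma survival_restart N t : 0 <= N -> 0 <= t -> (q (t + N))%:E =
  ((expR (- beta * t) * q N)%:E + \int[mu]_(s in `[0%R, t])
     (beta * expR (- beta * s) * branch p (q (t - s + N)))%:E)%E.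
Proof.
move=> N0 t0; have := @reach_restart 0 false setT measurableT N t 0 N0 t0.
rewrite reach_false /mean_reach (_ : (fun y => _) = fun=> (q N)%:E); last first.
  by apply/funext => y; rewrite reach_false.
rewrite root_mean_const ?survival_ge0//= => ->; congr (_ + _)%E.
apply: eq_integral => s _; rewrite [RHS]EFinM; congr (_ * _)%E.
rewrite (_ : (fun y => _) = fun=> (branch p (q (t - s + N)))%:E); last first.
  by apply/funext => y; rewrite reach_false.
by rewrite root_mean_const// branch_ge0.
Qed.

Lemma survival_exp_le N t : 0 <= N -> 0 <= t -> q (t + N) <= expR (- alpha beta p * t) * q N.
Proof.
move=> N0 t0; rewrite -(reach_false 0 _ 0).
rewrite (le_trans (@reach_le_mean 0 false setT measurableT N t 0 N0 t0))// ler_wpM2l ?expR_ge0//.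
by apply: (@mean_reach_le 0 false setT measurableT) => y; rewrite reach_false.
Qed.

Lemma survival0 : q 0 = 1.
Proof.
apply/EFin_inj; rewrite reachE// (_ : [set w | _] = setT) ?probability_setT//.
apply/seteqP; split=> // w _; exists [::] => //; split=> //; split=> //; split=> //.
by rewrite lexx /death/= add0r lifetime_gt0.
Qed.

Lemma survival_prob_gt0 t : 0 <= t -> 0 < q t.
Proof.
move=> t0; apply: (@lt_le_trans _ _ (expR (- beta * t))); first exact: expR_gt0.
rewrite -lee_fin -[t in q t]addr0 survival_restart// survival0 mulr1 leeDl//.
apply: integral_ge0 => s _; rewrite EFinM mule_ge0// lee_fin branch_ge0//.
Qed.

(** With v = K_t u(N, .), the factor v / q(N) lies in [0, 1] because reaching [A] at time N requires
    survival. Concavity lets this factor enter [branch], which turns the equation of q into the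
    subsolution inequality for the left-hand side. *)
Lemma mean_reach_le_reach rho b A N t x : measurable A -> 0 <= N -> 0 <= t ->
  q (t + N) / q N * mean_reach rho b A N t x <= reach rho b A setT W (t + N) x.
Proof.
move=> mA N0 t0; pose u := reach rho b A setT W; pose v := mean_reach rho b A N.
have qN := survival_prob_gt0 N0.
pose V t x := q (Num.max 0 t + N) / q N * v (Num.max 0 t) x.
have VE s y : 0 <= s -> V s y = q (s + N) / q N * v s y by move=> s0; rewrite /V max_r.
have mq : measurable_fun setT q.
  apply: (measurableT_comp (f := fun z : R * R => reach 0 false setT setT W z.1 z.2) (g := fun s => (s, 0))).
    exact: (@measurable_reach _ _ _ _ _ p 0 false setT measurableT setT W).
  exact: measurable_pair2.
have mmax0 : measurable_fun setT (fun s : R => Num.max 0 s) by exact: measurable_maxr.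
have mq' : measurable_fun setT (fun s => q (Num.max 0 s + N)).
  by apply: measurableT_comp => //; exact: measurable_funD.
have mV : measurable_fun setT (fun z : R * R => V z.1 z.2).
  apply: measurable_funM; last exact: measurable_mean_reach.
  apply: measurable_funM => //; exact: (measurableT_comp mq' measurable_fst).
have v1 s y : v s y <= q N by apply: (@mean_reach_le rho b A mA) => z; exact: reach_le_survival.
have v0 s y : 0 <= v s y by exact: (@mean_reach_ge0 rho b A mA).
have th s y : 0 <= v s y / q N <= 1.
  by rewrite divr_ge0 ?(ltW qN)//= ler_pdivrMr// mul1r.
rewrite -[leLHS]VE//.
apply: (@renewal_comparison _ _ _ P _ _ W rho b beta_gt0 p_law m_gt0 m_lt1
  V (fun s y => u (s + N) y) (fun t x => (expR (- beta * t) * v t x)%:E)) => //.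
- exact: measurable_reach_shift.
- move=> s y s0; rewrite VE// mulrAC -mulrA mulr_ile1 ?survival_ge0 ?survival_le1//.
  + by have /andP[] := th s y.
  + by have /andP[] := th s y.
- by move=> s y s0; exact: reach_ge0.
- move=> {t x t0} t x t0; rewrite VE//.
  (* The factor q(t + N) is expanded by its own restarted equation, and the two terms are then
     treated separately. *)
  have -> : (q (t + N) / q N * v t x)%:E = ((v t x / q N)%:E * (q (t + N))%:E)%E.
    by rewrite -EFinM; congr EFin; ring.
  have I0 : (0 <= \int[mu]_(s in `[0%R, t]) (beta * expR (- beta * s) * branch p (q (t - s + N)))%:E)%E.
    by apply: integral_ge0 => s _; rewrite EFinM mule_ge0// lee_fin branch_ge0.
  have mqs : measurable_fun setT (fun s => branch p (q (t - s + N))).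
    apply: measurableT_comp; first exact: measurable_branch.
    by apply: measurableT_comp => //; apply: measurable_funD => //; exact: measurable_funB.
  rewrite survival_restart// ge0_muleDr//; last by rewrite lee_fin mulr_ge0 ?expR_ge0// ltW.
  apply: leeD.
    rewrite -EFinM lee_fin le_eqVlt; apply/orP; left; apply/eqP.
    by rewrite mulrCA divfK ?gt_eqF.
  rewrite -ge0_integralZl_EFin//; last 3 first.
  + by move=> s _; rewrite EFinM mule_ge0// lee_fin branch_ge0.
  + apply/measurable_EFinP; apply: measurable_funTS; apply: measurable_funM => //.
    by apply: measurable_funM => //; apply: measurableT_comp => //; exact: measurable_funM.
  + by have /andP[] := th t x.
  have -> : (\int[mu]_(s in `[0%R, t]) ((v t x / q N)%:E *
      (beta * expR (- beta * s) * branch p (q (t - s + N)))%:E) =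
      \int[mu]_(s in `[0%R, t]) (beta * expR (- beta * s) *
      (branch p (q (t - s + N)) * (v t x / q N)))%:E)%E.
    by apply: eq_integral => s _; rewrite -EFinM; congr EFin; ring.
  apply: renewal_ge_integral => //.
  + exact: measurable_funM.
  + by move=> s _; rewrite mulr_ge0 ?branch_ge0//; have /andP[] := th t x.
  move=> s st; have /andP[s0 st'] := st; have ts0 : 0 <= t - s by rewrite subr_ge0.
  have -> : (branch p (q (t - s + N)) * (v t x / q N))%:E =
      root_mean rho b W s (fun y => (branch p (q (t - s + N)) / q N)%:E * (v (t - s) y)%:E)%E x.
    rewrite root_meanZ ?divr_ge0 ?branch_ge0 ?(ltW qN)//.
    + rewrite (@mean_reach_semigroup rho b A mA N s t x st) -EFinM; congr EFin; rewrite /v; ring.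
    + exact: measurable_mean_reachr.
    + by move=> y; rewrite lee_fin.
  apply: le_root_mean.
  + by apply: emeasurable_funM; [exact: measurable_cst|exact: measurable_mean_reachr].
  + by apply/measurable_EFinP; apply: measurableT_comp; [exact: measurable_branch|exact: (measurableT_comp mV (measurable_pair1 (t - s)))].
  + by move=> y; rewrite mule_ge0// lee_fin ?divr_ge0 ?branch_ge0 ?(ltW qN).
  move=> y; rewrite -EFinM lee_fin VE//.
  rewrite [leLHS](_ : _ = v (t - s) y / q N * branch p (q (t - s + N))); last by ring.
  rewrite [in leRHS](_ : _ * v (t - s) y = v (t - s) y / q N * q (t - s + N)); last by ring.
  by apply: branch_concave => //; rewrite survival_ge0 survival_le1.
- by move=> s y s0; rewrite reach_restart.
Qed.

End mean_bounds.

Lemma nonincreasing_cvg_pinfty (R : realType) (f : R -> R) (c : R) :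
    (forall s t, 0 <= s -> s <= t -> f t <= f s) -> (forall t, 0 <= t -> c <= f t) ->
  exists l, [/\ c <= l, forall t, 0 <= t -> l <= f t & f t @[t --> +oo] --> l].
Proof.
move=> fd fc; pose E := [set f t | t in [set t | 0 <= t]].
have E0 : E !=set0 by exists (f 0); exists 0 => //=.
have Ec : lbound E c by move=> _ [t /= t0 <-]; exact: fc.
have lf t : 0 <= t -> inf E <= f t by move=> t0; apply: ge_inf; [exists c|exists t].
exists (inf E); split=> //; first exact: lb_le_inf.
apply/cvgrPdist_lt => e e0.
have [_ [s /= s0 <-] fs] := @inf_adherent _ E e e0 (conj E0 (ex_intro _ c Ec)).
near=> t; have st : s <= t by near: t; apply: nbhs_pinfty_ge; exact: num_real.
have t0 : 0 <= t by exact: le_trans st.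
rewrite distrC ger0_norm ?subr_ge0 ?lf// ltrBlDl (le_lt_trans (fd _ _ s0 st))//.
Unshelve. all: end_near.
Qed.

(** * Extinction rate *)

Section log_potential.
Context (R : realType) (p : nat -> R) (p_law : offspring_law p).
Hypotheses (m_fin : mean_offspring p \is a fin_num) (klogk : (klogk_moment p < +oo)%E).
Implicit Types (q v l : R) (k : nat).

Let p0 k : 0 <= p k. Proof. by case: p_law. Qed.

Let m := fine (mean_offspring p).

(* Along a geometric sequence of v, the defects m - branch p v / v are bounded by a
   multiple of the increments of this function, hence summable; the k log k moment
   makes it finite. *)
Definition log_potential v : R :=
  fine (\sum_(0 <= k <oo) (p k * (k%:R * ln (1 + k%:R * v)))%:E)%E.

Let term_ge0 v k : 0 <= v -> 0 <= p k * (k%:R * ln (1 + k%:R * v)).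
Proof. by move=> v0; rewrite mulr_ge0// mulr_ge0// ln_ge0// lerDl mulr_ge0. Qed.

Let ln2_le1 : ln 2 <= 1 :> R.
Proof. by have := @le_ln1Dx R 1; rewrite (_ : 1 + 1 = 2)//; apply; lra. Qed.

Lemma log_potentialE v : 0 <= v <= 1 -> (log_potential v)%:E =
  (\sum_(0 <= k <oo) (p k * (k%:R * ln (1 + k%:R * v)))%:E)%E.
Proof.
move=> /andP[v0 v1]; rewrite fineK// ge0_fin_numE; last first.
  by apply: nneseries_ge0 => k _ _; rewrite lee_fin term_ge0.
pose a k : \bar R := (k%:R * p k)%:E.
pose b k : \bar R := (k%:R * ln k%:R * p k)%:E.
have b0 k : (0 <= b k)%E.
  rewrite lee_fin; case: k => [|k]; first by rewrite !mul0r.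
  by rewrite mulr_ge0// mulr_ge0// ln_ge0// ler1n.
apply: (@le_lt_trans _ _ (\sum_(0 <= k <oo) (a k + b k))%E).
  apply: lee_nneseries => k _; first by rewrite lee_fin term_ge0.
  rewrite -EFinD lee_fin; case: k => [|k]; first by rewrite !mul0r mulr0 addr0.
  rewrite [leRHS](_ : _ = p k.+1 * (k.+1%:R * (1 + ln k.+1%:R))); last by ring.
  rewrite ler_wpM2l// ler_wpM2l//.
  have k0 : 0 < k.+1%:R :> R by rewrite ltr0n.
  rewrite (@le_trans _ _ (ln (2 * k.+1%:R)))//; last by rewrite lnM ?posrE// lerD2r.
  have kv : k.+1%:R * v <= k.+1%:R by rewrite ler_piMr// ltW.
  have k1 : 1 <= k.+1%:R :> R by rewrite ler1n.
  rewrite ler_ln ?posrE ?mulr_gt0//; first lra.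
  by rewrite ltr_wpDr// mulr_ge0// ltW.
rewrite nneseriesD//; last by move=> k _ _; rewrite lee_fin mulr_ge0.
apply: lte_add_pinfty.
  by rewrite -ge0_fin_numE//; apply: nneseries_ge0 => k _ _; rewrite lee_fin mulr_ge0.
rewrite nneseries_recl//= /b mul0r mul0r add0e.
exact: klogk.
Qed.

Lemma log_potential_ge0 v : 0 <= v -> 0 <= log_potential v.
Proof. by move=> v0; apply: fine_ge0; apply: nneseries_ge0 => k _ _; rewrite lee_fin term_ge0. Qed.

(** A second-order Bonferroni bound with a coarse constant. *)
Let power_lower q k : 0 <= q <= 1 -> (1 - q) ^+ k <= 1 - k%:R * q + k%:R ^+ 2 * q ^+ 2.
Proof.
move=> /andP[q0 q1]; elim: k => [|k IH]; first by rewrite !expr0 mul0r expr0n/=; lra.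
rewrite exprS (le_trans (ler_wpM2l _ IH)) ?subr_ge0// -natr1.
have k0 : 0 <= k%:R :> R by [].
rewrite -subr_ge0 (_ : _ - _ = k%:R * q ^+ 2 + q ^+ 2 + k%:R ^+ 2 * q ^+ 3); last by ring.
by rewrite !addr_ge0// ?mulr_ge0// ?exprn_ge0.
Qed.

(** From ln(1 + h) <= h at h = (l - 1) y / (1 + y). *)
Let ln_telescope y l : 0 <= y -> 0 <= l < 1 ->
  (1 - l) * (y / (1 + y)) <= ln (1 + y) - ln (1 + l * y).
Proof.
move=> y0 /andP[l0 l1]; have ly0 : 0 <= l * y by exact: mulr_ge0.
have y1 : 0 < 1 + y by rewrite ltr_wpDr.
have ly1 : 0 < 1 + l * y by rewrite ltr_wpDr.
set Y := y / (1 + y).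
have Y0 : 0 <= Y by rewrite divr_ge0// ltW.
have Y1 : Y < 1 by rewrite ltr_pdivrMr// mul1r ltrDr.
have YY : (1 - l) * Y <= Y by rewrite ler_piMl//; lra.
have E : (1 + l * y) / (1 + y) = 1 + (l - 1) * Y by rewrite /Y; field; rewrite gt_eqF.
have L : ln ((1 + l * y) / (1 + y)) <= (l - 1) * Y by rewrite E le_ln1Dx//; lra.
rewrite ln_div ?posrE// in L; lra.
Qed.

Let branch_gap_term q v l k : 0 <= q <= 1 -> q <= v -> 0 <= l < 1 ->
  k%:R * q - (1 - (1 - q) ^+ k) <=
  2 / (1 - l) * q * (k%:R * (ln (1 + k%:R * v) - ln (1 + k%:R * (l * v)))).
Proof.
move=> /andP[q0 q1] qv l01; have /andP[l0 l1] := l01; have v0 : 0 <= v by exact: le_trans qv.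
have kv0 : 0 <= k%:R * v by exact: mulr_ge0.
have kq0 : 0 <= k%:R * q by exact: mulr_ge0.
have H := ln_telescope kv0 l01.
have l1' : 0 < 1 - l by rewrite subr_gt0.
apply: (@le_trans _ _ (2 / (1 - l) * q * (k%:R * ((1 - l) * (k%:R * v / (1 + k%:R * v)))))); last first.
  apply: ler_wpM2l; first by apply: mulr_ge0 => //; apply: divr_ge0 => //; exact: ltW.
  by apply: ler_wpM2l => //; rewrite [k%:R * (l * v)]mulrCA.
rewrite (_ : 2 / (1 - l) * q * _ = k%:R * q * (2 * (k%:R * v / (1 + k%:R * v)))); last first.
  by field; rewrite !gt_eqF// ltr_wpDr.
have y1 : 0 < 1 + k%:R * v by rewrite ltr_wpDr.
(* For k v <= 1 the defect is at most (k q)^2 by the quadratic bound, and y <= 2 y / (1 + y) at y =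
   k v. Beyond, the trivial bound k q is enough, since 2 y / (1 + y) >= 1. *)
have [k1|k1] := leP (k%:R * v) 1.
  apply: (@le_trans _ _ (k%:R * q * (k%:R * q))).
    by have := @power_lower q k; rewrite q0 q1 => /(_ erefl); rewrite !expr2; lra.
  rewrite ler_wpM2l// (@le_trans _ _ (k%:R * v))// ?ler_wpM2l//.
  have := k1; have := kv0; move: (k%:R * v) => y y0 yle1.
  by rewrite mulrA ler_pdivlMr; nra.
apply: (@le_trans _ _ (k%:R * q)).
  by rewrite gerDl oppr_le0 subr_ge0 exprn_ile1//; lra.
by rewrite ler_peMr// mulrA ler_pdivlMr// mul1r; lra.
Qed.

(** [v] is only an upper bound of [q]: an explicit geometric sequence can thus replace the unknown
    survival probabilities in the telescoping sum. *)
Lemma branch_gap q v l : 0 < q -> q <= v -> v <= 1 -> 0 <= l < 1 ->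
  m - branch p q / q <= 2 / (1 - l) * (log_potential v - log_potential (l * v)).
Proof.
move=> q0 qv v1 l01; have /andP[l0 l1] := l01.
have v0 : 0 <= v by apply: le_trans qv; exact: ltW.
have q1 : q <= 1 by exact: le_trans v1.
have lv : 0 <= l * v <= 1 by rewrite mulr_ge0//= mulr_ile1// ltW.
pose c := 2 / (1 - l) * q.
have c0 : 0 <= c by rewrite /c mulr_ge0 ?divr_ge0 ?subr_ge0// ltW.
suff H : m * q + c * log_potential (l * v) <= branch p q + c * log_potential v.
  rewrite -(ler_pM2r q0) mulrBl divfK ?gt_eqF// -[leRHS]mulrAC -/c mulrBr; lra.
rewrite -lee_fin 2!EFinD !EFinM branchE// !log_potentialE ?v0 ?lv//.
have -> : (m%:E = \sum_(0 <= k <oo) (k%:R * p k)%:E)%E by rewrite fineK.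
have lv0 : 0 <= l * v by case/andP: lv.
rewrite muleC -!nneseriesZl; try (by move=> k _; rewrite lee_fin mulr_ge0);
  try by move=> k _; rewrite lee_fin term_ge0.
rewrite -!nneseriesD; last 4 first.
- move=> k _ _; rewrite lee_fin mulr_ge0// subr_ge0 exprn_ile1// ?subr_ge0 ?clip_le1// gerBl clip_ge0//.
- by move=> k _ _; rewrite -EFinM lee_fin mulr_ge0// term_ge0.
- by move=> k _ _; rewrite -EFinM lee_fin mulr_ge0// ?mulr_ge0// ltW.
- by move=> k _ _; rewrite -EFinM lee_fin mulr_ge0// term_ge0//; case/andP: lv.
apply: lee_nneseries => k *.
  rewrite -!EFinM -EFinD lee_fin; apply: addr_ge0; first by rewrite mulr_ge0 ?mulr_ge0 ?(ltW q0).
  by apply: mulr_ge0; [exact: c0|exact: term_ge0].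
rewrite -!EFinM -!EFinD lee_fin clip_id ?(ltW q0)//.
have := @branch_gap_term q v l k; rewrite (ltW q0) q1 => /(_ erefl qv l01).
rewrite -/c => H.
rewrite (_ : q * (k%:R * p k) = p k * (k%:R * q)); last by ring.
rewrite (_ : c * (p k * (k%:R * ln (1 + k%:R * (l * v)))) =
  p k * (c * (k%:R * ln (1 + k%:R * (l * v))))); last by ring.
rewrite (_ : c * (p k * (k%:R * ln (1 + k%:R * v))) =
  p k * (c * (k%:R * ln (1 + k%:R * v)))); last by ring.
rewrite -!mulrDr ler_wpM2l//; move: H; rewrite mulrBr mulrBr; lra.
Qed.

End log_potential.

Section extinction_rate.
Context d (T : measurableType d) (R : realType) (P : probability T R).
Context (beta : R) (p : nat -> R) (W : branching_data P beta p).
Hypotheses (beta_gt0 : 0 < beta) (p_law : offspring_law p).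
Hypotheses (m_gt0 : (0 < mean_offspring p)%E) (m_lt1 : (mean_offspring p < 1)%E).
Hypothesis klogk : (klogk_moment p < +oo)%E.
Implicit Types (t N x : R).

Let m := fine (mean_offspring p).
Let m0 : 0 < m := mean_gt0 m_gt0 m_lt1.
Let m1 : m < 1 := mean_lt1 m_gt0 m_lt1.
Let q := survival_prob W.
Let q0 t : 0 <= t -> 0 < q t. Proof. by move=> t0; apply: survival_prob_gt0. Qed.

Let survival_const N : 0 <= N ->
  (fun y => (reach 0 false setT setT W N y)%:E) = fun=> (q N)%:E.
Proof. by move=> _; apply/funext => y; rewrite reach_false. Qed.

(** For e in [0, 1], concavity bounds [branch p (e * q N)] below by e times [branch p (q N)], so the
    exponential whose slope is frozen at time N is a subsolution. *)
Lemma survival_step N t : 0 <= N -> 0 <= t ->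
  q N * expR (- (beta * (1 - branch p (q N) / q N)) * t) <= q (t + N).
Proof.
move=> N0 t0; have qN := q0 N0; pose g := branch p (q N) / q N.
have g0 : 0 <= g by rewrite divr_ge0 ?branch_ge0// ltW.
have gm : g <= m.
  by rewrite ler_pdivrMr// (branch_le_mean p_law (mean_fin_num m_gt0 m_lt1))// ltW.
have g1 : 0 <= beta * (1 - g) by rewrite mulr_ge0 ?subr_ge0 ?(ltW beta_gt0)// (le_trans gm)// ltW.
pose V t (x : R) := q N * expR (- (beta * (1 - g)) * t).
have e1 s : 0 <= s -> expR (- (beta * (1 - g)) * s) <= 1.
  by move=> s0; rewrite -[leRHS]expR0 ler_expR mulNr oppr_le0 mulr_ge0.
have mV : measurable_fun setT (fun z : R * R => V z.1 z.2).
  apply: measurable_funM => //; apply: measurableT_comp => //; exact: measurable_funM.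
rewrite /q -(reach_false W 0 (t + N) 0) -[leLHS]/(V t 0).
apply: (@renewal_comparison _ _ _ P _ _ W 0 false beta_gt0 p_law m_gt0 m_lt1
  V (fun s y => reach 0 false setT setT W (s + N) y) (fun t x => (expR (- beta * t) * q N)%:E)) => //.
- exact: measurable_reach_shift.
- by move=> s y s0; rewrite /V mulr_ile1 ?expR_ge0 ?survival_ge0 ?survival_le1 ?e1.
- by move=> s y s0; exact: reach_ge0.
- move=> {t t0} t x t0.
  apply: (@le_trans _ _ ((expR (- beta * t) * q N)%:E + (q N *
      (expR (- (beta * (1 - g)) * t) - expR (- beta * t)))%:E)%E).
    by rewrite -EFinD lee_fin /V le_eqVlt; apply/orP; left; apply/eqP; ring.
  rewrite leeD2l// -integral_rate_convolution ?survival_ge0//.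
  apply: renewal_ge_integral => //.
  + apply: measurable_funM => //; apply: measurable_funM => //; apply: measurableT_comp => //.
    by apply: measurable_funM => //; exact: measurable_funB.
  + by move=> s _; rewrite mulr_ge0// mulr_ge0 ?expR_ge0// survival_ge0.
  move=> s /andP[s0 st].
  have -> : (fun y : R => (branch p (V (t - s) y))%:E) = fun=> (branch p (V (t - s) 0))%:E by [].
  rewrite root_meanE free_mean_cst ?branch_ge0// lee_fin.
  rewrite /V [leRHS](_ : _ = branch p (expR (- (beta * (1 - g)) * (t - s)) * q N)); last by rewrite mulrC.
  rewrite (_ : g * _ = expR (- (beta * (1 - g)) * (t - s)) * branch p (q N)); last first.
    by rewrite mulrA /g divfK ?gt_eqF// mulrC.
  apply: branch_concave => //; first by rewrite expR_ge0 e1// subr_ge0.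
  by rewrite survival_ge0 survival_le1.
- move=> s y s0; rewrite reach_restart//.
  rewrite /mean_reach survival_const// root_meanE free_mean_cst ?survival_ge0//.
Qed.

Let a := alpha beta p.
Let a0 : 0 < a := alpha_gt0 beta_gt0 m_gt0 m_lt1.

Lemma scaled_survival_lower (n : nat) :
  expR (- (beta * (2 / (1 - expR (- a))) *
     (log_potential p 1 - log_potential p (expR (- a * n%:R))))) <= expR (a * n%:R) * q n%:R.
Proof.
have l01 : 0 <= expR (- a) < 1 by rewrite expR_ge0/= -[X in _ < X]expR0 ltr_expR oppr_lt0.
elim: n => [|n IH]; first by rewrite !mulr0 expR0 subrr mulr0 oppr0 expR0 mul1r /q survival0.
have n0 : 0 <= n%:R :> R by [].
have qn := q0 n0.
have S := survival_step n0 (@ler01 R); rewrite mulr1 in S.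
have v1 : expR (- a * n%:R) <= 1 by rewrite -expR0 ler_expR mulNr oppr_le0 mulr_ge0// ltW.
have qv : q n%:R <= expR (- a * n%:R).
  have := @survival_exp_le _ _ _ P beta p W beta_gt0 p_law m_gt0 m_lt1 _ _ (lexx 0) n0.
  by rewrite addr0 survival0 mulr1.
have G := branch_gap p_law (mean_fin_num m_gt0 m_lt1) klogk qn qv v1 l01.
rewrite -/m -expRD in G.
have E : - a + - a * n%:R = - a * (1 + n%:R) by ring.
rewrite E in G.
have -> : n.+1%:R = 1 + n%:R :> R by rewrite -natr1 addrC.
apply: le_trans (ler_wpM2l (expR_ge0 _) S).
set g := branch p (q n%:R) / q n%:R in G *.
set c := 2 / (1 - expR (- a)) in G IH *.
set H1 := log_potential p 1 in IH *.
set Hn := log_potential p (expR (- a * n%:R)) in G IH *.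
set Hn1 := log_potential p (expR (- a * (1 + n%:R))) in G *.
have En : expR (a * (1 + n%:R)) * (q n%:R * expR (- (beta * (1 - g)))) =
    expR (a * n%:R) * q n%:R * expR (- (beta * (m - g))).
  have -> : - (beta * (m - g)) = a + - (beta * (1 - g)) by rewrite /a /alpha -/m; ring.
  have -> : a * (1 + n%:R) = a * n%:R + a by ring.
  by rewrite !expRD; ring.
rewrite En (le_trans _ (ler_wpM2r (expR_ge0 _) IH))// -expRD ler_expR.
have := ler_wpM2l (ltW beta_gt0) G; lra.
Qed.

(** The product exp(a t) q(t) is nonincreasing and stays above a positive constant. That the limit
    is also a lower bound at finite times is recorded for the case of positive drift. *)
Lemma C_sub_cvg : 0 < C_sub W /\ expR (a * t) * q t @[t --> +oo] --> C_sub W /\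
  forall t, 0 <= t -> C_sub W <= expR (a * t) * q t.
Proof.
pose f t := expR (a * t) * q t.
have fd s t : 0 <= s -> s <= t -> f t <= f s.
  move=> s0 st; have ts0 : 0 <= t - s by rewrite subr_ge0.
  have := @survival_exp_le _ _ _ P beta p W beta_gt0 p_law m_gt0 m_lt1 _ _ s0 ts0; rewrite subrK -/q => H.
  rewrite /f (le_trans (ler_wpM2l (expR_ge0 _) H))// mulrA -expRD.
  by rewrite (_ : a * t + _ = a * s) ?lexx// -/a; ring.
pose c := expR (- (beta * (2 / (1 - expR (- a))) * log_potential p 1)).
have l1 : expR (- a) < 1 by rewrite -[X in _ < X]expR0 ltr_expR oppr_lt0.
have fc t : 0 <= t -> c <= f t.
  move=> t0; have [n tn] : exists n : nat, t <= n%:R.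
    by exists (Num.truncn t).+1; apply: ltW; rewrite truncnS_gt.
  (* Monotonicity carries the bound at a later integer back to [t]. *)
  apply: (le_trans _ (fd _ _ t0 tn)); apply: le_trans (scaled_survival_lower n).
  rewrite ler_expR lerN2 ler_wpM2l//; last by rewrite gerBl log_potential_ge0// expR_ge0.
  by rewrite mulr_ge0 ?(ltW beta_gt0)// divr_ge0// subr_ge0 ltW.
have [l [cl lf fl]] := nonincreasing_cvg_pinfty fd fc.
have -> : C_sub W = l; last by split=> //; apply: lt_le_trans cl; exact: expR_gt0.
apply/cvg_lim => //; apply: cvg_trans fl; apply: near_eq_cvg.
near=> t; rewrite /f extinction_survival//.
Unshelve. all: end_near.
Qed.

End extinction_rate.

(** * Asymptotics of the killed kernel *)

Section exponential_integrals.
Context (R : realType).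
Implicit Types (c y z : R).
Local Notation mu := (@lebesgue_measure R).

(** Combines exp(- w) <= 1 / (1 + w) with (1 - w + w^2) (1 + w) = 1 + w^3. *)
Lemma expR_sqr_ub (w : R) : 0 <= w -> expR (- w) <= 1 - w + w ^+ 2.
Proof.
move=> w0; have w1 : 0 < 1 + w by rewrite ltr_wpDr.
rewrite expRN (@le_trans _ _ (1 + w)^-1)//.
  by rewrite lef_pV2 ?posrE ?expR_gt0// expR_ge1Dx.
rewrite -[leLHS]mul1r ler_pdivrMr//.
have : 0 <= w ^+ 3 by rewrite exprn_ge0.
rewrite (_ : _ * (1 + w) = 1 + w ^+ 3); last by ring.
lra.
Qed.

Lemma le_expR_linear c y : 0 < c -> y <= c^-1 * expR (c * y).
Proof.
move=> c0; rewrite mulrC ler_pdivlMr// mulrC (le_trans _ (expR_ge1Dx _))//.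
by rewrite lerDr.
Qed.

Lemma cvg_expR_linear c : 0 < c -> expR (- c * y) @[y --> +oo] --> (0 : R).
Proof.
move=> c0; have cy : c * y @[y --> +oo] --> +oo.
  apply/cvgryPge => A; near=> y; by rewrite mulrC -ler_pdivrMr.
rewrite (_ : (fun y => _) = (fun z => expR (- z)) \o (fun y => c * y)).
  exact: (cvg_comp _ _ cy (@cvgr_expR R)).
by apply/funext => y /=; rewrite mulNr.
Unshelve. all: end_near.
Qed.

Lemma cvg_invr_pinfty : (y : R)^-1 @[y --> +oo] --> (0 : R).
Proof.
apply/cvgrPdist_le => e e0; near=> y.
have y0 : 0 < y by [].
rewrite sub0r normrN gtr0_norm ?invr_gt0// -[e]invrK lef_pV2 ?posrE ?invr_gt0//.
Unshelve. all: end_near.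
Qed.

Lemma cvg_linear_expR c : 0 < c -> y * expR (- c * y) @[y --> +oo] --> (0 : R).
Proof.
move=> c0; have c20 : 0 < c / 2 by rewrite divr_gt0.
apply: (@squeeze_cvgr _ _ _ _ (fun=> 0) (fun y => (c / 2)^-1 * expR (- (c / 2) * y))).
- near=> y; have y0 : 0 <= y by [].
  rewrite mulr_ge0 ?expR_ge0//= (@le_trans _ _ ((c / 2)^-1 * expR (c / 2 * y) * expR (- c * y)))//.
    by rewrite ler_wpM2r ?expR_ge0// le_expR_linear.
  rewrite -mulrA -expRD; apply: ler_wpM2l; first by rewrite invr_ge0 ltW.
  by rewrite ler_expR; lra.
- exact: cvg_cst.
- rewrite -[X in _ --> X](mulr0 (c / 2)^-1); apply: cvgMr; exact: cvg_expR_linear.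
Unshelve. all: end_near.
Qed.

Let continuous_exp_linear c : continuous (fun y => expR (- c * y)).
Proof.
move=> s; apply: (@continuous_comp _ _ _ (fun s => - c * s) expR); last exact: continuous_expR.
by apply: (@continuousM _ _ (cst (- c)) id) => //; exact: cvg_cst.
Qed.

Let derive_exp_linear c (s : R) : is_derive s 1 (fun y => expR (- c * y)) (- c * expR (- c * s)).
Proof.
have dg : is_derive s 1 (fun s => - c * s) (- c).
  by apply: (is_derive_eq (is_deriveZ (- c) (is_derive_id s 1))); rewrite /GRing.scale/= mulr1.
have := @is_derive1_comp _ expR _ s _ _ (is_derive_expR (- c * s)) dg.
by move=> dH; apply: (is_derive_eq dH); rewrite mulrC.
Qed.

Lemma integral_exp_linear c z : 0 < c ->
  (\int[mu]_(y in `[z, +oo[) (expR (- c * y))%:E = (expR (- c * z) / c)%:E)%E.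
Proof.
move=> c0; pose H y := - c^-1 * expR (- c * y).
have dH (s : R) : is_derive s 1 H (expR (- c * s)).
  by apply: (is_derive_eq (is_deriveZ (- c^-1) (derive_exp_linear c s)));
    rewrite /GRing.scale/=; field; rewrite gt_eqF.
have cH (s : R) : {for s, continuous H}.
  by apply: differentiable_continuous; apply/derivable1_diffP; case: (dH s).
rewrite (@ge0_continuous_FTC2y _ _ H z 0).
- by rewrite -EFinB /H sub0r mulNr opprK mulrC.
- by move=> y _; exact: expR_ge0.
- by apply: continuous_subspaceT; exact: continuous_exp_linear.
- by rewrite -[X in _ --> X](mulr0 (- c^-1)); apply: cvgMr; exact: cvg_expR_linear.
- by move=> y _; case: (dH y).
- by apply: cvg_at_right_filter; exact: cH.
- by move=> y _; rewrite derive1E; apply: derive_val.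
Qed.

Lemma integral_linear_exp c z : 0 < c -> 0 <= z ->
  (\int[mu]_(y in `[z, +oo[) (y * expR (- c * y))%:E =
   ((c * z + 1) * expR (- c * z) / c ^+ 2)%:E)%E.
Proof.
move=> c0 z0; pose H y := - (c ^+ 2)^-1 * ((c * y + 1) * expR (- c * y)).
have dH (s : R) : is_derive s 1 H (s * expR (- c * s)).
  have dl : is_derive s 1 (c \*: id + cst 1 : R -> R) c.
    have d1 : is_derive s 1 (c \*: id : R -> R) (c *: 1) by exact: (is_deriveZ c (is_derive_id s 1)).
    have d2 : is_derive s 1 (cst 1 : R -> R) 0 by exact: is_derive_cst.
    by apply: (is_derive_eq (is_deriveD d1 d2)); rewrite /GRing.scale/= mulr1 addr0.
  have -> : H = - (c ^+ 2)^-1 \*: ((c \*: id + cst 1) * (fun y => expR (- c * y))) by [].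
  apply: (is_derive_eq (is_deriveZ (- (c ^+ 2)^-1) (is_deriveM dl (derive_exp_linear c s)))).
  change (- (c ^+ 2)^-1 * ((c * s + 1) * (- c * expR (- c * s)) + expR (- c * s) * c) =
    s * expR (- c * s)).
  by field; rewrite gt_eqF.
have cH (s : R) : {for s, continuous H}.
  by apply: differentiable_continuous; apply/derivable1_diffP; case: (dH s).
rewrite (@ge0_continuous_FTC2y _ _ H z 0).
- by rewrite -EFinB /H sub0r mulNr opprK mulrC.
- by move=> y zy; rewrite mulr_ge0 ?expR_ge0// (le_trans z0).
- apply: continuous_subspaceT => s.
  by apply: (@continuousM _ _ id (fun y => expR (- c * y))) => //; exact: continuous_exp_linear.
- have -> : (0 : R) = - (c ^+ 2)^-1 * (c * 0 + 0) by rewrite mulr0 addr0 mulr0.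
  apply: cvgMr; rewrite (_ : (fun y => _) = fun y => c * (y * expR (- c * y)) + expR (- c * y)).
    by apply: cvgD; [apply: cvgMr; exact: cvg_linear_expR|exact: cvg_expR_linear].
  by apply/funext => y; ring.
- by move=> y _; case: (dH y).
- by apply: cvg_at_right_filter; exact: cH.
- by move=> y _; rewrite derive1E; apply: derive_val.
Qed.

End exponential_integrals.

Section killed_kernel.
Context d (T : measurableType d) (R : realType) (P : probability T R).
Context (B : R -> {RV P >-> R}) (bmB : brownian_motion B) (rho : R).
Implicit Types (x y t c : R) (f : R -> \bar R).
Local Notation mu := (@lebesgue_measure R).

(** The image term exp(2 rho x) heat(y + x + rho t) that reflection subtracts equals the main term
    times exp(- 2 x y / t). *)
Definition killed_density t x y : R := heat t (y - x + rho * t) * (1 - expR (- (2 * x * y / t))).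

Lemma killed_density_ge0 t x y : 0 < t -> 0 <= x -> 0 <= y -> 0 <= killed_density t x y.
Proof.
move=> t0 x0 y0; rewrite mulr_ge0 ?heat_ge0// subr_ge0 -[leRHS]expR0 ler_expR oppr_le0.
by rewrite divr_ge0 ?mulr_ge0// ltW.
Qed.

Lemma killed_mean_density t x f : 0 < t -> 0 < x -> measurable_fun setT f ->
    (forall y, 0 <= f y)%E -> (forall y, f y <= 1%:E)%E ->
  (killed_mean B rho t f x = \int[mu]_(y in `]0%R, +oo[) (f y * (killed_density t x y)%:E))%E.
Proof.
move=> t0 x0 mf f0 f1; have tn0 : t != 0 by rewrite gt_eqF.
pose g := f \_ `]0, +oo[.
have g0 y : (0 <= g y)%E by rewrite /g patchE; case: ifP.
have mg : measurable_fun setT g by apply/(measurable_restrictT _ _).1 => //; exact: measurable_funTS.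
have g1 y : (g y <= 1%:E)%E by rewrite /g patchE; case: ifP.
pose h1 y := heat t (y - x + rho * t).
pose h2 y := h1 y * expR (- (2 * x * y / t)).
have mh1 : measurable_fun setT h1.
  apply: measurableT_comp; first exact: measurable_heat.
  by apply: measurable_funD => //; exact: measurable_funB.
have mh2 : measurable_fun setT h2.
  apply: measurable_funM => //; apply: measurableT_comp => //; apply: measurableT_comp => //.
  by apply: measurable_funM => //; exact: measurable_funM.
have h10 y : 0 <= h1 y by exact: heat_ge0.
have h20 y : 0 <= h2 y by rewrite mulr_ge0 ?expR_ge0.
have shift z : free_mean B rho t g z = (\int[mu]_y (g y * (heat t (y - z + rho * t))%:E))%E.
  rewrite (@free_meanE _ _ _ _ B bmB rho t g z t0 mg g0).
  rewrite -(@ge0_integral_shift _ (z - rho * t) (fun y => g y * (heat t (y - z + rho * t))%:E)%E).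
  - apply: eq_integral => y _; rewrite [(z + y - _)%R](_ : _ = y + (z - rho * t)); last by ring.
    by congr (_ * (heat _ _)%:E)%E; ring.
  - apply: emeasurable_funM => //; apply/measurable_EFinP; apply: measurableT_comp; first exact: measurable_heat.
    by apply: measurable_funD => //; exact: measurable_funB.
  - by move=> y; rewrite mule_ge0// lee_fin heat_ge0.
have := killed_mean_reflection bmB rho t0 x0 mf f0.
rewrite -/g free_mean_reflection ?(ltW t0)// /reflection !shift.
have -> : ((expR (2 * rho * x))%:E * (\int[mu]_y (g y * (heat t (y - - x + rho * t))%:E)) =
    \int[mu]_y (g y * (h2 y)%:E))%E.
  have mG : measurable_fun setT (fun y => g y * (heat t (y - - x + rho * t))%:E)%E.
    apply: emeasurable_funM => //; apply/measurable_EFinP; apply: measurableT_comp; first exact: measurable_heat.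
    by apply: measurable_funD => //; exact: measurable_funB.
  have G0 y : setT y -> (0 <= g y * (heat t (y - - x + rho * t))%:E)%E.
    by move=> _; rewrite mule_ge0// lee_fin heat_ge0.
  have k0 : (0 <= (expR (2 * rho * x))%:E)%E by rewrite lee_fin expR_ge0.
  rewrite -ge0_integralZl//.
  apply: eq_integral => y _; rewrite muleCA -EFinM; congr (_ * _%:E)%E.
  have EE : expR (2 * rho * x) * expR (- (y - - x + rho * t) ^+ 2 / (2 * t)) =
      expR (- (y - x + rho * t) ^+ 2 / (2 * t)) * expR (- (2 * x * y / t)).
    by rewrite -!expRD; congr expR; field.
  by rewrite /h2 /h1 /heat mulrCA EE mulrA.
have E : (\int[mu]_y (g y * (heat t (y - x + rho * t))%:E) =
    \int[mu]_(y in `]0%R, +oo[) (f y * (killed_density t x y)%:E) + \int[mu]_y (g y * (h2 y)%:E))%E.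
  rewrite [X in (_ = X + _)%E]integral_mkcond -ge0_integralD//; last 4 first.
  - move=> y _; rewrite patchE; case: ifPn => // /set_mem; rewrite /= in_itv/= andbT => y0.
    by rewrite mule_ge0// lee_fin killed_density_ge0// ltW.
  - apply/(measurable_restrictT _ _).1 => //; apply: measurable_funTS; apply: emeasurable_funM => //.
    apply/measurable_EFinP; apply: measurable_funM => //; apply: measurable_funB => //.
    apply: measurableT_comp => //; apply: measurableT_comp => //.
    by apply: measurable_funM => //; exact: measurable_funM.
  - by move=> y _; rewrite mule_ge0// lee_fin.
  - by apply: emeasurable_funM => //; exact/measurable_EFinP.
  apply: eq_integral => y _; rewrite /g !patchE; case: ifPn => [|_]; last by rewrite !mul0e adde0.
  move=> /set_mem; rewrite /= in_itv/= andbT => y0.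
  rewrite -ge0_muleDr ?lee_fin ?killed_density_ge0 ?(ltW y0) ?(ltW x0)//.
  by rewrite -EFinD; congr (_ * _%:E)%E; rewrite /killed_density /h2 -/(h1 y); ring.
rewrite E => KX.
(* Finiteness of the image term allows it to be cancelled on both sides. *)
have Xfin : (\int[mu]_y (g y * (h2 y)%:E))%E \is a fin_num.
  rewrite ge0_fin_numE; last by apply: integral_ge0 => y _; rewrite mule_ge0// lee_fin.
  apply: (@le_lt_trans _ _ 1%:E); last exact: ltry.
  apply: (@le_trans _ _ (free_mean B rho t g x)); last exact: free_mean_le_cst.
  rewrite shift; apply: ge0_le_integral => //.
  - by move=> y _; rewrite mule_ge0// lee_fin.
  - by apply: emeasurable_funM => //; exact/measurable_EFinP.
  - by apply: emeasurable_funM => //; exact/measurable_EFinP.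
  move=> y _; rewrite /g patchE; case: ifPn => [|_]; last by rewrite !mul0e.
  move=> /set_mem; rewrite /= in_itv/= andbT => y0.
  rewrite lee_wpmul2l// lee_fin ler_piMr// -[leRHS]expR0 ler_expR oppr_le0.
  by rewrite divr_ge0 ?mulr_ge0// ltW.
by rewrite -(addeK (killed_mean B rho t f x) Xfin) KX addeK.
Qed.

Section positive_drift.
Hypothesis rho_gt0 : 0 < rho.
Variables (x : R) (f : R -> \bar R).
Hypotheses (x_gt0 : 0 < x) (mf : measurable_fun setT f).
Hypotheses (f0 : forall y, (0 <= f y)%E) (f1 : forall y, (f y <= 1%:E)%E).

(** Pairing with y exp(- rho y), the endpoint factor of the kernel asymptotics; at f(y) = P_y(M_N >
    z) it is the integral in [Cz_approx]. *)
Definition tilted_mean : \bar R := (\int[mu]_(y in `]0%R, +oo[) ((y * expR (- rho * y))%:E * f y))%E.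

Let c0 : R := Num.sqrt (2 / pi) * expR (rho * x).
Let rate t : R := t `^ (3 / 2) * expR (rho ^+ 2 / 2 * t).

(** The factors that still depend on t tend to x y, whence the limiting kernel. *)
Let rate_density t y : 0 < t -> rate t * killed_density t x y =
  c0 * (expR (- rho * y) * (expR (- ((y - x) ^+ 2 / (2 * t))) *
    (t / 2 * (1 - expR (- (2 * x * y / t)))))).
Proof.
move=> t0; have tn0 : t != 0 by rewrite gt_eqF.
have pi0 : 0 < pi :> R by exact: pi_gt0.
have -> : rate t = t * Num.sqrt t * expR (rho ^+ 2 / 2 * t).
  rewrite /rate (_ : 3 / 2 = 1 + 2^-1 :> R); last by lra.
  by rewrite powRD ?tn0 ?implybT// powRr1 ?powR12_sqrt// ltW.
have s2 : Num.sqrt (2 * pi * t) = Num.sqrt (2 * pi) * Num.sqrt t by rewrite sqrtrM// mulr_ge0// ltW.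
have s3 : Num.sqrt (2 / pi) = 2 / Num.sqrt (2 * pi) :> R.
  have n0 : Num.sqrt (2 * pi) != 0 :> R by rewrite gt_eqF// sqrtr_gt0 mulr_gt0.
  apply: (mulIf n0); rewrite divfK// -sqrtrM ?divr_ge0 ?(ltW pi0)//.
  have -> : 2 / pi * (2 * pi) = 2 ^+ 2 * (pi^-1 * pi) :> R by ring.
  rewrite mulVf ?mulr1; last exact: lt0r_neq0.
  by rewrite sqrtr_sqr ger0_norm.
rewrite /killed_density /heat /c0 s2 s3.
have n0 : Num.sqrt (2 * pi) != 0 :> R by rewrite gt_eqF// sqrtr_gt0 mulr_gt0.
have n1 : Num.sqrt t != 0 by rewrite gt_eqF// sqrtr_gt0.
have -> : expR (- (y - x + rho * t) ^+ 2 / (2 * t)) = expR (- (rho ^+ 2 / 2 * t)) *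
    (expR (rho * x) * (expR (- rho * y) * expR (- ((y - x) ^+ 2 / (2 * t))))).
  by rewrite -!expRD; congr expR; field.
have e1 : expR (rho ^+ 2 / 2 * t) * expR (- (rho ^+ 2 / 2 * t)) = 1 by rewrite -expRD subrr expR0.
set e2 := expR (rho * x); set e3 := expR (- rho * y); set e4 := expR (- ((y - x) ^+ 2 / _)).
set e5 := 1 - _.
transitivity (expR (rho ^+ 2 / 2 * t) * expR (- (rho ^+ 2 / 2 * t)) * (t / Num.sqrt (2 * pi) * (e2 * (e3 * e4)) * e5)).
  by field; rewrite n0.
by rewrite e1; field.
Qed.

(** Numerator of an error of order 1 / t. With w = 2 x y / t and s = (y - x)^2 / (2 t), the first
    term comes from 1 - exp(- w) >= w - w^2, with a factor 2 to spare, and the second from exp(- s)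
    >= 1 - s. *)
Let defect y : R := 4 * x ^+ 2 * y ^+ 2 + x * y * (y - x) ^+ 2 / 2.

Let scaled_bounds t y : 0 < t -> 0 <= y ->
  expR (- ((y - x) ^+ 2 / (2 * t))) * (t / 2 * (1 - expR (- (2 * x * y / t)))) <= x * y /\
  x * y <= expR (- ((y - x) ^+ 2 / (2 * t))) * (t / 2 * (1 - expR (- (2 * x * y / t)))) + defect y / t.
Proof.
move=> t0 y0; have tn0 : t != 0 by rewrite gt_eqF.
set w := 2 * x * y / t; set s := (y - x) ^+ 2 / (2 * t).
have w0 : 0 <= w by rewrite /w divr_ge0 ?mulr_ge0// ltW.
have s0 : 0 <= s by rewrite /s divr_ge0 ?sqr_ge0// mulr_ge0// ltW.
have t20 : 0 <= t / 2 by rewrite divr_ge0// ltW.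
have A0 : 0 <= t / 2 * (1 - expR (- w)).
  by rewrite mulr_ge0// subr_ge0 -[leRHS]expR0 ler_expR oppr_le0.
have tw : t / 2 * w = x * y by rewrite /w; field.
have A1 : t / 2 * (1 - expR (- w)) <= x * y.
  by rewrite -tw ler_wpM2l//; have := expR_ge1Dx (- w); lra.
have A2 : x * y - 2 * x ^+ 2 * y ^+ 2 / t <= t / 2 * (1 - expR (- w)).
  rewrite (_ : x * y - _ = t / 2 * (w - w ^+ 2)); last by rewrite /w; field.
  by rewrite ler_wpM2l//; have := expR_sqr_ub w0; lra.
have e1 : expR (- s) <= 1 by rewrite -[leRHS]expR0 ler_expR oppr_le0.
have es : 1 - s <= expR (- s) by exact: expR_ge1Dx.
split; first by rewrite (le_trans _ A1)// ler_piMl.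
have dE : defect y / t = 2 * (2 * x ^+ 2 * y ^+ 2 / t) + s * (x * y) by rewrite /defect /s; field.
have d0 : 0 <= 2 * x ^+ 2 * y ^+ 2 / t by rewrite divr_ge0 ?mulr_ge0 ?sqr_ge0// ltW.
set A := t / 2 * _ in A0 A1 A2 *.
have := ler_wpM2r A0 es; have := ler_wpM2l s0 A1; rewrite dE; lra.
Qed.

(** The defect has degree 3 in y. Each power is absorbed by y <= (6 / rho) exp(rho y / 6), whose
    cube costs exp(rho y / 2), half of the available decay. *)
Let bound : R := let a := 6 / rho in
  4 * x ^+ 2 * a ^+ 2 + x * (a ^+ 3 / 2 + x ^+ 2 * a / 2).

Let a0 : 0 < 6 / rho. Proof. by rewrite divr_gt0. Qed.

Let bound_ge0 : 0 <= bound.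
Proof.
have := ltW a0; rewrite /bound /=; set a := 6 / rho => a1.
apply: addr_ge0.
  by apply: mulr_ge0; [apply: mulr_ge0 => //; exact: sqr_ge0|exact: sqr_ge0].
apply: mulr_ge0; first exact: ltW.
apply: addr_ge0; first by rewrite divr_ge0 ?exprn_ge0.
by apply: divr_ge0 => //; apply: mulr_ge0 => //; exact: sqr_ge0.
Qed.

Let defect_bound y : 0 <= y -> expR (- rho * y) * defect y <= bound * expR (- (rho / 2) * y).
Proof.
move=> y0; pose E := expR (rho / 6 * y).
have E1 : 1 <= E by rewrite -[leLHS]expR0 ler_expR mulr_ge0// divr_ge0// ltW.
have yE : y <= 6 / rho * E.
  have r6 : 0 < rho / 6 by rewrite divr_gt0.
  by have := le_expR_linear y r6; rewrite invf_div.
have E3 : expR (- (rho / 2) * y) = expR (- rho * y) * E ^+ 3.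
  by rewrite /E -expRM_natl -expRD; congr expR; field.
rewrite E3 mulrCA ler_wpM2l ?expR_ge0// /bound /defect.
set a := 6 / rho in yE *; have a1 : 0 <= a by exact: ltW.
have x0 : 0 <= x by exact: ltW.
have E0 : 0 <= E by exact: expR_ge0.
have aE0 : 0 <= a * E by exact: mulr_ge0.
have EE : E <= E ^+ 3 by rewrite -[leLHS]expr1 ler_weXn2l.
have EE2 : E ^+ 2 <= E ^+ 3 by rewrite ler_weXn2l.
have y2 : y ^+ 2 <= a ^+ 2 * E ^+ 3.
  rewrite (@le_trans _ _ ((a * E) ^+ 2))// ?lerXn2r ?nnegrE// exprMn.
  by rewrite ler_wpM2l ?sqr_ge0.
have y3 : y ^+ 3 <= a ^+ 3 * E ^+ 3 by rewrite -exprMn lerXn2r ?nnegrE.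
have y1 : y <= a * E ^+ 3 by rewrite (le_trans yE)// ler_wpM2l.
have xy2 : 0 <= x ^+ 2 * y ^+ 2 by rewrite mulr_ge0 ?sqr_ge0.
have X1 : 4 * x ^+ 2 * y ^+ 2 <= 4 * x ^+ 2 * (a ^+ 2 * E ^+ 3).
  by rewrite ler_wpM2l// mulr_ge0 ?sqr_ge0.
have X2 : x * y ^+ 3 <= x * (a ^+ 3 * E ^+ 3) by rewrite ler_wpM2l.
have X3 : x ^+ 3 * y <= x ^+ 3 * (a * E ^+ 3) by rewrite ler_wpM2l ?exprn_ge0.
lra.
Qed.

Let mexp c : measurable_fun setT (fun y => expR (- c * y)).
Proof. by apply: measurableT_comp => //; exact: measurable_funM. Qed.

Let y_exp_ge0 y : `]0, +oo[%classic y -> (0 <= (y * expR (- rho * y))%:E)%E.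
Proof. by rewrite /= in_itv/= andbT => y0; rewrite lee_fin mulr_ge0 ?expR_ge0// ltW. Qed.

Let measurable_linear_exp : measurable_fun setT (fun y => (y * expR (- rho * y))%:E).
Proof. by apply/measurable_EFinP; apply: measurable_funM => //; exact: mexp. Qed.

Lemma tilted_mean_ge0 : (0 <= tilted_mean)%E.
Proof. by apply: integral_ge0 => y /y_exp_ge0 y0; rewrite mule_ge0. Qed.

Lemma tilted_mean_fin_num : tilted_mean \is a fin_num.
Proof.
rewrite ge0_fin_numE ?tilted_mean_ge0//.
apply: (@le_lt_trans _ _ (\int[mu]_(y in `[0%R, +oo[) (y * expR (- rho * y))%:E)%E); last first.
  by rewrite integral_linear_exp// ltry.
apply: (@le_trans _ _ (\int[mu]_(y in `]0%R, +oo[) (y * expR (- rho * y))%:E)%E).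
  apply: ge0_le_integral => //.
  - by move=> y /y_exp_ge0 y0; rewrite mule_ge0.
  - by apply: measurable_funTS; exact: emeasurable_funM.
  - exact: measurable_funTS.
  - by move=> y /y_exp_ge0 y0; rewrite -[leRHS]mule1 lee_wpmul2l.
apply: ge0_subset_integral => //.
- exact: measurable_funTS.
- by move=> y; rewrite /= in_itv/= andbT => y0; rewrite lee_fin mulr_ge0 ?expR_ge0.
- by apply: subset_itvr; rewrite bnd_simp.
Qed.

Let c0_ge0 : 0 <= c0. Proof. by rewrite mulr_ge0 ?expR_ge0. Qed.

Let rate_ge0 t : 0 <= rate t. Proof. by rewrite mulr_ge0 ?powR_ge0 ?expR_ge0. Qed.

Let mdensity t : measurable_fun setT (fun y => (rate t * killed_density t x y)%:E).
Proof.
apply/measurable_EFinP; apply: measurable_funM => //; apply: measurable_funM.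
  apply: measurableT_comp; first exact: measurable_heat.
  by apply: measurable_funD => //; exact: measurable_funB.
apply: measurable_funB => //; apply: measurableT_comp => //; apply: measurableT_comp => //.
by apply: measurable_funM => //; exact: measurable_funM.
Qed.

Let density_pos t y : 0 < t -> `]0, +oo[%classic y -> (0 <= (rate t * killed_density t x y)%:E)%E.
Proof.
rewrite /= in_itv/= andbT => t0 y0; rewrite lee_fin mulr_ge0//.
by rewrite killed_density_ge0// ltW.
Qed.

Let killedE t : 0 < t -> ((rate t)%:E * killed_mean B rho t f x =
  \int[mu]_(y in `]0%R, +oo[) (f y * (rate t * killed_density t x y)%:E))%E.
Proof.
move=> t0; rewrite killed_mean_density// -ge0_integralZl//.
- by apply: eq_integral => y _; rewrite muleCA EFinM.
- apply: measurable_funTS; apply: emeasurable_funM => //; apply/measurable_EFinP; apply: measurable_funM.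
    apply: measurableT_comp; first exact: measurable_heat.
    by apply: measurable_funD => //; exact: measurable_funB.
  apply: measurable_funB => //; apply: measurableT_comp => //; apply: measurableT_comp => //.
  by apply: measurable_funM => //; exact: measurable_funM.
- move=> y; rewrite /= in_itv/= andbT => y0.
  by rewrite mule_ge0// lee_fin killed_density_ge0// ltW.
- by rewrite lee_fin.
Qed.

Let tiltedE : ((c0 * x)%:E * tilted_mean =
  \int[mu]_(y in `]0%R, +oo[) (f y * (c0 * (expR (- rho * y) * (x * y)))%:E))%E.
Proof.
rewrite -ge0_integralZl//.
- apply: eq_integral => y _; rewrite muleA -EFinM muleC; congr (_ * _%:E)%E; ring.
- by apply: measurable_funTS; exact: emeasurable_funM.
- by move=> y /y_exp_ge0 y0; rewrite mule_ge0.
- by rewrite lee_fin mulr_ge0// ltW.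
Qed.

Let mtilt : measurable_fun setT (fun y => (c0 * (expR (- rho * y) * (x * y)))%:E).
Proof.
apply/measurable_EFinP; apply: measurable_funM => //; apply: measurable_funM; first exact: mexp.
exact: measurable_funM.
Qed.

Let tilt_ge0 y : `]0, +oo[%classic y -> (0 <= (c0 * (expR (- rho * y) * (x * y)))%:E)%E.
Proof.
by rewrite /= in_itv/= andbT => y0; rewrite lee_fin !mulr_ge0 ?expR_ge0// ltW.
Qed.

Let D : R := c0 * bound * (rho / 2)^-1.

Let killed_upper t : 0 < t -> ((rate t)%:E * killed_mean B rho t f x <= (c0 * x)%:E * tilted_mean)%E.
Proof.
move=> t0; rewrite killedE// tiltedE; apply: ge0_le_integral => //.
- by move=> y /(density_pos t0) y0; rewrite mule_ge0.
- by apply: measurable_funTS; apply: emeasurable_funM => //; exact: mdensity.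
- by apply: measurable_funTS; exact: emeasurable_funM.
move=> y; rewrite /= in_itv/= andbT => y0.
rewrite lee_wpmul2l// lee_fin rate_density// ler_wpM2l// ler_wpM2l ?expR_ge0//.
by have [] := scaled_bounds t0 (ltW y0).
Qed.

Let killed_lower t : 0 < t ->
  ((c0 * x)%:E * tilted_mean <= (rate t)%:E * killed_mean B rho t f x + (D / t)%:E)%E.
Proof.
move=> t0; rewrite killedE// tiltedE.
pose g y : \bar R := ((c0 * bound / t)%:E * (expR (- (rho / 2) * y))%:E)%E.
have k0 : 0 <= c0 * bound / t by rewrite divr_ge0 ?mulr_ge0// ltW.
have g0 y : (0 <= g y)%E by rewrite mule_ge0// lee_fin ?expR_ge0.
have mg : measurable_fun setT g.
  by apply: emeasurable_funM => //; apply/measurable_EFinP; exact: mexp.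
apply: (@le_trans _ _ (\int[mu]_(y in `]0%R, +oo[)
    (f y * (rate t * killed_density t x y)%:E + g y))%E).
  apply: ge0_le_integral => //.
  - by move=> y /tilt_ge0 y0; rewrite mule_ge0.
  - by apply: measurable_funTS; exact: emeasurable_funM.
  - by apply: measurable_funTS; apply: emeasurable_funD => //; apply: emeasurable_funM => //; exact: mdensity.
  move=> y y0'; have := y0'; rewrite /= in_itv/= andbT => y0.
  have [_ L] := scaled_bounds t0 (ltW y0).
  have H : c0 * (expR (- rho * y) * (x * y)) <=
      rate t * killed_density t x y + c0 * bound / t * expR (- (rho / 2) * y).
    rewrite rate_density// (_ : c0 * bound / t * _ = c0 * (bound * expR (- (rho / 2) * y) / t)); last by ring.
    rewrite -mulrDr ler_wpM2l//.
    apply: le_trans (ler_wpM2l (expR_ge0 (- rho * y)) L) _.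
    rewrite mulrDr lerD2l mulrA ler_wpM2r ?invr_ge0 ?(ltW t0)//.
    exact: defect_bound (ltW y0).
  apply: (@le_trans _ _ (f y * ((rate t * killed_density t x y)%:E + g y))%E).
    by rewrite lee_wpmul2l// /g -EFinM -EFinD lee_fin.
  rewrite ge0_muleDr//; last exact: density_pos.
  by rewrite leeD2l// -[leRHS]mul1e lee_wpmul2r.
rewrite ge0_integralD//; last 3 first.
- by move=> y /(density_pos t0) y0; rewrite mule_ge0.
- by apply: measurable_funTS; apply: emeasurable_funM => //; exact: mdensity.
- exact: measurable_funTS.
rewrite leeD2l// (@le_trans _ _ (\int[mu]_(y in `[0%R, +oo[) g y)%E)//.
  apply: ge0_subset_integral => //; first exact: measurable_funTS.
  by apply: subset_itvr; rewrite bnd_simp.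
have me : measurable_fun (`[0, +oo[%classic : set R) (fun y : R => (expR (- (rho / 2) * y))%:E).
  by apply: measurable_funTS; apply/measurable_EFinP; exact: mexp.
have e0 y : `[0, +oo[%classic y -> (0 <= (expR (- (rho / 2) * y))%:E)%E.
  by move=> _; rewrite lee_fin expR_ge0.
rewrite ge0_integralZl//.
rewrite integral_exp_linear ?divr_gt0// mulr0 expR0 -EFinM lee_fin /D le_eqVlt; apply/orP; left.
by apply/eqP; rewrite mul1r; ring.
Qed.

(** Squeezed between L - D / t and L, where D comes from integrating the error bound exp(- rho y /
    2). *)
Lemma killed_mean_tilted_cvg :
  t `^ (3 / 2) * expR (rho ^+ 2 / 2 * t) * fine (killed_mean B rho t f x) @[t --> +oo] -->
  Num.sqrt (2 / pi) * x * expR (rho * x) * fine tilted_mean.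
Proof.
rewrite (_ : _ * fine tilted_mean = c0 * x * fine tilted_mean); last by rewrite /c0; ring.
set L := c0 * x * fine tilted_mean.
have KE t : (fine (killed_mean B rho t f x))%:E = killed_mean B rho t f x.
  by rewrite fineK//; apply: (@killed_mean_fin _ _ _ _ _ bmB rho t f 1).
have LE : (L%:E = (c0 * x)%:E * tilted_mean)%E by rewrite EFinM fineK ?tilted_mean_fin_num.
apply: (@squeeze_cvgr _ _ _ _ (fun t => L - D * t^-1) (fun=> L)).
- near=> t; have t0 : 0 < t by [].
  apply/andP; split.
    rewrite -/(rate t) lerBlDr -lee_fin LE EFinD (EFinM (rate t)) KE; exact: killed_lower.
  by rewrite -/(rate t) -lee_fin LE (EFinM (rate t)) KE; exact: killed_upper.
- rewrite -[X in _ --> X]subr0 -[X in _ - X](mulr0 D).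
  by apply: cvgB; [exact: cvg_cst|apply: cvgMr; exact: cvg_invr_pinfty].
- exact: cvg_cst.
Unshelve. all: end_near.
Qed.

End positive_drift.

End killed_kernel.

(** * Gaussian tails *)

Section gaussian_tail.
Context (R : realType).
Implicit Types (a b s t x z c : R).
Local Notation mu := (@lebesgue_measure R).

Definition heat_tail t a : \bar R := (\int[mu]_(v in `]a, +oo[) (heat t v)%:E)%E.

Lemma integral_heat t : 0 < t -> (\int[mu]_v (heat t v)%:E = 1)%E.
Proof.
move=> t0; rewrite -(@integral_normal_pdf R 0 (Num.sqrt t)).
by apply: eq_integral => v _; rewrite heat_normal_pdf.
Qed.

Let mheat t : measurable_fun setT (fun v => (heat t v)%:E).
Proof. by apply/measurable_EFinP; exact: measurable_heat. Qed.

Let heat0 t v : (0 <= (heat t v)%:E)%E. Proof. by rewrite lee_fin heat_ge0. Qed.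

Lemma heat_tail_fin_num t a : 0 < t -> heat_tail t a \is a fin_num.
Proof.
move=> t0; rewrite ge0_fin_numE; last exact: integral_ge0.
apply: (@le_lt_trans _ _ 1%E); last exact: ltry.
by rewrite -(integral_heat t0); apply: ge0_subset_integral => //; exact: mheat.
Qed.

Lemma heat_tail_split t a b : a <= b ->
  (heat_tail t a = \int[mu]_(v in `]a, b]) (heat t v)%:E + heat_tail t b)%E.
Proof.
move=> ab; rewrite /heat_tail (_ : `]a, +oo[%classic = `]a, b] `|` `]b, +oo[); last first.
  by rewrite -itv_bndbnd_setU ?bnd_simp.
have mab : measurable_fun (`]a, b] `|` `]b, +oo[) (fun v => (heat t v)%:E).
  by apply: measurable_funTS; exact: mheat.
have D : [disjoint `]a, b]%classic & `]b, +oo[%classic].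
  apply/disj_setPS => y []; rewrite /= !in_itv/= andbT => /andP[_ yb] by_.
  by move: (lt_le_trans by_ yb); rewrite ltxx.
by apply: ge0_integral_setU => // y _; exact: heat0.
Qed.

Let integral_itv_cst a b (k : R) : a <= b ->
  (\int[mu]_(v in `]a, b]) (cst k%:E v) = (k * (b - a))%:E)%E.
Proof.
move=> ab; have L : (lebesgue_measure (`]a, b]%classic : set R) = (b - a)%:E)%E.
  rewrite lebesgue_measure_itv/= lte_fin; case: ltP => [_|ba]; first by rewrite -EFinB.
  by rewrite (le_anti (introT andP (conj ab ba))) subrr.
rewrite integral_cst// EFinM; congr (_ * _)%E; exact: L.
Qed.

Lemma integral_heat_le t a b k : a <= b -> (forall v, a < v <= b -> heat t v <= k) ->
  (\int[mu]_(v in `]a, b]) (heat t v)%:E <= (k * (b - a))%:E)%E.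
Proof.
move=> ab H; rewrite -integral_itv_cst//; apply: ge0_le_integral => //.
by apply: measurable_funTS; exact: mheat.
Qed.

Lemma integral_heat_ge t a b k : a <= b -> 0 <= k -> (forall v, a < v <= b -> k <= heat t v) ->
  ((k * (b - a))%:E <= \int[mu]_(v in `]a, b]) (heat t v)%:E)%E.
Proof.
move=> ab k0 H; rewrite -integral_itv_cst//; apply: ge0_le_integral => //.
by apply: measurable_funTS; exact: mheat.
Qed.

(** Brownian scaling, by the substitution v |-> sqrt(t) v. *)
Lemma heat_tail_scale t a : 0 < t -> heat_tail t (Num.sqrt t * a) = heat_tail 1 a.
Proof.
move=> t0; have s0 : 0 < Num.sqrt t by rewrite sqrtr_gt0.
rewrite /heat_tail !integral_itv_obnd_cbnd; try by apply: measurable_funTS; exact: mheat.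
pose F : R -> R := fun v => Num.sqrt t * v.
have F' : derive1 F = cst (Num.sqrt t).
  apply/funext => v; rewrite derive1E.
  have dF : is_derive v 1 F (Num.sqrt t *: 1) by exact: (is_deriveZ (Num.sqrt t) (is_derive_id v 1)).
  by rewrite (@derive_val _ _ _ _ _ _ _ dF) /GRing.scale/= mulr1.
rewrite -[Num.sqrt t * a]/(F a) (@increasing_ge0_integration_by_substitutiony _ F (heat t) a).
- apply: eq_integral => v _; congr EFin; rewrite !fctE F' /F /heat.
  have t2 : Num.sqrt (2 * pi * t) = Num.sqrt (2 * pi * 1) * Num.sqrt t.
    by rewrite mulr1 sqrtrM// mulr_ge0// pi_ge0.
  rewrite t2 exprMn sqr_sqrtr ?(ltW t0)//.
  have -> : - (t * v ^+ 2) / (2 * t) = - v ^+ 2 / (2 * 1) by field; rewrite gt_eqF.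
  transitivity ((Num.sqrt (2 * pi * 1))^-1 * expR (- v ^+ 2 / (2 * 1)) * ((Num.sqrt t)^-1 * Num.sqrt t)).
    by rewrite invfM /=; ring.
  by rewrite mulVf ?mulr1// gt_eqF.
- by move=> u v _ _ uv; rewrite /F ltr_pM2l.
- by rewrite F' => v _; exact: cvg_cst.
- by rewrite F'; apply: is_cvg_cst.
- by rewrite F'; apply: is_cvg_cst.
- split; first by move=> v _; apply: derivableZ.
  by apply: cvg_at_right_filter; apply: cvgMr.
- apply/cvgryPge => A; near=> v; rewrite /F mulrC -ler_pdivrMr//.
- apply: continuous_subspaceT => v.
  rewrite /heat; apply: (@continuousM _ _ (cst (Num.sqrt (2 * pi * t))^-1) (fun v : R => expR (- v ^+ 2 / (2 * t)) : R)); first exact: cvg_cst.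
  apply: (@continuous_comp _ _ _ (fun v : R => - v ^+ 2 / (2 * t) : R) expR); last exact: continuous_expR.
  apply: (@continuousM _ _ (fun v : R => - v ^+ 2 : R) (cst (2 * t)^-1)); last exact: cvg_cst.
  by apply: (@continuousN _ _ _ (fun v : R => v ^+ 2 : R)); exact: exprn_continuous.
- by move=> v _; exact: heat_ge0.
Unshelve. all: end_near.
Qed.

Definition gauss_tail z : R := fine (heat_tail 1 z).

Lemma heat_tailE t a : 0 < t -> heat_tail t a = (gauss_tail (a / Num.sqrt t))%:E.
Proof.
move=> t0; rewrite /gauss_tail fineK ?heat_tail_fin_num// -(heat_tail_scale _ t0).
by rewrite mulrC divfK// gt_eqF// sqrtr_gt0.
Qed.

Lemma gauss_tailE z : gauss_tail z =
  (Num.sqrt (2 * pi))^-1 * \int[mu]_(y in `[z, +oo[) expR (- (y ^+ 2 / 2)).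
Proof.
have s0 : 0 < Num.sqrt (2 * pi) :> R by rewrite sqrtr_gt0 mulr_gt0// pi_gt0.
have E : (\int[mu]_(y in `[z, +oo[) (expR (- (y ^+ 2 / 2)))%:E =
    (Num.sqrt (2 * pi))%:E * heat_tail 1 z)%E.
  rewrite /heat_tail integral_itv_obnd_cbnd; last by apply: measurable_funTS; exact: mheat.
  rewrite -ge0_integralZl//.
  - apply: eq_integral => y _; rewrite -EFinM /heat !mulr1 mulNr mulrA divff ?mul1r//.
    by rewrite gt_eqF.
  - by apply: measurable_funTS; exact: mheat.
by rewrite /Rintegral E fineM ?heat_tail_fin_num// mulKf// gt_eqF.
Qed.

Lemma gauss_tail_gt0 z : 0 < gauss_tail z.
Proof.
have k0 : 0 < heat 1 (`|z| + 1) by rewrite mulr_gt0 ?expR_gt0// invr_gt0 sqrtr_gt0 mulr1 mulr_gt0// pi_gt0.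
rewrite -lte_fin /gauss_tail fineK ?heat_tail_fin_num//.
have z1 : z <= z + 1 by rewrite lerDl.
apply: (@lt_le_trans _ _ (heat 1 (`|z| + 1) * (z + 1 - z))%:E).
  by rewrite lte_fin mulr_gt0//; lra.
rewrite (heat_tail_split 1 z1) -[leLHS]adde0; apply: leeD; last exact: integral_ge0.
apply: integral_heat_ge => // [|v /andP[zv vz]]; first exact: ltW.
rewrite /heat ler_wpM2l ?invr_ge0// ler_expR ler_wpM2r//.
rewrite lerN2 -(real_normK (num_real v)) lerXn2r ?nnegrE ?addr_ge0//.
have := ler_norm z; have := ler_norm (- z); rewrite normrN ler_norml; lra.
Qed.

(** The standard Gaussian density is at most 1, because 2 pi >= 1. *)
Lemma gauss_tail_lipschitz a b : `|gauss_tail a - gauss_tail b| <= `|a - b|.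
Proof.
wlog ab : a b / a <= b.
  move=> H; have [ab|/ltW ba] := leP a b; first exact: H.
  by rewrite distrC [X in _ <= X]distrC; exact: H.
have pi1 : 1 <= 2 * pi :> R by have := @pi_ge2 R; lra.
have s1 : 1 <= Num.sqrt (2 * pi) :> R by rewrite -[leLHS]sqrtr1 ler_wsqrtr.
have h1 (v : R) : heat 1 v <= 1.
  rewrite /heat mulr1 mulr_ile1 ?expR_ge0 ?invr_ge0//.
    by rewrite invf_le1// (lt_le_trans ltr01 s1).
  by rewrite -[leRHS]expR0 ler_expR mulNr oppr_le0 mulr_ge0 ?sqr_ge0.
have I1 : (\int[mu]_(v in `]a, b]) (heat 1 v)%:E <= (1 * (b - a))%:E)%E.
  by apply: integral_heat_le.
have I0 : (0 <= \int[mu]_(v in `]a, b]) (heat 1 v)%:E)%E by exact: integral_ge0.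
have If : (\int[mu]_(v in `]a, b]) (heat 1 v)%:E)%E \is a fin_num.
  by rewrite ge0_fin_numE//; apply: (le_lt_trans I1); exact: ltry.
rewrite /gauss_tail (heat_tail_split 1 ab) fineD ?heat_tail_fin_num//.
rewrite addrK ger0_norm ?fine_ge0// distrC ger0_norm ?subr_ge0//.
by rewrite -lee_fin fineK// (le_trans I1)// mul1r.
Qed.

Lemma cvg_gauss_tail (F : set_system R) (FF : Filter F) (g : R -> R) z :
  g t @[t --> F] --> z -> gauss_tail (g t) @[t --> F] --> gauss_tail z.
Proof.
move=> /cvgrPdist_lt gz; apply/cvgrPdist_lt => e e0.
have := gz e e0; apply: filterS => t.
exact: le_lt_trans (gauss_tail_lipschitz _ _).
Qed.

End gaussian_tail.

Section killed_tail.
Context d (T : measurableType d) (R : realType) (P : probability T R).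
Context (B : R -> {RV P >-> R}) (bmB : brownian_motion B) (rho x : R).
Hypothesis x_gt0 : 0 < x.
Implicit Types (t c z : R).
Local Notation mu := (@lebesgue_measure R).

Definition killed_tail c t : R :=
  fine (killed_mean B rho t (fun y => (\1_`]c, +oo[%classic y)%:E) x).

Let mind c : measurable_fun setT (fun y : R => (\1_`]c, +oo[%classic y)%:E : \bar R).
Proof. by apply/measurable_EFinP; exact: measurable_indic. Qed.

Let ind0 c y : (0 <= (\1_`]c, +oo[%classic y)%:E :> \bar R)%E. Proof. by rewrite lee_fin. Qed.

Let ind1 c y : ((\1_`]c, +oo[%classic y)%:E <= 1%:E :> \bar R)%E.
Proof. by rewrite lee_fin indicE; case: (_ \in _). Qed.

Lemma killed_tailE c t : (killed_tail c t)%:E = killed_mean B rho t (fun y => (\1_`]c, +oo[%classic y)%:E) x.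
Proof. by rewrite fineK//; exact: (@killed_mean_fin _ _ _ _ _ bmB rho t _ 1 x (mind c) (ind0 c) (ind1 c)). Qed.

Lemma killed_tail_ge0 c t : 0 <= killed_tail c t.
Proof. by apply: fine_ge0; exact: killed_mean_ge0. Qed.

Lemma killed_tail_le1 c t : killed_tail c t <= 1.
Proof. by rewrite -lee_fin killed_tailE; apply: killed_mean_le_cst. Qed.

Lemma killed_tail_max c t : 0 <= t -> killed_tail c t = killed_tail (Num.max 0 c) t.
Proof.
move=> t0; congr fine; apply: eq_integral => w /set_mem sw.
have X0 : 0 < drifted B rho x t w by apply: sw; rewrite t0 lexx.
by rewrite !indicE !mem_setE !in_itv/= !andbT gt_max X0.
Qed.

Lemma free_tail c t y : 0 < t ->
  free_mean B rho t (fun y => (\1_`]c, +oo[%classic y)%:E) y = heat_tail t (c - y + rho * t).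
Proof.
move=> t0; rewrite (@free_meanE _ _ _ _ B bmB rho t _ y t0 (mind c) (ind0 c)).
rewrite /heat_tail [RHS]integral_mkcond; apply: eq_integral => v _.
rewrite epatch_indic muleC /=; congr (_ * _%:E)%E.
by apply: eq_indic; rewrite /= !in_itv/= !andbT; split; lra.
Qed.

Lemma killed_tail_heat c t : 0 <= c -> 0 < t ->
  ((killed_tail c t)%:E + (expR (2 * rho * x))%:E * heat_tail t (c + x + rho * t) =
   heat_tail t (c - x + rho * t))%E.
Proof.
move=> c0 t0; have := killed_mean_reflection bmB rho t0 x_gt0 (mind c) (ind0 c).
have -> : (fun y => (\1_`]c, +oo[%classic y)%:E : \bar R) \_ `]0, +oo[ =
    (fun y => (\1_`]c, +oo[%classic y)%:E).
  apply/funext => y; rewrite patchE; case: ifPn => // /negP y0; rewrite indicE memNset//=.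
  by rewrite in_itv/= andbT => cy; apply: y0; rewrite mem_setE in_itv/= andbT (le_lt_trans c0 cy).
rewrite (@free_mean_reflection _ _ _ _ B bmB rho t _ x (ltW t0) (mind c) (ind0 c)) /reflection.
by rewrite -killed_tailE !free_tail// opprK.
Qed.

Lemma killed_tail_gauss c t : 0 <= c -> 0 < t ->
  killed_tail c t = gauss_tail ((c - x + rho * t) / Num.sqrt t) -
    expR (2 * rho * x) * gauss_tail ((c + x + rho * t) / Num.sqrt t).
Proof.
move=> c0 t0; have := killed_tail_heat c0 t0; rewrite !heat_tailE// -EFinM -EFinD.
by move=> -[<-]; rewrite addrK.
Qed.

(** The start moves the two Gaussian arguments by x / sqrt(tau) in opposite directions, which
    vanishes in the limit; only the weight of the image term remains. *)
Lemma killed_tail_cvg_neg (c : R -> R) (tau : R -> R) z :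
    (\forall t \near +oo, 0 <= c t) -> (\forall t \near +oo, 0 < tau t) ->
    (c t + rho * tau t) / Num.sqrt (tau t) @[t --> +oo] --> z ->
    (Num.sqrt (tau t))^-1 @[t --> +oo] --> (0 : R) ->
  killed_tail (c t) (tau t) @[t --> +oo] --> (1 - expR (2 * rho * x)) * gauss_tail z.
Proof.
move=> c0 tau0 cz s0.
have E s : (c t + s + rho * tau t) / Num.sqrt (tau t) @[t --> +oo] --> z.
  rewrite -[X in _ --> X]addr0 -[X in _ --> _ + X](mulr0 s).
  rewrite (_ : (fun t => _) = fun t => (c t + rho * tau t) / Num.sqrt (tau t) + s * (Num.sqrt (tau t))^-1).
    by apply: cvgD => //; exact: cvgMr.
  by apply/funext => t; ring.
rewrite mulrBl mul1r; have H : gauss_tail ((c t - x + rho * tau t) / Num.sqrt (tau t)) -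
    expR (2 * rho * x) * gauss_tail ((c t + x + rho * tau t) / Num.sqrt (tau t)) @[t --> +oo] -->
    gauss_tail z - expR (2 * rho * x) * gauss_tail z.
  by apply: cvgB; [exact: cvg_gauss_tail|apply: cvgMr; exact: cvg_gauss_tail].
apply: cvg_trans H; apply: near_eq_cvg; near=> t; rewrite killed_tail_gauss//; by near: t.
Unshelve. all: end_near.
Qed.

(** Without drift the two Gaussian tails differ by the mass of ]c - x, c + x], estimated by its
    length 2 x times bounds on the density there. *)
Lemma killed_tail_bounds c t : rho = 0 -> 0 <= c -> 0 < t ->
  2 * x * (Num.sqrt (2 * pi * t))^-1 * expR (- (c + x) ^+ 2 / (2 * t)) <= killed_tail c t <=
  2 * x * (Num.sqrt (2 * pi * t))^-1 * expR (- (c ^+ 2 - 2 * c * x) / (2 * t)).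
Proof.
move=> rho0 c0 t0; have cx : c - x <= c + x by move: x_gt0; lra.
have := killed_tail_heat c0 t0; rewrite rho0 !(mulr0, mul0r, addr0) expR0 mul1e.
rewrite (heat_tail_split t cx) => H.
have KE : (killed_tail c t)%:E = (\int[mu]_(v in `](c - x)%R, (c + x)%R]) (heat t v)%:E)%E.
  have Xf := heat_tail_fin_num (c + x) t0.
  by rewrite -(addeK (killed_tail c t)%:E Xf) H addeK.
have t20 : 0 <= (2 * t)^-1 by rewrite invr_ge0 mulr_ge0// ltW.
have w : c + x - (c - x) = 2 * x by ring.
have x0 : 0 <= x by exact: ltW.
rewrite -!lee_fin KE; apply/andP; split.
  rewrite (_ : 2 * x * _ * _ = (Num.sqrt (2 * pi * t))^-1 * expR (- (c + x) ^+ 2 / (2 * t)) *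
    (c + x - (c - x))); last by rewrite w; ring.
  apply: integral_heat_ge; [exact: cx|by apply: mulr_ge0; [rewrite invr_ge0|exact: expR_ge0]|].
  move=> v /andP[v1 v2]; rewrite /heat ler_wpM2l ?invr_ge0// ler_expR ler_wpM2r// lerN2.
  by rewrite -(real_normK (num_real v)) lerXn2r ?nnegrE ?addr_ge0// ler_norml v2 andbT; lra.
rewrite (_ : 2 * x * _ * _ = (Num.sqrt (2 * pi * t))^-1 * expR (- (c ^+ 2 - 2 * c * x) / (2 * t)) *
  (c + x - (c - x))); last by rewrite w; ring.
apply: integral_heat_le => // v /andP[v1 v2].
rewrite /heat ler_wpM2l ?invr_ge0// ler_expR ler_wpM2r// lerN2.
(* From v^2 = c^2 + 2 c (v - c) + (v - c)^2 and v - c > - x one gets v^2 >= c^2 - 2 c x. *)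
have c1 : 0 <= c * (v - c + x) by rewrite mulr_ge0//; lra.
have := sqr_ge0 (v - c); nra.
Qed.

End killed_tail.

(** * Limit theorems *)

Section limits.
Context (R : realType).
Implicit Types (f g : R -> R) (l : R).

(** The bounding functions and their limits may depend on e, as they do when N is fixed before t
    grows. *)
Lemma cvg_between f l :
    (forall e, 0 < e -> exists g l', [/\ g t @[t --> +oo] --> l', l - e < l' & \forall t \near +oo, g t <= f t]) ->
    (forall e, 0 < e -> exists g l', [/\ g t @[t --> +oo] --> l', l' < l + e & \forall t \near +oo, f t <= g t]) ->
  f t @[t --> +oo] --> l.
Proof.
move=> lo up; apply/cvgrPdist_lt => e e0.
have [g [l1 [gl1 ll1 gf]]] := lo e e0; have [h [l2 [hl2 ll2 fh]]] := up e e0.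
have g1 : \forall t \near +oo, l - e < g t by exact: (cvgr_gt _ gl1 _ ll1).
have h1 : \forall t \near +oo, h t < l + e by exact: (cvgr_lt _ hl2 _ ll2).
near=> t.
have A : g t <= f t by near: t.
have B : f t <= h t by near: t.
have A' : l - e < g t by near: t.
have B' : h t < l + e by near: t.
by rewrite ltr_distlC (lt_le_trans A' A) (le_lt_trans B B').
Unshelve. all: end_near.
Qed.

Lemma cvg_subr_pinfty (N : R) : t - N @[t --> +oo] --> +oo.
Proof.
apply/cvgryPge => A; near=> t; rewrite lerBrDr; near: t; apply: nbhs_pinfty_ge; exact: num_real.
Unshelve. all: end_near.
Qed.

Lemma cvg_shift_pinfty f l (N : R) : f t @[t --> +oo] --> l -> f (t - N) @[t --> +oo] --> l.
Proof. by move=> fl; exact: (cvg_comp _ _ (cvg_subr_pinfty N) fl). Qed.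

Lemma cvg_invr_sqrt (N : R) : (Num.sqrt (t - N))^-1 @[t --> +oo] --> (0 : R).
Proof.
suff H : Num.sqrt (t : R) @[t --> +oo] --> +oo.
  apply: (@cvg_shift_pinfty (fun t => (Num.sqrt t)^-1)).
  exact: (cvg_comp _ _ H (@cvg_invr_pinfty R)).
apply/cvgryPge => A; near=> t.
rewrite (le_trans (ler_norm A))// -sqrtr_sqr ler_wsqrtr//.
Unshelve. all: end_near.
Qed.

Lemma cvg_sqrt_ratio (N : R) : Num.sqrt t / Num.sqrt (t - N) @[t --> +oo] --> (1 : R).
Proof.
have H : Num.sqrt (1 + N * (t - N)^-1) @[t --> +oo] --> Num.sqrt (1 + N * 0).
  apply: continuous_cvg; first exact: sqrt_continuous.
  apply: cvgD; first exact: cvg_cst.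
  by apply: cvgMr; apply: (@cvg_shift_pinfty (fun t => t^-1)); exact: cvg_invr_pinfty.
rewrite mulr0 addr0 sqrtr1 in H; apply: cvg_trans H; apply: near_eq_cvg; near=> t.
have tN : 0 < t - N by rewrite subr_gt0; near: t; apply: nbhs_pinfty_gt; exact: num_real.
rewrite -sqrtrV ?(ltW tN)// -sqrtrM; last by rewrite ltW//.
congr Num.sqrt; field; exact: lt0r_neq0.
Unshelve. all: end_near.
Qed.

Lemma asymp_equiv_scaled (r f g : R -> R) l : l != 0 -> (\forall t \near +oo, r t != 0) ->
  r t * f t @[t --> +oo] --> l -> r t * g t @[t --> +oo] --> l -> asymp_equiv f g.
Proof.
move=> l0 r0 fl gl; rewrite /asymp_equiv.
have H : (r t * f t) / (r t * g t) @[t --> +oo] --> l / l.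
  by apply: cvgM => //; exact: cvgV.
rewrite divff// in H; apply: cvg_trans H; apply: near_eq_cvg; near=> t.
have rt : r t != 0 by near: t.
by rewrite invfM mulrACA divff// mul1r.
Unshelve. all: end_near.
Qed.

Lemma gauss_tail_antitone (z z' : R) : z <= z' -> gauss_tail z' <= gauss_tail z.
Proof.
move=> zz'; rewrite /gauss_tail fine_le ?heat_tail_fin_num//.
apply: ge0_subset_integral => //.
- by apply/measurable_EFinP; apply: measurable_funTS; exact: measurable_heat.
- by move=> v _; rewrite lee_fin heat_ge0.
by apply: subset_itvr; rewrite bnd_simp.
Qed.

Lemma gauss_tail_cvg0 : gauss_tail z @[z --> +oo] --> (0 : R).
Proof.
apply: (@squeeze_cvgr _ _ _ _ (fun=> 0) (fun z => expR (- 2^-1 * z) / 2^-1)).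
- near=> z; rewrite ltW ?gauss_tail_gt0//= -lee_fin -integral_exp_linear// /gauss_tail.
  rewrite fineK ?heat_tail_fin_num// /heat_tail integral_itv_obnd_cbnd; last first.
    by apply/measurable_EFinP; apply: measurable_funTS; exact: measurable_heat.
  have z1 : 1 <= z by near: z; apply: nbhs_pinfty_ge; exact: num_real.
  apply: ge0_le_integral => //.
  + by move=> v _; rewrite lee_fin heat_ge0.
  + by apply/measurable_EFinP; apply: measurable_funTS; exact: measurable_heat.
  + by apply/measurable_EFinP; apply: measurable_funTS; apply: measurableT_comp.
  move=> v; rewrite /= in_itv/= andbT lee_fin => zv.
  have pi1 : 1 <= 2 * pi :> R by have := @pi_ge2 R; lra.
  have s1 : 1 <= Num.sqrt (2 * pi) :> R by rewrite -[leLHS]sqrtr1 ler_wsqrtr.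
  have v1 : 1 <= v by exact: le_trans zv.
  rewrite /heat mulr1 -[leRHS]mul1r ler_pM ?invr_ge0 ?expR_ge0//.
    by rewrite invf_le1// (lt_le_trans ltr01 s1).
  by rewrite ler_expR; nra.
- exact: cvg_cst.
- rewrite -[X in _ --> X](mul0r (2^-1)^-1); apply: cvgMl.
  by apply: cvg_expR_linear.
Unshelve. all: end_near.
Qed.

End limits.

Section tail_upper_bound.
Context d (T : measurableType d) (R : realType) (P : probability T R).
Context (beta : R) (p : nat -> R) (W : branching_data P beta p) (rho : R).
Hypotheses (beta_gt0 : 0 < beta) (p_law : offspring_law p).
Hypotheses (m_gt0 : (0 < mean_offspring p)%E) (m_lt1 : (mean_offspring p < 1)%E).
Implicit Types (c k t N x y : R).

Local Notation q := (survival_prob W).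
Local Notation a := (alpha beta p).
Local Notation B := (motion W [::]).

Definition tail_reach c t x : R := reach rho true `]c, +oo[%classic setT W t x.

Let mA c : measurable (`]c, +oo[%classic : set R). Proof. exact: measurable_itv. Qed.

Lemma prob_killed_maxE c t x : 0 <= t ->
  P [set w | (c%:E < killed_max W x rho t w)%E] = (tail_reach c t x)%:E.
Proof.
move=> t0; rewrite /tail_reach reachE//.
by congr (P _); apply/seteqP; split=> w /(killed_max_gtP _ _ _ _ _ t0).
Qed.

Lemma expected_killed_tail c t x : 0 <= t ->
  expected_killed W x rho t `]c, +oo[%classic = expR (- a * t) * killed_tail B rho x c t.
Proof. by move=> t0; rewrite expected_killedE// mean_fin_num. Qed.

Let mind c : measurable_fun setT (fun y : R => (\1_`]c, +oo[%classic y)%:E : \bar R).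
Proof. by apply/measurable_EFinP; exact: measurable_indic. Qed.

Let ind0 c y : (0 <= (\1_`]c, +oo[%classic y)%:E :> \bar R)%E. Proof. by rewrite lee_fin. Qed.

Let ind1 c y : ((\1_`]c, +oo[%classic y)%:E <= 1%:E :> \bar R)%E.
Proof. by rewrite lee_fin indicE; case: (_ \in _). Qed.

Lemma tail_reach0 c y : (tail_reach c 0 y)%:E =
  root_mean rho true W 0 (fun y => (\1_`]c, +oo[%classic y)%:E) y.
Proof.
rewrite /tail_reach (@reach_equation _ _ _ _ _ _ _ _ _ (mA c) beta_gt0 p_law W 0 y (lexx 0)).
by rewrite mulr0 expR0 mul1e /= set_itv1 integral_set1 adde0.
Qed.

Lemma mean_tail_reach0 c t x : 0 <= t ->
  mean_reach W rho true `]c, +oo[%classic 0 t x = killed_tail B rho x c t.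
Proof.
move=> t0; rewrite /mean_reach /killed_tail; congr fine.
have -> : (fun y => (reach rho true `]c, +oo[ setT W 0 y)%:E) =
    root_mean rho true W 0 (fun y => (\1_`]c, +oo[%classic y)%:E).
  by apply/funext => y; exact: tail_reach0.
rewrite (@root_mean_semigroup _ _ _ _ _ _ rho true W t 0 _ 1 x t0 (lexx 0) (mind c) (ind0 c) (ind1 c)).
by rewrite addr0 root_meanE.
Qed.

Lemma tail_reach_lower c t x : 0 <= t -> q t * killed_tail B rho x c t <= tail_reach c t x.
Proof.
move=> t0; have := @mean_reach_le_reach _ _ _ _ _ _ W beta_gt0 p_law m_gt0 m_lt1 rho true _ 0 t x (mA c) (lexx 0) t0.
by rewrite addr0 survival0 divr1 mean_tail_reach0.
Qed.

Lemma tail_reach_le_mean c t y : 0 <= t ->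
  tail_reach c t y <= expR (- a * t) * killed_tail B rho y c t.
Proof.
move=> t0; have := @reach_le_mean _ _ _ _ _ _ W beta_gt0 p_law m_gt0 m_lt1 rho true _ (mA c) 0 t y (lexx 0) t0.
by rewrite addr0 mean_tail_reach0.
Qed.

(** From a start at or below c - k a particle has to gain k in time N, which the free Gaussian tail
    controls through the first-moment bound. The indicator of the positive half-line stays in the
    error term, so that its mean under K_t decays like the main term. *)
Lemma tail_reach_le c k N y : 0 < N -> tail_reach c N y <=
  q N * \1_`](c - k)%R, +oo[%classic y + gauss_tail ((k + rho * N) / Num.sqrt N) * \1_`]0%R, +oo[%classic y.
Proof.
move=> N0; have G0 (z : R) : 0 <= gauss_tail z by rewrite ltW// gauss_tail_gt0.
have I0 : 0 <= q N * \1_`](c - k)%R, +oo[%classic y.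
  by rewrite mulr_ge0 ?survival_ge0.
have e1 : expR (- a * N) <= 1.
  by rewrite -[leRHS]expR0 ler_expR mulNr oppr_le0 mulr_ge0// ltW// (alpha_gt0 beta_gt0 m_gt0 m_lt1).
have H := tail_reach_le_mean c y (ltW N0).
have K0 : 0 <= killed_tail B rho y c N by exact: killed_tail_ge0.
have {}H : tail_reach c N y <= killed_tail B rho y c N by rewrite (le_trans H)// ler_piMl.
have [y0|y0] := leP y 0.
  apply: (@le_trans _ _ 0); last by apply: addr_ge0 => //; apply: mulr_ge0.
  by rewrite (le_trans H)// /killed_tail (killed_mean_le0 (motion_brownian W [::]) _ _ (ltW N0) y0).
rewrite [X in _ + _ * X]indicE mem_set ?mulr1; last by rewrite /= in_itv/= y0.
have [cy|yc] := ltP (c - k) y.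
  rewrite indicE mem_set ?mulr1; last by rewrite /= in_itv/= cy.
  apply: (@le_trans _ _ (q N)); last by rewrite lerDl.
  exact: reach_le_survival.
rewrite (le_trans _ (_ : gauss_tail ((k + rho * N) / Num.sqrt N) <= _))//; last by rewrite lerDr.
rewrite (le_trans H)// -lee_fin killed_tailE; last exact: motion_brownian.
have ck : k + rho * N <= c - y + rho * N by lra.
apply: (@le_trans _ _ (heat_tail N (c - y + rho * N))).
  rewrite -(@free_tail _ _ _ _ B (motion_brownian W [::]) rho c N y N0).
  apply: ge0_subset_integral => //; first exact: measurable_survival (motion_brownian W [::]) _ _ _.
  exact: (@measurable_comp_drifted _ _ _ _ B rho _ N y (mind c)).
rewrite (heat_tailE _ N0) lee_fin gauss_tail_antitone//.
by rewrite ler_wpM2r// invr_ge0 sqrtr_ge0.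
Qed.

Lemma tail_reach_upper c k N t x : 0 < N -> 0 <= t -> 0 < x ->
  tail_reach c (t + N) x <= expR (- a * t) *
    (q N * killed_tail B rho x (c - k) t +
     gauss_tail ((k + rho * N) / Num.sqrt N) * killed_tail B rho x 0 t).
Proof.
move=> N0 t0 x0; set e := gauss_tail _.
have e0 : 0 <= e by rewrite ltW// gauss_tail_gt0.
have q0 := survival_ge0 W N.
have := @reach_le_mean _ _ _ _ _ _ W beta_gt0 p_law m_gt0 m_lt1 rho true _ (mA c) N t x (ltW N0) t0.
move=> /le_trans; apply; rewrite ler_wpM2l ?expR_ge0//.
rewrite -lee_fin mean_reachE// EFinD !EFinM !killed_tailE ?(motion_brownian W [::])//; try exact: motion_brownian.
pose K f := root_mean rho true W t f x.
have KE f : killed_mean B rho t f x = K f by rewrite /K root_meanE.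
rewrite !KE /K -!root_meanZ// -root_meanD//; try by apply: emeasurable_funM.
- apply: le_root_mean.
  + by apply/measurable_EFinP; exact: measurable_reachr.
  + by apply: emeasurable_funD; apply: emeasurable_funM.
  + by move=> y; rewrite lee_fin reach_ge0.
  by move=> y; rewrite -!EFinM -EFinD lee_fin; exact: tail_reach_le.
- by move=> y; rewrite mule_ge0 ?lee_fin.
- by move=> y; rewrite mule_ge0 ?lee_fin.
Qed.

End tail_upper_bound.

Section driftless_or_outward.
Context d (T : measurableType d) (R : realType) (P : probability T R).
Context (beta : R) (p : nat -> R) (W : branching_data P beta p) (rho : R).
Hypotheses (beta_gt0 : 0 < beta) (p_law : offspring_law p).
Hypotheses (m_gt0 : (0 < mean_offspring p)%E) (m_lt1 : (mean_offspring p < 1)%E).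
Hypothesis klogk : (klogk_moment p < +oo)%E.
Variable x : R.
Hypothesis x_gt0 : 0 < x.
Implicit Types (c k t N z : R).

Local Notation q := (survival_prob W).
Local Notation a := (alpha beta p).
Local Notation B := (motion W [::]).
Let bmB : brownian_motion B := motion_brownian W [::].

Lemma cvg_sqrt_pinfty : Num.sqrt (t : R) @[t --> +oo] --> +oo.
Proof.
apply/cvgryPge => A; near=> t.
by rewrite (le_trans (ler_norm A))// -sqrtr_sqr ler_wsqrtr.
Unshelve. all: end_near.
Qed.

(** Common to zero and negative drift, with [r] equal to the square root or to 1. The first
    hypothesis says that a delay N and a shift k of the level leave the limit of the killed tail
    unchanged, the second that the scaled error term stays bounded. *)
Lemma tail_reach_cvg (r c : R -> R) (L : R) : (forall t, 0 <= r t) ->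
    (forall N k, 0 <= N -> 0 <= k ->
      r t * killed_tail B rho x (c t - k) (t - N) @[t --> +oo] --> L) ->
    (forall N, 0 <= N -> exists M, \forall t \near +oo, r t * killed_tail B rho x 0 (t - N) <= M) ->
  r t * expR (a * t) * tail_reach W rho (c t) t x @[t --> +oo] --> C_sub W * L.
Proof.
move=> r0 KL KM.
have [C0 [qC Cq]] := C_sub_cvg W beta_gt0 p_law m_gt0 m_lt1 klogk.
apply: cvg_between => e e0.
  (* Lower bound with N = k = 0, where exp(a t) q(t) tends to [C_sub W]. *)
  exists (fun t => expR (a * t) * q t * (r t * killed_tail B rho x (c t - 0) (t - 0))), (C_sub W * L); split.
  - by apply: cvgM => //; exact: KL.
  - by rewrite gtrBl.
  near=> t; rewrite !subr0 mulrACA [expR _ * r t]mulrC ler_wpM2l//.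
    by rewrite mulr_ge0// expR_ge0.
  by apply: tail_reach_lower.
have [N [N0 NP]] : exists N, 0 < N /\ expR (a * N) * q N * L < C_sub W * L + e / 2.
  have H : expR (a * t) * q t * L @[t --> +oo] --> C_sub W * L by exact: cvgMl.
  have /filter_ex[N [N1 N2]] : \forall N \near +oo, 0 < N /\ expR (a * N) * q N * L < C_sub W * L + e / 2.
    near=> N; split; first by near: N; apply: nbhs_pinfty_gt; exact: num_real.
    by near: N; apply: (cvgr_lt _ H); rewrite ltrDl divr_gt0.
  by exists N.
have [M MP] := KM N (ltW N0).
(* [k] is chosen after N and M: the factor exp(a N) is fixed while the Gaussian tail vanishes as k
   grows. *)
have [k [k0 kP]] : exists k, 0 <= k /\ expR (a * N) * gauss_tail ((k + rho * N) / Num.sqrt N) * M < e / 2.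
  have sN : 0 < Num.sqrt N by rewrite sqrtr_gt0.
  have H1 : (k + rho * N) / Num.sqrt N @[k --> +oo] --> +oo.
    apply/cvgryPge => A; near=> k; rewrite ler_pdivlMr// -lerBlDr.
    by near: k; apply: nbhs_pinfty_ge; exact: num_real.
  have H : expR (a * N) * gauss_tail ((k + rho * N) / Num.sqrt N) * M @[k --> +oo] --> expR (a * N) * 0 * M.
    apply: cvgMl; apply: cvgMr; exact: (cvg_comp _ _ H1 (@gauss_tail_cvg0 R)).
  rewrite mulr0 mul0r in H.
  have /filter_ex[k [k1 k2]] : \forall k \near +oo, 0 <= k /\ expR (a * N) * gauss_tail ((k + rho * N) / Num.sqrt N) * M < e / 2.
    near=> k; split; first by near: k; apply: nbhs_pinfty_ge; exact: num_real.
    by near: k; apply: (cvgr_lt _ H); rewrite divr_gt0.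
  by exists k.
set eps := gauss_tail _ in kP.
have eps0 : 0 <= eps by rewrite ltW// gauss_tail_gt0.
exists (fun t => expR (a * N) * (q N * (r t * killed_tail B rho x (c t - k) (t - N)) + eps * M)),
  (expR (a * N) * (q N * L + eps * M)); split.
- apply: cvgMr; apply: cvgD; last exact: cvg_cst.
  by apply: cvgMr; apply: KL => //; exact: ltW.
- by rewrite mulrDr !mulrA; lra.
near=> t.
have tN : 0 <= t - N by rewrite subr_ge0; near: t; apply: nbhs_pinfty_ge; exact: num_real.
have Mt : r t * killed_tail B rho x 0 (t - N) <= M by near: t.
have := @tail_reach_upper _ _ _ _ _ _ W rho beta_gt0 p_law m_gt0 m_lt1 (c t) k N (t - N) x N0 tN x_gt0.
rewrite subrK -/eps; set u := tail_reach _ _ _ _ _ => ut.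
have E : expR (a * t) * expR (- a * (t - N)) = expR (a * N) by rewrite -expRD; congr expR; ring.
apply: (@le_trans _ _ (r t * expR (a * t) * (expR (- a * (t - N)) *
  (q N * killed_tail B rho x (c t - k) (t - N) + eps * killed_tail B rho x 0 (t - N))))).
  by rewrite ler_wpM2l// mulr_ge0// expR_ge0.
rewrite mulrA -[r t * _ * _]mulrA E [r t * _]mulrC -mulrA ler_wpM2l ?expR_ge0// mulrDr.
by rewrite mulrCA lerD2l mulrCA ler_wpM2l.
Unshelve. all: end_near.
Qed.

(** Both sides have the same nonzero limit after multiplication by r exp(a t). *)
Lemma tail_reach_asymp (r c : R -> R) (L : R) : (forall t, 0 <= r t) ->
    (\forall t \near +oo, 0 < r t) -> 0 < L ->
    (forall N k, 0 <= N -> 0 <= k ->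
      r t * killed_tail B rho x (c t - k) (t - N) @[t --> +oo] --> L) ->
    (forall N, 0 <= N -> exists M, \forall t \near +oo, r t * killed_tail B rho x 0 (t - N) <= M) ->
  asymp_equiv (fun t => tail_reach W rho (c t) t x)
    (fun t => C_sub W * expected_killed W x rho t `]c t, +oo[).
Proof.
move=> r0 r1 L0 KL KM.
have [C0 _] := C_sub_cvg W beta_gt0 p_law m_gt0 m_lt1 klogk.
apply: (@asymp_equiv_scaled _ (fun t => r t * expR (a * t)) _ _ (C_sub W * L)).
- by rewrite mulf_neq0// lt0r_neq0.
- near=> t; have rt : 0 < r t by near: t.
  by rewrite lt0r_neq0// mulr_gt0// expR_gt0.
- exact: tail_reach_cvg.
have H : C_sub W * (r t * killed_tail B rho x (c t - 0) (t - 0)) @[t --> +oo] --> C_sub W * L.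
  by apply: cvgMr; exact: KL.
apply: cvg_trans H; apply: near_eq_cvg; near=> t.
rewrite expected_killed_tail// !subr0 mulNr expRN.
have e0 := lt0r_neq0 (expR_gt0 (a * t)); move: (expR (a * t)) e0 => e e0.
move: (C_sub W) (r t) (killed_tail _ _ _ _ _) => C w k.
have -> : w * e * (C * (e^-1 * k)) = (e * e^-1) * (C * (w * k)) by ring.
by rewrite divff// mul1r.
Unshelve. all: end_near.
Qed.

Lemma cvg_endpoint N k z : (Num.sqrt t * z - k) / Num.sqrt (t - N) @[t --> +oo] --> z.
Proof.
have H : Num.sqrt t / Num.sqrt (t - N) * z - k * (Num.sqrt (t - N))^-1 @[t --> +oo] --> 1 * z - k * 0.
  apply: cvgB; first by apply: cvgMl; exact: cvg_sqrt_ratio.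
  by apply: cvgMr; exact: cvg_invr_sqrt.
rewrite mul1r mulr0 subr0 in H; apply: cvg_trans H; apply: near_eq_cvg; near=> t.
by rewrite mulrBl mulrAC.
Unshelve. all: end_near.
Qed.

Lemma killed_tail_cvg_driftless N k z : rho = 0 -> 0 <= z ->
  Num.sqrt t * killed_tail B rho x (Num.sqrt t * z - k) (t - N) @[t --> +oo] -->
    Num.sqrt (2 / pi) * x * expR (- (z ^+ 2 / 2)).
Proof.
move=> rho0 z0.
(* The level is clamped at 0 because [z] may vanish while [k] is positive; the killed tail does not
   see the clamp, and the explicit bounds ask for a nonnegative level. *)
pose s t := Num.sqrt (t - N); pose v t := Num.max 0 ((Num.sqrt t * z - k) / s t).
have vz : v t @[t --> +oo] --> z.
  have H : (0 + (Num.sqrt t * z - k) / s t + `|0 - (Num.sqrt t * z - k) / s t|) / 2 @[t --> +oo] --> (0 + z + `|0 - z|) / 2.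
    apply: cvgMl; apply: cvgD; first by apply: cvgD; [exact: cvg_cst|exact: cvg_endpoint].
    by apply: cvg_norm; apply: cvgB; [exact: cvg_cst|exact: cvg_endpoint].
  have zE : (0 + z + `|0 - z|) / 2 = z by rewrite sub0r normrN ger0_norm//; lra.
  rewrite zE in H.
  apply: cvg_trans H; apply: near_eq_cvg; near=> t; by rewrite /v maxr_absE.
have sv : (s t)^-1 @[t --> +oo] --> (0 : R) by exact: cvg_invr_sqrt.
have rat : Num.sqrt t / s t @[t --> +oo] --> (1 : R) by exact: cvg_sqrt_ratio.
pose K : R := 2 * x / Num.sqrt (2 * pi).
have -> : Num.sqrt (2 / pi) * x * expR (- (z ^+ 2 / 2)) = K * 1 * expR (- (z ^+ 2 / 2)).
  rewrite mulr1 /K; congr (_ * _).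
  have pi0 : pi != 0 :> R by rewrite gt_eqF// pi_gt0.
  have -> : 2 / pi = 2 ^+ 2 / (2 * pi) :> R by move: pi0; move: pi => u u0; field.
  by rewrite sqrtrM ?exprn_ge0// sqrtr_sqr ger0_norm// sqrtrV ?mulr_ge0 ?pi_ge0//; ring.
have lo : K * (Num.sqrt t / s t) * expR (- ((v t + x * (s t)^-1) * (v t + x * (s t)^-1) / 2)) @[t --> +oo] -->
    K * 1 * expR (- ((z + x * 0) * (z + x * 0) / 2)).
  apply: cvgM; first exact: cvgMr.
  apply: continuous_cvg; first exact: continuous_expR.
  apply: cvgN; apply: cvgMl.
  have H : v t + x / s t @[t --> +oo] --> z + x * 0 by apply: cvgD => //; exact: cvgMr.
  exact: cvgM.
have up : K * (Num.sqrt t / s t) * expR (- ((v t * v t - 2 * v t * x * (s t)^-1) / 2)) @[t --> +oo] -->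
    K * 1 * expR (- ((z * z - 2 * z * x * 0) / 2)).
  apply: cvgM; first exact: cvgMr.
  apply: continuous_cvg; first exact: continuous_expR.
  apply: cvgN; apply: cvgMl; apply: cvgB; first exact: cvgM.
  by apply: cvgM => //; apply: cvgMl; exact: cvgMr.
rewrite mulr0 addr0 -(expr2 z) in lo; rewrite mulr0 subr0 -(expr2 z) in up.
apply: (squeeze_cvgr _ lo up); near=> t.
have tN : 0 < t - N by rewrite subr_gt0; near: t; apply: nbhs_pinfty_gt; exact: num_real.
have st : 0 < s t by rewrite sqrtr_gt0.
have v0 : 0 <= v t by rewrite le_max lexx.
rewrite (@killed_tail_max _ _ _ _ B rho x _ _ (ltW tN)).
have -> : Num.max 0 (Num.sqrt t * z - k) = s t * v t.
  by rewrite /v maxr_pMr ?(ltW st)// mulr0 mulrCA divff ?mulr1// lt0r_neq0.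
have tE : t - N = s t ^+ 2 by rewrite sqr_sqrtr// ltW.
have := killed_tail_bounds bmB x_gt0 rho0 (mulr_ge0 (ltW st) v0) tN.
have -> : Num.sqrt (2 * pi * (t - N)) = Num.sqrt (2 * pi) * s t by rewrite sqrtrM// mulr_ge0// pi_ge0.
rewrite tE.
have p0 : Num.sqrt (2 * pi) != 0 :> R by rewrite lt0r_neq0// sqrtr_gt0 mulr_gt0// pi_gt0.
have s0 := lt0r_neq0 st.
have -> : - (s t * v t + x) ^+ 2 / (2 * s t ^+ 2) = - ((v t + x * (s t)^-1) * (v t + x * (s t)^-1) / 2) by field.
have -> : - ((s t * v t) ^+ 2 - 2 * (s t * v t) * x) / (2 * s t ^+ 2) =
    - ((v t * v t - 2 * v t * x * (s t)^-1) / 2) by field.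
have -> : K * (Num.sqrt t / s t) = Num.sqrt t * (2 * x / (Num.sqrt (2 * pi) * s t)) by rewrite /K; field; rewrite p0 s0.
by move=> /andP[l u]; rewrite -!mulrA !ler_wpM2l ?sqrtr_ge0 ?mulrA.
Unshelve. all: end_near.
Qed.

Lemma killed_tail_cvg_outward N k z : rho < 0 ->
  killed_tail B rho x (Num.sqrt t * z - rho * t - k) (t - N) @[t --> +oo] -->
    (1 - expR (2 * rho * x)) * gauss_tail z.
Proof.
have /cvgryPge sge := cvg_sqrt_pinfty.
move=> rho0; apply: (killed_tail_cvg_neg bmB x_gt0).
- near=> t.
  have s1 : 1 <= Num.sqrt t by near: t; exact: sge.
  have s2 : (`|k| + `|z|) / - rho <= Num.sqrt t by near: t; exact: sge.
  have t0 : 0 <= t by near: t; apply: nbhs_pinfty_ge; exact: num_real.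
  rewrite ler_pdivrMr ?oppr_gt0// in s2.
  have tE : t = Num.sqrt t ^+ 2 by rewrite sqr_sqrtr.
  have k1 := ler_norm k; have z1 := ler_norm (- z); rewrite normrN in z1.
  have k2 := normr_ge0 k.
  rewrite [in rho * t]tE; set s := Num.sqrt t in s1 s2 *.
  (* With s = sqrt(t), the term - rho s^2 dominates both s z and k once s is large; the three
     products combine into this estimate. *)
  have : 0 <= s * (s * - rho - `|k| - `|z|) by apply: mulr_ge0; lra.
  have : 0 <= s * (`|z| + z) by apply: mulr_ge0; lra.
  have : 0 <= (s - 1) * `|k| by apply: mulr_ge0; lra.
  by nra.
- by near=> t; rewrite subr_gt0; near: t; apply: nbhs_pinfty_gt; exact: num_real.
- have H := @cvg_endpoint N (k + rho * N) z; apply: cvg_trans H; apply: near_eq_cvg; near=> t.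
  by congr (_ / _); ring.
- exact: cvg_invr_sqrt.
Unshelve. all: end_near.
Qed.

End driftless_or_outward.

(** * Inward drift and the constant C_z *)

Section inward.
Context d (T : measurableType d) (R : realType) (P : probability T R).
Context (beta : R) (p : nat -> R) (W : branching_data P beta p) (rho : R).
Hypotheses (beta_gt0 : 0 < beta) (p_law : offspring_law p).
Hypotheses (m_gt0 : (0 < mean_offspring p)%E) (m_lt1 : (mean_offspring p < 1)%E).
Hypothesis klogk : (klogk_moment p < +oo)%E.
Variables (x z : R).
Hypotheses (rho_gt0 : 0 < rho) (x_gt0 : 0 < x) (z_ge0 : 0 <= z).
Implicit Types (t N M y : R).

Local Notation q := (survival_prob W).
Local Notation a := (alpha beta p).
Local Notation B := (motion W [::]).
Local Notation u := (tail_reach W rho z).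
Let bmB : brownian_motion B := motion_brownian W [::].
Let mA : measurable (`]z, +oo[%classic : set R). Proof. exact: measurable_itv. Qed.

Let C := C_sub W.
Let C0 : 0 < C := (C_sub_cvg W beta_gt0 p_law m_gt0 m_lt1 klogk).1.
Let qC : expR (a * t) * q t @[t --> +oo] --> C := (C_sub_cvg W beta_gt0 p_law m_gt0 m_lt1 klogk).2.1.
Let Cq t : 0 <= t -> C <= expR (a * t) * q t := (C_sub_cvg W beta_gt0 p_law m_gt0 m_lt1 klogk).2.2 t.

Let mu_ N : measurable_fun setT (fun y => (u N y)%:E).
Proof. by apply/measurable_EFinP; exact: measurable_reachr. Qed.

Let u0 N y : (0 <= (u N y)%:E :> \bar R)%E. Proof. by rewrite lee_fin reach_ge0. Qed.

Let u1 N y : ((u N y)%:E <= 1%:E :> \bar R)%E. Proof. by rewrite lee_fin reach_le1. Qed.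

Let weight t : R := t `^ (3 / 2) * expR (rho ^+ 2 / 2 * t).
Let h : R := Num.sqrt (2 / pi) * x * expR (rho * x).
Let A N : R := expR ((a + rho ^+ 2 / 2) * N) * fine (tilted_mean rho (fun y => (u N y)%:E)).
(** Ratio of the lower to the upper bound with delay N; for N >= 0 it is at most 1, and it tends to
    1. *)
Let lambda N : R := C / (expR (a * N) * q N).

Let h0 : 0 < h.
Proof. by rewrite /h !mulr_gt0 ?expR_gt0// sqrtr_gt0 divr_gt0// pi_gt0. Qed.

Let weight_ge0 t : 0 <= weight t.
Proof. by rewrite mulr_ge0 ?powR_ge0 ?expR_ge0. Qed.

Let A_ge0 N : 0 <= A N.
Proof. by rewrite mulr_ge0 ?expR_ge0// fine_ge0// tilted_mean_ge0. Qed.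

Lemma powR_three_halves t : 0 <= t -> t `^ (3 / 2) = Num.sqrt t ^+ 3.
Proof.
move=> t0; rewrite -powR12_sqrt// -powR_mulrn ?powR_ge0// -powRrM.
by congr (_ `^ _); field.
Qed.

Let weight_shift N t : 0 < t - N -> 0 <= t ->
  weight t = (Num.sqrt t / Num.sqrt (t - N)) ^+ 3 * expR (rho ^+ 2 / 2 * N) * weight (t - N).
Proof.
move=> tN t0; rewrite /weight !powR_three_halves ?(ltW tN)//.
have -> : rho ^+ 2 / 2 * t = rho ^+ 2 / 2 * N + rho ^+ 2 / 2 * (t - N) by ring.
have s0 : Num.sqrt (t - N) != 0 by rewrite lt0r_neq0// sqrtr_gt0.
by rewrite expRD; field.
Qed.

Let weight_mean_cvg N :
  weight t * mean_reach W rho true `]z, +oo[%classic N t x @[t --> +oo] -->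
    h * fine (tilted_mean rho (fun y => (u N y)%:E)).
Proof.
have H := killed_mean_tilted_cvg bmB rho_gt0 x_gt0 (@mu_ N) (@u0 N) (@u1 N).
apply: cvg_trans H; apply: near_eq_cvg; near=> t.
by rewrite /mean_reach root_meanE.
Unshelve. all: end_near.
Qed.

(** Passing from t - N to t in the normalization costs exp(rho^2 N / 2), which completes exp(a N) to
    the prefactor of [Cz_approx]; the powers of t have ratio tending to 1. *)
Let shifted_cvg N :
  expR (a * N) * (weight t * mean_reach W rho true `]z, +oo[%classic N (t - N) x) @[t --> +oo] --> h * A N.
Proof.
have H1 : weight (t - N) * mean_reach W rho true `]z, +oo[%classic N (t - N) x @[t --> +oo] -->
    h * fine (tilted_mean rho (fun y => (u N y)%:E)).
  exact: (@cvg_shift_pinfty _ (fun t => weight t * mean_reach W rho true `]z, +oo[%classic N t x) _ N (@weight_mean_cvg N)).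
have H2 := @cvg_sqrt_ratio R N.
have H3 : Num.sqrt t / Num.sqrt (t - N) * (Num.sqrt t / Num.sqrt (t - N)) *
    (Num.sqrt t / Num.sqrt (t - N)) @[t --> +oo] --> (1 * 1 * 1 : R).
  by apply: cvgM => //; exact: cvgM.
have H4 : expR (a * N) * (Num.sqrt t / Num.sqrt (t - N) * (Num.sqrt t / Num.sqrt (t - N)) *
    (Num.sqrt t / Num.sqrt (t - N)) * expR (rho ^+ 2 / 2 * N) *
    (weight (t - N) * mean_reach W rho true `]z, +oo[%classic N (t - N) x)) @[t --> +oo] -->
  expR (a * N) * (1 * 1 * 1 * expR (rho ^+ 2 / 2 * N) * (h * fine (tilted_mean rho (fun y => (u N y)%:E)))).
  by apply: cvgMr; apply: cvgM; [exact: cvgMl|exact: H1].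
have E : expR (a * N) * (1 * 1 * 1 * expR (rho ^+ 2 / 2 * N) * (h * fine (tilted_mean rho (fun y => (u N y)%:E)))) = h * A N.
  by rewrite /A mulrDl expRD; ring.
rewrite E in H4; apply: cvg_trans H4; apply: near_eq_cvg; near=> t.
have tN : 0 < t - N by rewrite subr_gt0; near: t; apply: nbhs_pinfty_gt; exact: num_real.
have t0 : 0 <= t by near: t; apply: nbhs_pinfty_ge; exact: num_real.
by rewrite (weight_shift tN t0); ring.
Unshelve. all: end_near.
Qed.

Let tail t : R := weight t * expR (a * t) * u t x.

Let tail_upper N t : 0 <= N -> N <= t ->
  tail t <= expR (a * N) * (weight t * mean_reach W rho true `]z, +oo[%classic N (t - N) x).
Proof.
move=> N0 Nt; have tN : 0 <= t - N by rewrite subr_ge0.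
have := @reach_le_mean _ _ _ _ _ _ W beta_gt0 p_law m_gt0 m_lt1 rho true _ mA N (t - N) x N0 tN.
rewrite subrK => ut.
have -> : expR (a * N) = expR (a * t) * expR (- a * (t - N)) by rewrite -expRD; congr expR; ring.
rewrite /tail -mulrA mulrCA -[leRHS]mulrA ler_wpM2l ?expR_ge0// [leRHS]mulrCA ler_wpM2l//.
Qed.

Let tail_lower N t : 0 <= N -> N <= t ->
  lambda N * (expR (a * N) * (weight t * mean_reach W rho true `]z, +oo[%classic N (t - N) x)) <= tail t.
Proof.
move=> N0 Nt; have tN : 0 <= t - N by rewrite subr_ge0.
have t0 : 0 <= t by exact: le_trans Nt.
have := @mean_reach_le_reach _ _ _ _ _ _ W beta_gt0 p_law m_gt0 m_lt1 rho true _ N (t - N) x mA N0 tN.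
rewrite subrK => ut.
have qN : 0 < q N by exact: survival_prob_gt0.
have m0 : 0 <= mean_reach W rho true `]z, +oo[%classic N (t - N) x by exact: mean_reach_ge0.
apply: (@le_trans _ _ (weight t * expR (a * t) * (q t / q N * mean_reach W rho true `]z, +oo[%classic N (t - N) x))); last first.
  by rewrite ler_wpM2l// mulr_ge0 ?expR_ge0.
have -> : lambda N * (expR (a * N) * (weight t * mean_reach W rho true `]z, +oo[%classic N (t - N) x)) =
    C * (weight t * mean_reach W rho true `]z, +oo[%classic N (t - N) x / q N).
  rewrite /lambda; have := lt0r_neq0 (expR_gt0 (a * N)); move: (expR _) => e e0; field.
  by rewrite e0 lt0r_neq0.
have -> : weight t * expR (a * t) * (q t / q N * mean_reach W rho true `]z, +oo[%classic N (t - N) x) =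
    expR (a * t) * q t * (weight t * mean_reach W rho true `]z, +oo[%classic N (t - N) x / q N) by ring.
by rewrite ler_wpM2r ?Cq//; apply: divr_ge0; [exact: mulr_ge0|exact: ltW].
Qed.

Let lambda_cvg : lambda N @[N --> +oo] --> (1 : R).
Proof.
rewrite -(divff (lt0r_neq0 C0)); apply: cvgMr; apply: cvgV => //; exact: lt0r_neq0.
Qed.

Let lambda_gt0 N : 0 <= N -> 0 < lambda N.
Proof. by move=> N0; rewrite divr_gt0// mulr_gt0 ?expR_gt0// survival_prob_gt0. Qed.

(* The limit of [tail] lies between h lambda_N A_N and h A_N for every N. *)
Let A_comparable N M : 0 <= N -> 0 <= M -> lambda N * A N <= A M.
Proof.
move=> N0 M0; rewrite -(ler_pM2l h0) mulrCA.
have H1 : lambda N * (expR (a * N) * (weight t * mean_reach W rho true `]z, +oo[%classic N (t - N) x)) @[t --> +oo] -->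
    lambda N * (h * A N) by apply: cvgMr; exact: shifted_cvg.
have H2 := @shifted_cvg M.
apply: (ler_cvg_to H1 H2); near=> t.
have Nt : N <= t by near: t; apply: nbhs_pinfty_ge; exact: num_real.
have Mt : M <= t by near: t; apply: nbhs_pinfty_ge; exact: num_real.
exact: le_trans (tail_lower N0 Nt) (tail_upper M0 Mt).
Unshelve. all: end_near.
Qed.

(** The integral of y exp(- rho y) over [z, +oo[. *)
Let I0 : R := (rho * z + 1) * expR (- rho * z) / rho ^+ 2.

Let I0_gt0 : 0 < I0.
Proof. by rewrite /I0 divr_gt0 ?exprn_gt0// mulr_gt0 ?expR_gt0// ltr_wpDl// mulr_ge0// ltW. Qed.

Lemma tilted_mean_tail : fine (tilted_mean rho (fun y => (\1_`]z, +oo[%classic y)%:E)) = I0.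
Proof.
suff -> : tilted_mean rho (fun y => (\1_`]z, +oo[%classic y)%:E) = I0%:E by [].
rewrite -integral_linear_exp// /tilted_mean.
rewrite -integral_itv_obnd_cbnd; last first.
  by apply/measurable_EFinP; apply: measurable_funTS; apply: measurable_funM => //; apply: measurableT_comp.
rewrite [LHS]integral_mkcond [RHS]integral_mkcond; apply: eq_integral => y _.
rewrite !patchE !mem_setE !in_itv/= !andbT; have [y0|y0] := ltP 0 y.
  by rewrite indicE mem_setE in_itv/= andbT; case: ifP => _; rewrite ?mule1// mule0.
by rewrite ltNge (le_trans y0 z_ge0).
Qed.

Lemma killed_tail_cvg_inward :
  weight t * killed_tail B rho x z t @[t --> +oo] --> h * I0.
Proof.
rewrite -tilted_mean_tail; apply: killed_mean_tilted_cvg => //.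
- by apply/measurable_EFinP; exact: measurable_indic.
- by move=> y; rewrite lee_fin indicE; case: (_ \in _).
Qed.

(** The lower bound with N = 0, where [lambda] equals C because q(0) = 1, keeps the limit away from
    0. *)
Let A_lower M : 0 <= M -> C * I0 <= A M.
Proof.
move=> M0; rewrite -(ler_pM2l h0) mulrCA.
have H1 : C * (weight t * killed_tail B rho x z t) @[t --> +oo] --> C * (h * I0).
  by apply: cvgMr; exact: killed_tail_cvg_inward.
apply: (ler_cvg_to H1 (@shifted_cvg M)); near=> t.
have t0 : 0 <= t by near: t; apply: nbhs_pinfty_ge; exact: num_real.
have Mt : M <= t by near: t; apply: nbhs_pinfty_ge; exact: num_real.
have := @tail_lower 0 t (lexx 0) t0.
rewrite /lambda mulr0 expR0 mul1r survival0 divr1 subr0 mul1r mean_tail_reach0// => H.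
exact: le_trans H (tail_upper M0 Mt).
Unshelve. all: end_near.
Qed.

(** As an infimum it is trapped between lambda N * A N and A N for every N >= 0, so that convergence
    of [A] follows from [lambda_cvg]. It does not depend on the start x, since [A] does not. *)
Let ell : R := inf [set A M | M in `[0, +oo[].

Let ell_inf : has_inf [set A M | M in `[0, +oo[].
Proof.
split; first by exists (A 0); exists 0 => //=; rewrite in_itv/= lexx.
by exists 0 => _ [M _ <-]; exact: A_ge0.
Qed.

Let ell_le N : 0 <= N -> ell <= A N.
Proof. by move=> N0; apply: ge_inf; [exact: ell_inf.2|exists N => //=; rewrite in_itv/= N0]. Qed.

Let ell_ge N : 0 <= N -> lambda N * A N <= ell.
Proof.
move=> N0; apply: lb_le_inf; first exact: ell_inf.1.
by move=> v [M /=]; rewrite in_itv/= andbT => M0 <-; exact: A_comparable.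
Qed.

Let ell_gt0 : 0 < ell.
Proof.
apply: (@lt_le_trans _ _ (C * I0)); first by rewrite mulr_gt0.
apply: lb_le_inf; first exact: ell_inf.1.
by move=> v [M /=]; rewrite in_itv/= andbT => M0 <-; exact: A_lower.
Qed.

Let A_cvg : A N @[N --> +oo] --> ell.
Proof.
have H : ell / lambda N @[N --> +oo] --> ell / 1.
  by apply: cvgMr; apply: cvgV.
rewrite divr1 in H; apply: (squeeze_cvgr _ (cvg_cst ell) H); near=> N.
have N0 : 0 <= N by near: N; apply: nbhs_pinfty_ge; exact: num_real.
by rewrite ell_le//= ler_pdivlMr ?lambda_gt0// mulrC ell_ge.
Unshelve. all: end_near.
Qed.

Let tail_cvg : tail t @[t --> +oo] --> h * ell.
Proof.
have lA : lambda N * (h * A N) @[N --> +oo] --> h * ell.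
  by rewrite -[X in _ --> X]mul1r; apply: cvgM => //; exact: cvgMr.
have uA : h * A N @[N --> +oo] --> h * ell by exact: cvgMr.
apply: cvg_between => e e0.
  have /filter_ex[N [N0 Ne]] : \forall N \near +oo, 0 <= N /\ h * ell - e < lambda N * (h * A N).
    near=> N; split; first by near: N; apply: nbhs_pinfty_ge; exact: num_real.
    by near: N; apply: (cvgr_gt _ lA); rewrite gtrBl.
  exists (fun t => lambda N * (expR (a * N) * (weight t * mean_reach W rho true `]z, +oo[%classic N (t - N) x))), (lambda N * (h * A N)); split => //.
    by apply: cvgMr; exact: shifted_cvg.
  near=> t; apply: tail_lower => //; near: t; apply: nbhs_pinfty_ge; exact: num_real.
have /filter_ex[N [N0 Ne]] : \forall N \near +oo, 0 <= N /\ h * A N < h * ell + e.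
  near=> N; split; first by near: N; apply: nbhs_pinfty_ge; exact: num_real.
  by near: N; apply: (cvgr_lt _ uA); rewrite ltrDl.
exists (fun t => expR (a * N) * (weight t * mean_reach W rho true `]z, +oo[%classic N (t - N) x)), (h * A N); split => //.
near=> t; apply: tail_upper => //; near: t; apply: nbhs_pinfty_ge; exact: num_real.
Unshelve. all: end_near.
Qed.

Let Cz_approxE N : 0 <= N -> Cz_approx W rho z N = (A N)%:E.
Proof.
move=> N0; rewrite /Cz_approx /A EFinM fineK; last exact: (tilted_mean_fin_num rho_gt0 (@mu_ N) (@u0 N) (@u1 N)).
congr (_ * _)%E; apply: eq_integral => y _; by rewrite prob_killed_maxE.
Qed.

Let Cz_approx_cvg : Cz_approx W rho z N @[N --> +oo] --> ell%:E.
Proof.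
have H : (A N)%:E @[N --> +oo] --> ell%:E by apply: cvg_EFin; [exact: nearW|exact: A_cvg].
apply: cvg_trans H; apply: near_eq_cvg; near=> N; rewrite Cz_approxE//.
Unshelve. all: end_near.
Qed.

Lemma tail_reach_cvg_inward :
  [/\ cvg (Cz_approx W rho z N @[N --> +oo]),
      (0 < Cz W rho z < +oo)%E,
      t `^ (3 / 2) * expR ((a + rho ^+ 2 / 2) * t) * u t x @[t --> +oo] -->
        Num.sqrt (2 / pi) * fine (Cz W rho z) * x * expR (rho * x)
    & asymp_equiv (fun t => u t x)
        (fun t => rho ^+ 2 * fine (Cz W rho z) * expR (rho * z) / (rho * z + 1) *
           expected_killed W x rho t `]z, +oo[)].
Proof.
have CzE : Cz W rho z = ell%:E by apply: cvg_lim => //; exact: Cz_approx_cvg.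
rewrite CzE; split.
- by apply/cvg_ex; exists ell%:E; exact: Cz_approx_cvg.
- by rewrite lte_fin ell_gt0 ltry.
- have -> : Num.sqrt (2 / pi) * fine ell%:E * x * expR (rho * x) = h * ell by rewrite /h /=; ring.
  apply: cvg_trans tail_cvg; apply: near_eq_cvg; near=> t.
  by rewrite /tail /weight [(a + _) * t]mulrDl expRD; ring.
apply: (@asymp_equiv_scaled _ (fun t => weight t * expR (a * t)) _ _ (h * ell)).
- by rewrite mulf_neq0// lt0r_neq0.
- near=> t.
  have t0 : 0 < t by near: t; apply: nbhs_pinfty_gt; exact: num_real.
  by rewrite lt0r_neq0// !mulr_gt0 ?expR_gt0// powR_gt0.
- exact: tail_cvg.
pose c : R := rho ^+ 2 * ell * expR (rho * z) / (rho * z + 1).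
have H : c * (weight t * killed_tail B rho x z t) @[t --> +oo] --> c * (h * I0).
  by apply: cvgMr; exact: killed_tail_cvg_inward.
(* The prefactor of the expectation in the equivalence is exactly ell / I0. *)
have E : c * (h * I0) = h * ell.
  rewrite /c /I0 mulNr expRN.
  have e0 := lt0r_neq0 (expR_gt0 (rho * z)); move: (expR (rho * z)) e0 => e e0.
  have r0 := lt0r_neq0 rho_gt0.
  have z1 : rho * z + 1 != 0 by rewrite lt0r_neq0// ltr_wpDl// mulr_ge0// ltW.
  by move: h => h'; field; rewrite e0 z1 r0.
rewrite E in H; apply: cvg_trans H; apply: near_eq_cvg; near=> t.
rewrite expected_killed_tail// /c mulNr expRN.
have e0 := lt0r_neq0 (expR_gt0 (a * t)); move: (expR (a * t)) e0 => e e0.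
rewrite /= -/c; move: c E => c' _.
move: (weight t) (killed_tail B rho x z t) => w k /=.
have -> : w * e * (c' * (e^-1 * k)) = (e * e^-1) * (c' * (w * k)) by ring.
by rewrite divff// mul1r.
Unshelve. all: end_near.
Qed.

End inward.

Lemma near_asymp_equiv (R : realType) (f f' g : R -> R) :
  (\forall t \near +oo, f t = f' t) -> asymp_equiv f g -> asymp_equiv f' g.
Proof.
move=> ff' fg; apply: cvg_trans fg; apply: near_eq_cvg; near=> t.
have tE : f t = f' t by near: t.
by rewrite tE.
Unshelve. all: end_near.
Qed.

Theorem theorem1p3 (R : realType) (d : measure_display) (T : measurableType d)
    (P : probability T R) (beta : R) (p : nat -> R)
    (W : branching_data P beta p)
    (beta_gt0 : 0 < beta) (p_law : offspring_law p)
    (m_gt0 : (0 < mean_offspring p)%E) (m_lt1 : (mean_offspring p < 1)%E)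
    (klogk : (klogk_moment p < +oo)%E)
    (x : R) (x_gt0 : 0 < x) :
  [/\ (forall z : R, 0 <= z ->
        let prob (t : R) : R :=
          fine (P [set w | (Num.sqrt t * z)%:E < killed_max W x 0 t w]%E) in
        Num.sqrt t * expR (alpha beta p * t) * prob t @[t --> +oo] -->
          Num.sqrt (2 / pi) * C_sub W * x * expR (- (z ^+ 2 / 2))
        /\ asymp_equiv prob
             (fun t => C_sub W *
                expected_killed W x 0 t `]Num.sqrt t * z, +oo[)),
      (forall rho z : R, rho < 0 ->
        let prob (t : R) : R :=
          fine (P [set w | (Num.sqrt t * z)%:E <
                             killed_max W x rho t w + (rho * t)%:E]%E) in
        expR (alpha beta p * t) * prob t @[t --> +oo] -->
          C_sub W * (1 - expR (2 * rho * x)) / Num.sqrt (2 * pi) *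
            \int[lebesgue_measure]_(y in `[z, +oo[) expR (- (y ^+ 2 / 2))
        /\ asymp_equiv prob
             (fun t => C_sub W *
                expected_killed W x rho t `]Num.sqrt t * z - rho * t, +oo[))
    & (forall rho z : R, 0 < rho -> 0 <= z ->
        let prob (t : R) : R :=
          fine (P [set w | z%:E < killed_max W x rho t w]%E) in
        [/\ cvg (Cz_approx W rho z N @[N --> +oo]),
            (0 < Cz W rho z < +oo)%E,
            t `^ (3 / 2) * expR ((alpha beta p + rho ^+ 2 / 2) * t) * prob t
              @[t --> +oo] -->
              Num.sqrt (2 / pi) * fine (Cz W rho z) * x * expR (rho * x)
          & asymp_equiv prob
              (fun t => rho ^+ 2 * fine (Cz W rho z) * expR (rho * z)
                          / (rho * z + 1) *
                 expected_killed W x rho t `]z, +oo[)])].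
Proof.
have bmB : brownian_motion (motion W [::]) := motion_brownian W [::].
have cvg_bounded (f : R -> R) (l : R) : f t @[t --> +oo] --> l -> exists M, \forall t \near +oo, f t <= M.
  by move=> fl; exists (l + 1); apply: (cvgr_le _ fl); rewrite ltrDl.
split.
- move=> z z0 prob.
  have probE t : 0 <= t -> prob t = tail_reach W 0 (Num.sqrt t * z) t x.
    by move=> t0; rewrite /prob prob_killed_maxE.
  have KL N k : 0 <= N -> 0 <= k ->
      Num.sqrt t * killed_tail (motion W [::]) 0 x (Num.sqrt t * z - k) (t - N) @[t --> +oo] -->
      Num.sqrt (2 / pi) * x * expR (- (z ^+ 2 / 2)).
    by move=> N0 k0; exact: killed_tail_cvg_driftless.
  have KM N : 0 <= N -> exists M, \forall t \near +oo,
      Num.sqrt t * killed_tail (motion W [::]) 0 x 0 (t - N) <= M.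
    (* The tail beyond level 0 is the case z = k = 0 of the same limit, hence bounded once
       scaled. *)
    move=> N0; have := @killed_tail_cvg_driftless _ _ _ _ _ _ W 0 x x_gt0 N 0 0 erefl (lexx 0).
    by move=> /cvg_bounded[M MP]; exists M; apply: filterS MP => t; rewrite mulr0 subr0.
  split.
    have H := @tail_reach_cvg _ _ _ _ _ _ W 0 beta_gt0 p_law m_gt0 m_lt1 klogk x x_gt0
      (fun t => Num.sqrt t) (fun t => Num.sqrt t * z) _ (fun t => sqrtr_ge0 t) KL KM.
    have -> : Num.sqrt (2 / pi) * C_sub W * x * expR (- (z ^+ 2 / 2)) =
      C_sub W * (Num.sqrt (2 / pi) * x * expR (- (z ^+ 2 / 2))) by rewrite !mulrA [C_sub W * _]mulrC.
    by apply: cvg_trans H; apply: near_eq_cvg; near=> t; rewrite probE.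
  apply: (@near_asymp_equiv _ (fun t => tail_reach W 0 (Num.sqrt t * z) t x)).
    by near=> t; rewrite probE.
  apply: (@tail_reach_asymp _ _ _ _ _ _ W 0 beta_gt0 p_law m_gt0 m_lt1 klogk x x_gt0
    (fun t => Num.sqrt t) _ _ (fun t => sqrtr_ge0 t) _ _ KL KM).
    by near=> t; rewrite sqrtr_gt0.
  by rewrite !mulr_gt0 ?expR_gt0// sqrtr_gt0 divr_gt0// pi_gt0.
- move=> rho z rho0 prob.
  have probE t : 0 <= t -> prob t = tail_reach W rho (Num.sqrt t * z - rho * t) t x.
    move=> t0; rewrite /prob -[RHS]/(fine (tail_reach _ _ _ _ _)%:E) -prob_killed_maxE//.
    congr (fine (P _)); apply/funext => w /=; congr is_true.
    (* The maximum may be infinite, but the shift rho t is finite and can be moved across the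
       inequality. *)
    by rewrite EFinB lteBlDr.
  have KL N k : 0 <= N -> 0 <= k ->
      1 * killed_tail (motion W [::]) rho x (Num.sqrt t * z - rho * t - k) (t - N) @[t --> +oo] -->
      (1 - expR (2 * rho * x)) * gauss_tail z.
    move=> N0 k0; have H := @killed_tail_cvg_outward _ _ _ _ _ _ W rho x x_gt0 N k z rho0.
    by apply: cvg_trans H; apply: near_eq_cvg; near=> t; rewrite mul1r.
  have KM N : 0 <= N -> exists M, \forall t \near +oo,
      1 * killed_tail (motion W [::]) rho x 0 (t - N) <= M.
    by move=> N0; exists 1; near=> t; rewrite mul1r killed_tail_le1.
  split.
    have H := @tail_reach_cvg _ _ _ _ _ _ W rho beta_gt0 p_law m_gt0 m_lt1 klogk x x_gt0
      (fun=> 1) (fun t => Num.sqrt t * z - rho * t) _ (fun=> ler01) KL KM.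
    have E : C_sub W * (1 - expR (2 * rho * x)) / Num.sqrt (2 * pi) *
        \int[lebesgue_measure]_(y in `[z, +oo[) expR (- (y ^+ 2 / 2)) =
      C_sub W * ((1 - expR (2 * rho * x)) * gauss_tail z) by rewrite gauss_tailE !mulrA.
    by rewrite E; apply: cvg_trans H; apply: near_eq_cvg; near=> t; rewrite mul1r probE.
  apply: (@near_asymp_equiv _ (fun t => tail_reach W rho (Num.sqrt t * z - rho * t) t x)).
    by near=> t; rewrite probE.
  apply: (@tail_reach_asymp _ _ _ _ _ _ W rho beta_gt0 p_law m_gt0 m_lt1 klogk x x_gt0
    (fun=> 1) _ _ (fun=> ler01) _ _ KL KM).
    by near=> t.
  rewrite mulr_gt0 ?gauss_tail_gt0// subr_gt0 -expR0 ltr_expR.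
  by rewrite pmulr_llt0// pmulr_rlt0.
move=> rho z rho0 z0 prob.
have probE t : 0 <= t -> prob t = tail_reach W rho z t x.
  by move=> t0; rewrite /prob prob_killed_maxE.
have [c1 c2 c3 c4] := @tail_reach_cvg_inward _ _ _ _ _ _ W rho beta_gt0 p_law m_gt0 m_lt1 klogk x z rho0 x_gt0 z0.
split => //.
  by apply: cvg_trans c3; apply: near_eq_cvg; near=> t; rewrite probE.
apply: (@near_asymp_equiv _ (fun t => tail_reach W rho z t x)) => //.
by near=> t; rewrite probE.
Unshelve. all: end_near.
Qed.
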